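(* Let $\mathbf F$ be a field. Let $L,L'$ be two equivalent (oriented) virtual link diagrams such that the atoms $V(L)$ and $V(L')$ corresponding to them are orientable. Then $Kh_{\mathbf F}(L)\cong Kh_{\mathbf F}(L')$ as bigraded $\mathbf F$-vector spaces.
   Context: **Virtual diagrams.** A virtual link diagram is a generic immersion of finitely many closed curves in the plane in which each double point is marked either as classical (with over/under information) or as virtual (circled, no over/under information). Detour move: an arc of the diagram between two points $A,B$ that contains only virtual crossings may be removed and replaced by any other path joining $A$ and $B$, all new crossings being declared virtual. Generalised Reidemeister moves are the detour move and the classical Reidemeister moves $\Omega_1,\Omega_2,\Omega_3$ (performed in small discs containing only classical crossings). Two diagrams are equivalent if related by a finite sequence of generalised Reidemeister moves; the intermediate diagrams may be arbitrary. Diagrams are oriented and moves respect orientation. **Smoothings.** At a classical crossing, the $A$-smoothing is the one that joins the two regions swept when the overcrossing strand is rotated counterclockwise towards the undercrossing one; the $B$-smoothing is the other one. A state is a choice of smoothing at each classical crossing; smoothing accordingly gives a set of closed curves meeting only in virtual crossings, called circles (each counted as one unicursal curve). **Atoms.** An atom is a closed (not necessarily connected) 2-manifold $M$ with a 4-valent graph $\Gamma\subset M$ (the frame) dividing $M$ into checkerboard coloured cells. The atom $V(L)$ of a diagram $L$ has frame whose vertices are the classical crossings and whose edges are the branches of $L$ between classical crossings (virtual crossings ignored); opposite half-edges at a vertex are opposite at the crossing, and black angles are those swept by rotating the overcrossing strand counterclockwise. Equivalently, cells are discs glued along the circles of the all-$B$ state (black) and the all-$A$ state (white). (A component without classical crossings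 contributes a sphere.) The atom is orientable if $M$ is. **Khovanov homology.** Let $L$ be an oriented diagram with $N$ classical crossings, $n_+$ positive and $n_-$ negative, with $V(L)$ orientable. Order the crossings; vertices $s=(a_1,\dots,a_N)\in\{0,1\}^N$ correspond to states ($0$ for $A$, $1$ for $B$); let $\gamma(s)$ be the number of circles. Let $V$ be the graded $\mathbf F$-vector space with basis $v_+,v_-$ of degrees $+1,-1$. To $s$ assign $V^{\otimes\gamma(s)}\{\sum a_i\}$ (one factor per circle), where $\{l\}$ raises the grading by $l$. Along each edge of the cube, from $0$ to $1$ in one coordinate, either two circles merge or one splits into two (orientability excludes an edge on which one circle becomes one circle). The edge map is $m\otimes \mathrm{Id}$ or $\Delta\otimes\mathrm{Id}$, respectively, with $m(v_+\otimes v_+)=v_+$, $m(v_+\otimes v_-)=m(v_-\otimes v_+)=v_-$, $m(v_-\otimes v_-)=0$; $\Delta(v_+)=v_+\otimes v_-+v_-\otimes v_+$, $\Delta(v_-)=v_-\otimes v_-$, times the standard sign $(-1)^{a_1+\dots+a_{i-1}}$ for an edge in direction $i$, making the cube anticommutative. The chain space of height $k$ is the direct sum over vertices with $\sum a_i=k$, and the differential is the sum of the signed edge maps. $\mathcal C(L)$ is this complex with the grading shifted by $+(n_+-2n_-)$ and the height shifted by $-n_-$. $Kh_{\mathbf F}(L)$ is its homology, bigraded by height and grading. *)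

(* Defs.v *)
From HB Require Import structures.
From Stdlib Require Import Relation_Operators.
From mathcomp Require Import all_boot all_order all_algebra all_fingroup.

Set Implicit Arguments.
Unset Strict Implicit.
Unset Printing Implicit Defensive.

Import GRing.Theory.

(* ------------------------------------------------------------------------ *)
(* A generic immersion of oriented closed curves in the plane is encoded as *)
(* a hypermap of genus 0.  Turn the plane so that both strands of a         *)
(* crossing c point upwards.  Then (c, false) is the strand going from the  *)
(* bottom left to the top right, and (c, true) is the strand going from the *)
(* bottom right to the top left:                                            *)
(*                                                                          *)
(*                 (c,true)  ^   ^  (c,false)                               *)
(*                            \ /                                           *)
(*                             c                                            *)
(*                            / \                                           *)
(*                 (c,false) /   \  (c,true)                                *)
(*                                                                          *)
(* The curves also carry auxiliary regular points, which play the role of   *)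
(* the vertices of a polygon: they represent the curves without crossings,  *)
(* and mark the ends of the arcs on which the moves take place.             *)
(* A passage is one traversal of a crossing or of a regular point, and      *)
(* next_passage sends a passage to the following one on the same curve. The *)
(* strand (c, over_strand c) is the overcrossing one, so that c is positive *)
(* iff over_strand c = false.                                               *)
(* ------------------------------------------------------------------------ *)

Record diagram := Diagram {
  classical : finType;
  virtual : finType;
  point : finType;
  over_strand : classical -> bool;
  next_passage : {perm ((classical + virtual) * bool + point)}
}.

Definition crossing (D : diagram) : finType := (classical D + virtual D)%type.

Definition passage (D : diagram) : finType :=
  (crossing D * bool + point D)%type.

Definition kind (D : diagram) (c : crossing D) : option bool :=
  if c is inl c' then Some (over_strand c') else None.

(* The half-edges: (x, true) leaves the passage x and (x, false) enters it. *)
Definition dart (D : diagram) : finType := (passage D * bool)%type.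

Definition other_end (D : diagram) (h : dart D) : dart D :=
  if h.2 then (next_passage D h.1, false)
  else ((next_passage D)^-1%g h.1, true).

(* The half-edge following h around its crossing, counterclockwise if ccw   *)
(* and clockwise otherwise.                                                 *)
Definition turn (D : diagram) (ccw : bool) (h : dart D) : dart D :=
  match h with
  | (inl (c, s), out) => (inl (c, ~~ s), out (+) (s == ccw))
  | (inr p, out) => (inr p, ~~ out)
  end.

Definition face_step (D : diagram) (h : dart D) : dart D :=
  turn true (other_end h).

Definition adjacent (D : diagram) : rel (dart D) :=
  [rel h h' | (h' == other_end h) || (h' == turn true h)].

(* Euler's formula V + F = E + 2 C for the graph whose vertices are the     *)
(* crossings and the regular points; there is one edge after each passage.  *)
Definition planar (D : diagram) : bool :=
  #|crossing D| + #|point D| + fcard (@face_step D) (dart D)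
    == #|passage D| + (n_comp (@adjacent D) (dart D)).*2.

Record virtual_diagram := VirtualDiagram {
  curves :> diagram;
  curves_planar : planar curves
}.

(* y is the first passage satisfying S that is met strictly after x. *)
Definition first_return (D : diagram) (S : pred (passage D))
    (x y : passage D) : Prop :=
  exists n, [/\ y = iter n.+1 (next_passage D) x, S y
              & forall i, i < n -> ~~ S (iter i.+1 (next_passage D) x)].

Definition carry (R D : diagram) (f : crossing R -> crossing D)
    (g : point R -> point D) (x : passage R) : passage D :=
  match x with
  | inl (c, s) => inl (f c, s)
  | inr p => inr (g p)
  end.

(* R is what remains of D when some of its crossings are erased, both       *)
(* strands being continued straight on, and some of its regular points are  *)
(* forgotten.  No closed curve may disappear.                               *)
Record erasure (R D : diagram) := Erasure {
  on_crossing : crossing R -> crossing D;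
  on_point :> point R -> point D;
  on_crossing_inj : injective on_crossing;
  on_point_inj : injective on_point;
  erasure_kind : forall c, kind (on_crossing c) = kind c;
  erasure_next : forall x,
    first_return [pred y in codom (carry on_crossing on_point)]
      (carry on_crossing on_point x)
      (carry on_crossing on_point (next_passage R x));
  erasure_meets : forall y, exists x,
    fconnect (next_passage D) y (carry on_crossing on_point x)
}.

Definition erased_crossings (R D : diagram) (e : erasure R D) :
    {set crossing D} :=
  [set c | c \notin codom (on_crossing e)].

Definition erased_points (R D : diagram) (e : erasure R D) : {set point D} :=
  [set p | p \notin codom (on_point e)].

(* The curve runs from a to b and meets exactly the crossings listed in t.  *)
Definition strand (D : diagram) (a : point D) (t : seq (crossing D * bool))
    (b : point D) : bool :=
  fpath (next_passage D) (inr a) (rcons [seq inl x | x <- t] (inr b)).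

(* Plane isotopy: relabelling, and adding or (by symmetry) forgetting       *)
(* regular points.                                                          *)
Definition isotopy (D D' : diagram) : Prop :=
  exists e : erasure D D', erased_crossings e = set0.

(* R is the common part of D and D' outside of the rerouted arc; its edge   *)
(* from a to b stands for the missing arc, hence R need not be planar.      *)
Definition detour (D D' : diagram) : Prop :=
  exists (R : diagram) (e : erasure R D) (e' : erasure R D') (a b : point R)
         (t : seq (crossing D * bool)) (t' : seq (crossing D' * bool)),
    [/\ a != b,
        [/\ erased_points e = set0, strand (e a) t (e b),
            all (fun x => kind x.1 == None) t
          & erased_crossings e = [set x.1 | x in t]]
      & [/\ erased_points e' = set0, strand (e' a) t' (e' b),
            all (fun x => kind x.1 == None) t'
          & erased_crossings e' = [set x.1 | x in t']]].

(* In the three moves below the regular points involved are the points at   *)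
(* which the diagrams cross the boundary of the disc.                       *)

(* The four oriented kinks are given by s and the over/under information.   *)
Definition Omega1 (D D' : diagram) : Prop :=
  exists (e : erasure D D') (a b : point D) (c : classical D') (s : bool),
    [/\ strand a [::] b,
        strand (e a) [:: (inl c, s); (inl c, ~~ s)] (e b),
        erased_points e = set0 & erased_crossings e = [set inl c]].

(* The first strand passes over both crossings if over_strand c = s, and    *)
(* under both of them otherwise. As the second strand moves to the other    *)
(* side of the first one and back again, the first strand occupies the slot *)
(* s at c and ~~ s at d. The strands are parallel if par and antiparallel   *)
(* otherwise.                                                               *)
Definition Omega2 (D D' : diagram) : Prop :=
  exists (e : erasure D D') (a1 b1 a2 b2 : point D) (c d : classical D')
         (s par : bool),
    let t2 := [:: (inl c, ~~ s); (inl d, s)] in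
    [/\ strand a1 [::] b1 /\ strand a2 [::] b2,
        strand (e a1) [:: (inl c, s); (inl d, ~~ s)] (e b1),
        strand (e a2) (if par then t2 else rev t2) (e b2),
        over_strand d = ~~ over_strand c
      & erased_points e = set0 /\ erased_crossings e = [set inl c; inl d]].

Definition in_order (T : Type) (o : bool) (x y : T) : seq T :=
  if o then [:: x; y] else [:: y; x].

(* Three strands crossing pairwise, the first one lying above the second    *)
(* one and the second one above the third one.  The i-th strand meets its   *)
(* two crossings in the lexicographic order of their names iff oi.  Let dij *)
(* be +1 if strand j crosses strand i from right to left (that is, if       *)
(* sij = false) and -1 otherwise, and wi be +1 if oi and -1 otherwise.  The *)
(* three crossings bound an empty triangle iff                              *)
(* d12 w1 w2 = d13 w1 w3 = d23 w2 w3, and this common sign is given by k.   *)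
Definition triangle (D : diagram) (a1 b1 a2 b2 a3 b3 : point D)
    (k o1 o2 o3 : bool) (c12 c13 c23 : classical D) : Prop :=
  let s12 := k (+) o1 (+) o2 in
  let s13 := k (+) o1 (+) o3 in
  let s23 := k (+) o2 (+) o3 in
  [/\ uniq [:: c12; c13; c23],
      [/\ over_strand c12 = s12, over_strand c13 = s13 & over_strand c23 = s23],
      strand a1 (in_order o1 (inl c12, s12) (inl c13, s13)) b1,
      strand a2 (in_order o2 (inl c12, ~~ s12) (inl c23, s23)) b2
    & strand a3 (in_order o3 (inl c13, ~~ s13) (inl c23, ~~ s23)) b3].

(* Each strand is moved across the crossing of the other two: its two       *)
(* crossings are met in the opposite order.                                 *)
Definition Omega3 (D D' : diagram) : Prop :=
  exists (R : diagram) (e : erasure R D) (e' : erasure R D')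
         (a1 b1 a2 b2 a3 b3 : point R) (k o1 o2 o3 : bool)
         (c12 c13 c23 : classical D) (c12' c13' c23' : classical D'),
    [/\ triangle (e a1) (e b1) (e a2) (e b2) (e a3) (e b3)
          k o1 o2 o3 c12 c13 c23,
        triangle (e' a1) (e' b1) (e' a2) (e' b2) (e' a3) (e' b3)
          k (~~ o1) (~~ o2) (~~ o3) c12' c13' c23',
        erased_points e = set0 /\ erased_points e' = set0,
        erased_crossings e = [set inl c12; inl c13; inl c23]
      & erased_crossings e' = [set inl c12'; inl c13'; inl c23']].

Definition move (L L' : virtual_diagram) : Prop :=
  isotopy L L' \/ [\/ detour L L', Omega1 L L', Omega2 L L' | Omega3 L L'].

Definition equivalent : virtual_diagram -> virtual_diagram -> Prop :=
  clos_refl_sym_trans virtual_diagram move.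

(* The half-edge with which h bounds a black angle (if black) or a white    *)
(* angle of the crossing c.  The black angles are those swept by the        *)
(* overcrossing strand when it is turned counterclockwise.                  *)
Definition angle_mate (D : diagram) (black : bool) (c : classical D)
    (s : bool) (h : dart D) : dart D :=
  turn ((s == over_strand c) == black) h.

(* A state maps A-smoothed crossings to false, B-smoothed ones to true.     *)
Definition state (D : diagram) : finType := {ffun classical D -> bool}.

(* The A-smoothing joins the two black regions, so the half-edges which it  *)
(* connects are those bounding a white angle.                               *)
Definition through (D : diagram) (st : state D) (h : dart D) : dart D :=
  match h.1 with
  | inl (inl c, s) => angle_mate (st c) c s h
  | _ => (h.1, ~~ h.2)
  end.

Definition circle_of (D : diagram) (st : state D) (h : dart D) :
    {set dart D} :=
  [set h' | connect [rel u v | (v == other_end u) || (v == through st u)] h h'].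

Definition circles (D : diagram) (st : state D) : {set {set dart D}} :=
  [set circle_of st h | h : dart D].

(* A closed surface with a checkerboard cell decomposition along a 4-valent *)
(* frame.  The sides of a half-edge are indexed by the colour of the cell:  *)
(* true is black.  The relation frame_edge holds for the two half-edges of  *)
(* an edge (in at least one of the two orders).                             *)
Record atom := Atom {
  half_edge : Type;
  frame_edge : half_edge -> half_edge -> Prop;
  corner_mate : bool -> half_edge -> half_edge
}.

(* The flags (vertex, edge, cell) of the surface are the pairs of a         *)
(* half-edge and a colour.  The surface is orientable iff its flags can be  *)
(* given signs that change whenever exactly one of the vertex, the edge and *)
(* the cell of the flag is changed.                                         *)
Definition orientable (V : atom) : Prop :=
  exists sg : half_edge V -> bool -> bool,
    [/\ forall h h' col, frame_edge h h' -> sg h' col = ~~ sg h col,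
        forall h col, sg (corner_mate col h) col = ~~ sg h col
      & forall h, sg h false = ~~ sg h true].

Definition classical_passage (D : diagram) (x : passage D) : bool :=
  if x is inl (inl _, _) then true else false.

(* The half-edge ((c, s), out) is the outgoing or incoming one of the       *)
(* strand s at c.  A component without classical crossings would only add   *)
(* a sphere, which is orientable; it has no half-edges here.                *)
Definition atom_half_edge (D : diagram) : Type :=
  (classical D * bool * bool)%type.

Definition atom_frame_edge (D : diagram) (h h' : atom_half_edge D) : Prop :=
  let: ((c, s), out) := h in
  let: ((c', s'), out') := h' in
  [/\ out = true, out' = false
    & first_return (@classical_passage D)
        (inl (inl c, s) : passage D) (inl (inl c', s') : passage D)].

Definition atom_corner_mate (D : diagram) (black : bool)
    (h : atom_half_edge D) : atom_half_edge D :=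
  let: ((c, s), out) := h in
  ((c, ~~ s), (angle_mate black c s (inl (inl c, s) : passage D, out)).2).

Definition atom_of (D : diagram) : atom :=
  Atom (@atom_frame_edge D) (@atom_corner_mate D).

Local Open Scope ring_scope.

Section VectorQuotient.

Variables (F : fieldType) (V : vectType F) (W : {vspace V}).

(* The library makes V / W an abelian group; the scaling is added below.    *)
Definition vquot : Type := Quotient.quot (pred_of_vspace W).

HB.instance Definition _ := GRing.Zmodule.on vquot.

Definition vquot_pi (x : V) : vquot :=
  \pi_(Quotient.quot (pred_of_vspace W))%qT x.

Definition vquot_repr (x : vquot) : V :=
  generic_quotient.repr (x : Quotient.quot (pred_of_vspace W)).

Definition vquot_scale (a : F) (x : vquot) : vquot :=
  vquot_pi (a *: vquot_repr x).

Lemma vquot_reprK x : vquot_pi (vquot_repr x) = x.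
Proof. exact: reprK. Qed.

Lemma vquot_piE x y : (vquot_pi x = vquot_pi y) <-> (x - y \in W).
Proof.
by split=> [/eqP|] h; [|apply/eqP]; move: h; rewrite -Quotient.idealrBE.
Qed.

Lemma vquot_piD : {morph vquot_pi : x y / x + y}.
Proof. by move=> x y; rewrite /vquot_pi raddfD. Qed.

Lemma vquot_piZ a x : vquot_pi (a *: x) = vquot_scale a (vquot_pi x).
Proof.
apply/vquot_piE; rewrite -scalerBr memvZ //; apply/vquot_piE.
by rewrite vquot_reprK.
Qed.

Lemma vquot_scaleA a b x :
  vquot_scale a (vquot_scale b x) = vquot_scale (a * b) x.
Proof. by rewrite -(vquot_reprK x) -!vquot_piZ scalerA. Qed.

Lemma vquot_scale1 : left_id 1 vquot_scale.
Proof. by move=> x; rewrite -(vquot_reprK x) -vquot_piZ scale1r. Qed.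

Lemma vquot_scaleDr : right_distributive vquot_scale +%R.
Proof.
move=> a x y; rewrite -(vquot_reprK x) -(vquot_reprK y).
by rewrite -vquot_piD -!vquot_piZ -vquot_piD scalerDr.
Qed.

Lemma vquot_scaleDl x : {morph vquot_scale^~ x : a b / a + b}.
Proof.
by move=> a b; rewrite -(vquot_reprK x) -!vquot_piZ -vquot_piD scalerDl.
Qed.

HB.instance Definition _ := GRing.Zmodule_isLmodule.Build F vquot
  vquot_scaleA vquot_scale1 vquot_scaleDr vquot_scaleDl.

End VectorQuotient.

Section Khovanov.

Variables (F : fieldType) (D : diagram).

(* The order of the crossings: c comes before c' iff rk c < rk c'.          *)
Variable rk : classical D -> nat.

Definition n_plus : nat := #|[set c : classical D | ~~ over_strand c]|.
Definition n_minus : nat := #|[set c : classical D | over_strand c]|.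

(* A basis of the direct sum over the states st of the tensor powers of V   *)
(* with one factor per circle of st: the set e.2 of circles selects the     *)
(* factors that are equal to v_+, the other ones being equal to v_-.        *)
Definition enhanced_state : finType :=
  {e : state D * {set {set dart D}} | e.2 \subset circles e.1}.

Definition state_of (e : enhanced_state) : state D := (val e).1.

Definition plus (e : enhanced_state) (C : {set dart D}) : bool :=
  C \in (val e).2.

Definition B_count (st : state D) : nat := (\sum_(c : classical D) st c)%N.

Definition height (e : enhanced_state) : int :=
  (B_count (state_of e))%:Z - n_minus%:Z.

Definition grading (e : enhanced_state) : int :=
  \sum_(C in circles (state_of e)) (if plus e C then 1 else -1)
    + (B_count (state_of e))%:Z + n_plus%:Z - 2 * n_minus%:Z.

(* The coefficient of v_z in m (v_x (x) v_y), where true stands for +.      *)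
Definition m_coef (x y z : bool) : F :=
  match x, y, z with
  | true, true, true => 1
  | true, false, false => 1
  | false, true, false => 1
  | _, _, _ => 0
  end.

(* The coefficient of v_y (x) v_z in Delta v_x.                             *)
Definition Delta_coef (x y z : bool) : F :=
  match x, y, z with
  | true, true, false => 1
  | true, false, true => 1
  | false, false, false => 1
  | _, _, _ => 0
  end.

(* The coefficient of e' in m (x) Id or Delta (x) Id applied to e.  Circles *)
(* are sets of half-edges, so that the circles which an edge of the cube    *)
(* does not affect are those common to both states.                         *)
Definition edge_map (e e' : enhanced_state) : F :=
  let K := circles (state_of e) in
  let K' := circles (state_of e') in
  if [forall C in K :&: K', plus e C == plus e' C] then
    match enum (K :\: K'), enum (K' :\: K) with
    | [:: C1; C2], [:: C] => m_coef (plus e C1) (plus e C2) (plus e' C)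
    | [:: C], [:: C1; C2] => Delta_coef (plus e C) (plus e' C1) (plus e' C2)
    | _, _ => 0
    end
  else 0.

Definition cube_edge (c : classical D) (st st' : state D) : bool :=
  ~~ st c && (st' == [ffun c' => (c' == c) || st c']).

Definition edge_sign (c : classical D) (st : state D) : F :=
  (-1) ^+ (\sum_(c' | (rk c' < rk c)%N) st c')%N.

Definition differential_coef (e e' : enhanced_state) : F :=
  \sum_(c | cube_edge c (state_of e) (state_of e'))
    edge_sign c (state_of e) * edge_map e e'.

Definition chain : vectType F := {ffun enhanced_state -> F^o}.

Definition basis_chain (e : enhanced_state) : chain :=
  [ffun e' => (e' == e)%:R].

Definition differential_fun (x : chain) : chain :=
  [ffun e' => \sum_e differential_coef e e' * x e].

Lemma differential_fun_is_linear : linear differential_fun.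
Proof.
move=> a x y; apply/ffunP=> e'; rewrite !ffunE /GRing.scale /= mulr_sumr.
rewrite -big_split /=; apply: eq_bigr => e _.
by rewrite !ffunE mulrDr; congr (_ + _); rewrite mulrCA.
Qed.

HB.instance Definition _ :=
  GRing.isLinear.Build F chain chain _ differential_fun
    differential_fun_is_linear.

Definition differential : 'End(chain) := linfun differential_fun.

Definition bihomogeneous (k q : int) : {vspace chain} :=
  (\sum_(e | (height e == k) && (grading e == q)) <[basis_chain e]>)%VS.

Definition cycles (k q : int) : {vspace chain} :=
  (lker differential :&: bihomogeneous k q)%VS.

(* The differential preserves the grading and raises the height by 1, so    *)
(* that its image meets cycles k q in the image of bihomogeneous (k - 1) q. *)
(* No anticommutativity is built in: when the atom is not orientable this   *)
(* is just the quotient of the cycles by those cycles that are boundaries.  *)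
Definition boundaries (k q : int) : {vspace subvs_of (cycles k q)} :=
  (linfun (@vsval F chain (cycles k q)) @^-1: limg differential)%VS.

Definition Kh (k q : int) : lmodType F := vquot (boundaries k q).

End Khovanov.

Definition bigraded_isomorphic (F : fieldType)
    (H H' : int -> int -> lmodType F) : Prop :=
  exists f : forall k q, {linear H k q -> H' k q},
    forall k q, bijective (f k q).

(* Main.v *)
(* The diagrams in a sequence of moves from L to L' need not have orientable
   atoms, so their cubes may contain edges from one circle to one circle. Parity
   avoids them. Treat the crossings outside of a set S as virtual, and let tau
   colour the edges so that the colour changes exactly when a crossing of S is
   traversed. A crossing of S is even if its two strands have different colours;
   the atom is orientable iff all crossings are even for some tau. A move carries
   tau along: the crossing of a kink is even, the two crossings of a second move
   have the same parity, those of a third move keep their parity, and exactly two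
   of them are never even. So a sequence of moves induces one between the sets of
   even crossings, some moves becoming detours, and iterating this makes every
   diagram of the sequence orientable, with L itself unchanged. This links L to a
   diagram A' obtained from L' by forgetting crossings, and likewise L' to some A
   obtained from L; if A' is not L' and A is not L, the same argument links A and
   A', which are smaller, and an induction on the number of crossings concludes.

   Along a sequence of orientable diagrams the complexes are compared in the usual
   way: the small circle created by the move allows the complex to be contracted.
   The circles of a state are the classes of an equivalence relation on the edges,
   and inside of a move this relation is determined by a computation on the few
   edges of the tangle, in all the finitely many cases. *)

(* Tensor powers are not built circle by circle. In F[X]/X^2, with v_+ = 1 and v_- = X, the
   comultiplication is injective. So the tensor power with one factor per circle embeds in the one
   with a factor per edge, as the subspace on which X_a = X_b whenever a and b lie on the same
   circle. There the comultiplication is an inclusion and the multiplication is the product by X_p +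
   X_q. Faces of the cube commute because products do, and edges may be forgotten as long as every
   circle keeps one.

   A colouring for which all kept crossings are even orients the circles of all states coherently. A
   state is then a permutation of the edges, and changing one smoothing multiplies it by a
   transposition, so that it merges two circles or splits one.

   The colouring carried from L to L' depends on the moves. Although L' has a colouring with all
   crossings even, the carried one may be another one; this is why L' can shrink to A', and why the
   argument is run from both ends. *)
Require Import Defs.
From HB Require Import structures.
From Stdlib Require Import Relation_Operators ClassicalEpsilon.
From mathcomp Require Import all_boot all_order all_algebra all_fingroup.
From mathcomp Require Import zify.

Set Implicit Arguments.
Unset Strict Implicit.
Unset Printing Implicit Defensive.

Import GRing.Theory.
Local Open Scope ring_scope.

(** * Complexes up to correspondence of their homology *)

(* A reflexive decision procedure for identities between sums and opposites:
   ring and lia do not apply to the elements of an abstract module. *)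
Inductive zexp := ZVar of nat | ZZero | ZAdd of zexp & zexp | ZOpp of zexp.

Section Zexp.
Variables (V : zmodType) (env : seq V).
Fixpoint zeval (e : zexp) : V :=
  match e with
  | ZVar i => env`_i
  | ZZero => 0
  | ZAdd a b => zeval a + zeval b
  | ZOpp a => - zeval a
  end.
Fixpoint zcoef (e : zexp) (i : nat) : int :=
  match e with
  | ZVar j => if i == j then 1 else 0
  | ZZero => 0
  | ZAdd a b => zcoef a i + zcoef b i
  | ZOpp a => - zcoef a i
  end.
Lemma zeval_coef e : zeval e = \sum_(i < size env) env`_i *~ zcoef e i.
Proof.
elim: e => [j||a ea b eb|a ea] /=; rewrite ?ea ?eb.
- have [lj|lj] := ltnP j (size env).
    rewrite (bigD1 (Ordinal lj)) //= eqxx big1 ?addr0 // => i.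
    by rewrite -val_eqE /= => /negPf->.
  rewrite nth_default // big1 // => i _; case: eqP => // e.
  by move: (ltn_ord i); rewrite e ltnNge lj.
- by rewrite big1.
- by rewrite -big_split; apply: eq_bigr => i _; rewrite mulrzDr.
- by rewrite -sumrN; apply: eq_bigr => i _; rewrite mulrNz.
Qed.
Lemma zexp_eq e e' :
  all (fun i => zcoef e i == zcoef e' i) (iota 0 (size env)) -> zeval e = zeval e'.
Proof.
move=> /allP h; rewrite !zeval_coef; apply: eq_bigr => i _.
by rewrite (eqP (h i _)) // mem_iota add0n ltn_ord.
Qed.
End Zexp.

Ltac zmod_add t l :=
  let rec go l' := lazymatch l' with
    | t :: _ => l | _ :: ?r => go r | _ => constr:(t :: l) end in go l.
Ltac zmod_idx t l := lazymatch l with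
  | t :: _ => constr:(0%N)
  | _ :: ?r => let n := zmod_idx t r in constr:(S n) end.
Ltac zmod_vars t l := lazymatch t with
  | 0%R => l
  | (?a + ?b)%R => let l1 := zmod_vars a l in zmod_vars b l1
  | (- ?a)%R => zmod_vars a l
  | _ => zmod_add t l end.
Ltac zmod_reify t l := lazymatch t with
  | 0%R => constr:(ZZero)
  | (?a + ?b)%R => let x := zmod_reify a l in let y := zmod_reify b l in
      constr:(ZAdd x y)
  | (- ?a)%R => let x := zmod_reify a l in constr:(ZOpp x)
  | _ => let n := zmod_idx t l in constr:(ZVar n) end.
Ltac zmod := lazymatch goal with |- @eq ?T ?a ?b =>
  let l0 := zmod_vars a (@nil T) in let l := zmod_vars b l0 in
  let x := zmod_reify a l in let y := zmod_reify b l in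
  apply: (@zexp_eq _ l x y); vm_compute; reflexivity end.

Section Complexes.

Variable F : fieldType.

Definition lin (V W : lmodType F) (f : V -> W) : Prop :=
  forall a u v, f (a *: u + v) = a *: f u + f v.

Section Lin.
Variables (V W : lmodType F) (f : V -> W) (hf : lin f).
Lemma lin0 : f 0 = 0.
Proof.
have := hf 1 0 0; rewrite !scale1r addr0 => /(congr1 (fun x => x - f 0)).
by rewrite subrr addrK.
Qed.
Lemma linZ a u : f (a *: u) = a *: f u.
Proof. by rewrite -[a *: u]addr0 hf lin0 addr0. Qed.
Lemma linD u v : f (u + v) = f u + f v.
Proof. by rewrite -[u]scale1r hf !scale1r. Qed.
Lemma linN u : f (- u) = - f u.
Proof. by rewrite -!scaleN1r linZ. Qed.
Lemma linB u v : f (u - v) = f u - f v.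
Proof. by rewrite linD linN. Qed.
End Lin.

(* The chains are the x such that cT x, those of bidegree (k, q) are the x such
   that cH k q x. Nothing below depends on the square of cd being zero. *)
Record cplx := Cplx {
  cV : lmodType F;
  cT : cV -> Prop;
  cH : int -> int -> cV -> Prop;
  cd : cV -> cV;
  cd_lin : lin cd;
  cT0 : cT 0;
  cT_lin : forall a x y, cT x -> cT y -> cT (a *: x + y);
  cH0 : forall k q, cH k q 0;
  cH_lin : forall k q a x y, cH k q x -> cH k q y -> cH k q (a *: x + y);
  cHT : forall k q x, cH k q x -> cT x;
  cdT : forall x, cT x -> cT (cd x)
}.

Section CplxLemmas.
Variable A : cplx.
Implicit Types x y : cV A.
Lemma cTZ a x : cT x -> cT (a *: x).
Proof. by move=> h; rewrite -[a *: x]addr0; apply: cT_lin => //; apply: cT0. Qed.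
Lemma cTD x y : cT x -> cT y -> cT (x + y).
Proof. by move=> h h'; rewrite -[x]scale1r; apply: cT_lin. Qed.
Lemma cTN x : cT x -> cT (- x).
Proof. by move=> h; rewrite -scaleN1r; apply: cTZ. Qed.
Lemma cTB x y : cT x -> cT y -> cT (x - y).
Proof. by move=> h h'; apply: cTD => //; apply: cTN. Qed.
Lemma cHZ k q a x : cH k q x -> cH k q (a *: x).
Proof. by move=> h; rewrite -[a *: x]addr0; apply: cH_lin => //; apply: cH0. Qed.
Lemma cHD k q x y : cH k q x -> cH k q y -> cH k q (x + y).
Proof. by move=> h h'; rewrite -[x]scale1r; apply: cH_lin. Qed.
Lemma cHN k q x : cH k q x -> cH k q (- x).
Proof. by move=> h; rewrite -scaleN1r; apply: cHZ. Qed.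
Lemma cHB k q x y : cH k q x -> cH k q y -> cH k q (x - y).
Proof. by move=> h h'; apply: cHD => //; apply: cHN. Qed.
Lemma cH_eq k q k' q' x : cH k q x -> k = k' -> q = q' -> cH k' q' x.
Proof. by move=> h <- <-. Qed.
End CplxLemmas.

Definition cyc (A : cplx) k q (x : cV A) := cH k q x /\ cd x = 0.
Definition bdry (A : cplx) (x : cV A) := exists2 y, cT y & x = cd y.

Lemma bdry_lin (A : cplx) a (x y : cV A) : bdry x -> bdry y -> bdry (a *: x + y).
Proof.
move=> [x' hx ->] [y' hy ->]; exists (a *: x' + y'); first exact: cT_lin.
by rewrite cd_lin.
Qed.
Lemma bdry0 (A : cplx) : bdry (0 : cV A).
Proof. by exists 0; [apply: cT0 | rewrite (lin0 (@cd_lin A))]. Qed.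
Lemma bdryD (A : cplx) (x y : cV A) : bdry x -> bdry y -> bdry (x + y).
Proof. by move=> hx hy; rewrite -[x]scale1r; apply: bdry_lin. Qed.
Lemma bdryN (A : cplx) (x : cV A) : bdry x -> bdry (- x).
Proof. by move=> h; rewrite -scaleN1r -[_ *: x]addr0; apply: bdry_lin => //; apply: bdry0. Qed.

(* Isomorphisms in homology are given by linear correspondences between cycles,
   which can be inverted and composed without choosing representatives. *)
Definition Hiso (r s : int) (A B : cplx) : Prop :=
  forall k q, exists G : cV A -> cV B -> Prop,
    [/\ forall x y, G x y -> cyc k q x /\ cyc (k + r) (q + s) y,
        forall a x y x' y', G x y -> G x' y' -> G (a *: x + x') (a *: y + y'),
        forall x, cyc k q x -> exists y, G x y,
        forall y, cyc (k + r) (q + s) y -> exists x, G x y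
      & forall x y, G x y -> (bdry x <-> bdry y)].

Lemma Hiso_sym r s A B : Hiso r s A B -> Hiso (- r) (- s) B A.
Proof.
move=> h k q; have [G [h1 h2 h3 h4 h5]] := h (k - r) (q - s).
have ek : k - r + r = k by rewrite subrK.
have eq : q - s + s = q by rewrite subrK.
rewrite ek eq in h1 h4.
exists (fun y x => G x y); split=> //.
- by move=> x y /h1 [].
- by move=> a x y x' y'; apply: h2.
- by move=> x y /h5 [? ?]; split.
Qed.

Lemma Hiso_trans r s r' s' A B C :
  Hiso r s A B -> Hiso r' s' B C -> Hiso (r + r') (s + s') A C.
Proof.
move=> h h' k q; have [G [h1 h2 h3 h4 h5]] := h k q.
have [G' [h1' h2' h3' h4' h5']] := h' (k + r) (q + s).
rewrite -!addrA in h1' h4'.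
exists (fun x z => exists2 y, G x y & G' y z); split.
- by move=> x z [y /h1[? _] /h1'[_ ?]].
- move=> a x y x' y' [z g1 g2] [z' g1' g2'].
  by exists (a *: z + z'); [apply: h2|apply: h2'].
- by move=> x /h3[y g]; have [_ /h3'[z g']] := h1 _ _ g; exists z, y.
- by move=> z /h4'[y g]; have [/h4[x g'] _] := h1' _ _ g; exists x, y.
- by move=> x z [y /h5 e /h5' e']; rewrite e e'.
Qed.

Lemma Hiso_eq r s r' s' A B : Hiso r s A B -> r = r' -> s = s' -> Hiso r' s' A B.
Proof. by move=> h <- <-. Qed.

(** The scalars [e] and [e'] allow for the sign -1 that a shift of height puts on the differential.
    The composites are compared with the identity on cycles only and up to boundaries; [x]
    corresponds to [y] when [f x - y] is a boundary. *)
Lemma Hiso_equiv r s A B (f : cV A -> cV B) (g : cV B -> cV A) (e e' : F) :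
  e != 0 -> e' != 0 -> lin f -> lin g ->
  (forall x, cT x -> cT (f x)) -> (forall y, cT y -> cT (g y)) ->
  (forall k q x, cH k q x -> cH (k + r) (q + s) (f x)) ->
  (forall k q y, cH (k + r) (q + s) y -> cH k q (g y)) ->
  (forall x, cT x -> f (cd x) = e *: cd (f x)) ->
  (forall y, cT y -> g (cd y) = e' *: cd (g y)) ->
  (forall x, cT x -> cd x = 0 -> bdry (g (f x) - x)) ->
  (forall y, cT y -> cd y = 0 -> bdry (f (g y) - y)) ->
  Hiso r s A B.
Proof.
move=> ne ne' lf lg fT gT fH gH fd gd gf fg k q.
have fb x : bdry x -> bdry (f x).
  move=> [y hy ->]; exists (e *: f y); first by apply: cTZ; apply: fT.
  by rewrite fd // (linZ (@cd_lin B)).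
have gb x : bdry x -> bdry (g x).
  move=> [y hy ->]; exists (e' *: g y); first by apply: cTZ; apply: gT.
  by rewrite gd // (linZ (@cd_lin A)).
have f0 x : cT x -> cd x = 0 -> cd (f x) = 0.
  move=> hx h; have := fd _ hx; rewrite h (lin0 lf) => /esym/eqP.
  by rewrite scaler_eq0 (negPf ne) => /eqP.
have g0 x : cT x -> cd x = 0 -> cd (g x) = 0.
  move=> hx h; have := gd _ hx; rewrite h (lin0 lg) => /esym/eqP.
  by rewrite scaler_eq0 (negPf ne') => /eqP.
exists (fun x y => [/\ cyc k q x, cyc (k + r) (q + s) y & bdry (f x - y)]).
split.
- by move=> x y [].
- move=> a x y x' y' [[hx dx] [hy dy] b] [[hx' dx'] [hy' dy'] b'].
  split; try split; try exact: cH_lin.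
  + by rewrite cd_lin dx dx' scaler0 addr0.
  + by rewrite cd_lin dy dy' scaler0 addr0.
  + rewrite lf opprD addrACA -scalerBr; exact: bdry_lin.
- move=> x [hx dx]; exists (f x); split=> //.
    by split; [apply: fH | apply: f0 => //; apply: cHT hx].
  by rewrite subrr; apply: bdry0.
- move=> y [hy dy]; exists (g y); split=> //.
    by split; [apply: gH | apply: g0 => //; apply: cHT hy].
  by apply: fg => //; apply: cHT hy.
- move=> x y [[hx dx] [hy dy] b]; split.
    move=> /fb bx; rewrite -[y](subKr (f x)); apply: bdryD => //; exact: bdryN.
  move=> h; have bfx : bdry (f x) by rewrite -[f x](subrK y); apply: bdryD.
  rewrite -[x](subKr (g (f x))); apply: bdryD; first exact: gb.
  by apply: bdryN; apply: gf => //; apply: cHT hx.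
Qed.

Record hom (s : int) (A B : cplx) := Hom {
  hf :> cV A -> cV B;
  hlin : lin hf;
  hT : forall x, cT x -> cT (hf x);
  hH : forall k q x, cH k q x -> cH k (q + s) (hf x);
  hd : forall x, cT x -> hf (cd x) = cd (hf x)
}.

Record ciso (A B : cplx) (f : cV A -> cV B) : Prop := Ciso {
  ilin : lin f;
  iT : forall x, cT x -> cT (f x);
  iH : forall k q x, cT x -> cH k q (f x) <-> cH k q x;
  ci_diff : forall x, cT x -> f (cd x) = cd (f x);
  iinj : forall x, cT x -> f x = 0 -> x = 0;
  isurj : forall y, cT y -> exists2 x, cT x & f x = y
}.

Lemma ciso_Hiso A B f : @ciso A B f -> Hiso 0 0 A B.
Proof.
move=> [fl fT fH fd fi fs] k q.
have fiB x y : cT x -> cT y -> f x = f y -> x = y.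
  move=> hx hy e; apply/eqP; rewrite -subr_eq0; apply/eqP; apply: fi.
    exact: cTB.
  by rewrite (linB fl) e subrr.
exists (fun x y => cyc k q x /\ f x = y); rewrite !addr0; split.
- move=> x y [[hx dx] <-]; split=> //; split; first exact/fH/hx/cHT/hx.
  by rewrite -fd ?dx ?(lin0 fl) //; apply: cHT hx.
- move=> a x y x' y' [[hx dx] <-] [[hx' dx'] <-]; rewrite fl; split=> //.
  by split; [apply: cH_lin | rewrite cd_lin dx dx' scaler0 addr0].
- by move=> x hx; exists (f x).
- move=> y [hy dy]; have [x hx e] := fs _ (cHT hy); exists x; split=> //.
  rewrite -e in hy dy; split; first exact/fH.
  by apply: fi; [apply: cdT | rewrite fd].
- move=> x y [[hx dx] <-]; have tx := cHT hx; split.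
    by move=> [z hz ->]; exists (f z); [apply: fT | rewrite fd].
  move=> [z hz e]; have [w hw ew] := fs _ hz; exists w => //.
  by apply: fiB => //; [apply: cdT | rewrite fd // e ew].
Qed.

(** Only linearity is asked: the composite of a chain map with a retraction or an inclusion of [sdr]
    anticommutes with the differentials and shifts the height, so that it is no longer a [hom]. *)
Record tmap (A B : cplx) := Tmap {
  tf :> cV A -> cV B;
  tlin : lin tf;
  tT : forall x, cT x -> cT (tf x)
}.

Definition tmap_of_hom s A B (f : hom s A B) : tmap A B := Tmap (hlin f) (@hT s A B f).
Coercion tmap_of_hom : hom >-> tmap.

(** * Cones, and their reduction when one side retracts onto a smaller complex *)

Section Cone.

Variables (m n : int) (e : F) (A B : cplx) (f : tmap A B).

Definition coneV : lmodType F := (cV A * cV B)%type.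
Definition coneT (p : coneV) : Prop := cT p.1 /\ cT p.2.
Definition coneH (k q : int) (p : coneV) : Prop :=
  cH k q p.1 /\ cH (k - m) (q - n) p.2.
(** If the differentials of [A] and [B] square to zero, so does this map when [e = -1] and [f]
    commutes with them, or when [e = 1] and [f] anticommutes with them. Both cases occur: the second
    one arises after a retraction. *)
Definition coned (p : coneV) : coneV := (cd p.1, f p.1 + e *: cd p.2).

Program Definition gcone : cplx :=
  @Cplx coneV coneT coneH coned _ _ _ _ _ _ _.
Next Obligation.
move=> a [u u'] [v v']; congr pair => /=; rewrite ?cd_lin //.
by rewrite (tlin f) scalerDr addrACA scalerDr !scalerA mulrC.
Qed.
Next Obligation. by split; apply: cT0. Qed.
Next Obligation. by case: H H0 => ? ? [? ?]; split; apply: cT_lin. Qed.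
Next Obligation. by split; apply: cH0. Qed.
Next Obligation. by case: H H0 => ? ? [? ?]; split; apply: cH_lin. Qed.
Next Obligation. by case: H => h h'; split; [apply: cHT h | apply: cHT h']. Qed.
Next Obligation.
case: H => h h'; split; first exact: cdT.
by apply: cTD; [apply: tT | apply: cTZ; apply: cdT].
Qed.

End Cone.

Lemma gcone_ciso m n e A B A' B' (f : tmap A B) (f' : tmap A' B')
    (a : cV A -> cV A') (b : cV B -> cV B') :
  ciso a -> ciso b -> (forall x, cT x -> b (f x) = f' (a x)) ->
  @ciso (gcone m n e f) (gcone m n e f') (fun p => (a p.1, b p.2)).
Proof.
move=> [al aT aH ad ai asj] [bl bT bH bd bi bsj] comm; split.
- by move=> c [u u'] [v v'] /=; rewrite al bl.
- by move=> [x y] [/= hx hy]; split; [apply: aT|apply: bT].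
- move=> k q [x y] [/= hx hy]; split=> -[/= h1 h2]; split=> /=;
    by [apply/aH|apply/bH].
- move=> [x y] [/= hx hy]; rewrite /coned /=; congr pair; first exact: ad.
  by rewrite (linD bl) (linZ bl) comm // bd.
- by move=> [x y] [/= hx hy] [/ai-> // /bi-> //].
- move=> [x y] [/= /asj[u hu eu] /bsj[v hv ev]]; exists (u, v) => //=.
  by rewrite eu ev.
Qed.

Definition cone A B (f : hom (-1) A B) : cplx := gcone 1 1 (-1) f.

Lemma ciso_opp A : @ciso A A -%R.
Proof.
split.
- by move=> a u v; rewrite opprD scalerN.
- exact: cTN.
- by move=> k q x hx; split=> /cHN //; rewrite opprK.
- by move=> x hx; rewrite (linN (@cd_lin A)).
- by move=> x _ /eqP; rewrite oppr_eq0 => /eqP.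
- by move=> y hy; exists (- y); [apply: cTN | rewrite opprK].
Qed.

Lemma ciso_comp A B C f g : @ciso A B f -> @ciso B C g -> @ciso A C (fun x => g (f x)).
Proof.
move=> [fl fT fH fd fi fs] [gl gT gH gd gi gs]; split.
- by move=> a u v; rewrite fl gl.
- by move=> x /fT/gT.
- move=> k q x hx; split; first by move=> /(gH _ _ _ (fT _ hx))/fH; apply.
  by move=> h; apply/gH; [apply: fT|apply/fH].
- by move=> x hx; rewrite fd // gd //; apply: fT.
- by move=> x hx /(gi _ (fT _ hx))/fi; apply.
- by move=> z /gs[y /fs[x hx <-] <-]; exists x.
Qed.

(* B' sits one step higher than B in both gradings, whence the signs in srd and sid. *)
Record sdr (B B' : cplx) := Sdr {
  sr : cV B -> cV B'; si : cV B' -> cV B; sh : cV B -> cV B;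
  srl : lin sr; sil : lin si; shl : lin sh;
  srT : forall x, cT x -> cT (sr x);
  siT : forall x, cT x -> cT (si x);
  shT : forall x, cT x -> cT (sh x);
  srH : forall k q x, cH k q x -> cH (k - 1) (q - 1) (sr x);
  siH : forall k q x, cH (k - 1) (q - 1) x -> cH k q (si x);
  shH : forall k q x, cH k q x -> cH (k - 1) q (sh x);
  srd : forall x, cT x -> sr (cd x) = - cd (sr x);
  sid : forall x, cT x -> si (cd x) = - cd (si x);
  sri : forall x, cT x -> sr (si x) = x;
  sir : forall x, cT x -> x - si (sr x) = cd (sh x) + sh (cd x);
  srh : forall x, cT x -> sr (sh x) = 0;
  shi : forall x, cT x -> sh (si x) = 0
}.

Lemma sdr_Hiso B B' : sdr B B' -> Hiso (-1) (-1) B B'.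
Proof.
move=> S; apply: (@Hiso_equiv (-1) (-1) B B' (sr S) (si S) (-1) (-1)) => //.
- by rewrite oppr_eq0 oner_eq0.
- by rewrite oppr_eq0 oner_eq0.
- exact: srl.
- exact: sil.
- exact: srT.
- exact: siT.
- exact: srH.
- exact: siH.
- by move=> x hx; rewrite scaleN1r srd.
- by move=> x hx; rewrite scaleN1r sid.
- move=> x hx dx; exists (- sh S x); first by apply: cTN; apply: shT.
  by rewrite (linN (@cd_lin B)) -opprB sir // dx (lin0 (@shl _ _ S)) addr0.
- by move=> x hx dx; rewrite sri // subrr; apply: bdry0.
Qed.

Section ConeSdr.

Variables A B : cplx.

Program Definition tmap_sr B' (S : sdr B B') (f : hom (-1) A B) : tmap A B' :=
  @Tmap _ _ (fun x => sr S (f x)) _ _.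
Next Obligation. by move=> a x y; rewrite hlin (@srl _ _ S). Qed.
Next Obligation. by apply: srT; apply: hT. Qed.

(** Homological perturbation with a single correction, the term [sh S (f x)] of the inclusion, since
    only the target is contracted. The cone already raises [B] by one step and [B'] sits one step
    above it, whence the shift by 2; [e] becomes 1 because [sr] anticommutes with the
    differential. *)
Lemma cone_sr B' (S : sdr B B') (f : hom (-1) A B) :
  Hiso 0 0 (cone f) (gcone 2 2 1 (tmap_sr S f)).
Proof.
have n1 : (1 : F) != 0 by rewrite oner_eq0.
apply: (@Hiso_equiv 0 0 (cone f) (gcone 2 2 1 (tmap_sr S f))
  (fun p => (p.1, sr S p.2)) (fun p => (p.1, si S p.2 + sh S (f p.1))) 1 1) => //.
- by move=> a [u u'] [v v'] /=; rewrite (@srl _ _ S).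
- move=> a [u u'] [v v'] /=; congr pair.
  rewrite /= (@sil _ _ S) hlin (@shl _ _ S) [RHS]/= scalerDr; zmod.
- by move=> [x y] [/= hx hy]; split=> //; apply: srT.
- move=> [x y] [/= hx hy]; split=> //; apply: cTD; first exact: siT.
  by apply: shT; apply: hT.
- move=> k q [x y] [/= hx hy]; split; rewrite /= !addr0 //.
  by apply: (cH_eq (srH S hy)); lia.
- move=> k q [x y]; rewrite /= !addr0 => -[/= hx hy]; split => //=.
  apply: cHD; first by apply: siH; apply: (cH_eq hy); lia.
  by apply: shH; apply: hH.
- move=> [x y] [/= hx hy]; congr pair; rewrite /= !scale1r //.
  by rewrite (linD (@srl _ _ S)) (linZ (@srl _ _ S)) srd // scaleN1r opprK.
- move=> [x y] [/= hx hy]; congr pair; rewrite /= !scale1r //.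
  have fx : cT (f x) by apply: hT.
  have -> : si S (sr S (f x) + cd y) = f x - (cd (sh S (f x)) + sh S (cd (f x))) - cd (si S y).
    by rewrite (linD (@sil _ _ S)) sid // -sir // subKr.
  by rewrite (linD (@cd_lin B)) scaleN1r hd //; zmod.
- move=> [x y] [/= hx hy] [/= dx]; rewrite scaleN1r => /eqP.
  rewrite subr_eq0 => /eqP e; exists (0, sh S y).
    by split; [apply: cT0 | apply: shT].
  congr pair; rewrite /= ?(lin0 (@cd_lin A)) ?(lin0 (hlin f)) ?subrr //.
  have := sir S hy; rewrite scaleN1r e => /(congr1 (fun z => z + si S (sr S y))).
  by rewrite subrK => {3}->; zmod.
- move=> [x y] [/= hx hy] _; exists 0; first exact: cT0.
  rewrite (lin0 (@cd_lin _)) /= (linD (@srl _ _ S)) sri // srh ?addr0; last exact: hT.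
  by rewrite subrr.
Qed.

Program Definition tmap_si A' (S : sdr A A') (f : hom (-1) A B) : tmap A' B :=
  @Tmap _ _ (fun x => f (si S x)) _ _.
Next Obligation. by move=> a x y; rewrite (@sil _ _ S) hlin. Qed.
Next Obligation. by apply: hT; apply: siT. Qed.

(** Dual to the contraction of the target: the correction [f (sh S x)] sits in the projection.
    Source and target now lie on the same level, one step up in the original cone, whence the
    relative shift 0 and the global shift by -1. *)
Lemma cone_si A' (S : sdr A A') (f : hom (-1) A B) :
  Hiso (-1) (-1) (cone f) (gcone 0 0 1 (tmap_si S f)).
Proof.
have n1 : (-1 : F) != 0 by rewrite oppr_eq0 oner_eq0.
apply: (@Hiso_equiv (-1) (-1) (cone f) (gcone 0 0 1 (tmap_si S f))
  (fun p => (sr S p.1, f (sh S p.1) - p.2)) (fun p => (si S p.1, - p.2)) (-1) (-1)) => //.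
- move=> a [u u'] [v v'] /=; congr pair; rewrite /= ?(@srl _ _ S) //.
  by rewrite (@shl _ _ S) hlin [RHS]/= scalerDr scalerN; zmod.
- by move=> a [u u'] [v v'] /=; rewrite (@sil _ _ S) opprD -scalerN.
- move=> [x y] [/= hx hy]; split; first exact: srT.
  by apply: cTB => //; apply: hT; apply: shT.
- by move=> [x y] [/= hx hy]; split; [apply: siT|apply: cTN].
- move=> k q [x y] [/= hx hy]; split; rewrite /= ?subr0.
    by apply: (cH_eq (srH S hx)); lia.
  by apply: cHB => //; apply: hH; apply: shH.
- move=> k q [x y] [/=]; rewrite !subr0 => hx hy; split => /=.
    by apply: siH.
  by apply: cHN.
- move=> [x y] [/= hx hy]; congr pair; rewrite /= !scaleN1r ?scale1r ?srd //.
  have := sir S hx => /(congr1 (fun z => f (z - sh S (cd x)))).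
  rewrite addrK hd; last exact: shT.
  rewrite (linB (@cd_lin B)) => <-; rewrite !(linD (hlin f)) !(linN (hlin f)); zmod.
- move=> [x y] [/= hx hy]; congr pair; rewrite /= !scaleN1r ?scale1r ?sid //.
  by rewrite (linN (@cd_lin B)); zmod.
- move=> [x y] [/= hx hy] [/= dx _]; exists (- sh S x, 0).
    by split; [apply: cTN; apply: shT | apply: cT0].
  congr pair; rewrite /= ?(lin0 (@cd_lin B)) ?(linN (hlin f)) ?(linN (@cd_lin A)).
    have := sir S hx; rewrite dx (lin0 (@shl _ _ S)) addr0 => <-; zmod.
  by rewrite scaler0; zmod.
- move=> [x y] [/= hx hy] _; exists 0; first exact: cT0.
  rewrite (lin0 (@cd_lin _)) /= sri // shi // (lin0 (hlin f)); congr pair => /=.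
    by rewrite subrr.
  by zmod.
Qed.

End ConeSdr.

(** * Cancellation in a square of complexes *)

Section Square.

Variables (K00 K01 K10 K11 : cplx).

Program Definition hom_cone (f : hom (-1) K00 K01) (g : hom (-1) K10 K11)
    (b : hom (-1) K00 K10) (c : hom (-1) K01 K11)
    (comm : forall x, cT x -> c (f x) = g (b x)) : hom (-1) (cone f) (cone g) :=
  @Hom _ (cone f) (cone g) (fun p => (b p.1, c p.2)) _ _ _ _.
Next Obligation. by move=> a [u u'] [v v'] /=; rewrite !hlin. Qed.
Next Obligation. by case: H => h h'; split; apply: hT. Qed.
Next Obligation.
case: H => h h'; split; first exact: hH.
by rewrite /= addrAC; apply: hH.
Qed.
Next Obligation.
case: H => /= h h'; rewrite /coned /= (linD (hlin c)) (linZ (hlin c)) !hd //.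
by rewrite comm.
Qed.

Variables (al : hom (-1) K00 K01) (be : hom (-1) K00 K10)
  (ga : hom (-1) K01 K11) (de : hom (-1) K10 K11)
  (ep : hom 1 K01 K00) (io : hom 1 K11 K01).
Hypothesis sq : forall x, cT x -> ga (al x) = de (be x).
Hypothesis ep_al : forall x, cT x -> ep (al x) = x.
Hypothesis ga_io : forall x, cT x -> ga (io x) = x.
Hypothesis ep_io : forall x, cT x -> ep (io x) = 0.
Hypothesis dec : forall x, cT x ->
  al (ep x) + io (ga x) = x + io (ga (al (ep x))).

Definition Tot : cplx := cone (hom_cone sq).

(** Gaussian elimination. By [ep_al], [ga_io], [ep_io] and [dec], the corner [K01] is the direct sum
    of the image of [al], a copy of [K00], and of the image of [io], a copy of [K11]. Both copies
    cancel against these corners and [K10] is left. The entry [io (de x)] of the inclusion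
    compensates the arrow from [K10] to [K11]; the term [be (ep _)] of the retraction is the price
    of removing [K00]. *)
Program Definition sdr_Tot : sdr Tot K10 :=
  @Sdr Tot K10 (fun p => p.2.1 - be (ep p.1.2)) (fun x => ((0, io (de x)), (x, 0)))
    (fun p => ((ep p.1.2, io p.2.2), (0, 0))) _ _ _ _ _ _ _ _ _ _ _ _ _ _ _.
Next Obligation.
move=> a [[u u1] [u2 u3]] [[v v1] [v2 v3]] /=.
by rewrite !hlin scalerDr scalerN; zmod.
Qed.
Next Obligation.
move=> a u v; rewrite !hlin; congr (_, _); congr pair; rewrite /= ?scaler0 ?addr0 //.
Qed.
Next Obligation.
move=> a [[u u1] [u2 u3]] [[v v1] [v2 v3]] /=; rewrite !hlin.
by congr (_, _); congr pair; rewrite /= ?scaler0 ?addr0.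
Qed.
Next Obligation. by case: H => -[h h'] [h2 h3]; apply: cTB => //; do 2!apply: hT. Qed.
Next Obligation.
by do ![split=> //=]; try exact: cT0; do 2!apply: hT.
Qed.
Next Obligation.
by case: H => -[h h'] [h2 h3]; do ![split=> //=]; try exact: cT0; apply: hT.
Qed.
Next Obligation.
case: H => -[h h'] [h2 h3]; apply: cHB => //.
by have := hH be (hH ep h'); rewrite addrK.
Qed.
Next Obligation.
do ![split=> //=]; try exact: cH0.
by have := hH io (hH de H); rewrite subrK.
Qed.
Next Obligation.
case: H => -[/= h h'] [/= h2 h3]; do ![split=> //=]; try exact: cH0.
  by have := hH ep h'; rewrite subrK.
by have := hH io h3; rewrite subrK.
Qed.
Next Obligation.
case: H => -[/= h h'] [/= h2 h3].
rewrite (linD (hlin ep)) (linD (hlin be)) (linZ (hlin ep)) (linZ (hlin be)).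
rewrite ep_al // !scaleN1r (linB (@cd_lin K10)) !hd //; last exact: hT.
by zmod.
Qed.
Next Obligation.
have t := hT de H.
congr (_, _); congr pair; rewrite /= ?(lin0 (@cd_lin _)) ?(lin0 (hlin al))
  ?(lin0 (hlin be)) ?hd // ?scaleN1r ?ga_io // ?scaler0; zmod.
Qed.
Next Obligation. by rewrite ep_io ?(lin0 (hlin be)) ?subr0 //; apply: hT. Qed.
Next Obligation.
case: H => -[/= h h'] [/= h2 h3]; congr (_, _); congr pair => /=.
- by rewrite (linD (hlin ep)) (linZ (hlin ep)) ep_al // scaleN1r hd //; zmod.
- have := dec h'; rewrite sq ?(linB (hlin de)); last exact: hT.
  rewrite !scaleN1r !(linD (hlin io)) !(linN (hlin io)) (linB (hlin io)) hd // => e.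
  have -> : io (ga s2) = s2 + io (de (be (ep s2))) - al (ep s2) by rewrite -e; zmod.
  zmod.
- by rewrite (lin0 (@cd_lin _)) scaler0; zmod.
- rewrite ga_io // (lin0 (@cd_lin _)).
  change (s0 - 0 = s0 + -1 *: (de 0 + -1 *: (0 : cV K11)) + 0).
  by rewrite (lin0 (hlin de)) scaler0 add0r scaler0; zmod.
Qed.
Next Obligation.
by case: H => -[/= h h'] [/= h2 h3]; rewrite ep_io // (lin0 (hlin be)) subrr.
Qed.
Next Obligation.
by rewrite ep_io ?(lin0 (hlin io)) //; apply: hT.
Qed.

End Square.

(** Each cone negates the differential of its target, so the order in which the two directions are
    coned off is visible on the arrows into the last corner; the sign there repairs it. *)
Lemma Tot_swap (K00 K01 K10 K11 : cplx) (al : hom (-1) K00 K01) (be : hom (-1) K00 K10)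
  (ga : hom (-1) K01 K11) (de : hom (-1) K10 K11)
  (sq : forall x, cT x -> ga (al x) = de (be x))
  (sq' : forall x, cT x -> de (be x) = ga (al x)) :
  @ciso (cone (hom_cone sq)) (cone (hom_cone sq'))
    (fun p => ((p.1.1, p.2.1), (p.1.2, - p.2.2))).
Proof.
split.
- move=> a [[u u1] [u2 u3]] [[v v1] [v2 v3]]; congr (_, _); congr pair => /=.
  by rewrite opprD scalerN.
- by move=> [[u u1] [u2 u3]] [[/= h h1] [/= h2 h3]]; split; split=> //=; apply: cTN.
- move=> k q [[u u1] [u2 u3]] _; split=> -[[/= h h1] [/= h2 h3]]; split; split=> //=.
    by rewrite -[u3]opprK; apply: cHN.
  exact: cHN.
- move=> [[u u1] [u2 u3]] _; congr (_, _); congr pair => /=.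
  by rewrite (linN (@cd_lin _)) !scaleN1r; zmod.
- by move=> [[u u1] [u2 u3]] _ [-> -> -> /eqP]; rewrite oppr_eq0 => /eqP->.
- move=> [[u u1] [u2 u3]] [[/= h h1] [/= h2 h3]].
  exists ((u, u2), (u1, - u3)); first by split; split=> //=; apply: cTN.
  by rewrite /= opprK.
Qed.

End Complexes.

(** * Circles as classes of an equivalence relation, and the operators of the cube *)

Section Merge.

Variable X : finType.
Implicit Types R : rel X.

Definition eqv R : Prop := [/\ reflexive R, symmetric R & transitive R].

Definition merge (p q : X) R R' : Prop :=
  ~~ R p q /\ forall a b, R' a b = [|| R a b, R a p && R q b | R a q && R p b].

Definition saddle (p q : X) R R' : Prop := merge p q R R' \/ merge p q R' R.

Definition classes R : {set {set X}} := [set [set y | R x y] | x : X].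

Lemma merge_pq p q R R' : eqv R -> merge p q R R' -> R' p q.
Proof. by move=> [r _ _] [_ ->]; rewrite !r orbT. Qed.

Lemma merge_sub p q R R' a b : merge p q R R' -> R a b -> R' a b.
Proof. by move=> [_ ->] ->. Qed.

Lemma merge_change p q p' q' R R' :
  eqv R -> R p p' -> R q q' -> merge p q R R' -> merge p' q' R R'.
Proof.
move=> [r s t] pp qq [n e].
have ep a : R a p' = R a p.
  by apply/idP/idP => h; [rewrite s in pp|]; apply: t h _.
have eq a : R a q' = R a q.
  by apply/idP/idP => h; [rewrite s in qq|]; apply: t h _.
have eq' a : R q' a = R q a by rewrite s eq s.
have ep' a : R p' a = R p a by rewrite s ep s.
by split; [rewrite ep' eq|move=> a b; rewrite ep eq ep' eq' e].
Qed.

Lemma card_merge p q R R' : eqv R -> eqv R' -> merge p q R R' ->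
  #|classes R| = #|classes R'|.+1.
Proof.
move=> er er' m; have [r s t] := er; have [r' s' t'] := er'; have [n e] := m.
pose cl x := [set y | R x y]; pose cl' x := [set y | R' x y].
have clE x y : (cl x == cl y) = R x y.
  apply/eqP/idP => [/setP/(_ y)|h]; first by rewrite !inE r.
  apply/setP => z; rewrite !inE; apply/idP/idP; last exact: t.
  by apply: t; rewrite s.
have clE' x y : (cl' x == cl' y) = R' x y.
  apply/eqP/idP => [/setP/(_ y)|h]; first by rewrite !inE r'.
  apply/setP => z; rewrite !inE; apply/idP/idP; last exact: t'.
  by apply: t'; rewrite s'.
pose f (C : {set X}) := if C == cl p then cl' p else C.
have pq : R' p q by apply: merge_pq m.
have fE x : ~~ R x q -> f (cl x) = cl' x.
  move=> nx; rewrite /f clE; case: ifP => h.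
    by apply/eqP; rewrite clE' s'; apply: merge_sub m h.
  by apply/setP => y; rewrite !inE e h (negPf nx) /= orbF.
have K : classes R' = f @: (classes R :\ cl q).
  apply/setP => C; apply/imsetP/imsetP.
    move=> [x _ ->]; case h: (R x q).
      exists (cl p); first by rewrite !inE clE n imset_f.
      by rewrite fE //; apply/eqP; rewrite clE'; apply: (t' q); [apply: merge_sub m h|rewrite s'].
    exists (cl x); first by rewrite !inE clE h imset_f.
    by rewrite fE ?h.
  move=> [D]; rewrite !inE => /andP[nD /imsetP[x _ eD]] ->.
  by exists x; rewrite // eD fE // -clE; move: nD; rewrite eD.
rewrite (cardsD1 (cl q)) imset_f // K card_in_imset // => C D.
rewrite !inE => /andP[nC /imsetP[x _ eC]] /andP[nD /imsetP[y _ eD]].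
have nx : ~~ R x q by rewrite -clE; move: nC; rewrite eC.
have ny : ~~ R y q by rewrite -clE; move: nD; rewrite eD.
rewrite {}eC {}eD !fE // => /eqP; rewrite clE' e (negPf nx) [R q y]s (negPf ny) andbF /= !orbF.
by rewrite -clE => /eqP.
Qed.

End Merge.

Lemma card_classes_pull (X Z : finType) (R : rel X) (RZ : rel Z) (io : Z -> X) :
  eqv R -> (forall z z', RZ z z' = R (io z) (io z')) ->
  (forall x, exists z, R x (io z)) -> #|classes RZ| = #|classes R|.
Proof.
move=> [r s t] e mt; pose g (C : {set X}) := io @^-1: C.
have -> : classes RZ = g @: classes R.
  apply/setP => C; apply/imsetP/imsetP.
    move=> [z _ ->]; exists [set y | R (io z) y]; first exact: imset_f.
    by apply/setP => y; rewrite !inE e.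
  move=> [D /imsetP[x _ ->] ->]; have [z h] := mt x; exists z => //.
  apply/setP => y; rewrite !inE e; apply/idP/idP; last exact: t.
  by apply: t; rewrite s.
rewrite card_in_imset // => C D /imsetP[x _ ->] /imsetP[y _ ->] /setP h.
have [z hz] := mt x; move: (h z); rewrite !inE hz => /esym hy.
apply/setP => w; rewrite !inE; apply/idP/idP => h'.
  by apply: (t _ _ _ hy); apply: (t _ _ _ _ h'); rewrite s.
by apply: (t _ _ _ hz); apply: (t _ _ _ _ h'); rewrite s.
Qed.

Section Tqft.

Variable F : fieldType.

(* For an equivalence relation R on X, a tensor power of V with one factor per
   class is encoded by the functions f on the subsets of X such that TR R f: when
   the points of U lie in distinct classes, f U is the coefficient for which v_+
   stands at the classes meeting U; f vanishes on the other subsets. The operator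
   xop a is the multiplication by v_- at the class of a. *)
Definition Rg (X : finType) : lmodType F := {ffun {set X} -> F^o}.

Section Ops.

Variable X : finType.
Implicit Types (R : rel X) (f : Rg X) (a b p q : X) (U : {set X}).

Definition xop a f : Rg X := [ffun U : {set X} => if a \in U then 0 else f (a |: U)].

Lemma xop_lin a : lin (xop a).
Proof.
move=> c u v; apply/ffunP => U; rewrite !ffunE; case: ifP => // _.
by rewrite scaler0 addr0.
Qed.

Lemma xopC a b f : xop a (xop b f) = xop b (xop a f).
Proof.
apply/ffunP => U; rewrite !ffunE !inE setUCA (eq_sym b).
by case: (a == b); case: (a \in U); case: (b \in U).
Qed.

(** For distinct related [a] and [b] in [U], evaluation at [U :\ a] gives [f U = 0]. For [U]
    containing neither, the equation says that [f (a |: U) = f (b |: U)]. The functions so selected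
    form the image of the iterated comultiplication. *)
Definition TR R f : Prop := forall a b, R a b -> xop a f = xop b f.

Lemma TR_lin R (c : F) f g : TR R f -> TR R g -> TR R (c *: f + g).
Proof. by move=> h h' x y r; rewrite !xop_lin (h _ _ r) (h' _ _ r). Qed.

Lemma TR0 R : TR R 0.
Proof. by move=> x y _; rewrite !(lin0 (@xop_lin _)). Qed.

Lemma TR_xop R a f : TR R f -> TR R (xop a f).
Proof. by move=> h x y r; rewrite xopC (h _ _ r) xopC. Qed.

(* With this encoding the comultiplication does not change f, and the
   multiplication of the classes of p and q is xop p + xop q. *)
Definition Dop R R' f : Rg X :=
  if [pick pq : X * X | R' pq.1 pq.2 && ~~ R pq.1 pq.2] is Some pq
  then xop pq.1 f + xop pq.2 f else f.

Lemma Dop_lin R R' : lin (Dop R R').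
Proof.
move=> c u v; rewrite /Dop; case: pickP => // x _.
by rewrite !xop_lin scalerDr addrACA.
Qed.

Lemma Dop_split R R' f : (forall a b, R' a b -> R a b) -> Dop R R' f = f.
Proof.
by move=> h; rewrite /Dop; case: pickP => // x /andP[/h ->].
Qed.

Lemma Dop_merge p q R R' f : eqv R -> merge p q R R' -> TR R f ->
  Dop R R' f = xop p f + xop q f.
Proof.
move=> er m hf; rewrite /Dop; case: pickP => [[a b]|/(_ (p, q))] /=; last first.
  by rewrite (merge_pq er m) m.1.
have [_ s _] := er.
rewrite m.2 => /andP[/orP[->//|/orP[/andP[ap qb]|/andP[aq pb]]]] _.
  by rewrite (hf _ _ ap) (hf _ _ qb).
by rewrite (hf _ _ aq) (hf _ _ pb) addrC.
Qed.

Lemma Dop_xop a R R' f : Dop R R' (xop a f) = xop a (Dop R R' f).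
Proof.
rewrite /Dop; case: pickP => // x _.
by rewrite (linD (@xop_lin a)) !(xopC a).
Qed.

(** Since [xop] squares to zero, (X_p + X_q) X_p = X_p X_q = (X_p + X_q) X_q: after the
    multiplication the classes of [p] and [q] act alike. *)
Lemma merge_TR p q R R' f : eqv R -> merge p q R R' -> TR R f ->
  TR R' (xop p f + xop q f).
Proof.
move=> er m hf a b; have [_ s _] := er; rewrite m.2.
have xx c : xop c (xop c f) = 0 by apply/ffunP => U; rewrite !ffunE setU11 if_same.
move=> /orP[r|/orP[/andP[ap qb]|/andP[aq pb]]].
- by rewrite !(linD (@xop_lin _)) -!(xopC p) -!(xopC q) (hf _ _ r).
- rewrite !(linD (@xop_lin _)) (xopC a p) (xopC a q) -(xopC p b) -(xopC q b).
  by rewrite (hf _ _ ap) -(hf _ _ qb) !xx add0r addr0 xopC.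
- rewrite !(linD (@xop_lin _)) (xopC a p) (xopC a q) -(xopC p b) -(xopC q b).
  by rewrite (hf _ _ aq) -(hf _ _ pb) !xx add0r addr0 xopC.
Qed.

Lemma Dop_TR p q R R' f : eqv R -> saddle p q R R' -> TR R f -> TR R' (Dop R R' f).
Proof.
move=> er [m|m] hf; first by rewrite (Dop_merge er m hf); apply: merge_TR hf.
have sub a b : R' a b -> R a b by apply: merge_sub m.
by rewrite Dop_split // => a b /sub; apply: hf.
Qed.

Lemma Dop_saddle p q R R' f : eqv R -> eqv R' -> saddle p q R R' -> TR R f ->
  Dop R R' f = if R p q then f else xop p f + xop q f.
Proof.
move=> er er' [m|m] hf; first by rewrite (negPf m.1); apply: Dop_merge.
by rewrite (merge_pq er' m) Dop_split // => a b; apply: merge_sub m.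
Qed.

Lemma saddle_pq p q R R' : eqv R -> eqv R' -> saddle p q R R' -> R' p q = ~~ R p q.
Proof.
move=> er er' [m|m]; first by rewrite (merge_pq er m) m.1.
by rewrite (merge_pq er' m) (negPf m.1).
Qed.

Lemma saddle_merge p q R R' : eqv R' -> saddle p q R R' -> ~~ R p q -> merge p q R R'.
Proof. by move=> er' [m|m] //; rewrite (merge_pq er' m). Qed.

Lemma saddle_split p q R R' : saddle p q R R' -> R p q -> merge p q R' R.
Proof. by move=> [[]/negPf->|m]. Qed.

(** Every arrow is the identity or the product by X_p + X_q or by X_r + X_s, and these commute. It
    remains to see that both paths have the same factors. The only delicate cases are two splittings
    followed by mergings and two mergings followed by splittings: there [r] and [s] are related in
    [R00] to [p] and [q], in one order or the other, so that both sums act equally on [f]. *)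
Lemma Dop_face p q r s R00 R01 R10 R11 f :
  eqv R00 -> eqv R01 -> eqv R10 -> eqv R11 ->
  saddle p q R00 R10 -> saddle p q R01 R11 ->
  saddle r s R00 R01 -> saddle r s R10 R11 -> TR R00 f ->
  Dop R10 R11 (Dop R00 R10 f) = Dop R01 R11 (Dop R00 R01 f).
Proof.
move=> e00 e01 e10 e11 s1 s2 t1 t2 hf.
have h1 := Dop_TR e00 s1 hf; have h2 := Dop_TR e00 t1 hf.
rewrite (Dop_saddle e10 e11 t2) // (Dop_saddle e00 e10 s1) //.
rewrite (Dop_saddle e01 e11 s2) // (Dop_saddle e00 e01 t1) //.
have [_ sy00 _] := e00.
have r10 := saddle_pq e00 e10 s1; have r01 := saddle_pq e00 e01 t1.
have r11 := saddle_pq e01 e11 s2; have r11' := saddle_pq e10 e11 t2.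
case pq: (R00 p q) r10; case rs: (R00 r s) r01 => /= r01 r10.
- have m1 := saddle_split s1 pq; have m2 := saddle_split t1 rs.
  case rs': (R10 r s) r11'; case pq': (R01 p q) r11 => //= r11 r11'.
  + have m3 := saddle_merge e11 s2 (negbT pq').
    have m4 := saddle_split t2 rs'.
    by move: (merge_sub m4 r11); rewrite r10.
  + have m3 := saddle_split s2 pq'.
    by move: (merge_sub m3 r11'); rewrite r01.
  + move: (rs); rewrite m1.2 rs' /=.
    have sub a b : R10 a b -> R00 a b by apply: merge_sub m1.
    move=> /orP[/andP[/sub a /sub b]|/andP[/sub a /sub b]].
      by rewrite (hf _ _ a) -(hf _ _ b).
    by rewrite (hf _ _ a) -(hf _ _ b) addrC.
- have m1 := saddle_split s1 pq; have m2 := saddle_merge e01 t1 (negbT rs).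
  rewrite (merge_sub m2 pq); case rs': (R10 r s) => //.
  by move: rs; rewrite (merge_sub m1 rs').
- have m1 := saddle_merge e10 s1 (negbT pq); have m2 := saddle_split t1 rs.
  rewrite (merge_sub m1 rs); case pq': (R01 p q) => //.
  by move: pq; rewrite (merge_sub m2 pq').
- have m1 := saddle_merge e10 s1 (negbT pq); have m2 := saddle_merge e01 t1 (negbT rs).
  case rs': (R10 r s) r11'; case pq': (R01 p q) r11 => //= r11 r11'.
  + move: rs'; rewrite m1.2 rs /= => /orP[/andP[a b]|/andP[a b]].
      by rewrite (hf _ _ a) -(hf _ _ b).
    by rewrite (hf _ _ a) -(hf _ _ b) addrC.
  + have m3 := saddle_split t2 rs'.
    have := merge_sub (saddle_merge e11 s2 (negbT pq')) r01.
    by rewrite r11'.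
  + have := merge_sub (saddle_merge e11 t2 (negbT rs')) r10.
    by rewrite r11.
  + by rewrite !(linD (@xop_lin _)) !(xopC r) !(xopC s); zmod.
Qed.

End Ops.

Section Res.

Variables (X Z : finType) (io : Z -> X) (io_inj : injective io).
Variables (R : rel X) (RZ : rel Z).
Hypothesis eR : eqv R.
Hypothesis RZE : forall z z', RZ z z' = R (io z) (io z').

Definition res (f : Rg X) : Rg Z := [ffun V : {set Z} => f (io @: V)].

Lemma res_lin : lin res.
Proof. by move=> a u v; apply/ffunP => V; rewrite !ffunE. Qed.

Lemma res_xop z f : res (xop (io z) f) = xop z (res f).
Proof. by apply/ffunP => V; rewrite !ffunE mem_imset // imsetU1. Qed.

Lemma res_TR f : TR R f -> TR RZ (res f).
Proof. by move=> h a b; rewrite RZE -!res_xop => /h->. Qed.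

Lemma pull_eqv : eqv RZ.
Proof.
have [r s t] := eR; split.
- by move=> x; rewrite RZE.
- by move=> x y; rewrite !RZE s.
- by move=> x y z; rewrite !RZE; apply: t.
Qed.

Lemma pull_merge R' RZ' p q :
  (forall z z', RZ' z z' = R' (io z) (io z')) ->
  merge (io p) (io q) R R' -> merge p q RZ RZ'.
Proof. by move=> h [n e]; split; rewrite ?RZE // => a b; rewrite h e !RZE. Qed.

Hypothesis meets : forall x, exists z, R x (io z).

(** A point of [U] outside of the image of [io] can be exchanged for a related point inside it
    without changing the value of [f]; the new point is not already in [U], as [f U] would be zero.
    Hence the induction on the number of points of [U] outside of the image. *)
Lemma res_repr f (U : {set X}) : TR R f -> f U != 0 ->
  exists2 V : {set Z}, f (io @: V) = f U & #|V| = #|U|.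
Proof.
move=> h; have [n] := ubnP #|[set a in U | a \notin codom io]|.
elim: n U => // n IH U; rewrite ltnS => le nz.
have [E|[a]] := set_0Vmem [set a in U | a \notin codom io].
  have e : io @: (io @^-1: U) = U.
    apply/setP => x; apply/imsetP/idP => [[z + ->]|xU]; first by rewrite inE.
    move/setP/(_ x): E; rewrite !inE xU /= => /negbT; rewrite negbK.
    by move=> /codomP[z e]; exists z; rewrite // inE -e.
  by exists (io @^-1: U); rewrite -?(card_imset _ io_inj) e.
rewrite inE => /andP[aU na]; have [z az] := meets a.
have := congr1 (fun g : Rg X => g (U :\ a)) (h _ _ az).
rewrite !ffunE setD11 setD1K // => eU; move: nz; rewrite eU; case: ifP => [|zU nz].
  by rewrite eqxx.
have -> : #|U| = #|io z |: U :\ a| by rewrite cardsU1 zU [LHS](cardsD1 a) aU.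
apply: IH => //; apply: leq_trans le; apply: proper_card; apply/properP; split.
  apply/subsetP => x; rewrite !inE => /andP[/orP[/eqP->|/andP[_ ->]]] //.
  by rewrite codom_f.
exists a; rewrite !inE ?aU ?na //= eqxx orbF.
by apply/negP => /andP[/eqP e]; rewrite {1}e codom_f in na.
Qed.

Lemma res_inj f : TR R f -> res f = 0 -> f = 0.
Proof.
move=> h h0; apply/ffunP => U; rewrite [RHS]ffunE; case: (eqVneq (f U) 0) => //.
move=> nz; have [V e _] := res_repr h nz; rewrite -e.
by have := congr1 (fun g : Rg Z => g V) h0; rewrite !ffunE.
Qed.

(** The preimage is [g] composed with a retraction [rho] of [io] that stays inside the classes. It
    has to be set to zero by hand on sets with two related points: [rho] may identify these points,
    and then [g] may be nonzero on the image. *)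
Lemma res_surj g : TR RZ g -> exists2 f, TR R f & res f = g.
Proof.
move=> hg; have [r s t] := eR.
have [rho rhoK rhoR] : exists2 rho : X -> Z, cancel io rho & forall x, R x (io (rho x)).
  have ex x : [exists z, R x (io z)] by have [z h] := meets x; apply/existsP; exists z.
  pose z0 x := xchoose (existsP (ex x)).
  exists (fun x => if [pick z | io z == x] is Some z then z else z0 x).
    by move=> z; case: pickP => [w /eqP/io_inj //|/(_ z)]; rewrite eqxx.
  by move=> x; case: pickP => [w /eqP->|_]; [apply: r|apply: (xchooseP (existsP (ex x)))].
pose good (U : {set X}) := [forall a in U, [forall b in U, R a b ==> (a == b)]].
have goodP (U : {set X}) : reflect {in U &, forall a b, R a b -> a = b} (good U).
  apply: (iffP forall_inP) => [h a b aU bU ab|h a aU].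
    by have /forall_inP/(_ _ bU)/implyP/(_ ab)/eqP := h _ aU.
  by apply/forall_inP => b bU; apply/implyP => ab; apply/eqP; apply: h.
pose f : Rg X := [ffun U : {set X} => if good U then g (rho @: U) else 0].
have goodU a b (U : {set X}) : R a b -> a \notin U -> good (a |: U) -> good (b |: U).
  move=> ab na /goodP h; apply/goodP => x y; rewrite !inE.
  have hU u : u \in U -> R b u -> b = u.
    move=> uU bu; have e : a = u by apply: h; rewrite ?setU11 ?setU1r //; apply: t ab bu.
    by rewrite e uU in na.
  move=> /orP[/eqP->|xU] /orP[/eqP->|yU] // xy.
  - exact: hU.
  - by symmetry; apply: hU => //; rewrite s.
  - by apply: h => //; rewrite setU1r.
exists f; last first.
  apply/ffunP => V; rewrite !ffunE; case: ifP => [_|/negbT/goodP h].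
    by congr (g _); rewrite -imset_comp (eq_imset _ rhoK) imset_id.
  have [h0|] := eqVneq (g V) 0; first by rewrite h0.
  move=> ng; case: h => x y /imsetP[z zV ->] /imsetP[w wV ->] zw.
  congr (io _); apply/eqP/negPn/negP => nzw.
  have := hg _ _ (etrans (RZE z w) zw) => /(congr1 (fun f : Rg Z => f (V :\ z))).
  rewrite !ffunE setD11 setD1K // !inE wV eq_sym nzw => e.
  by rewrite e eqxx in ng.
have fx a b (U : {set X}) : R a b -> b \in U -> a \notin U -> f (a |: U) = 0.
  move=> ab bU na; rewrite ffunE; case: ifP => // /goodP/(_ a b).
  rewrite setU11 setU1r // => /(_ isT isT ab) e.
  by rewrite e bU in na.
move=> a b ab; apply/ffunP => U; rewrite ![xop _ _ _]ffunE.
have ba : R b a by rewrite s.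
case aU: (a \in U); case bU: (b \in U) => //.
- by rewrite (fx b a) // bU.
- by rewrite (fx a b) // aU.
have gab : good (b |: U) = good (a |: U).
  by apply/idP/idP; apply: goodU; rewrite ?aU ?bU.
rewrite !ffunE gab; case: ifP => // ga.
have rn c : R a c -> c \notin U -> good (c |: U) -> rho c \notin rho @: U.
  move=> ac nc /goodP h; apply/imsetP => -[u uU e].
  have cu : c = u.
    apply: h; rewrite ?setU11 ?setU1r //; apply: t (rhoR c) _.
    by rewrite e s.
  by rewrite cu uU in nc.
have := hg (rho a) (rho b); rewrite RZE => h.
have {h} /(congr1 (fun f : Rg Z => f (rho @: U))) : xop (rho a) g = xop (rho b) g.
  by apply: h; apply: (t a); [rewrite s|apply: t ab (rhoR b)].
have nra := rn a (r a) (negbT aU) ga.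
have nrb := rn b ab (negbT bU) (etrans gab ga).
by rewrite !ffunE !imsetU1 (negPf nra) (negPf nrb).
Qed.

Lemma res_Dop R' RZ' f :
  (forall z z', RZ' z z' = R' (io z) (io z')) -> eqv R' ->
  (exists p q, saddle p q R R') -> TR R f ->
  res (Dop R R' f) = Dop RZ RZ' (res f).
Proof.
move=> e' er' [p [q [m|m]]] hf; last first.
  rewrite !Dop_split //; first by move=> a b; rewrite RZE e'; apply: merge_sub m.
  by move=> a b; apply: merge_sub m.
have [u pu] := meets p; have [v qv] := meets q.
have m' := merge_change eR pu qv m.
rewrite (Dop_merge eR m' hf) (Dop_merge pull_eqv (pull_merge e' m') (res_TR hf)).
by rewrite (linD res_lin) !res_xop.
Qed.

End Res.

End Tqft.

Definition clear (I : finType) (c : I) (st : {ffun I -> bool}) : {ffun I -> bool} :=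
  [ffun i => (i != c) && st i].

Definition ones (I : finType) (st : {ffun I -> bool}) : nat := (\sum_i st i)%N.

Definition oext (I : finType) (b : bool) (st : {ffun I -> bool}) : {ffun option I -> bool} :=
  [ffun o => if o is Some i then st i else b].

Definition ork (I : Type) (rk : I -> nat) (o : option I) : nat :=
  if o is Some i then (rk i).+1 else 0%N.

Lemma clearC (I : finType) (c d : I) st : clear c (clear d st) = clear d (clear c st).
Proof. by apply/ffunP => i; rewrite !ffunE andbCA. Qed.

Lemma clear_oext (I : finType) b (c : I) st :
  clear (Some c) (oext b st) = oext b (clear c st).
Proof. by apply/ffunP => -[i|]; rewrite !ffunE. Qed.

Lemma clear_oextN (I : finType) b (st : {ffun I -> bool}) :
  clear None (oext b st) = oext false st.
Proof. by apply/ffunP => -[i|]; rewrite !ffunE. Qed.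

Lemma ones_oext (I : finType) b (st : {ffun I -> bool}) : ones (oext b st) = (b + ones st)%N.
Proof.
rewrite /ones (bigD1 None) //= ffunE; congr addn.
rewrite (reindex_omap Some (fun o => o)) /=; last by case.
by apply: eq_big => [i|i _]; rewrite ?eqxx ?ffunE.
Qed.

Lemma oext_surj (I : finType) (st : {ffun option I -> bool}) :
  st = oext (st None) [ffun i => st (Some i)].
Proof. by apply/ffunP => -[i|]; rewrite !ffunE. Qed.

(** * Cubes of equivalence relations and their complexes *)

Section Cubes.

Variable F : fieldType.

(* Consecutive relations differ by one merging or one splitting of classes: a
   single-cycle smoothing never occurs. *)
Record vcube (I X : finType) := VCube {
  vR :> {ffun I -> bool} -> rel X;
  v_eqv : forall st, eqv (vR st);
  v_sad : forall (st : {ffun I -> bool}) c, st c -> exists p q, saddle p q (vR (clear c st)) (vR st);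
  v_face : forall (st : {ffun I -> bool}) c d, c != d -> st c -> st d ->
    forall f : Rg F X, TR (vR (clear c (clear d st))) f ->
      Dop (vR (clear c st)) (vR st) (Dop (vR (clear d (clear c st))) (vR (clear c st)) f)
      = Dop (vR (clear d st)) (vR st) (Dop (vR (clear c (clear d st))) (vR (clear d st)) f)
}.

Section Cube.

Variables (I X : finType) (R : vcube I X) (rk : I -> nat).

Definition cubeV : lmodType F := {ffun {ffun I -> bool} -> Rg F X}.
Definition cubeT (f : cubeV) : Prop := forall st, TR (R st) (f st).
(** With [#|U|] factors v_+ and all others v_-, a tensor has degree twice [#|U|] minus the number of
    circles. The normalising shifts by the signs of the crossings are added only in [HI]. *)
Definition cubeH (k q : int) (f : cubeV) : Prop :=
  cubeT f /\ forall st U, f st U != 0 ->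
    k = (ones st)%:Z /\ q = (#|U|.*2)%:Z - #|classes (R st)|%:Z + (ones st)%:Z.
Definition csgn (c : I) (st : {ffun I -> bool}) : F :=
  (-1) ^+ (\sum_(i | (rk i < rk c)%N) st i)%N.
Definition cubed (f : cubeV) : cubeV :=
  [ffun st : {ffun I -> bool} => \sum_(c | st c) csgn c st *: Dop (R (clear c st)) (R st) (f (clear c st))].

Program Definition cube : cplx F := @Cplx F cubeV cubeT cubeH cubed _ _ _ _ _ _ _.
Next Obligation.
move=> a u v; apply/ffunP => st; rewrite !ffunE scaler_sumr -big_split /=.
apply: eq_bigr => c _; rewrite !ffunE Dop_lin scalerDr !scalerA.
by rewrite mulrC.
Qed.
Next Obligation. by move=> st; rewrite ffunE; apply: TR0. Qed.
Next Obligation. by move=> st; rewrite !ffunE; apply: TR_lin. Qed.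
Next Obligation.
by split=> [st|st U]; rewrite !ffunE ?eqxx //; apply: TR0.
Qed.
Next Obligation.
case: H H0 => [h h'] [h1 h1']; split=> [st|st U].
  by rewrite !ffunE; apply: TR_lin.
rewrite !ffunE; case e: (x st U == 0); last by move=> _; apply/h'/negbT.
by rewrite (eqP e) scaler0 add0r; apply: h1'.
Qed.
Next Obligation. by case: H. Qed.
Next Obligation.
move=> st; rewrite ffunE; elim/big_ind: _; first exact: TR0.
  by move=> u v hu hv; rewrite -[u]scale1r; apply: TR_lin.
move=> c hc; rewrite -[_ *: _]addr0; apply: TR_lin; last exact: TR0.
have [p [q s]] := v_sad R hc; apply: Dop_TR s (H _); exact: v_eqv.
Qed.

End Cube.

Lemma Dop_deg (X : finType) (R R' : rel X) p q (f : Rg F X) U :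
  eqv R -> eqv R' -> saddle p q R R' -> TR R f -> Dop R R' f U != 0 ->
  exists2 U' : {set X}, f U' != 0 & (#|U|.*2 + #|classes R| + 1 = #|U'|.*2 + #|classes R'|)%N.
Proof.
move=> er er' s hf; rewrite (Dop_saddle er er' s hf); case: ifP => pq h.
  exists U => //; have := card_merge er' er (saddle_split s pq); lia.
have e := card_merge er er' (saddle_merge er' s (negbT pq)).
have : (xop p f U != 0) || (xop q f U != 0).
  by apply/norP => -[/negbNE/eqP a /negbNE/eqP b]; move: h; rewrite ffunE a b addr0 eqxx.
rewrite !ffunE => /orP[] ; case: ifP => u; rewrite ?eqxx // => nz.
  by exists (p |: U); rewrite // cardsU1 u e /=; lia.
by exists (q |: U); rewrite // cardsU1 u e /=; lia.
Qed.

Record vedge (I X : finType) (R0 R1 : vcube I X) : Prop := VEdge {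
  e_sad : forall st, exists p q, saddle p q (R0 st) (R1 st);
  e_face : forall (st : {ffun I -> bool}) c, st c ->
    forall f : Rg F X, TR (R0 (clear c st)) f ->
      Dop (R0 st) (R1 st) (Dop (R0 (clear c st)) (R0 st) f)
      = Dop (R1 (clear c st)) (R1 st) (Dop (R0 (clear c st)) (R1 (clear c st)) f)
}.

Section Edge.

Variables (I X : finType) (R0 R1 : vcube I X) (E : vedge R0 R1) (rk : I -> nat).

Definition vedge_map (f : cubeV I X) : cubeV I X :=
  [ffun st : {ffun I -> bool} => Dop (R0 st) (R1 st) (f st)].

Program Definition hedge : hom (-1) (cube R0 rk) (cube R1 rk) :=
  @Hom F (-1) (cube R0 rk) (cube R1 rk) vedge_map _ _ _ _.
Next Obligation. by move=> a u v; apply/ffunP => st; rewrite !ffunE Dop_lin. Qed.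
Next Obligation.
move=> st; rewrite ffunE; have [p [q s]] := e_sad E st.
exact: Dop_TR (v_eqv R0 _) s (H st).
Qed.
Next Obligation.
have [h h'] := H; split=> [st|st U]; rewrite ffunE; have [p0 [q0 s]] := e_sad E st.
  exact: Dop_TR (v_eqv R0 _) s (h st).
move=> /(Dop_deg (v_eqv R0 _) (v_eqv R1 _) s (h st))[U' /h'[-> ->]].
move=> e; split=> //=; move: e; set a := #|classes _|; set b := #|classes _|; lia.
Qed.
Next Obligation.
apply/ffunP => st; rewrite !ffunE (big_morph _ (linD (@Dop_lin _ _ _ _)) (lin0 (@Dop_lin _ _ _ _))).
apply: eq_bigr => c hc; rewrite !ffunE (linZ (@Dop_lin _ _ _ _)) /=.
by congr (_ *: _); apply: e_face => //; apply: H.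
Qed.

End Edge.

Section Sub.

Variables (I X : finType).

Program Definition vsub (R : vcube (option I) X) b : vcube I X :=
  @VCube I X (fun st => R (oext b st)) _ _ _.
Next Obligation. exact: v_eqv. Qed.
Next Obligation. by rewrite -clear_oext; apply: v_sad; rewrite ffunE. Qed.
Next Obligation.
by rewrite -!clear_oext; apply: v_face; rewrite ?ffunE // -!clear_oext in H2 *.
Qed.

Lemma vsub_edge (R : vcube (option I) X) : vedge (vsub R false) (vsub R true).
Proof.
split=> [st|st c hc f hf] /=.
  by rewrite -(clear_oextN true st); apply: v_sad; rewrite ffunE.
have := @v_face _ _ R (oext true st) None (Some c) isT; rewrite !ffunE => /(_ isT hc f).
by rewrite !(clear_oext, clear_oextN) => ->.
Qed.

Lemma vedge_sub (R0 R1 : vcube (option I) X) b :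
  vedge R0 R1 -> vedge (vsub R0 b) (vsub R1 b).
Proof.
move=> [es ef]; split=> [st|st c hc f hf]; first exact: es.
have := ef (oext b st) (Some c); rewrite ffunE => /(_ hc f).
by rewrite /= clear_oext => ->.
Qed.

Variable rk : I -> nat.

Definition hsad (R : vcube (option I) X) := hedge (vsub_edge R) rk.

Lemma hsad_edge (R0 R1 : vcube (option I) X) (E : vedge R0 R1) x :
  cT (c := cube (vsub R0 false) rk) x ->
  hedge (vedge_sub true E) rk (hsad R0 x) = hsad R1 (hedge (vedge_sub false E) rk x).
Proof.
move=> hx; apply/ffunP => st; rewrite !ffunE /=.
have := @e_face _ _ _ _ E (oext true st) None; rewrite ffunE => /(_ isT (x st)).
by rewrite clear_oextN => -> //; apply: hx.
Qed.

Definition hcone (R0 R1 : vcube (option I) X) (E : vedge R0 R1) :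
  hom (-1) (cone (hsad R0)) (cone (hsad R1)) := hom_cone (hsad_edge E).

Definition split_cube (f : cubeV (option I) X) : cubeV I X * cubeV I X :=
  ([ffun st : {ffun I -> bool} => f (oext false st)], [ffun st : {ffun I -> bool} => f (oext true st)]).

Lemma split_edge (R0 R1 : vcube (option I) X) (E : vedge R0 R1) x :
  split_cube (hedge E (ork rk) x) = hcone E (split_cube x).
Proof. by congr pair; apply/ffunP => st; rewrite !ffunE. Qed.

Lemma sum_ork (c : I) b (st : {ffun I -> bool}) :
  (\sum_(o | (ork rk o < ork rk (Some c))%N) oext b st o
   = b + \sum_(i | (rk i < rk c)%N) st i)%N.
Proof.
rewrite (bigD1 None) //= ffunE; congr addn.
rewrite (reindex_omap Some (fun o => o)) /=; last by case=> [i|]; rewrite ?andbF.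
by apply: eq_big => [i|i _]; rewrite ?eqxx ?ltnS ?andbT ?ffunE.
Qed.

Lemma big_option (V : zmodType) (P : pred (option I)) (G : option I -> V) :
  \sum_(o | P o) G o = (if P None then G None else 0) + \sum_(i | P (Some i)) G (Some i).
Proof.
have e : \sum_(o | P o && (o != None)) G o = \sum_(i | P (Some i)) G (Some i).
  rewrite (reindex_omap Some (fun o => o)) /=; last by case=> [i|]; rewrite ?andbF.
  by apply: eq_big => [i|i _] //; rewrite eqxx !andbT.
rewrite -e; case: ifP => h; first by rewrite (bigD1 None).
by rewrite add0r; apply: eq_bigl => -[i|]; rewrite ?andbT // h.
Qed.

(** [ork] puts the new crossing before all others. Its own edges thus have sign 1, while every other
    edge receives one more sign where the new crossing is labelled 1; this is the -1 in [cone]. *)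
Lemma cube_cone (R : vcube (option I) X) : @ciso F (cube R (ork rk)) (cone (hsad R)) split_cube.
Proof.
split.
- by move=> a u v; congr pair; apply/ffunP => st; rewrite !ffunE.
- by move=> x h; split=> st; rewrite ffunE; apply: h.
- move=> k q x hx; split.
    move=> [[/= _ h0] [/= _ h1]]; split=> // st U; rewrite (oext_surj st).
    move: (st None) [ffun _ => _] => {st} b st; rewrite ones_oext.
    case: b => nz; last by have := h0 st U; rewrite !ffunE add0n; apply.
    have := h1 st U; rewrite !ffunE => /(_ nz)[a b].
    by rewrite PoszD (_ : Posz true = Posz 1%N) //; move: a b; set c := #|classes _|; lia.
  move=> [_ h]; split; split=> [st|st U]; rewrite /= ?ffunE; try exact: hx.
    by move=> /h; rewrite ones_oext add0n.
  move=> /h; rewrite ones_oext PoszD (_ : Posz true = Posz 1%N) // => -[-> ->] /=.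
  by set c := #|classes _|; lia.
- move=> x hx; congr pair; apply/ffunP => st; rewrite !ffunE big_option ffunE.
    rewrite add0r; apply: eq_big => [i|i _]; rewrite ?ffunE //.
    by rewrite /csgn sum_ork add0n clear_oext.
  rewrite /csgn big_pred0 ?expr0 ?scale1r ?clear_oextN; last first.
    by case=> [i|] //.
  congr (_ + _); rewrite scaler_sumr; apply: eq_big => [i|i _]; rewrite ?ffunE //.
  by rewrite sum_ork exprS clear_oext scalerA.
- move=> x _ [/ffunP h0 /ffunP h1]; apply/ffunP => st; rewrite (oext_surj st).
  case: (st None).
    by have := h1 [ffun i => st (Some i)]; rewrite !ffunE.
  by have := h0 [ffun i => st (Some i)]; rewrite !ffunE.
- move=> [y0 y1] [/= h0 h1].
  pose f : cubeV (option I) X :=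
    [ffun st : {ffun option I -> bool} => if st None then y1 [ffun i => st (Some i)] else y0 [ffun i => st (Some i)]].
  have oeK b (st : {ffun I -> bool}) : [ffun i => oext b st (Some i)] = st.
    by apply/ffunP => i; rewrite !ffunE.
  exists f; last by congr pair; apply/ffunP => st; rewrite !ffunE oeK.
  move=> st; rewrite (oext_surj st) ffunE oeK ffunE.
  by case: (st None); [apply: h1|apply: h0].
Qed.

End Sub.

End Cubes.

(** * Independence of the order of the crossings and of the chosen points *)

Section Gauge.

Variables (F : fieldType) (I : finType) (rk rk' : I -> nat).
Hypotheses (rk_inj : injective rk) (rk'_inj : injective rk').

(* The sign of the reordering of the crossings with label 1. *)
Definition gauge (st : {ffun I -> bool}) : F :=
  (-1) ^+ (\sum_i \sum_j ((rk' i < rk' j) && (rk j < rk i)) * (st i * st j))%N.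

(** The exponent of [gauge] counts the pairs of crossings labelled 1 that the two orders list
    differently. Relabelling [c] affects the pairs containing [c]. The crossings labelled 1 whose
    position relative to [c] differs are those that precede [c] in exactly one order, so their
    number has the parity of the two sign exponents together. *)
Lemma gauge_csgn (st : {ffun I -> bool}) c : st c ->
  gauge st * csgn F rk c st = csgn F rk' c st * gauge (clear c st).
Proof.
move=> sc; pose w i j : nat := ((rk' i < rk' j) && (rk j < rk i))%N.
pose inv (s : {ffun I -> bool}) := (\sum_i \sum_j w i j * (s i * s j))%N.
have w0 : w c c = 0%N by rewrite /w ltnn.
have E : inv st = (inv (clear c st) + \sum_(i | i != c) (w c i + w i c) * st i)%N.
  rewrite /inv (bigD1 c) //= [in RHS](bigD1 c) //=.
  rewrite [X in _ = (X + _ + _)%N]big1 ?add0n; last first.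
    by move=> j _; rewrite ffunE eqxx muln0.
  rewrite (bigD1 c) //= w0 mul0n add0n.
  under [X in _ = (_ + X)%N]eq_bigr do rewrite mulnDl.
  rewrite big_split /= addnCA; congr addn.
    by apply: eq_bigr => i _; rewrite sc mul1n.
  rewrite -big_split; apply: eq_bigr => i ic /=.
  rewrite (bigD1 c) //= [in RHS](bigD1 c) //= sc muln1 !ffunE ic eqxx !muln0 add0n addnC.
  by congr addn; apply: eq_bigr => j jc; rewrite !ffunE jc.
rewrite /gauge -/(inv st) -/(inv (clear c st)) E /csgn -!exprD.
rewrite -[LHS]signr_odd -[RHS]signr_odd; congr (_ ^+ _); congr (nat_of_bool _).
rewrite !oddD -addbA addbC; congr addb; rewrite -oddD.
rewrite (big_mkcond (fun i => rk i < rk c)%N) (big_mkcond (fun i => rk' i < rk' c)%N) /=.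
rewrite [X in (_ + X)%N](bigD1 c) //= ltnn add0n -big_split [in RHS](bigD1 c) //= ltnn add0n.
elim/big_rec2: _ => // i x y ic e; rewrite !oddD e; congr addb; rewrite /w.
have n1 : (rk i == rk c) = false by rewrite (inj_eq rk_inj) (negPf ic).
have n2 : (rk' i == rk' c) = false by rewrite (inj_eq rk'_inj) (negPf ic).
by case: (ltngtP (rk i) (rk c)) n1; case: (ltngtP (rk' i) (rk' c)) n2 => //=;
  case: (st i).
Qed.

End Gauge.

Section Equiv.

Variables (F : fieldType) (I J X Z : finType) (R : vcube F I X) (Q : vcube F J Z).
Variables (h : J -> I) (g : I -> J) (io : Z -> X).
Hypotheses (hK : cancel h g) (gK : cancel g h) (io_inj : injective io).
Definition spull (st : {ffun J -> bool}) : {ffun I -> bool} := [ffun i => st (g i)].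
Hypothesis QE : forall st z z', Q st z z' = R (spull st) (io z) (io z').
Hypothesis meets : forall st x, exists z, R st x (io z).
Variables (rk : I -> nat) (rk' : J -> nat).
Hypotheses (rk_inj : injective rk) (rk'_inj : injective rk').

Lemma ones_spull (st : {ffun J -> bool}) : ones (spull st) = ones st.
Proof.
rewrite /ones (reindex h) /=; first by apply: eq_bigr => j _; rewrite ffunE hK.
by exists g => ? _; rewrite ?hK ?gK.
Qed.

Lemma spull_surj (st : {ffun I -> bool}) : spull [ffun j => st (h j)] = st.
Proof. by apply/ffunP => i; rewrite !ffunE gK. Qed.

Lemma clear_spull c (st : {ffun J -> bool}) : clear c (spull st) = spull (clear (g c) st).
Proof. by apply/ffunP => i; rewrite !ffunE (can_eq gK). Qed.

Definition equiv_map (f : cubeV F I X) : cubeV F J Z :=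
  [ffun st : {ffun J -> bool} => gauge F (rk \o h) rk' st *: res io (f (spull st))].

(** Three changes are made at once: the crossings are renamed, their order is changed at the cost of
    the sign [gauge], and the tensors are restricted to points meeting all circles. *)
Lemma cube_equiv : @ciso F (cube R rk) (cube Q rk') equiv_map.
Proof.
have gs (st : {ffun J -> bool}) : gauge F (rk \o h) rk' st != 0 by rewrite expf_neq0 // oppr_eq0 oner_eq0.
have cd (st : {ffun J -> bool}) : #|classes (Q st)| = #|classes (R (spull st))|.
  by apply: (card_classes_pull (v_eqv R _) (QE st)); apply: meets.
have rT (st : {ffun J -> bool}) f : TR (R (spull st)) f -> TR (Q st) (res io f).
  exact: res_TR io_inj _ _ (QE st) f.
have ri (st : {ffun J -> bool}) f : TR (R (spull st)) f -> res io f = 0 -> f = 0.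
  exact: res_inj (meets _) f.
have mT f : cubeT R f -> cubeT Q (equiv_map f).
  move=> hf st; rewrite ffunE -[_ *: _]addr0; apply: TR_lin; last exact: TR0.
  exact/rT/hf.
split.
- move=> a u v; apply/ffunP => st; rewrite !ffunE res_lin.
  by rewrite scalerDr !scalerA mulrC.
- exact: mT.
- move=> k q f hf; split=> -[_ h0]; (split; first by [|apply: mT]) => st U.
    move: (spull_surj st) => <-; move: [ffun j => _] => {}st nz.
    have tst : TR (R (spull st)) (f (spull st)) := hf _.
    have [V e cV] := res_repr io_inj (meets _) tst nz.
    have nzV : f (spull st) (io @: V) != 0 by rewrite e.
    have := h0 st V; rewrite !ffunE scaler_eq0 (negPf (gs st)) => /(_ nzV).
    by rewrite cV cd ones_spull.
  rewrite !ffunE scaler_eq0 (negPf (gs st)) => /h0.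
  by rewrite ones_spull card_imset // cd.
- move=> f hf; apply/ffunP => st; rewrite !ffunE.
  rewrite (big_morph _ (linD (@res_lin _ _ _ _)) (lin0 (@res_lin _ _ _ _))) scaler_sumr.
  rewrite (reindex h) /=; last by exists g => ? _; rewrite ?hK ?gK.
  apply: eq_big => [j|j]; first by rewrite ffunE hK.
  rewrite ffunE hK => sj.
  rewrite clear_spull hK ffunE (linZ (@Dop_lin _ _ _ _)) (linZ (@res_lin _ _ _ _)) !scalerA.
  have -> : csgn F rk (h j) (spull st) = csgn F (rk \o h) j st.
    congr (_ ^+ _); rewrite (reindex h) /=; last by exists g => ? _; rewrite ?hK ?gK.
    by apply: eq_bigr => i _; rewrite ffunE hK.
  rewrite gauge_csgn //; last by apply: inj_comp => //; apply: can_inj hK.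
  congr (_ *: _); have e := clear_spull (h j) st; rewrite hK in e.
  apply: (res_Dop io_inj (v_eqv R _) (QE (clear j st)) (meets _) (QE st)) => //.
  + exact: v_eqv.
  + by rewrite -e; apply: v_sad; rewrite ffunE hK.
- move=> f hf /ffunP f0; apply/ffunP => st; rewrite -(spull_surj st) ffunE.
  apply: ri; first exact: hf.
  by have := f0 [ffun j => st (h j)]; rewrite !ffunE => /eqP; rewrite scaler_eq0 (negPf (gs _)) => /eqP.
- move=> y hy.
  have /fin_all_exists2[f hf e] (st : {ffun I -> bool}) : exists2 f : Rg F X, TR (R st) f &
      res io f = (gauge F (rk \o h) rk' [ffun j => st (h j)])^-1 *: y [ffun j => st (h j)].
    move: (spull_surj st) => <-; move: [ffun j => _] => {}st.
    have -> : [ffun j => spull st (h j)] = st by apply/ffunP => j; rewrite !ffunE hK.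
    apply: (res_surj io_inj (v_eqv R _) (QE _) (meets _)).
    by rewrite -[_ *: _]addr0; apply: TR_lin; [apply: hy|apply: TR0].
  exists [ffun st => f st]; first by move=> st; rewrite ffunE.
  apply/ffunP => st; rewrite !ffunE e.
  have -> : [ffun j => spull st (h j)] = st by apply/ffunP => j; rewrite !ffunE hK.
  by rewrite scalerA divff ?scale1r.
Qed.

End Equiv.

Section Pull.

Variables (F : fieldType) (I J X Z : finType) (R : vcube F I X).
Variables (h : J -> I) (g : I -> J) (io : Z -> X) (Q : {ffun J -> bool} -> rel Z).
Hypotheses (hK : cancel h g) (gK : cancel g h) (io_inj : injective io).
Hypothesis QE : forall st z z', Q st z z' = R (spull g st) (io z) (io z').
Hypothesis meets : forall st x, exists z, R st x (io z).

(** The faces of the new cube commute because each tensor over [Z] is the restriction of one over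
    [X] ([res_surj]), for which the face of [R] commutes, and restriction commutes with the
    arrows. *)
Lemma vpull : exists V : vcube F J Z, forall st, V st = Q st.
Proof.
have eQ st : eqv (Q st) by exact: pull_eqv (v_eqv R _) (QE st).
have cs c (st : {ffun J -> bool}) : clear (h c) (spull g st) = spull g (clear c st).
  by rewrite (clear_spull gK) hK.
have sad (st : {ffun J -> bool}) c : st c -> exists p q, saddle p q (R (spull g (clear c st))) (R (spull g st)).
  by move=> sc; rewrite -cs; apply: v_sad; rewrite ffunE hK.
unshelve eexists (@VCube F J Z Q eQ _ _); last by [].
- move=> st c sc; have [p [q s]] := sad st c sc.
  have [u pu] := meets (spull g (clear c st)) p; have [v qv] := meets (spull g (clear c st)) q.
  have [u' pu'] := meets (spull g st) p; have [v' qv'] := meets (spull g st) q.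
  case: s => m.
    exists u, v; left; apply: (pull_merge (QE _) (QE _)).
    exact: merge_change (v_eqv R _) pu qv m.
  exists u', v'; right; apply: (pull_merge (QE _) (QE _)).
  exact: merge_change (v_eqv R _) pu' qv' m.
- move=> st c d cd sc sd f hf.
  have [f' hf' <-] := res_surj io_inj (v_eqv R _) (QE _) (meets _) hf.
  have sdc : clear c st d by rewrite ffunE sd eq_sym cd.
  have scd : clear d st c by rewrite ffunE sc cd.
  have rD c' (st' : {ffun J -> bool}) (u : Rg F X) : st' c' -> TR (R (spull g (clear c' st'))) u ->
      res io (Dop (R (spull g (clear c' st'))) (R (spull g st')) u)
      = Dop (Q (clear c' st')) (Q st') (res io u).
    move=> sc' hu; apply: (res_Dop io_inj (v_eqv R _) (QE _) (meets _) (QE _)) => //.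
      exact: v_eqv.
    exact: sad.
  have tD c' (st' : {ffun J -> bool}) (u : Rg F X) : st' c' -> TR (R (spull g (clear c' st'))) u ->
      TR (R (spull g st')) (Dop (R (spull g (clear c' st'))) (R (spull g st')) u).
    by move=> sc' hu; have [p [q s]] := sad _ _ sc'; apply: Dop_TR s hu; apply: v_eqv.
  have hf2 : TR (R (spull g (clear d (clear c st)))) f' by rewrite clearC.
  rewrite -!rD //; try exact: tD.
  congr (res io _); have := @v_face _ _ _ R (spull g st) (h c) (h d).
  rewrite !ffunE !hK (can_eq hK) !cs; apply => //.
Qed.

End Pull.

(** * Adding and removing a small circle *)

Lemma mergeC (X : finType) (p q : X) R R' : eqv R -> merge p q R R' -> merge q p R R'.
Proof.
move=> [_ s _] [n e]; split; first by rewrite s.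
by move=> a b; rewrite e; congr orb; rewrite orbC.
Qed.

Section Loop.

Variables (F : fieldType) (Z : finType).
Local Notation OZ := (option Z).
Implicit Types (f : Rg F OZ) (u v : Rg F Z) (R : rel OZ) (Q : rel Z) (q : Z).

Lemma Some_inj' : injective (@Some Z). Proof. by move=> x y []. Qed.

(** [None] is a point put on the small circle. When it forms a class of its own, [low] and [up] are
    the components with v_- and with v_+ on that circle, and they are independent ([TR_mk]). When it
    is related to a point [q], [up] is determined by [low] ([up_att]). *)
Definition low f : Rg F Z := res Some f.
Definition up f : Rg F Z := res Some (xop None f).
Definition mk u v : Rg F OZ :=
  [ffun U : {set OZ} => if None \in U then v (Some @^-1: U) else u (Some @^-1: U)].

Lemma mem_Some (x : Z) (U : {set Z}) : (Some x \in [set Some y | y in U]) = (x \in U).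
Proof. exact/mem_imset/Some_inj'. Qed.

Lemma preSome (U : {set Z}) : Some @^-1: [set Some x | x in U] = U.
Proof. by apply/setP => x; rewrite inE mem_Some. Qed.

Lemma preSomeN (U : {set Z}) : Some @^-1: (None |: [set Some x | x in U]) = U.
Proof. by apply/setP => x; rewrite !inE mem_Some. Qed.

Lemma Nin_Some (U : {set Z}) : (None \in [set Some x | x in U]) = false.
Proof. by apply/negP => /imsetP[x]. Qed.

Lemma lowE f V : low f V = f [set Some x | x in V].
Proof. by rewrite ffunE. Qed.

Lemma upE f V : up f V = f (None |: [set Some x | x in V]).
Proof. by rewrite !ffunE Nin_Some. Qed.

Lemma low_mk u v : low (mk u v) = u.
Proof. by apply/ffunP => V; rewrite !ffunE Nin_Some preSome. Qed.

Lemma up_mk u v : up (mk u v) = v.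
Proof. by apply/ffunP => V; rewrite upE ffunE setU11 preSomeN. Qed.

Lemma setOE (U : {set OZ}) :
  U = if None \in U then None |: [set Some x | x in Some @^-1: U]
      else [set Some x | x in Some @^-1: U].
Proof.
apply/setP => -[x|]; case: ifP => h; rewrite ?inE ?mem_Some ?inE //=.
by rewrite Nin_Some.
Qed.

Lemma mkK f : mk (low f) (up f) = f.
Proof.
apply/ffunP => U; rewrite ffunE [in RHS](setOE U); case: ifP => h.
  by rewrite upE.
by rewrite lowE.
Qed.

Lemma lowup_inj f g : low f = low g -> up f = up g -> f = g.
Proof. by move=> e e'; rewrite -[f]mkK -[g]mkK e e'. Qed.

Lemma low_lin : lin low. Proof. exact: res_lin. Qed.
Lemma up_lin : lin up.
Proof. by move=> a f g; rewrite /up xop_lin res_lin. Qed.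
Lemma mk_lin a u v u' v' : mk (a *: u + u') (a *: v + v') = a *: mk u v + mk u' v'.
Proof.
by apply: lowup_inj; rewrite ?low_lin ?up_lin ?low_mk ?up_mk ?low_lin ?up_lin ?low_mk ?up_mk.
Qed.

Lemma low_xop z f : low (xop (Some z) f) = xop z (low f).
Proof. exact: res_xop Some_inj' _ _. Qed.
Lemma up_xop z f : up (xop (Some z) f) = xop z (up f).
Proof. by rewrite /up xopC (res_xop Some_inj'). Qed.
Lemma low_xopN f : low (xop None f) = up f. Proof. by []. Qed.
Lemma up_xopN f : up (xop None f) = 0.
Proof. by apply/ffunP => V; rewrite upE !ffunE setU11. Qed.
Lemma xop_sq (X : finType) (a : X) (f : Rg F X) : xop a (xop a f) = 0.
Proof. by apply/ffunP => V; rewrite !ffunE setU11 if_same. Qed.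

Section Rel.

Variables (R : rel OZ) (Q : rel Z).
Hypothesis eR : eqv R.
Hypothesis QE : forall z z', Q z z' = R (Some z) (Some z').

Lemma TR_low f : TR R f -> TR Q (low f).
Proof. exact: res_TR Some_inj' _ _ QE f. Qed.
Lemma TR_up f : TR R f -> TR Q (up f).
Proof. by move=> h; apply: (res_TR Some_inj' QE); apply: TR_xop. Qed.

Section Iso.
Hypothesis iso : forall z, ~~ R None (Some z).

Lemma TR_mk u v : TR Q u -> TR Q v -> TR R (mk u v).
Proof.
have [r s t] := eR.
move=> hu hv [a|] [b|] // ab; rewrite -?QE in ab; first last.
- by case/negP: (iso b).
- by case/negP: (iso a); rewrite s.
apply: lowup_inj; rewrite ?low_xop ?up_xop ?low_mk ?up_mk; [exact: hu|exact: hv].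
Qed.

Lemma card_iso : #|classes R| = #|classes Q|.+1.
Proof.
have [r s t] := eR.
have -> : classes R = [set None] |: [set [set Some x | x in C : {set Z}] | C in classes Q].
  apply/setP => C; rewrite !inE; apply/imsetP/idP.
    move=> [[x|] _ ->]; apply/orP; [right|left]; last first.
      by apply/eqP/setP => -[y|]; rewrite !inE ?r // (negPf (iso y)).
    apply/imsetP; exists [set y | Q x y]; first exact: imset_f.
    apply/setP => -[y|]; rewrite inE ?mem_Some ?inE ?QE // Nin_Some s.
    by rewrite (negPf (iso x)).
  move=> /orP[/eqP->|/imsetP[D /imsetP[x _ ->] ->]].
    by exists None => //; apply/setP => -[y|]; rewrite !inE ?r // (negPf (iso y)).
  exists (Some x) => //; apply/setP => -[y|]; rewrite [RHS]inE ?mem_Some ?inE ?QE // Nin_Some s.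
  by rewrite (negPf (iso x)).
rewrite cardsU1 card_imset; last by move=> C D /(congr1 (fun U : {set OZ} => Some @^-1: U)); rewrite !preSome.
rewrite (_ : _ \in _ = false) //; apply/negP => /imsetP[D /imsetP[x _ ->]] /setP/(_ (Some x)).
by rewrite !inE mem_Some inE QE r.
Qed.

End Iso.

Section Att.
Variable q : Z.
Hypothesis att : R None (Some q).

Lemma att_meets (x : OZ) : exists z, R x (Some z).
Proof. by case: x => [x|]; [exists x; case: eR|exists q]. Qed.

Lemma up_att f : TR R f -> up f = xop q (low f).
Proof. by move=> h; rewrite -low_xop -low_xopN (h _ _ att). Qed.

Lemma TR_mk_att u : TR Q u -> TR R (mk u (xop q u)).
Proof.
have [r s t] := eR => hu.
have h0 a : R None (Some a) -> xop None (mk u (xop q u)) = xop (Some a) (mk u (xop q u)).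
  move=> na; have qa : Q q a by rewrite QE; apply: t na; rewrite s.
  apply: lowup_inj; rewrite ?low_xop ?up_xop ?up_xopN ?low_mk ?up_mk.
    by rewrite low_xopN up_mk; apply: hu.
  by rewrite xopC -(hu _ _ qa) xop_sq.
move=> [a|] [b|] // ab.
- rewrite -QE in ab; apply: lowup_inj; rewrite ?low_xop ?up_xop ?low_mk ?up_mk; first exact: hu.
  by rewrite !(xopC _ q) (hu _ _ ab).
- by rewrite -h0 // s.
- exact: h0.
Qed.

Lemma card_att : #|classes R| = #|classes Q|.
Proof. by rewrite (card_classes_pull eR QE) //; apply: att_meets. Qed.

End Att.

End Rel.

Lemma low_Dop R R' Q Q' f :
  eqv R -> eqv R' -> (exists x y : OZ, saddle x y R R') -> TR R f ->
  (forall z z', Q z z' = R (Some z) (Some z')) ->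
  (forall z z', Q' z z' = R' (Some z) (Some z')) ->
  (forall z, ~~ R None (Some z)) /\ (forall z, ~~ R' None (Some z))
    \/ (exists q, R None (Some q)) ->
  low (Dop R R' f) = Dop Q Q' (low f).
Proof.
move=> eR eR' sad hf QE QE' [[i i']|[q a]]; last first.
  by apply: (res_Dop Some_inj' eR QE (att_meets eR a) QE').
have [_ s _] := eR; have [_ s' _] := eR'; have [r _ _] := eR; have [r' _ _] := eR'.
case: sad => -[p|] [[q|] [m|m]]; first last.
- by case/negP: m.1.
- by case/negP: m.1.
- by have := merge_pq eR' m; rewrite (negPf (i _)).
- by have := merge_pq eR m; rewrite (negPf (i' _)).
- by have := merge_pq eR' m; rewrite s (negPf (i _)).
- by have := merge_pq eR m; rewrite s' (negPf (i' _)).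
- rewrite !Dop_split //; first by move=> a b; rewrite QE QE'; apply: merge_sub m.
  by move=> a b; apply: merge_sub m.
rewrite (Dop_merge eR m hf).
rewrite (@Dop_merge _ _ p q) ?(linD low_lin) ?low_xop //; last exact: (TR_low QE).
- exact: pull_eqv eR QE.
- exact: pull_merge QE' m.
Qed.

End Loop.

Section LoopCube.

Variables (F : fieldType) (I Z : finType) (rk : I -> nat).
Local Notation OZ := (option Z).
Local Notation st_t := {ffun I -> bool}.

Definition isolated (R : vcube F I OZ) : Prop := forall st z, ~~ R st None (Some z).
Definition attached (q : Z) (R : vcube F I OZ) : Prop := forall st, R st None (Some q).
Definition restricts (R : vcube F I OZ) (Q : vcube F I Z) : Prop :=
  forall st z z', Q st z z' = R st (Some z) (Some z').

Definition lowC (f : cubeV F I OZ) : cubeV F I Z := [ffun st : st_t => low (f st)].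
Definition upC (f : cubeV F I OZ) : cubeV F I Z := [ffun st : st_t => up (f st)].
Definition mkC (u v : cubeV F I Z) : cubeV F I OZ := [ffun st : st_t => mk (u st) (v st)].
Definition xopC' (X : finType) (q : X) (u : cubeV F I X) : cubeV F I X :=
  [ffun st : st_t => xop q (u st)].

Lemma low_mkC u v : lowC (mkC u v) = u.
Proof. by apply/ffunP => st; rewrite !ffunE low_mk. Qed.
Lemma up_mkC u v : upC (mkC u v) = v.
Proof. by apply/ffunP => st; rewrite !ffunE up_mk. Qed.
Lemma mkCK f : mkC (lowC f) (upC f) = f.
Proof. by apply/ffunP => st; rewrite !ffunE mkK. Qed.
Lemma lowup_injC f g : lowC f = lowC g -> upC f = upC g -> f = g.
Proof. by move=> e e'; rewrite -[f]mkCK -[g]mkCK e e'. Qed.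
Lemma lowC_lin : lin lowC.
Proof. by move=> a u v; apply/ffunP => st; rewrite !ffunE low_lin. Qed.
Lemma upC_lin : lin upC.
Proof. by move=> a u v; apply/ffunP => st; rewrite !ffunE up_lin. Qed.
Lemma mkC_lin a u v u' v' : mkC (a *: u + u') (a *: v + v') = a *: mkC u v + mkC u' v'.
Proof. by apply/ffunP => st; rewrite !ffunE mk_lin. Qed.
Lemma xopC_lin (X : finType) (q : X) : lin (@xopC' X q).
Proof. by move=> a u v; apply/ffunP => st; rewrite !ffunE xop_lin. Qed.

Lemma xopC_d (X : finType) (q : X) (R : vcube F I X) f :
  xopC' q (cubed R rk f) = cubed R rk (xopC' q f).
Proof.
apply/ffunP => st; rewrite !ffunE (big_morph _ (linD (@xop_lin _ _ q)) (lin0 (@xop_lin _ _ q))).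
by apply: eq_bigr => c _; rewrite (linZ (@xop_lin _ _ q)) -Dop_xop ffunE.
Qed.

Lemma cubed0 (X : finType) (R : vcube F I X) : cubed R rk 0 = 0.
Proof. exact: (lin0 (@cd_lin _ (cube R rk))). Qed.

Section One.
Variables (R : vcube F I OZ) (Q : vcube F I Z).
Hypothesis RQ : restricts R Q.
Hypothesis h : isolated R \/ exists q, attached q R.

Lemma lowC_d f : cubeT R f -> lowC (cubed R rk f) = cubed Q rk (lowC f).
Proof.
move=> hf; apply/ffunP => st; rewrite !ffunE (big_morph _ (linD (@low_lin _ _)) (lin0 (@low_lin _ _))).
apply: eq_bigr => c hc; rewrite (linZ (@low_lin _ _)) ffunE; congr (_ *: _).
apply: low_Dop; try exact: v_eqv; try exact: RQ; [exact: v_sad|exact: hf|].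
by case: h => [i|[q a]]; [left|right; exists q].
Qed.

Lemma upC_d f : cubeT R f -> upC (cubed R rk f) = cubed Q rk (upC f).
Proof.
move=> hf; have e (g : cubeV F I OZ) : upC g = lowC (xopC' None g) by apply/ffunP => st; rewrite !ffunE.
rewrite !e xopC_d lowC_d // => st; rewrite ffunE; exact/TR_xop/hf.
Qed.
End One.

Lemma lowC_T R Q f : restricts R Q -> cubeT R f -> cubeT Q (lowC f).
Proof. by move=> RQ hf st; rewrite ffunE; apply: (TR_low (RQ st)). Qed.
Lemma upC_T R Q f : restricts R Q -> cubeT R f -> cubeT Q (upC f).
Proof. by move=> RQ hf st; rewrite ffunE; apply: (TR_up (RQ st)). Qed.
Lemma xopC_T (X : finType) (q : X) (R : vcube F I X) f : cubeT R f -> cubeT R (xopC' q f).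
Proof. by move=> hf st; rewrite ffunE; apply: TR_xop. Qed.

Section Pair.

Variables (Ri Ra : vcube F I OZ) (Q : vcube F I Z) (q : Z).
Hypotheses (ri : restricts Ri Q) (ra : restricts Ra Q).
Hypotheses (iso : isolated Ri) (att : attached q Ra).

Lemma cubeT_mk u v : cubeT Q u -> cubeT Q v -> cubeT Ri (mkC u v).
Proof. by move=> hu hv st; rewrite ffunE; apply: (TR_mk (v_eqv Ri st) (ri st)). Qed.
Lemma cubeT_att u : cubeT Q u -> cubeT Ra (mkC u (xopC' q u)).
Proof. by move=> hu st; rewrite !ffunE; apply: (TR_mk_att (v_eqv Ra st) (ra st)). Qed.
Lemma upC_att f : cubeT Ra f -> upC f = xopC' q (lowC f).
Proof. by move=> hf; apply/ffunP => st; rewrite !ffunE (up_att (att st)). Qed.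
Lemma att_injC f g : cubeT Ra f -> cubeT Ra g -> lowC f = lowC g -> f = g.
Proof. by move=> hf hg e; apply: lowup_injC => //; rewrite !upC_att ?e. Qed.

Lemma cards st : #|classes (Ri st)| = #|classes (Q st)|.+1 /\
  #|classes (Ra st)| = #|classes (Q st)|.
Proof.
split; first exact: (card_iso (v_eqv Ri st) (ri st)).
exact: (card_att (v_eqv Ra st) (ra st) (att st)).
Qed.

Lemma mkC_neq0 u v st U : mkC u v st U != 0 ->
  if None \in U then v st (Some @^-1: U) != 0 /\ #|U| = #|Some @^-1: U|.+1
  else u st (Some @^-1: U) != 0 /\ #|U| = #|Some @^-1: U|.
Proof.
rewrite !ffunE; have := setOE U; case: ifP => _ e h; split=> //.
  by rewrite [in LHS]e cardsU1 Nin_Some card_imset //; apply: Some_inj'.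
by rewrite [in LHS]e card_imset //; apply: Some_inj'.
Qed.

Lemma xopC_neq0 (X : finType) (p : X) (u : cubeV F I X) st U : xopC' p u st U != 0 ->
  exists2 U' : {set X}, u st U' != 0 & #|U'| = #|U|.+1.
Proof.
rewrite !ffunE; case: ifP => [|h nz]; first by rewrite eqxx.
by exists (p |: U) => //; rewrite cardsU1 h.
Qed.

Lemma lowC_neq0 f st U : lowC f st U != 0 ->
  exists2 U' : {set OZ}, f st U' != 0 & #|U'| = #|U|.
Proof.
rewrite !ffunE => nz; exists [set Some x | x in U] => //.
by rewrite card_imset //; apply: Some_inj'.
Qed.

Lemma upC_neq0 f st U : upC f st U != 0 ->
  exists2 U' : {set OZ}, f st U' != 0 & #|U'| = #|U|.+1.
Proof.
rewrite ffunE upE => nz; exists (None |: [set Some x | x in U]) => //.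
by rewrite cardsU1 Nin_Some card_imset //; apply: Some_inj'.
Qed.

(** [death_map] is the counit on the small circle, which sends v_- to 1 and v_+ to 0; its second
    component is the one that attachment to [q] forces. [birth_map] is the unit: the circle appears
    with v_+. *)
Definition death_map (f : cubeV F I OZ) : cubeV F I OZ := mkC (lowC f) (xopC' q (lowC f)).
Definition birth_map (f : cubeV F I OZ) : cubeV F I OZ := mkC 0 (lowC f).

Let T0 (R : vcube F I Z) : cubeT R 0. Proof. exact: (@cT0 _ (cube R rk)). Qed.

Let dT (X : finType) (R : vcube F I X) f : cubeT R f -> cubeT R (cubed R rk f).
Proof. exact: (@cdT _ (cube R rk)). Qed.

Program Definition death : hom 1 (cube Ri rk) (cube Ra rk) :=
  @Hom F 1 (cube Ri rk) (cube Ra rk) death_map _ _ _ _.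
Next Obligation. by move=> a u v; rewrite /death_map lowC_lin xopC_lin mkC_lin. Qed.
Next Obligation. by apply: cubeT_att; apply: lowC_T ri H. Qed.
Next Obligation.
have [h h'] := H; split; first by apply: cubeT_att; apply: lowC_T ri h.
move=> st U /mkC_neq0; have [c1 c2] := cards st; case: ifP => _ [].
  move=> /xopC_neq0[U1 /lowC_neq0[U2 /h'[-> ->] e2] e1] e; split=> //.
  by rewrite c1 c2 e2 e1 e; lia.
move=> /lowC_neq0[U2 /h'[-> ->] e2] e; split=> //.
by rewrite c1 c2 e2 e; lia.
Qed.
Next Obligation.
have hl := lowC_T ri H; apply: att_injC.
- by apply: cubeT_att; apply: (lowC_T ri); apply: dT.
- by apply: dT; apply: cubeT_att.
rewrite (lowC_d (Q := Q)) //; [|by right; exists q|exact: cubeT_att].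
by rewrite !low_mkC (lowC_d (Q := Q)) //; left.
Qed.

Program Definition birth : hom 1 (cube Ra rk) (cube Ri rk) :=
  @Hom F 1 (cube Ra rk) (cube Ri rk) birth_map _ _ _ _.
Next Obligation.
by move=> a u v; rewrite /birth_map lowC_lin -mkC_lin scaler0 addr0.
Qed.
Next Obligation. by apply: cubeT_mk; [apply: T0|apply: lowC_T ra H]. Qed.
Next Obligation.
have [h h'] := H; split; first by apply: cubeT_mk; [apply: T0|apply: lowC_T ra h].
move=> st U /mkC_neq0; have [c1 c2] := cards st; case: ifP => _ [].
  move=> /lowC_neq0[U2 /h'[-> ->] e2] e; split=> //.
  by rewrite c1 c2 e2 e; lia.
by rewrite !ffunE eqxx.
Qed.
Next Obligation.
have hl := lowC_T ra H; have hd := dT H.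
have ht : cubeT Ri (mkC 0 (lowC x)) by apply: cubeT_mk.
apply: lowup_injC.
  rewrite (lowC_d (Q := Q)) //; last by left.
  by rewrite !low_mkC cubed0.
rewrite (upC_d (Q := Q)) //; last by left.
by rewrite !up_mkC (lowC_d (Q := Q)) //; right; exists q.
Qed.

Lemma iso_att_merge st p r : saddle p r (Ri st) (Ra st) -> merge None (Some q) (Ri st) (Ra st).
Proof.
have [rr s t] := v_eqv Ri st; have [rr' s' t'] := v_eqv Ra st.
case=> m; last by move: (merge_sub m (att st)); rewrite (negPf (iso _ _)).
have := att st; rewrite m.2 (negPf (iso _ _)) /= => /orP[/andP[a b]|/andP[a b]].
  by rewrite s in a; apply: merge_change (v_eqv _ _) a b m.
by rewrite s in a; apply: merge_change (v_eqv _ _) a b (mergeC (v_eqv _ _) m).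
Qed.

(** Merging the small circle into the circle of [q]: the factor v_+ acts as 1, which contributes
    [upC f], and v_- acts as X_q. *)
Lemma edge_iso_att (E : vedge Ri Ra) f : cubeT Ri f ->
  hedge E rk f = mkC (upC f + xopC' q (lowC f)) (xopC' q (upC f)).
Proof.
move=> hf; apply: lowup_injC; rewrite ?low_mkC ?up_mkC; apply/ffunP => st;
  have [p [r s]] := e_sad E st;
  rewrite ![in LHS]ffunE (Dop_merge (v_eqv Ri st) (iso_att_merge s) (hf st)).
  by rewrite (linD (@low_lin _ _)) low_xop !ffunE.
by rewrite (linD (@up_lin _ _)) up_xopN up_xop add0r !ffunE.
Qed.

Lemma edge_att_iso (E : vedge Ra Ri) f : hedge E rk f = f.
Proof.
apply/ffunP => st; rewrite ffunE Dop_split // => a b.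
have [p [r s]] := e_sad E st.
have := iso_att_merge (st := st) (p := p) (r := r).
case: s => m /(_ _)/merge_sub; apply; [by right|by left].
Qed.

Lemma death_edge (E : vedge Ra Ri) f : cubeT Ra f -> death (hedge E rk f) = f.
Proof.
move=> hf; rewrite edge_att_iso; apply: att_injC => //=; last by rewrite low_mkC.
by apply: cubeT_att; apply: lowC_T ra hf.
Qed.

Lemma edge_birth (E : vedge Ri Ra) f : cubeT Ra f -> hedge E rk (birth f) = f.
Proof.
move=> hf; have hl := lowC_T ra hf.
rewrite edge_iso_att; last by apply: cubeT_mk.
rewrite /= low_mkC up_mkC (lin0 (@xopC_lin _ _)) addr0.
by rewrite -upC_att // mkCK.
Qed.

Lemma death_birth f : death_map (birth_map f) = 0.
Proof.
rewrite /death_map /birth_map low_mkC (lin0 (@xopC_lin _ _)).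
by apply/ffunP => st; apply/ffunP => U; rewrite !ffunE if_same.
Qed.

End Pair.

Lemma mkCD u v u' v' : mkC u v + mkC u' v' = mkC (u + u') (v + v').
Proof. by rewrite -[u in RHS]scale1r -[v in RHS]scale1r mkC_lin scale1r. Qed.

Lemma loop_dec_eq (q q' : Z) f :
  mkC (lowC f) (xopC' q (lowC f)) + mkC 0 (upC f + xopC' q' (lowC f))
  = f + mkC 0 (xopC' q (lowC f) + xopC' q' (lowC f)).
Proof.
apply: etrans (mkCD _ _ _ _) _; rewrite -[X in _ = X + _]mkCK.
by apply: etrans _ (esym (mkCD _ _ _ _)); rewrite addrCA.
Qed.

(** The factor of the small circle is split into its v_- and v_+ parts. The circle may touch
    different strands, at [q] before and at [q'] after, and the composite of the splitting and the
    merging is X_q + X_q', not zero; this is the correction on the right. *)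
Lemma loop_dec (Ri Ra Rb : vcube F I OZ) (Q : vcube F I Z) (q q' : Z)
  (ri : restricts Ri Q) (ra : restricts Ra Q) (rb : restricts Rb Q)
  (iso : isolated Ri) (att : attached q Ra) (att' : attached q' Rb)
  (E : vedge Ra Ri) (E' : vedge Ri Rb) f : cubeT Ri f ->
  hedge E rk (death ri ra iso att f) + birth ri rb iso att' (hedge E' rk f)
  = f + birth ri rb iso att' (hedge E' rk (hedge E rk (death ri ra iso att f))).
Proof.
move=> hf; have hl := lowC_T ri hf.
have he : cubeT Ri (hedge E rk (death ri ra iso att f)).
  by apply: (hT (hedge E rk)); apply: (hT (death ri ra iso att)).
rewrite (edge_iso_att iso att' E' he).
rewrite (edge_iso_att iso att' E' hf).
rewrite (edge_att_iso iso att).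
rewrite /death /birth /= /death_map /birth_map.
rewrite !low_mkC up_mkC.
exact: loop_dec_eq.
Qed.

End LoopCube.

(** * Complexes with one crossing whose smoothing creates a small circle *)

Section Moves.

Variables (F : fieldType) (I Z : finType) (rk : I -> nat).
Hypothesis rk_inj : injective rk.
Local Notation OZ := (option Z).

Section R1.

Variables (R : vcube F (option I) OZ) (Q : vcube F I Z) (q : Z).
Hypotheses (r0 : restricts (vsub R false) Q) (r1 : restricts (vsub R true) Q).

Lemma mkCN (u v : cubeV F I Z) : mkC (- u) (- v) = - mkC u v.
Proof.
have := mkC_lin (-1) u v 0 0; rewrite !addr0 !scaleN1r => ->.
rewrite (_ : mkC 0 0 = 0) ?addr0 //.
by apply/ffunP => st; apply/ffunP => U; rewrite !ffunE if_same.
Qed.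

Lemma loop0_eq (f : cubeV F I OZ) :
  mkC (lowC f) (- xopC' q (lowC f)) - f = - mkC 0 (upC f + xopC' q (lowC f)).
Proof.
rewrite -[X in _ - X]mkCK -mkCN; apply: etrans (mkCD _ _ _ _) _.
by rewrite subrr -mkCN oppr0 opprD [RHS]/= addrC.
Qed.

Lemma loop1_eq (f : cubeV F I OZ) :
  mkC 0 (upC f - xopC' q (lowC f)) - f = - mkC (lowC f) (xopC' q (lowC f)).
Proof.
rewrite -[X in _ - X]mkCK -!mkCN; apply: etrans (mkCD _ _ _ _) _.
by rewrite sub0r addrAC subrr sub0r.
Qed.

(** The complex is the cone of a merging, which is surjective. Its kernel consists of the elements
    with v_- part [z] and v_+ part [- xopC' q z], whose degree is one less than that of [z]. *)
Lemma loop0_Hiso : isolated (vsub R false) -> attached q (vsub R true) ->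
  Hiso 0 1 (cube R (ork rk)) (cube Q rk).
Proof.
move=> iso att.
apply: (@Hiso_eq _ (0 + 0) (0 + 1)); [|by []|by []].
apply: Hiso_trans (ciso_Hiso (cube_cone rk R)) _.
have n1 : (1 : F) != 0 by rewrite oner_eq0.
pose fm (p : cV (cone (hsad rk R))) : cV (cube Q rk) := lowC p.1.
pose gm (z : cV (cube Q rk)) : cV (cone (hsad rk R)) := (mkC z (- xopC' q z), 0).
have gT z : cubeT Q z -> cubeT (vsub R false) (mkC z (- xopC' q z)).
  move=> hz; apply: (cubeT_mk r0 iso) => //.
  by apply: (@cTN _ (cube Q rk)); apply: xopC_T.
have E0 := vsub_edge R.
have hs f (hf : cubeT (vsub R false) f) := edge_iso_att rk iso att E0 hf.
rewrite /= in hs.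
have i0 : isolated (vsub R false) \/ exists q, attached q (vsub R false) by left.
apply: (@Hiso_equiv _ 0 1 (cone (hsad rk R)) (cube Q rk) fm gm 1 1) => //.
- by move=> a [u u'] [v v']; rewrite /fm lowC_lin.
- move=> a u v; rewrite /gm; congr pair; last by rewrite /= scaler0 addr0.
  by rewrite /= -mkC_lin xopC_lin scalerN opprD.
- by move=> [u u'] [/= hu _]; apply: lowC_T hu.
- by move=> z hz; split; [apply: gT|apply: (@cT0 _ (cube (vsub R true) rk))].
- move=> k d [u u'] [[hu h] _]; split; first exact: lowC_T hu.
  move=> st U /lowC_neq0[U' /h[-> ->] e]; have [c1 c2] := cards r0 r1 iso att st.
  by rewrite addr0 c1 e; split=> //; lia.
- move=> k d z [hz h]; split; last exact: (@cH0 _ (cube (vsub R true) rk)).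
  split; first exact: gT.
  move=> st U /mkC_neq0; have [c1 c2] := cards r0 r1 iso att st.
  have hz' (U1 : {set Z}) : z st U1 != 0 -> k = ones st /\ d = (#|U1|.*2)%:Z - #|classes (Q st)|%:Z + (ones st)%:Z - 1.
    by move=> /h[<- <-]; rewrite addr0 addrK.
  have opp0 (v : cubeV F I Z) (U1 : {set Z}) : (- v) st U1 != 0 -> v st U1 != 0.
    by rewrite !ffunE oppr_eq0.
  case: ifP => _ [].
    move=> /opp0/xopC_neq0[U1 /hz'[-> ->] e1] e; split=> //.
    by rewrite c1 e1 e; lia.
  by move=> /hz'[-> ->] e; split=> //; rewrite c1 e; lia.
- move=> [u u'] [/= hu hu']; rewrite scale1r /fm /=; apply: lowC_d => //.
- move=> z hz; rewrite scale1r /gm.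
  have ht := gT _ hz.
  have e1 : cubed (vsub R false) rk (mkC z (- xopC' q z)) = mkC (cubed Q rk z) (- xopC' q (cubed Q rk z)).
    apply: lowup_injC.
      by rewrite (lowC_d rk r0 i0 ht) !low_mkC.
    rewrite (upC_d rk r0 i0 ht) !up_mkC xopC_d.
    exact: (linN (@cd_lin _ (cube Q rk))).
  congr pair; rewrite /= ?e1 // hs // low_mkC up_mkC addNr.
  rewrite (linN (@xopC_lin F I Z q)) cubed0 scaler0 addr0.
  apply/ffunP => st; apply/ffunP => U; rewrite !ffunE.
  by case: ifP; rewrite // setU11 if_same oppr0.
- move=> [u u'] [/= hu hu'] [/= du] /eqP; rewrite scaleN1r subr_eq0 => /eqP e.
  (* [birth] is a section of the merging, so the boundary of this chain cancels the second
     component; the cycle condition [e] takes care of the first one. *)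
  exists ((- birth rk r0 r1 iso att u', 0) : cV (cone (hsad rk R))).
    split; last exact: (@cT0 _ (cube (vsub R true) rk)).
    by apply: cTN; apply: (hT (birth rk r0 r1 iso att)).
  have d1 : cd (- birth rk r0 r1 iso att u') = - birth rk r0 r1 iso att (hsad rk R u).
    have -> : hsad rk R u = cd u' by exact: e.
    by rewrite (linN (@cd_lin _ _)) -hd.
  have d2 : hsad rk R (- birth rk r0 r1 iso att u') = - u'.
    rewrite (linN (hlin _)); congr (- _); exact: (edge_birth rk r0 r1).
  congr pair.
    by apply: etrans (esym d1); rewrite /= hs // /birth_map low_mkC; apply: loop0_eq.
  by rewrite [RHS]/= cubed0 scaler0 addr0 sub0r; apply: esym d2.
- move=> z hz _; rewrite /fm /gm /= low_mkC subrr; exact: bdry0.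
Qed.

(** The complex is the cone of a splitting, which is injective, and [fm] reads off its cokernel. The
    degree falls by 2: one for the label 1 of the crossing and one for the v_+ on the small
    circle. *)
Lemma loop1_Hiso : attached q (vsub R false) -> isolated (vsub R true) ->
  Hiso (-1) (-2) (cube R (ork rk)) (cube Q rk).
Proof.
move=> att iso.
apply: (@Hiso_eq _ (0 - 1) (0 - 2)); [|by []|by []].
apply: Hiso_trans (ciso_Hiso (cube_cone rk R)) _.
have n1 : (-1 : F) != 0 by rewrite oppr_eq0 oner_eq0.
have N1 : (-1 : int) = Negz 0 by [].
have N2 : (-2 : int) = Negz 1 by [].
pose fm (p : cV (cone (hsad rk R))) : cV (cube Q rk) := upC p.2 - xopC' q (lowC p.2).
pose gm (z : cV (cube Q rk)) : cV (cone (hsad rk R)) := (0, mkC 0 z).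
have T0 : cubeT Q 0 by apply: (@cT0 _ (cube Q rk)).
have gT z : cubeT Q z -> cubeT (vsub R true) (mkC 0 z).
  by move=> hz; apply: (cubeT_mk r1 iso).
have E0 := vsub_edge R.
have hs f := edge_att_iso (rk := rk) iso att E0 f.
rewrite /= in hs.
have i1 : isolated (vsub R true) \/ exists q, attached q (vsub R true) by left.
have uT u : cubeT (vsub R true) u -> cubeT Q (upC u - xopC' q (lowC u)).
  move=> hu; apply: (@cTB _ (cube Q rk)); first exact: upC_T hu.
  by apply: xopC_T; apply: lowC_T hu.
apply: (@Hiso_equiv _ (-1) (-2) (cone (hsad rk R)) (cube Q rk) fm gm (-1) (-1)) => //.
- move=> a [u u'] [v v']; rewrite /fm /= upC_lin lowC_lin xopC_lin.
  by rewrite scalerDr scalerN opprD addrACA.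
- move=> a u v; rewrite /gm; congr pair; first by rewrite /= scaler0 addr0.
  by rewrite /= -mkC_lin scaler0 addr0.
- by move=> [u u'] [/= _ hu]; apply: uT.
- by move=> z hz; split; [apply: (@cT0 _ (cube (vsub R false) rk))|apply: gT].
- move=> k d [u u'] [_ [hu h]]; split; first exact: uT.
  move=> st U; rewrite /fm /=; have [c1 c2] := cards r1 r0 iso att st => nz.
  have : (upC u' st U != 0) || (xopC' q (lowC u') st U != 0).
    apply/norP => -[/negbNE/eqP a /negbNE/eqP b]; move: nz.
    by rewrite !ffunE in a b *; rewrite a b subr0 eqxx.
  case/orP.
    by move=> /upC_neq0[U2 /h[a b] e]; move: a b; rewrite N1 N2 c1 e; set c := #|classes _|; lia.
  by move=> /xopC_neq0[U1 /lowC_neq0[U' /h[a b] e] e1]; move: a b; rewrite N1 N2 c1 e e1; set c := #|classes _|; lia.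
- move=> k d z [hz h]; split; first exact: (@cH0 _ (cube (vsub R false) rk)).
  split; first exact: gT.
  move=> st U /mkC_neq0; have [c1 c2] := cards r1 r0 iso att st.
  case: ifP => _ []; last by rewrite !ffunE eqxx.
  by move=> /h[a b] e; move: a b; rewrite N1 N2 c1 e; set c := #|classes _|; lia.
- move=> [u u'] [/= hu hu']; rewrite scaleN1r /fm /= hs.
  have tt := @cdT _ (cube (vsub R true) rk) _ hu'.
  have e1 := lowC_d rk r1 i1 hu'; have e2 := upC_d rk r1 i1 hu'.
  rewrite (linD (@upC_lin _ _ _)) (linD (@lowC_lin _ _ _)) (linD (@xopC_lin F I Z q)).
  rewrite (linZ (@upC_lin _ _ _)) (linZ (@lowC_lin _ _ _)) (linZ (@xopC_lin F I Z q)).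
  rewrite (upC_att att hu) !scaleN1r e1 e2 xopC_d.
  have -> : cubed Q rk (upC u' - xopC' q (lowC u')) = cubed Q rk (upC u') - cubed Q rk (xopC' q (lowC u')).
    exact: (linB (@cd_lin _ (cube Q rk))).
  by zmod.
- move=> z hz; rewrite scaleN1r /gm.
  have ht := gT _ hz.
  have e1 : cubed (vsub R true) rk (mkC 0 z) = mkC 0 (cubed Q rk z).
    apply: lowup_injC; first by rewrite (lowC_d rk r1 i1 ht) !low_mkC cubed0.
    by rewrite (upC_d rk r1 i1 ht) !up_mkC.
  congr pair; first by rewrite /= cubed0 oppr0.
  by rewrite /= e1 scaleN1r hs sub0r opprK.
- move=> [u u'] [/= hu hu'] [/= du] /eqP; rewrite scaleN1r subr_eq0 => /eqP e.
  have ee : cd (death rk r1 r0 iso att u') = u.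
    rewrite -hd // -[cd u']e; exact: (death_edge rk r1 r0 iso att E0).
  (* [death] is a retraction of the splitting; applied to the cycle condition, it exhibits the first
     component as a boundary. *)
  exists ((- death rk r1 r0 iso att u', 0) : cV (cone (hsad rk R))).
    split; last exact: (@cT0 _ (cube (vsub R true) rk)).
    by apply: cTN; apply: (hT (death rk r1 r0 iso att)).
  have ed : cd (- death rk r1 r0 iso att u') = - u.
    by rewrite (linN (@cd_lin _ _)) ee.
  congr pair; first by rewrite [LHS]/= sub0r; apply: esym ed.
  rewrite [RHS]/= cubed0 scaler0 addr0 hs; exact: loop1_eq.
- move=> z hz _; rewrite /fm /gm /= low_mkC up_mkC.
  by rewrite (lin0 (@xopC_lin F I Z q)) subr0 subrr; exact: bdry0.
Qed.

End R1.

End Moves.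

Section Ext.

Variables (F : fieldType) (I X : finType) (rk : I -> nat).

Definition same_rel (R R' : vcube F I X) : Prop := forall st a b, R st a b = R' st a b.

Lemma Dop_ext (R R' S S' : rel X) (f : Rg F X) :
  (forall a b, R a b = R' a b) -> (forall a b, S a b = S' a b) -> Dop R S f = Dop R' S' f.
Proof. by move=> e e'; rewrite /Dop; under eq_pick do rewrite e e'. Qed.

Lemma cubeT_ext R R' f : same_rel R R' -> cubeT R f -> cubeT R' f.
Proof. by move=> e h st a b; rewrite -e; apply: h. Qed.

Lemma cubeH_ext R R' k q f : same_rel R R' -> cubeH R k q f -> cubeH R' k q f.
Proof.
move=> e [h h']; split; first exact: cubeT_ext h.
move=> st U /h'; suff -> : classes (R st) = classes (R' st) by [].
by apply: eq_imset => x; apply/setP => y; rewrite !inE e.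
Qed.

Lemma cubed_ext R R' f : same_rel R R' -> cubed R rk f = cubed R' rk f.
Proof.
move=> e; apply/ffunP => st; rewrite !ffunE; apply: eq_bigr => c _.
by congr (_ *: _); apply: Dop_ext => a b; apply: e.
Qed.

Lemma edge_map_ext (R R' S S' : vcube F I X) f :
  same_rel R R' -> same_rel S S' -> vedge_map R S f = vedge_map R' S' f.
Proof. by move=> e e'; apply/ffunP => st; rewrite !ffunE; apply: Dop_ext => a b. Qed.

Lemma edge_map_lin (R S : vcube F I X) : lin (vedge_map R S).
Proof. by move=> a u v; apply/ffunP => st; rewrite !ffunE Dop_lin. Qed.

Lemma edge_map_T (R S : vcube F I X) f : (forall st, exists p q, saddle p q (R st) (S st)) ->
  cubeT R f -> cubeT S (vedge_map R S f).
Proof.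
move=> sd hf st; rewrite ffunE; have [p [q s]] := sd st.
exact: Dop_TR (v_eqv R _) s (hf st).
Qed.

Lemma same_relC R R' : same_rel R R' -> same_rel R' R.
Proof. by move=> e st a b; rewrite e. Qed.

Lemma ciso_ext (A B : cplx F) (f g : cV A -> cV B) : (forall x, f x = g x) -> ciso f -> ciso g.
Proof.
move=> e [h1 h2 h3 h4 h5 h6]; split.
- by move=> a u v; rewrite -!e h1.
- by move=> x hx; rewrite -e; apply: h2.
- by move=> k q x hx; rewrite -e; apply: h3.
- by move=> x hx; rewrite -!e; apply: h4.
- by move=> x hx; rewrite -e; apply: h5.
- by move=> y /h6[x hx <-]; exists x.
Qed.

End Ext.

Section Double.

Variables (F : fieldType) (I X : finType) (rk : I -> nat).
Implicit Types R : vcube F (option (option I)) X.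

Definition T2 R : cplx F := cone (hcone rk (vsub_edge R)).

Definition split2 R (f : cV (cube R (ork (ork rk)))) : cV (T2 R) :=
  (split_cube (split_cube f).1, split_cube (split_cube f).2).

Lemma split2_ciso R : @ciso F (cube R (ork (ork rk))) (T2 R) (@split2 R).
Proof.
have comm x : cT x -> split_cube (hsad (ork rk) R x) = hcone rk (vsub_edge R) (split_cube x).
  by move=> _; exact: split_edge.
exact: (ciso_comp (cube_cone (ork rk) R)
  (gcone_ciso (f := hsad (ork rk) R) (f' := hcone rk (vsub_edge R)) 1 1 (-1)
    (cube_cone rk (vsub R false)) (cube_cone rk (vsub R true)) comm)).
Qed.

Variables R0 R1 : vcube F (option (option I)) X.
Hypothesis E : vedge R0 R1.

Lemma hcone_edge x : cT (c := cone (hsad rk (vsub R0 false))) x ->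
  hcone rk (vedge_sub true E) (hcone rk (vsub_edge R0) x)
  = hcone rk (vsub_edge R1) (hcone rk (vedge_sub false E) x).
Proof.
move: x => [x y] [/= hx hy]; congr pair; apply/ffunP => st; rewrite !ffunE /=.
  have := @e_face _ _ _ _ _ E (oext true (oext false st)) None; rewrite ffunE.
  by move=> /(_ isT (x st)); rewrite clear_oextN => -> //; apply: hx.
have := @e_face _ _ _ _ _ E (oext true (oext true st)) None; rewrite ffunE.
by move=> /(_ isT (y st)); rewrite clear_oextN => -> //; apply: hy.
Qed.

Definition hcone2 : hom (-1) (T2 R0) (T2 R1) := hom_cone hcone_edge.

Lemma split2_edge x : split2 (hedge E (ork (ork rk)) x : cV (cube R1 _)) = hcone2 (split2 (x : cV (cube R0 _))).
Proof. by congr (_, _); congr pair; apply/ffunP => st; rewrite !ffunE. Qed.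

End Double.

Lemma split3_ciso (F : fieldType) (I X : finType) (rk : I -> nat)
    (R : vcube F (option (option (option I))) X) :
  exists f, @ciso F (cube R (ork (ork (ork rk)))) (cone (hcone2 rk (vsub_edge R))) f.
Proof.
have comm x : cT x -> @split2 F I X rk _ (hsad (ork (ork rk)) R x)
    = hcone2 rk (vsub_edge R) (split2 x).
  by move=> _; exact: split2_edge.
eexists; exact: (ciso_comp (cube_cone (ork (ork rk)) R)
  (gcone_ciso (f := hsad (ork (ork rk)) R) (f' := hcone2 rk (vsub_edge R)) 1 1 (-1)
    (split2_ciso rk (vsub R false)) (split2_ciso rk (vsub R true)) comm)).
Qed.

(** * Two crossings enclosing a small circle, alone and under a third crossing *)

Section Low.

Variables (F : fieldType) (I Z : finType) (rk : I -> nat).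
Hypothesis rk_inj : injective rk.
Local Notation OZ := (option Z).

Lemma lowC_ciso (R : vcube F I OZ) (Q : vcube F I Z) q : restricts R Q -> attached q R ->
  @ciso F (cube R rk) (cube Q rk) (@lowC F I Z).
Proof.
move=> RQ att.
have idK : cancel (fun i : I => i) (fun i => i) by [].
have sid (st : {ffun I -> bool}) : spull (fun i => i) st = st by apply/ffunP => i; rewrite ffunE.
have QE st z z' : Q st z z' = R (spull (fun i => i) st) (Some z) (Some z') by rewrite sid.
have mt st x : exists z, R st x (Some z) by apply: (att_meets (v_eqv R st) (att st)).
apply: ciso_ext (cube_equiv idK idK (@Some_inj' Z) QE mt rk_inj rk_inj) => f.
apply/ffunP => st; rewrite !ffunE sid /gauge big1 ?expr0 ?scale1r // => i _.
rewrite big1 // => j _; rewrite /= (_ : _ && _ = false) //.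
by case: (ltngtP (rk i) (rk j)).
Qed.

Lemma low_edge (R0 R1 : vcube F I OZ) (Q0 Q1 : vcube F I Z) f :
  restricts R0 Q0 -> restricts R1 Q1 ->
  (isolated R0 /\ isolated R1 \/ exists q, attached q R0) -> vedge R0 R1 -> cubeT R0 f ->
  lowC (vedge_map R0 R1 f) = vedge_map Q0 Q1 (lowC f).
Proof.
move=> r0 r1 h E hf; apply/ffunP => st; rewrite !ffunE.
apply: low_Dop; try exact: v_eqv; try exact: r0; try exact: r1; [exact: e_sad|exact: hf|].
by case: h => [[i j]|[q a]]; [left|right; exists q].
Qed.

Local Notation K R a b := (vsub (vsub R a) b).

Section R2.

Variables (R : vcube F (option (option I)) OZ) (Q : vcube F I Z) (q1 q2 : Z).
Hypotheses (r00 : restricts (K R false false) Q) (r01 : restricts (K R false true) Q)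
  (r11 : restricts (K R true true) Q).
Hypotheses (iso : isolated (K R false true))
  (a00 : attached q1 (K R false false)) (a11 : attached q2 (K R true true)).

(** The small circle lives at (false, true). It splits off from (false, false), with retraction
    [death], and merges into (true, true), with section [birth]. What survives is (true, false). *)
Definition sdr2 : sdr (T2 rk R) (cube (K R true false) rk) :=
  @sdr_Tot F (cube (K R false false) rk) (cube (K R false true) rk)
    (cube (K R true false) rk) (cube (K R true true) rk)
    (hsad rk (vsub R false)) (hedge (vedge_sub false (vsub_edge R)) rk)
    (hedge (vedge_sub true (vsub_edge R)) rk) (hsad rk (vsub R true))
    (death rk r01 r00 iso a00) (birth rk r01 r11 iso a11)
    (hsad_edge (vsub_edge R))
    (fun x => @death_edge F I Z rk _ _ _ _ r01 r00 iso a00 (vsub_edge (vsub R false)) x)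
    (fun x => @edge_birth F I Z rk _ _ _ _ r01 r11 iso a11 (vedge_sub true (vsub_edge R)) x)
    (fun x _ => @death_birth F I Z q1 x)
    (fun x => @loop_dec F I Z rk _ _ _ _ _ _ r01 r00 r11 iso a00 a11 (vsub_edge (vsub R false))
      (vedge_sub true (vsub_edge R)) x).

Lemma R2_Hiso (QG : vcube F I Z) (q3 : Z) :
  restricts (K R true false) QG -> attached q3 (K R true false) ->
  Hiso (-1) (-1) (cube R (ork (ork rk))) (cube QG rk).
Proof.
move=> r10 a10.
apply: (@Hiso_eq _ (0 + (-1 + 0)) (0 + (-1 + 0))); [|by []|by []].
apply: Hiso_trans (ciso_Hiso (split2_ciso rk R)) _.
exact: Hiso_trans (sdr_Hiso sdr2) (ciso_Hiso (lowC_ciso r10 a10)).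
Qed.

End R2.

Definition T2low (f : (cubeV F I OZ * cubeV F I OZ) * (cubeV F I OZ * cubeV F I OZ)) :=
  ((lowC f.1.1, lowC f.1.2), (lowC f.2.1, lowC f.2.2)).

Definition restricts2 (R : vcube F (option (option I)) OZ)
    (Q : vcube F (option (option I)) Z) : Prop :=
  forall a b, restricts (K R a b) (K Q a b) /\ exists q, attached q (K R a b).

Lemma T2low_ciso R Q : restricts2 R Q -> @ciso F (T2 rk R) (T2 rk Q) T2low.
Proof.
move=> h.
have C a b : @ciso F (cube (K R a b) rk) (cube (K Q a b) rk) (@lowC F I Z).
  by have [r [q at']] := h a b; apply: lowC_ciso r at'.
have D a b a' b' f : vedge (K R a b) (K R a' b') -> cubeT (K R a b) f ->
    lowC (vedge_map (K R a b) (K R a' b') f) = vedge_map (K Q a b) (K Q a' b') (lowC f).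
  have [r [q at']] := h a b; have [r' _] := h a' b'.
  by move=> E hf; apply: low_edge => //; right; exists q.
have D1 a x : cT x -> lowC (hsad rk (vsub R a) x) = hsad rk (vsub Q a) (lowC x).
  by apply: D; apply: vsub_edge.
have D2 x : cT x -> (fun p : cV (cone (hsad rk (vsub R true))) => (lowC p.1, lowC p.2))
    (hcone rk (vsub_edge R) x) = hcone rk (vsub_edge Q) (lowC x.1, lowC x.2).
  move: x => [x y] [/= hx hy]; congr pair.
    by apply: D => //; apply: (vedge_sub false (vsub_edge R)).
  by apply: D => //; apply: (vedge_sub true (vsub_edge R)).
have c0 := gcone_ciso (f := hsad rk (vsub R false)) (f' := hsad rk (vsub Q false)) 1 1 (-1)
  (C false false) (C false true) (D1 false).
have c1 := gcone_ciso (f := hsad rk (vsub R true)) (f' := hsad rk (vsub Q true)) 1 1 (-1)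
  (C true false) (C true true) (D1 true).
exact: (gcone_ciso (f := hcone rk (vsub_edge R)) (f' := hcone rk (vsub_edge Q)) 1 1 (-1) c0 c1 D2).
Qed.

Definition saddles (R S : vcube F I Z) : Prop := forall st, exists p q, saddle p q (R st) (S st).

Section Psi.
Variables (QA : vcube F (option (option I)) Z) (QB : vcube F I Z).
Hypotheses (s10 : saddles (K QA true false) QB) (s01 : saddles (K QA false true) QB).

(** The attaching map of the third move after its target has been retracted. The difference is that
    of the retraction in [sdr_Tot], whose second term arrives through the state with the circle. *)
Program Definition psi : tmap (T2 rk QA) (cube QB rk) :=
  @Tmap F (T2 rk QA) (cube QB rk)
    (fun p => vedge_map (K QA true false) QB p.2.1 - vedge_map (K QA false true) QB p.1.2) _ _.
Next Obligation.
move=> a [[u u1] [u2 u3]] [[v v1] [v2 v3]] /=.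
by rewrite !edge_map_lin scalerDr scalerN; zmod.
Qed.
Next Obligation.
case: H => -[/= h h'] [/= h2 h3].
by apply: (@cTB _ (cube QB rk)); apply: edge_map_T.
Qed.
End Psi.

Section Phi.
Variables (QA : vcube F I Z) (QB : vcube F (option (option I)) Z).
Hypotheses (s10 : saddles QA (K QB true false)) (s01 : saddles QA (K QB false true)).

(** The counterpart of [psi] when the source has been retracted: the two nonzero entries are those
    of the inclusion in [sdr_Tot]. *)
Program Definition phi : tmap (cube QA rk) (T2 rk QB) :=
  @Tmap F (cube QA rk) (T2 rk QB)
    (fun z => ((0, vedge_map QA (K QB false true) z), (vedge_map QA (K QB true false) z, 0))) _ _.
Next Obligation.
move=> a u v /=; rewrite !edge_map_lin; congr (_, _); congr pair; rewrite /= ?scaler0 ?addr0 //.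
Qed.
Next Obligation.
by do ![split=> //=]; try exact: (@cT0 _ (cube _ rk)); apply: edge_map_T.
Qed.
End Phi.

Section R3.

Variable R : vcube F (option (option (option I))) OZ.

(** The circle is in the target of the cone over the first crossing. On the entry from (false, true)
    the circle is split off and at once removed by [death], so that this entry reduces to one
    saddle, the second term of [psi]. *)
Lemma R3I_cone (QA : vcube F (option (option I)) Z) (QB Q : vcube F I Z) q1 q2 q3
    (s10 : saddles (K QA true false) QB) (s01 : saddles (K QA false true) QB) :
  restricts2 (vsub R false) QA ->
  restricts (K (vsub R true) false false) Q -> attached q1 (K (vsub R true) false false) ->
  restricts (K (vsub R true) false true) Q -> isolated (K (vsub R true) false true) ->
  restricts (K (vsub R true) true true) Q -> attached q2 (K (vsub R true) true true) ->
  restricts (K (vsub R true) true false) QB -> attached q3 (K (vsub R true) true false) ->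
  same_rel (K QA false true) Q ->
  Hiso 0 0 (cube R (ork (ork (ork rk)))) (gcone 2 2 1 (psi s10 s01)).
Proof.
move=> rA r00 a00 r01 iso r11 a11 r10 a10 QQ.
have [f3 c3] := split3_ciso rk R.
apply: (@Hiso_eq _ (0 + (0 + 0)) (0 + (0 + 0))); [|by []|by []].
apply: Hiso_trans (ciso_Hiso c3) _.
apply: Hiso_trans (cone_sr (sdr2 r00 r01 r11 iso a00 a11) _) _.
have E := vsub_edge R.
have comm x : cT x ->
    lowC (tmap_sr (sdr2 r00 r01 r11 iso a00 a11) (hcone2 rk (vsub_edge R)) x)
    = psi s10 s01 (T2low x).
  move: x => [[x00 x01] [x10 x11]] [[/= h00 h01] [/= h10 h11]].
  have E1 : vedge (K (vsub R false) true false) (K (vsub R true) true false).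
    by apply: (vedge_sub false (vedge_sub true E)).
  have E2 : vedge (K (vsub R false) false true) (K (vsub R true) false true).
    by apply: (vedge_sub true (vedge_sub false E)).
  have E3 : vedge (K (vsub R true) false false) (K (vsub R true) true false).
    by apply: (vedge_sub false (vsub_edge (vsub R true))).
  have [rA10 [qa1 aA10]] := rA true false; have [rA01 [qa2 aA01]] := rA false true.
  rewrite (linB (@lowC_lin _ _ _)); congr (_ - _).
    by apply: low_edge => //; right; exists qa1.
  have -> : vedge_map (K (vsub R false) false true) (K (vsub R true) false true) x01 = x01.
    exact: (edge_att_iso (rk := rk) iso aA01 E2).
  rewrite (low_edge (Q0 := K QA false true) (Q1 := QB)) //; first by rewrite low_mkC.
  + by move=> st z z'; rewrite QQ r00.
  + by right; exists q1.
  + apply: (cubeT_att r00 a00).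
    by apply: cubeT_ext QQ _; apply: lowC_T rA01 h01.
exact: (ciso_Hiso (gcone_ciso 2 2 1 (T2low_ciso rA) (lowC_ciso r10 a10) comm)).
Qed.

(** The circle is in the source. The inclusion creates it by [birth] and the arrow to the other face
    merges it at once, so that only the saddle producing the entry (false, true) of [phi]
    remains. *)
Lemma R3II_cone (QA Q : vcube F I Z) (QB : vcube F (option (option I)) Z) q1 q2 q3
    (s10 : saddles QA (K QB true false)) (s01 : saddles QA (K QB false true)) :
  restricts2 (vsub R true) QB ->
  restricts (K (vsub R false) false false) Q -> attached q1 (K (vsub R false) false false) ->
  restricts (K (vsub R false) false true) Q -> isolated (K (vsub R false) false true) ->
  restricts (K (vsub R false) true true) Q -> attached q2 (K (vsub R false) true true) ->
  restricts (K (vsub R false) true false) QA -> attached q3 (K (vsub R false) true false) ->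
  same_rel (K QB false true) Q ->
  Hiso (-1) (-1) (cube R (ork (ork (ork rk)))) (gcone 0 0 1 (phi s10 s01)).
Proof.
move=> rB r00 a00 r01 iso r11 a11 r10 a10 QQ.
have [f3 c3] := split3_ciso rk R.
apply: (@Hiso_eq _ (0 + (-1 + 0)) (0 + (-1 + 0))); [|by []|by []].
apply: Hiso_trans (ciso_Hiso c3) _.
apply: Hiso_trans (cone_si (sdr2 r00 r01 r11 iso a00 a11) _) _.
have E := vsub_edge R.
have comm x : cT x ->
    T2low (tmap_si (sdr2 r00 r01 r11 iso a00 a11) (hcone2 rk (vsub_edge R)) x)
    = phi s10 s01 (lowC x).
  move=> hx.
  have E1 : vedge (K (vsub R false) true false) (K (vsub R true) true false).
    by apply: (vedge_sub false (vedge_sub true E)).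
  have E2 : vedge (K (vsub R false) false true) (K (vsub R true) false true).
    by apply: (vedge_sub true (vedge_sub false E)).
  have E3 := vsub_edge (vsub (vsub R false) true).
  have [rB10 [qb1 aB10]] := rB true false; have [rB01 [qb2 aB01]] := rB false true.
  have l0 (R0 R1 : vcube F I OZ) : lowC (vedge_map R0 R1 0) = 0.
    by rewrite (lin0 (@edge_map_lin _ _ _ _ _)) (lin0 (@lowC_lin _ _ _)).
  congr (_, _); congr pair; rewrite /= ?l0 //.
    have ht : cubeT (K (vsub R false) true true) (vedge_map (K (vsub R false) true false) (K (vsub R false) true true) x).
      by apply: (hT (hedge E3 rk)).
    have hl := lowC_T r11 ht.
    have hi : cubeT (K (vsub R false) false true) (birth_map (vedge_map (K (vsub R false) true false) (K (vsub R false) true true) x)).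
      by apply: (hT (birth rk r01 r11 iso a11)).
    apply: etrans (congr1 (@lowC F I Z) (edge_iso_att rk iso aB01 E2 hi)) _.
    rewrite low_mkC /birth_map up_mkC low_mkC (lin0 (@xopC_lin F I Z qb2)) addr0.
    rewrite (low_edge (Q0 := QA) (Q1 := K QB false true)) //.
      by move=> st z z'; rewrite QQ r11.
    by right; exists q3.
  by apply: low_edge => //; right; exists q3.
exact: (ciso_Hiso (gcone_ciso 0 0 1 (lowC_ciso r10 a10) (T2low_ciso rB) comm)).
Qed.

End R3.

End Low.

(** * Comparison of the two sides of the third move *)

Section Swap.

Variables (F : fieldType) (I Z : finType) (rk : I -> nat).
Hypothesis rk_inj : injective rk.
Local Notation OZ := (option Z).
Local Notation K R a b := (vsub (vsub R a) b).

Lemma same_rel_ciso (X : finType) (Q Q' : vcube F I X) :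
  same_rel Q Q' -> @ciso F (cube Q rk) (cube Q' rk) (fun x => x).
Proof.
move=> e; split=> //.
- by move=> x; apply: cubeT_ext.
- by move=> k q x hx; split; apply: cubeH_ext => //; apply: same_relC.
- by move=> x _; apply: cubed_ext.
- by move=> y hy; exists y => //; apply: (cubeT_ext (same_relC e)).
Qed.

Section SwapT2.

Variables QA QA' : vcube F (option (option I)) Z.
Hypothesis sw : forall a b, same_rel (K QA a b) (K QA' b a).

Definition swap (p : cV (T2 rk QA)) : cV (T2 rk QA') :=
  ((p.1.1, p.2.1), (p.1.2, - p.2.2)).

Lemma swap_ciso : ciso swap.
Proof.
pose E := vsub_edge QA.
have sq x : cT x -> hsad rk (vsub QA true) (hedge (vedge_sub false E) rk x)
    = hedge (vedge_sub true E) rk (hsad rk (vsub QA false) x).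
  by move=> hx; rewrite (hsad_edge E).
have C a b : @ciso F (cube (K QA a b) rk) (cube (K QA' b a) rk) (fun x => x).
  exact: same_rel_ciso.
have c0 := gcone_ciso (f := hedge (vedge_sub false E) rk) (f' := hsad rk (vsub QA' false)) 1 1 (-1)
  (C false false) (C true false) (fun x _ => edge_map_ext x (sw _ _) (sw _ _)).
have c1 := gcone_ciso (f := hedge (vedge_sub true E) rk) (f' := hsad rk (vsub QA' true)) 1 1 (-1)
  (C false true) (C true true) (fun x _ => edge_map_ext x (sw _ _) (sw _ _)).
have comm x : cT x -> (fun p : cV (cone (hedge (vedge_sub true E) rk)) => (p.1, p.2)) (hom_cone sq x)
    = hcone rk (vsub_edge QA') (x.1, x.2).
  by move=> _; exact: (congr2 pair (edge_map_ext x.1 (sw _ _) (sw _ _))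
    (edge_map_ext x.2 (sw _ _) (sw _ _))).
have c2 := gcone_ciso (f := hom_cone sq) (f' := hcone rk (vsub_edge QA')) 1 1 (-1) c0 c1 comm.
exact: (ciso_comp (Tot_swap (hsad_edge E) sq) c2).
Qed.

End SwapT2.

(** Exchanging the two crossings exchanges the two terms of [psi], which carry opposite signs.
    Negating the target restores the square. *)
Lemma psi_swap (QA QA' : vcube F (option (option I)) Z) (QB QB' : vcube F I Z)
    (s10 : saddles (K QA true false) QB) (s01 : saddles (K QA false true) QB)
    (s10' : saddles (K QA' true false) QB') (s01' : saddles (K QA' false true) QB') :
  (forall a b, same_rel (K QA a b) (K QA' b a)) -> same_rel QB QB' ->
  Hiso 0 0 (gcone 2 2 1 (psi rk s10 s01)) (gcone 2 2 1 (psi rk s10' s01')).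
Proof.
move=> sw eB.
have comm x : cT x -> - (psi rk s10 s01 x : cV (cube QB rk)) = psi rk s10' s01' (swap QA' x).
  move: x => [[x00 x01] [x10 x11]] _ /=.
  rewrite (edge_map_ext x10 (sw _ _) eB) (edge_map_ext x01 (sw _ _) eB).
  by rewrite opprB.
have cB := ciso_comp (ciso_opp (cube QB rk)) (same_rel_ciso eB).
exact: (ciso_Hiso (gcone_ciso (f := psi rk s10 s01) (f' := psi rk s10' s01') 2 2 1 (swap_ciso sw) cB comm)).
Qed.

Lemma phi_swap (QA QA' : vcube F I Z) (QB QB' : vcube F (option (option I)) Z)
    (s10 : saddles QA (K QB true false)) (s01 : saddles QA (K QB false true))
    (s10' : saddles QA' (K QB' true false)) (s01' : saddles QA' (K QB' false true)) :
  (forall a b, same_rel (K QB a b) (K QB' b a)) -> same_rel QA QA' ->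
  Hiso 0 0 (gcone 0 0 1 (phi rk s10 s01)) (gcone 0 0 1 (phi rk s10' s01')).
Proof.
move=> sw eA.
have comm x : cT x -> swap QB' (phi rk s10 s01 x) = phi rk s10' s01' (x : cV (cube QA rk)).
  move=> _; congr (_, _); congr pair; rewrite /= ?oppr0 //; exact: edge_map_ext.
exact: (ciso_Hiso (gcone_ciso (f := phi rk s10 s01) (f' := phi rk s10' s01') 0 0 1 (same_rel_ciso eA) (swap_ciso sw) comm)).
Qed.

Local Notation K3 R a b c := (vsub (vsub (vsub R a) b) c).

Definition flat (R R' : vcube F I OZ) : Prop :=
  forall st z z', R st (Some z) (Some z') = R' st (Some z) (Some z').

Definition att_ex (J : finType) (R : vcube F J OZ) : Prop :=
  forall st, exists q, R st None (Some q).

Lemma vpull_low (J : finType) (R : vcube F J OZ) : att_ex R ->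
  exists Q : vcube F J Z, forall st z z', Q st z z' = R st (Some z) (Some z').
Proof.
move=> h; pose Q (st : {ffun J -> bool}) : rel Z := fun z z' => R st (Some z) (Some z').
have idK : cancel (fun i : J => i) (fun i => i) by [].
have sid (st : {ffun J -> bool}) : spull (fun i => i) st = st by apply/ffunP => i; rewrite ffunE.
have QE st z z' : Q st z z' = R (spull (fun i => i) st) (Some z) (Some z') by rewrite sid.
have mt st x : exists z, R st x (Some z).
  by have [q hq] := h st; apply: (att_meets (v_eqv R st) hq).
have [V hV] := vpull idK idK (@Some_inj' Z) QE mt.
by exists V => st z z'; rewrite hV.
Qed.

Lemma saddles_low (R0 R1 : vcube F I OZ) (Q0 Q1 : vcube F I Z) :
  vedge R0 R1 -> restricts R0 Q0 -> restricts R1 Q1 -> att_ex R0 -> att_ex R1 ->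
  saddles Q0 Q1.
Proof.
move=> E r0 r1 a0 a1 st; have [p [q s]] := e_sad E st.
have [q0 h0] := a0 st; have [q1 h1] := a1 st.
have mt0 := att_meets (v_eqv R0 st) h0; have mt1 := att_meets (v_eqv R1 st) h1.
case: s => m.
  have [u pu] := mt0 p; have [v qv] := mt0 q.
  exists u, v; left; apply: (pull_merge (r0 st) (r1 st)).
  exact: merge_change (v_eqv _ _) pu qv m.
have [u pu] := mt1 p; have [v qv] := mt1 q.
exists u, v; right; apply: (pull_merge (r1 st) (r0 st)).
exact: merge_change (v_eqv _ _) pu qv m.
Qed.

Definition att_cst (R : vcube F I OZ) : Prop := exists q, attached q R.

Lemma att_cst_ex R : att_cst R -> att_ex R.
Proof. by move=> [q h] st; exists q. Qed.

(* The pivot is the first crossing: it is open in the states (~~ p, _, _); in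
   the states (p, _, _) the strand over or under it forms a bigon, which is a
   circle in the state (p, false, true). *)
Record r3_side (p : bool) (R : vcube F (option (option (option I))) OZ) : Prop := R3Side {
  r3_open : forall a b, att_cst (K3 R (~~ p) a b);
  r3_loop : isolated (K3 R p false true);
  r3_att : [/\ att_cst (K3 R p false false), att_cst (K3 R p true true)
             & att_cst (K3 R p true false)];
  r3_flat : [/\ flat (K3 R p false true) (K3 R p false false),
                flat (K3 R p false true) (K3 R p true true)
              & flat (K3 R p false true) (K3 R (~~ p) false true)]
}.

Lemma open_QA p R : r3_side p R ->
  exists2 QA : vcube F (option (option I)) Z, restricts2 (vsub R (~~ p)) QA &
    forall st z z', QA st z z' = vsub R (~~ p) st (Some z) (Some z').
Proof.
move=> h; have [|QA hQA] := @vpull_low _ (vsub R (~~ p)).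
  move=> st; rewrite (oext_surj st) (oext_surj [ffun i => st (Some i)]).
  by have [q hq] := r3_open h (st None) ([ffun i => st (Some i)] None); exists q; apply: hq.
exists QA => // a b; split; last exact: (r3_open h).
by move=> st z z'; rewrite /= hQA.
Qed.

(** Retracting the face with the circle leaves a cone between the open face and the state (p, true,
    false). On the two sides of the move the open faces agree after exchanging the two crossings,
    the remaining states agree, and the attaching maps are sums of saddles between them, so that the
    cones are isomorphic. *)
Lemma R3_eq p (R R' : vcube F (option (option (option I))) OZ) :
  r3_side p R -> r3_side p R' ->
  (forall a b, flat (K3 R (~~ p) a b) (K3 R' (~~ p) b a)) ->
  flat (K3 R p true false) (K3 R' p true false) ->
  Hiso 0 0 (cube R (ork (ork (ork rk)))) (cube R' (ork (ork (ork rk)))).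
Proof.
move=> h h' fo fp.
have [QA rA eA] := open_QA h; have [QA' rA' eA'] := open_QA h'.
have sw a b : same_rel (K QA a b) (K QA' b a).
  by move=> st z z'; rewrite /= eA eA'; apply: fo.
have [[q1 a00] [q2 a11] [q3 a10]] := r3_att h.
have [[q1' a00'] [q2' a11'] [q3' a10']] := r3_att h'.
have ex q (V : vcube F I OZ) : attached q V -> att_ex V by move=> ha st; exists q.
have [QB rB] := vpull_low (ex _ _ a10); have [QB' rB'] := vpull_low (ex _ _ a10').
have [Q r00] := vpull_low (ex _ _ a00); have [Q' r00'] := vpull_low (ex _ _ a00').
have eB : same_rel QB QB' by move=> st z z'; rewrite rB rB'; apply: fp.
have [f1 f2 f3] := r3_flat h; have [f1' f2' f3'] := r3_flat h'.
have r01 : restricts (K3 R p false true) Q by move=> st z z'; rewrite r00 f1.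
have r01' : restricts (K3 R' p false true) Q' by move=> st z z'; rewrite r00' f1'.
have r11 : restricts (K3 R p true true) Q by move=> st z z'; rewrite r01 f2.
have r11' : restricts (K3 R' p true true) Q' by move=> st z z'; rewrite r01' f2'.
have QQ : same_rel (K QA false true) Q.
  by move=> st z z'; rewrite r01 f3 /= eA.
have QQ' : same_rel (K QA' false true) Q'.
  by move=> st z z'; rewrite r01' f3' /= eA'.
have [o10 o10'] := (rA true false, rA' true false).
case: p h h' fo fp rA rA' eA eA' a00 a11 a10 a00' a11' a10' rB rB' r00 r00' f1 f2 f3 f1' f2' f3'
  r01 r01' r11 r11' o10 o10' => /=; intros.
- have E10 (V : vcube F (option (option (option I))) OZ) : vedge (K3 V false true false) (K3 V true true false).
    by apply: (vedge_sub false (vedge_sub true (vsub_edge V))).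
  have E01 (V : vcube F (option (option (option I))) OZ) : vedge (K3 V true false false) (K3 V true true false).
    by apply: (vedge_sub false (vsub_edge (vsub V true))).
  have s10 : saddles (K QA true false) QB.
    by apply: (saddles_low (E10 R) o10.1 rB); [apply: att_cst_ex; exact: o10.2|apply: ex a10].
  have s10' : saddles (K QA' true false) QB'.
    by apply: (saddles_low (E10 R') o10'.1 rB'); [apply: att_cst_ex; exact: o10'.2|apply: ex a10'].
  (* The states (false, false, true) and (true, true, false) are not joined by an edge of the cube.
     By [r3_flat] the former induces the same relation as (true, false, false), which is. *)
  have s01 : saddles (K QA false true) QB.
    apply: (saddles_low (E01 R) _ rB); [|exact: ex a00|exact: ex a10].
    by move=> st z z'; rewrite QQ r00.
  have s01' : saddles (K QA' false true) QB'.
    apply: (saddles_low (E01 R') _ rB'); [|exact: ex a00'|exact: ex a10'].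
    by move=> st z z'; rewrite QQ' r00'.
  have H := R3I_cone rk_inj s10 s01 rA r00 a00 r01 (r3_loop h) r11 a11 rB a10 QQ.
  have H' := R3I_cone rk_inj s10' s01' rA' r00' a00' r01' (r3_loop h') r11' a11' rB' a10' QQ'.
  apply: (@Hiso_eq _ (0 + (0 - 0)) (0 + (0 - 0))); [|by []|by []].
  exact: Hiso_trans H (Hiso_trans (psi_swap s10 s01 s10' s01' sw eB) (Hiso_sym H')).
- have E10 (V : vcube F (option (option (option I))) OZ) : vedge (K3 V false true false) (K3 V true true false).
    by apply: (vedge_sub false (vedge_sub true (vsub_edge V))).
  have E01 (V : vcube F (option (option (option I))) OZ) : vedge (K3 V false true false) (K3 V false true true).
    by apply: (vsub_edge (vsub (vsub V false) true)).
  have s10 : saddles QB (K QA true false).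
    by apply: (saddles_low (E10 R) rB o10.1); [apply: ex a10|apply: att_cst_ex; exact: o10.2].
  have s10' : saddles QB' (K QA' true false).
    by apply: (saddles_low (E10 R') rB' o10'.1); [apply: ex a10'|apply: att_cst_ex; exact: o10'.2].
  have s01 : saddles QB (K QA false true).
    apply: (saddles_low (E01 R) rB _); [|exact: ex a10|exact: ex a11].
    by move=> st z z'; rewrite QQ r11.
  have s01' : saddles QB' (K QA' false true).
    apply: (saddles_low (E01 R') rB' _); [|exact: ex a10'|exact: ex a11'].
    by move=> st z z'; rewrite QQ' r11'.
  have H := R3II_cone rk_inj s10 s01 rA r00 a00 r01 (r3_loop h) r11 a11 rB a10 QQ.
  have H' := R3II_cone rk_inj s10' s01' rA' r00' a00' r01' (r3_loop h') r11' a11' rB' a10' QQ'.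
  apply: (@Hiso_eq _ (-1 + (0 - -1)) (-1 + (0 - -1))); [|by []|by []].
  exact: Hiso_trans H (Hiso_trans (phi_swap s10 s01 s10' s01' sw eB) (Hiso_sym H')).
Qed.

End Swap.

(** * Smoothings of a diagram with some crossings forgotten *)

Section PermSaddle.

Variable T : finType.

Definition porb (s : {perm T}) : rel T := fun x y => y \in porbit s x.

Lemma orb_eqv s : eqv (porb s).
Proof.
split.
- by move=> x; apply: porbit_id.
- by move=> x y; rewrite /porb porbit_sym.
- by move=> y x z; rewrite /porb -!eq_porbit_mem => /eqP-> /eqP->.
Qed.

Lemma orb_closed (s : {perm T}) (R : rel T) : eqv R -> (forall x, R x (s x)) ->
  forall x y, porb s x y -> R x y.
Proof.
move=> [r _ t] h x y /porbitP[i ->]; elim: i => [|i IH]; first by rewrite expg0 perm1.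
by rewrite expgSr permM; apply: t IH (h _).
Qed.

(** The orbits of either permutation are contained in those of the other one once the orbits of [p]
    and [q] are joined. Multiplication by a transposition changes the number of cycles by exactly
    one, which excludes that [p] and [q] are related on both sides or on neither. *)
Lemma perm_saddle (s : {perm T}) p q : p != q -> saddle p q (porb s) (porb (tperm p q * s)%g).
Proof.
move=> pq; pose G (R : rel T) : rel T := fun a b => [|| R a b, R a p && R q b | R a q && R p b].
have Geqv R : eqv R -> eqv (G R).
  move=> [r sy t].
  have tt a b c : R a b -> R b c -> R a c by move=> *; apply: (t b).
  have ss a b : R a b -> R b a by rewrite sy.
  split.
  - by move=> x; rewrite /G r.
  - move=> x y; rewrite /G (sy x y) (sy x p) (sy q y) (sy x q) (sy p y).
    by congr orb; rewrite orbC andbC; congr orb; rewrite andbC.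
  - move=> y x z; rewrite /G => /orP[h1|/orP[/andP[h1 h1']|/andP[h1 h1']]]
      /orP[h2|/orP[/andP[h2 h2']|/andP[h2 h2']]].
    + by rewrite (tt _ _ _ h1 h2).
    + by rewrite (tt _ _ _ h1 h2) h2' orbT.
    + by rewrite (tt _ _ _ h1 h2) h2' !orbT.
    + by rewrite h1 (tt _ _ _ h1' h2) orbT.
    + by rewrite h1 h2' orbT.
    + by rewrite (tt _ _ _ h1 h2').
    + by rewrite h1 (tt _ _ _ h1' h2) !orbT.
    + by rewrite (tt _ _ _ h1 h2').
    + by rewrite h1 h2' !orbT.
have sub (u : {perm T}) x y : porb (tperm p q * u)%g x y -> G (porb u) x y.
  apply: orb_closed; first exact/Geqv/orb_eqv.
  have us z : porb u z (u z) by have := mem_porbit u 1 z; rewrite expg1.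
  have uu z : porb u z z by apply: porbit_id.
  move=> z; rewrite permM /G; case: tpermP => [->|->|_ _].
  - by rewrite us uu orbT.
  - by rewrite us uu !orbT.
  - by rewrite us.
have sub' x y : porb s x y -> G (porb (tperm p q * s)%g) x y.
  by move=> h; apply: sub; rewrite mulgA tperm2 mul1g.
have cnt (u : {perm T}) : #|porbits (tperm p q * u)| + (~~ porb u p q).*2 = (#|porbits u| + 1)%N.
  by have := porbits_mul_tperm u p q; rewrite pq /porb (porbit_sym u q p).
have [r sy t] := orb_eqv s; have [r' sy' t'] := orb_eqv (tperm p q * s)%g.
have GE (u : {perm T}) a b : porb u p q -> G (porb u) a b = porb u a b.
  have [_ su tu] := orb_eqv u.
  move=> h; apply/idP/idP; last by rewrite /G => ->.
  move=> /orP[//|/orP[/andP[h1 h2]|/andP[h1 h2]]]; first exact: tu h1 (tu _ _ _ h h2).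
  by apply: tu h1 (tu _ _ _ _ h2); rewrite su.
have GS (u u' : {perm T}) a b : (forall x y, porb u x y -> porb u' x y) -> porb u' p q ->
    G (porb u) a b -> porb u' a b.
  move=> h h1 g; rewrite -(GE u' a b h1); move: g; rewrite /G.
  case/orP => [/h->//|/orP[/andP[/h-> /h->]|/andP[/h-> /h->]]]; by rewrite ?orbT.
case h: (porb s p q); case h': (porb (tperm p q * s)%g p q).
- have E : porbits (tperm p q * s)%g = porbits s.
    apply: eq_imset => x; apply/setP => y; apply/idP/idP => hh.
      by have := sub s x y hh; rewrite GE.
    by have := sub' x y hh; rewrite GE.
  by have := cnt s; rewrite E h /=; lia.
- right; split; first by rewrite h'.
  move=> a b; apply/idP/idP; first exact: sub'.
  by apply: GS => // x y /(sub s); rewrite GE.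
- left; split; first by rewrite h.
  move=> a b; apply/idP/idP; first exact: sub.
  by apply: GS => // x y /sub'; rewrite GE.
- have := cnt s; have := cnt (tperm p q * s)%g; rewrite mulgA tperm2 mul1g h h' /=; lia.
Qed.

End PermSaddle.

Lemma saddle_ext (T : finType) (R R' S S' : rel T) p q :
  (forall x y, R x y = S x y) -> (forall x y, R' x y = S' x y) ->
  saddle p q R R' -> saddle p q S S'.
Proof.
by move=> e e' [[n h]|[n h]]; [left|right]; split; rewrite -?e -?e' // => a b;
  rewrite -!e -!e' h.
Qed.

Section Smooth.

Variable D : diagram.
Implicit Types (asg : classical D -> option bool) (h : dart D) (x y : passage D).

(* asg c = None means that both strands go straight on at c, as at a virtual
   crossing. A passage x also names the edge which leaves it. *)
Definition smooth asg h : dart D :=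
  match h.1 with
  | inl (inl c, s) => if asg c is Some b then angle_mate b c s h else (h.1, ~~ h.2)
  | _ => (h.1, ~~ h.2)
  end.

Definition edge h : passage D := if h.2 then h.1 else (next_passage D)^-1%g h.1.

Definition link asg : rel (passage D) :=
  fun x y => [exists h, (edge h == x) && (edge (smooth asg h) == y)].

Definition Rel asg : rel (passage D) := connect (link asg).

Lemma smoothE asg c s o : smooth asg (inl (inl c, s), o) =
  if asg c is Some b then (inl (inl c, ~~ s), o (+) (over_strand c == b))
  else (inl (inl c, s), ~~ o).
Proof.
rewrite /smooth /=; case: (asg c) => // b; rewrite /angle_mate /=.
by congr (_, _); case: s; case: o; case: b; case: (over_strand c).
Qed.

Lemma smoothK asg : involutive (smooth asg).
Proof.
move=> [[[[c|c] s]|p] o]; [|by rewrite /smooth /= negbK|by rewrite /smooth /= negbK].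
rewrite smoothE; case e: (asg c) => [b|]; rewrite smoothE e ?negbK //.
by rewrite -addbA addbb addbF.
Qed.

Lemma linkP asg x y : reflect (exists h, edge h = x /\ edge (smooth asg h) = y) (link asg x y).
Proof.
apply: (iffP existsP) => -[h].
  by move=> /andP[/eqP h1 /eqP h2]; exists h.
by move=> [h1 h2]; exists h; rewrite h1 h2 !eqxx.
Qed.

Lemma link_dart asg h : link asg (edge h) (edge (smooth asg h)).
Proof. by apply/linkP; exists h. Qed.

Lemma link_sym asg : symmetric (link asg).
Proof.
have s x y : link asg x y -> link asg y x.
  by move=> /linkP[h [<- <-]]; apply/linkP; exists (smooth asg h); rewrite smoothK.
by move=> x y; apply/idP/idP; apply: s.
Qed.

Lemma Rel_eqv asg : eqv (Rel asg).
Proof.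
split; [exact: connect0|exact/sym_connect_sym/link_sym|exact: connect_trans].
Qed.

Lemma other_endK : involutive (@other_end D).
Proof. by move=> [x []]; rewrite /other_end /= ?permK ?permKV. Qed.

Lemma edge_other h : edge (other_end h) = edge h.
Proof. by case: h => x []; rewrite /edge /other_end /= ?permK. Qed.

Lemma edge_eq h h' : edge h = edge h' -> h' = h \/ h' = other_end h.
Proof.
case: h h' => x [] [y []]; rewrite /edge /other_end /= => e; subst; rewrite ?permKV; auto.
by left; rewrite (perm_inj e).
Qed.

(** The circles in the definition of Khovanov homology are sets of half-edges. As [other_end] joins
    the halves of each edge, they correspond to classes of edges, which are half as many and carry
    the permutations used below. *)
Lemma Rel_darts asg h h' :
  connect [rel u v | (v == other_end u) || (v == smooth asg u)] h h' = Rel asg (edge h) (edge h').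
Proof.
apply/idP/idP => /connectP[p].
  elim: p h => [|u p IH] h /=; first by move=> _ ->; apply: connect0.
  move=> /andP[/orP[]/eqP e /IH{}IH /IH]; rewrite e ?edge_other //.
  by apply: connect_trans; apply: connect1; apply: link_dart.
have step u v : v = other_end u \/ v = smooth asg u ->
    connect [rel u v | (v == other_end u) || (v == smooth asg u)] u v.
  by move=> e; apply: connect1 => /=; case: e => ->; rewrite eqxx ?orbT.
elim: p h => [|u p IH] h /=.
  move=> _ /esym/edge_eq[->|->]; first exact: connect0.
  by apply: step; left.
move=> /andP[/linkP[h1 [e1 e2]] hp e].
rewrite -e2 in hp e.
apply: connect_trans (IH _ hp e).
apply: (connect_trans (y := h1)); last by apply: step; right.
by case: (edge_eq (esym e1)) => ->; [apply: connect0|apply: step; left].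
Qed.

End Smooth.

(** * Coherent orientations of the circles of all states *)

Section Orient.

Variables (D : diagram) (S : {set classical D}) (tau : passage D -> bool).

Definition kept (x : passage D) : bool := if x is inl (inl c, _) then c \in S else false.

(* tau orients the edges against their direction when it is true; the circles of
   a state on the even crossings are then oriented coherently. *)
Definition flips : Prop := forall x, tau (next_passage D x) = tau x (+) kept (next_passage D x).

Definition evens : {set classical D} :=
  [set c in S | tau (inl (inl c, false)) != tau (inl (inl c, true))].

Hypotheses (fl : flips) (ev : evens = S).

Lemma evenE c s : c \in S -> tau (inl (inl c, ~~ s)) = ~~ tau (inl (inl c, s)).
Proof.
by rewrite -ev inE => /andP[_]; case: s => /=;
  case: (tau (inl (inl c, false))); case: (tau (inl (inl c, true))).
Qed.

(** A sign on half-edges that is opposite at the two ends of an edge and, because all kept crossings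
    are even, opposite on the two half-edges that a smoothing joins. This is the coherent
    orientation. *)
Definition sgd (h : dart D) : bool := if h.2 then tau h.1 else ~~ tau ((next_passage D)^-1%g h.1).

Lemma tau_prev x : tau ((next_passage D)^-1%g x) = tau x (+) kept x.
Proof. by have := fl ((next_passage D)^-1%g x); rewrite permKV => ->; rewrite -addbA addbb addbF. Qed.

Lemma sgdE x o : sgd (x, o) = tau x (+) (~~ o && ~~ kept x).
Proof. by rewrite /sgd /=; case: o; rewrite ?addbF // tau_prev; case: (tau x); case: (kept x). Qed.

Lemma sgd_other h : sgd (other_end h) = ~~ sgd h.
Proof. by case: h => x []; rewrite /sgd /other_end /= ?permK // negbK. Qed.

Definition on_S (asg : classical D -> option bool) : Prop := forall c, (asg c != None) = (c \in S).

Lemma sgd_smooth asg h : on_S asg -> sgd (smooth asg h) = ~~ sgd h.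
Proof.
case: h => [[[[c|c] s]|p] o] hS; last 2 first.
- by rewrite /smooth /= !sgdE /=; case: o; case: (tau _).
- by rewrite /smooth /= !sgdE /=; case: o; case: (tau _).
rewrite smoothE; have := hS c; case: (asg c) => [b|] /= /esym hc; rewrite !sgdE /= hc /=.
  by rewrite evenE // !andbF !addbF.
by case: o; case: (tau _).
Qed.

Definition pdart (x : passage D) : dart D := if tau x then (x, true) else (next_passage D x, false).

Lemma edge_pdart x : edge (pdart x) = x.
Proof. by rewrite /pdart; case: ifP => _; rewrite /edge /= ?permK. Qed.

Lemma sgd_pdart x : sgd (pdart x).
Proof. by rewrite /pdart; case: ifP => [|/negbT] h; rewrite /sgd /= ?permK. Qed.

Lemma pdart_edge h : sgd h -> pdart (edge h) = h.
Proof.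
case: h => x []; rewrite /sgd /pdart /edge /=; first by move=> ->.
by move=> /negPf->; rewrite permKV.
Qed.

Section Asg.

Variables (asg : classical D -> option bool) (hS : on_S asg).

(** The successor of the edge [x] along its oriented circle. *)
Definition pi_fun (x : passage D) : passage D := edge (smooth asg (other_end (pdart x))).

Lemma pdart_pi x : pdart (pi_fun x) = smooth asg (other_end (pdart x)).
Proof. by rewrite pdart_edge // sgd_smooth // sgd_other negbK sgd_pdart. Qed.

Lemma pi_inj : injective pi_fun.
Proof.
move=> x y /(congr1 pdart); rewrite !pdart_pi => /(inv_inj (smoothK asg)).
by move=> /(inv_inj (@other_endK D)) /(congr1 (@edge D)); rewrite !edge_pdart.
Qed.

Definition pi : {perm passage D} := perm pi_inj.

Lemma link_pi x y : link asg x y = (y == pi x) || (x == pi y).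
Proof.
rewrite !permE; apply/linkP/orP.
  move=> [h [<- <-]]; case hs: (sgd h); [right|left]; apply/eqP; rewrite /pi_fun.
    have -> : pdart (edge (smooth asg h)) = other_end (smooth asg h).
      rewrite -edge_other pdart_edge // sgd_other sgd_smooth // negbK; exact: hs.
    by rewrite other_endK smoothK.
  have -> : pdart (edge h) = other_end h by rewrite -edge_other pdart_edge // sgd_other hs.
  by rewrite other_endK.
move=> [/eqP->|/eqP->].
  by exists (other_end (pdart x)); rewrite edge_other edge_pdart.
exists (smooth asg (other_end (pdart y))).
by rewrite smoothK edge_other edge_pdart.
Qed.

Lemma Rel_orb x y : Rel asg x y = porb pi x y.
Proof.
apply/idP/idP.
  have [r s t] := orb_eqv pi.
  have st z : porb pi z (pi z) by have := mem_porbit pi 1 z; rewrite expg1.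
  move=> /connectP[p]; elim: p x => [|z p IH] x /=; first by move=> _ ->; apply: r.
  rewrite link_pi => /andP[/orP[]/eqP e hp ey]; apply: t (IH _ hp ey); first by rewrite e.
  by rewrite s e.
apply: orb_closed; first exact: Rel_eqv.
by move=> z; apply: connect1; rewrite link_pi eqxx.
Qed.

End Asg.

(** Of the two edges leaving an even crossing exactly one is coloured [true]: this is [pivot], and
    [pivot'] is the edge entering along the same strand. By these two edges the oriented circles
    leave [c], whichever smoothing is chosen. *)
Definition pivot (c : classical D) : passage D := inl (inl c, tau (inl (inl c, true))).
Definition pivot' (c : classical D) : passage D := (next_passage D)^-1%g (pivot c).

Lemma tau_pivot c : c \in S -> tau (pivot c).
Proof.
move=> cS; rewrite /pivot; case e: (tau (inl (inl c, true))) => //.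
by have := evenE true cS; rewrite e => ->.
Qed.

(** Both smoothings of an even crossing match its two ingoing half-edges with its two outgoing ones.
    Changing the smoothing exchanges the outgoing ones, so that the successor permutation is
    multiplied by a transposition. *)
Lemma Rel_saddle asg asg' c : on_S asg -> c \in S ->
  (forall c', c' != c -> asg' c' = asg c') -> asg c = Some false -> asg' c = Some true ->
  saddle (pivot c) (pivot' c) (Rel asg) (Rel asg').
Proof.
move=> hS cS ne e0 e1.
have hS' : on_S asg'.
  move=> c'; rewrite -hS; have [->|/ne->//] := eqVneq c' c; by rewrite e0 e1.
have tp := tau_pivot cS.
have tp' : tau (pivot' c) = false by rewrite /pivot' tau_prev tp /= cS.
have E : pi hS' = (pi hS * tperm (pivot c) (pivot' c))%g.
  apply/permP => x; rewrite permM [pi hS' x]permE [pi hS x]permE /pi_fun.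
  move: (other_end (pdart x)) (sgd_other (pdart x)); rewrite sgd_pdart => h /= sh.
  have same : smooth asg h = smooth asg' h -> edge (smooth asg' h) =
      tperm (pivot c) (pivot' c) (edge (smooth asg h)) ->  edge (smooth asg' h) =
      tperm (pivot c) (pivot' c) (edge (smooth asg h)) by [].
  have far : h.1 <> inl (inl c, false) -> h.1 <> inl (inl c, true) ->
      smooth asg' h = smooth asg h.
    case: h {sh same} => [[[[c'|c'] s]|p] o] //= n1 n2; rewrite !smoothE ne //.
    by apply/eqP => ec; subst; case: s n1 n2.
  have sh0 : sgd (smooth asg h) by rewrite sgd_smooth // sh.
  have nfar : smooth asg' h = smooth asg h -> (smooth asg h).1 <> pivot c ->
     edge (smooth asg' h) = tperm (pivot c) (pivot' c) (edge (smooth asg h)).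
    move=> -> np; rewrite tpermD //; apply/eqP.
      move=> e; apply: np; move: sh0; case: (smooth asg h) e => y [] /=; rewrite /edge /sgd /=; first by move=> ->.
      by move=> <-; rewrite tp.
    move=> e; apply: np; move: sh0; case: (smooth asg h) e => y [] /=; rewrite /edge /sgd /=.
      by move=> <-; rewrite tp'.
    by move=> /perm_inj ->.
  case hc: ((h.1 == inl (inl c, false)) || (h.1 == inl (inl c, true))); last first.
    move/negbT: hc; rewrite negb_or => /andP[/eqP n1 /eqP n2].
    apply: nfar; first exact: far.
    rewrite /pivot; case: h n1 n2 {sh sh0 far same} => [[[[c'|c'] s]|p] o] //= n1 n2.
      have nc : c' <> c by move=> e; subst c'; case: s n1 n2.
      by rewrite smoothE; case: (asg c') => [b|] /= [].
  have [s es] : exists s, h.1 = inl (inl c, s) by move: hc => /orP[]/eqP->; eauto.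
  case: h es sh sh0 {far nfar same hc} => y o /= -> sh; rewrite !smoothE e0 e1.
  have ps : inl (inl c, ~~ s) = pivot c.
    have ts : tau (inl (inl c, s)) = false by move: sh; rewrite sgdE /= cS andbF addbF.
    rewrite /pivot; congr (inl (_, _)); have := evenE s cS; rewrite ts.
    by case: s ts {sh} => /= [->|].
  rewrite ps; case: (over_strand c); case: o {sh} => _ /=;
    by rewrite /edge /= ?tpermL ?tpermR.
(* The transposition stands on the right here and on the left in [perm_saddle]; passing to inverses
   does not change the orbits. *)
have E' : ((pi hS')^-1 = tperm (pivot c) (pivot' c) * (pi hS)^-1)%g by rewrite E invMg tpermV.
have RE a (h : on_S a) x y : porb (pi h)^-1%g x y = Rel a x y.
  by rewrite (Rel_orb h) /porb porbitV.
have pq : pivot c != pivot' c by apply/eqP => e; move: tp; rewrite e tp'.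
apply: saddle_ext (RE _ hS) (RE _ hS') _.
rewrite E'; exact: perm_saddle.
Qed.

Variable F : fieldType.

Definition asg_of (T : {set classical D}) (st : {ffun {c | c \in T} -> bool}) :
    classical D -> option bool := fun c => omap st (insub c).

Lemma asg_ofE (T : {set classical D}) (st : {ffun {c | c \in T} -> bool}) c :
  asg_of st (val c) = Some (st c).
Proof. by rewrite /asg_of valK. Qed.

Lemma asg_ofN (T : {set classical D}) (st : {ffun {c | c \in T} -> bool}) c :
  c \notin T -> asg_of st c = None.
Proof. by move=> h; rewrite /asg_of insubN. Qed.

Lemma asg_of_on (st : {ffun {c | c \in S} -> bool}) : on_S (asg_of st).
Proof.
by move=> c; rewrite /asg_of; case: insubP => [u /= -> _|/negPf->].
Qed.

Lemma asg_of_saddle (st : {ffun {c | c \in S} -> bool}) c : st c ->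
  saddle (pivot (val c)) (pivot' (val c)) (Rel (asg_of (clear c st))) (Rel (asg_of st)).
Proof.
move=> sc; apply: Rel_saddle (asg_of_on _) (valP c) _ _ _.
- move=> c' ne; rewrite /asg_of; case: insubP => //= u _ eu.
  by rewrite ffunE -val_eqE /= eu ne.
- by rewrite asg_ofE ffunE eqxx.
- by rewrite asg_ofE sc.
Qed.

Lemma Rel_vcube : exists V : vcube F {c | c \in S} (passage D), forall st, V st = Rel (asg_of st).
Proof.
unshelve eexists (@VCube F _ _ (fun st => Rel (asg_of st)) _ _ _).
- by move=> st; apply: Rel_eqv.
- by move=> st c sc; exists (pivot (val c)), (pivot' (val c)); apply: asg_of_saddle.
- move=> st c d cd sc sd f hf.
  have scd : clear d st c by rewrite ffunE sc cd.
  have sdc : clear c st d by rewrite ffunE sd eq_sym cd.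
  have h1 := asg_of_saddle scd; have h2 := asg_of_saddle sdc.
  rewrite clearC in h2.
  rewrite [clear d (clear c st)]clearC.
  by apply: (Dop_face _ _ _ _ h2 (asg_of_saddle sd) h1 (asg_of_saddle sc) hf); apply: Rel_eqv.
- by [].
Qed.

End Orient.

Definition oriented (D : diagram) (S : {set classical D}) : Prop :=
  exists2 tau, flips S tau & evens S tau = S.

Definition kept_neg (D : diagram) (S : {set classical D}) : nat :=
  #|[set c in S | over_strand c]|.
Definition kept_pos (D : diagram) (S : {set classical D}) : nat :=
  #|[set c in S | ~~ over_strand c]|.
Definition kept_shift (D : diagram) (S : {set classical D}) : int :=
  (kept_pos S)%:Z - (kept_neg S)%:Z - (kept_neg S)%:Z.

Section HI.

Variable F : fieldType.

Definition realizes (D : diagram) (S : {set classical D})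
    (V : vcube F {c | c \in S} (passage D)) : Prop :=
  forall st, V st = Rel (asg_of st).

(* Both diagrams are read with only the crossings of S and S' counting as
   classical; the degrees take the shifts by these crossings into account. *)
Definition HI (D : diagram) (S : {set classical D}) (D' : diagram) (S' : {set classical D'}) : Prop :=
  forall V V' rk rk', realizes V -> realizes V' -> injective rk -> injective rk' ->
  Hiso ((kept_neg S')%:Z - (kept_neg S)%:Z) (kept_shift S - kept_shift S')
    (cube (V : vcube F {c | c \in S} (passage D)) rk)
    (cube (V' : vcube F {c | c \in S'} (passage D')) rk').

Lemma HI_sym D S D' S' : @HI D S D' S' -> @HI D' S' D S.
Proof.
move=> h V V' rk rk' hV hV' i i'; have H := Hiso_sym (h _ _ _ _ hV' hV i' i).
by apply: Hiso_eq H _ _; zmod.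
Qed.

Lemma ex_rank (T : finType) : exists rk : T -> nat, injective rk.
Proof.
exists (fun x => enum_rank x : nat) => x y e.
exact/enum_rank_inj/val_inj.
Qed.

(** [HI] quantifies over the cubes that realise the two ends. Orientability of the middle diagram
    provides one there; without a cube in the middle the two hypotheses could hold vacuously. *)
Lemma HI_trans D S D' S' D'' S'' : oriented S' ->
  @HI D S D' S' -> @HI D' S' D'' S'' -> @HI D S D'' S''.
Proof.
move=> [tau fl ev] h h' V V'' rk rk'' hV hV'' i i''.
have [V' hV'] := Rel_vcube fl ev F.
have [rk' i'] := ex_rank {c | c \in S'}.
have H := Hiso_trans (h _ _ _ _ hV hV' i i') (h' _ _ _ _ hV' hV'' i' i'').
by apply: Hiso_eq H _ _; zmod.
Qed.

Section Same.

Variables (D : diagram) (S : {set classical D}) (D' : diagram) (S' : {set classical D'}).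
Variables (f : classical D -> classical D').
Hypotheses (f_inj : injective f) (fS : S' = f @: S) (f_over : forall c, over_strand (f c) = over_strand c).

Lemma kept_neg_eq : kept_neg S' = kept_neg S.
Proof.
rewrite /kept_neg -(card_imset _ f_inj); apply: eq_card => c; rewrite fS inE.
apply/andP/imsetP => [[/imsetP[d dS ->] o]|[d]].
  by exists d; rewrite // inE dS -f_over.
by rewrite inE => /andP[dS o] ->; rewrite imset_f // f_over.
Qed.

Lemma kept_pos_eq : kept_pos S' = kept_pos S.
Proof.
rewrite /kept_pos -(card_imset _ f_inj); apply: eq_card => c; rewrite fS inE.
apply/andP/imsetP => [[/imsetP[d dS ->] o]|[d]].
  by exists d; rewrite // inE dS -f_over.
by rewrite inE => /andP[dS o] ->; rewrite imset_f // f_over.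
Qed.

Lemma kept_fun_subproof (c : {c | c \in S}) : f (val c) \in S'.
Proof. by rewrite fS imset_f // (valP c). Qed.

Definition kept_fun (c : {c | c \in S}) : {c | c \in S'} := Sub (f (val c)) (kept_fun_subproof c).

Lemma kept_fun_bij : bijective kept_fun.
Proof.
apply: inj_card_bij; first by move=> c d /(congr1 val) /= /f_inj/val_inj.
by rewrite !card_sig fS -(card_imset _ f_inj) leqnn.
Qed.

Variables (Z : finType) (io : Z -> passage D) (io' : Z -> passage D').
Hypotheses (io_inj : injective io) (io_inj' : injective io').

Lemma HI_same :
  (forall asg asg', on_S S asg -> on_S S' asg' -> (forall c, c \in S -> asg' (f c) = asg c) ->
     forall z z', Rel asg (io z) (io z') = Rel asg' (io' z) (io' z')) ->
  (forall asg, on_S S asg -> forall x, exists z, Rel asg x (io z)) ->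
  (forall asg, on_S S' asg -> forall x, exists z, Rel asg x (io' z)) ->
  HI S S'.
Proof.
move=> eq mt mt' V V' rk rk' hV hV' i i'.
rewrite /kept_shift kept_neg_eq kept_pos_eq !subrr.
have [g hK gK] := kept_fun_bij.
have idK : cancel (fun c : {c | c \in S} => c) (fun c => c) by [].
have sid (st : {ffun {c | c \in S} -> bool}) : spull (fun i => i) st = st by apply/ffunP => c; rewrite ffunE.
have QE st z z' : V st (io z) (io z') = V (spull (fun i => i) st) (io z) (io z') by rewrite sid.
have mtV st x : exists z, V st x (io z) by rewrite hV; apply/mt/asg_of_on.
have [Q hQ] := vpull idK idK io_inj QE mtV.
have QE1 st z z' : Q st z z' = V (spull (fun i => i) st) (io z) (io z') by rewrite hQ sid.
have c1 := cube_equiv idK idK io_inj QE1 mtV i i.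
have QE2 st z z' : Q st z z' = V' (spull g st) (io' z) (io' z').
  rewrite hQ hV hV'; apply: eq; try exact: asg_of_on.
  move=> c cS; rewrite -[c]/(val (Sub c cS : {c | c \in S})) asg_ofE.
  rewrite -[f _]/(val (kept_fun (Sub c cS))) asg_ofE ffunE hK //.
have mtV' st x : exists z, V' st x (io' z) by rewrite hV'; apply/mt'/asg_of_on.
have c2 := cube_equiv hK gK io_inj' QE2 mtV' i' i.
have := Hiso_trans (ciso_Hiso c1) (Hiso_sym (ciso_Hiso c2)).
by move=> H; apply: Hiso_eq H _ _.
Qed.

End Same.

End HI.

(** * Contraction of graphs, and diagrams with erased crossings *)

Section Contract.

Variables (X Z : finType) (l : rel X) (lz : rel Z) (io : Z -> X) (ka : X -> Z).
Hypotheses (ls : symmetric l) (lzs : symmetric lz).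

Lemma connect_contract :
  (forall z z', lz z z' -> connect l (io z) (io z')) ->
  (forall x x', l x x' -> connect lz (ka x) (ka x')) ->
  (forall z, connect lz z (ka (io z))) ->
  forall z z', connect l (io z) (io z') = connect lz z z'.
Proof.
move=> h1 h2 h3 z z'; apply/idP/idP.
  have cs := sym_connect_sym lzs.
  have h x y : connect l x y -> connect lz (ka x) (ka y).
    move=> /connectP[p]; elim: p x => [|w p IH] x /=; first by move=> _ ->; apply: connect0.
    by move=> /andP[/h2 hw hp] e; apply: connect_trans hw (IH _ hp e).
  move=> /h hk; apply: connect_trans (h3 z) (connect_trans hk _).
  by rewrite cs; apply: h3.
move=> /connectP[p]; elim: p z => [|w p IH] x /=; first by move=> _ ->; apply: connect0.
by move=> /andP[/h1 hw hp] e; apply: connect_trans hw (IH _ hp e).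
Qed.

End Contract.

Section Segments.

Variables (T U : finType) (f : {perm T}) (g : {perm U}) (cr : U -> T).
Hypothesis cr_inj : injective cr.
Hypothesis first : forall x, exists n, cr (g x) = iter n.+1 f (cr x) /\
  forall i, (i < n)%N -> iter i.+1 f (cr x) \notin codom cr.
Hypothesis meets : forall y, exists x, fconnect f y (cr x).

(** The passage [y] of the larger diagram lies on the edge which leaves [x] in the smaller one. The
    segments partition the larger diagram, and [segments] extracts the map to the smaller one along
    which it is contracted. *)
Definition in_seg (y : T) (x : U) : Prop := exists n, y = iter n f (cr x) /\
  forall i, (i < n)%N -> iter i.+1 f (cr x) \notin codom cr.

Lemma ex_seg y : exists x, in_seg y x.
Proof.
have [x] := meets y; rewrite fconnect_sym; last exact: perm_inj.
move=> /iter_findex <-; elim: (findex _ _ _) => [|m [x' [n [e h]]]].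
  by exists x, 0%N.
case: (boolP (iter m.+1 f (cr x) \in codom cr)) => [/codomP[z ez]|nc].
  by exists z, 0%N; rewrite -ez.
exists x', n.+1; rewrite iterS e; split=> // i; rewrite ltnS leq_eqVlt => /orP[/eqP->|/h//].
by rewrite iterS -e -iterS.
Qed.

Lemma iter_perm_inj n : injective (iter n f).
Proof. by elim: n => // n IH x y /= /perm_inj/IH. Qed.

Lemma seg_uniq y x x' : in_seg y x -> in_seg y x' -> x = x'.
Proof.
have H n n' : iter n f (cr x) = iter n' f (cr x') -> (n <= n')%N ->
    (forall i, (i < n')%N -> iter i.+1 f (cr x') \notin codom cr) -> x = x'.
  move=> e le h; move: e; rewrite -(subnKC le) iterD => /iter_perm_inj.
  case en : (n' - n)%N => [|m] e; first exact: cr_inj.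
  have : iter m.+1 f (cr x') \notin codom cr by apply: h; lia.
  by rewrite -e codom_f.
have H' n n' : iter n f (cr x) = iter n' f (cr x') -> (n' <= n)%N ->
    (forall i, (i < n)%N -> iter i.+1 f (cr x) \notin codom cr) -> x = x'.
  move=> e le h; move: e; rewrite -(subnKC le) iterD => /iter_perm_inj.
  case en : (n - n')%N => [|m] e; first exact: cr_inj.
  have : iter m.+1 f (cr x) \notin codom cr by apply: h; lia.
  by rewrite e codom_f.
move=> [n [-> h]] [n' [e h']]; case: (leqP n n') => le; first exact: H e le h'.
exact: H' e (ltnW le) h.
Qed.

Lemma segments : exists ka : T -> U,
  [/\ cancel cr ka, forall y, y \notin codom cr -> ka y = ka (f^-1%g y),
      forall x, ka (f^-1%g (cr x)) = g^-1%g x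
    & forall y, in_seg y (ka y)].
Proof.
have /fin_all_exists[ka kaP] := ex_seg; exists ka; split=> //.
- by move=> x; apply: seg_uniq (kaP _) _; exists 0%N.
- move=> y ny; apply: seg_uniq (kaP _) _; have [n [e h]] := kaP (f^-1%g y).
  exists n.+1; rewrite iterS -e permKV; split=> // i.
  rewrite ltnS leq_eqVlt => /orP[/eqP->|/h//].
  by rewrite iterS -e permKV.
- move=> x; apply: seg_uniq (kaP _) _; have [n [e h]] := first (g^-1%g x).
  by exists n; rewrite -{1}[x](permKV g) e /= permK.
Qed.

End Segments.

Section Erasure.

Variables (R D : diagram) (e : erasure R D).

Local Notation cr := (carry (on_crossing e) (on_point e)).

Lemma carry_inj : injective cr.
Proof.
move=> [[c s]|p] [[c' s']|p'] //= []; first by move=> /on_crossing_inj-> ->.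
by move=> /on_point_inj->.
Qed.

Lemma ex_on_classical : exists oc : classical R -> classical D,
  forall c, on_crossing e (inl c) = inl (oc c).
Proof.
have h c : exists c', on_crossing e (inl c) = inl c'.
  by have := erasure_kind e (inl c); case: (on_crossing e (inl c)) => // c'; exists c'.
by have [oc hoc] := fin_all_exists h; exists oc.
Qed.

Variable oc : classical R -> classical D.
Hypothesis ocE : forall c, on_crossing e (inl c) = inl (oc c).

Lemma oc_inj : injective oc.
Proof.
move=> c c' E; have E' : on_crossing e (inl c) = on_crossing e (inl c') by rewrite !ocE E.
by have [] := on_crossing_inj E'.
Qed.

Lemma oc_over c : over_strand (oc c) = over_strand c.
Proof. by have := erasure_kind e (inl c); rewrite ocE => -[]. Qed.

Lemma carry_oc c s : cr (inl (inl c, s)) = inl (inl (oc c), s).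
Proof. by rewrite /= ocE. Qed.

Lemma carry_kept (S : {set classical R}) x : kept (oc @: S) (cr x) = kept S x.
Proof.
case: x => [[[c|c] s]|p] //.
  by rewrite carry_oc /= mem_imset //; apply: oc_inj.
by have /= := erasure_kind e (inr c); case: (on_crossing e (inr c)).
Qed.

Lemma kept_codom (S : {set classical R}) y : kept (oc @: S) y -> y \in codom cr.
Proof.
case: y => [[[c|c] s]|p] //= /imsetP[d _ ->].
by rewrite -carry_oc codom_f.
Qed.

Lemma carry_smooth asg asg' h : (forall c, asg' (oc c) = asg c) ->
  smooth asg' (cr h.1, h.2) = (cr (smooth asg h).1, (smooth asg h).2).
Proof.
move=> ea; case: h => [[[[c|c] s]|p] o] //.
  rewrite carry_oc !smoothE ea; case: (asg c) => [b|]; last by rewrite carry_oc.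
  by rewrite carry_oc oc_over.
by have /= := erasure_kind e (inr c); rewrite /smooth /=; case: (on_crossing e (inr c)).
Qed.

Lemma carry_first x : exists n, cr (next_passage R x) = iter n.+1 (next_passage D) (cr x) /\
  forall i, (i < n)%N -> iter i.+1 (next_passage D) (cr x) \notin codom cr.
Proof. by have [n [h1 h2 h3]] := erasure_next e x; exists n. Qed.

Section Virtual.

Variable S : {set classical R}.
Local Notation S' := (oc @: S).

Lemma on_S_oc asg asg' : on_S S asg -> on_S S' asg' ->
  (forall c, c \in S -> asg' (oc c) = asg c) -> forall c, asg' (oc c) = asg c.
Proof.
move=> h h' ea c; case cS: (c \in S); first exact: ea.
have := h c; have := h' (oc c); rewrite mem_imset; last exact: oc_inj.
by rewrite cS; case: (asg c); case: (asg' _).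
Qed.

Lemma smooth_erased asg' w o : on_S S' asg' -> w \notin codom cr -> smooth asg' (w, o) = (w, ~~ o).
Proof.
move=> h; case: w => [[[c|c] s]|p] // nw; rewrite smoothE.
have := h c; case: (asg' c) => // b /esym/= cS.
by case/negP: nw; apply: (@kept_codom S).
Qed.

Lemma seg_Rel asg' z x : on_S S' asg' ->
  in_seg (next_passage D) cr z x -> Rel asg' (cr x) z.
Proof.
move=> h [n [-> hn]]; elim: n hn => [|n IH] hn; first exact: connect0.
apply: connect_trans (IH (fun i hi => hn i (ltnW hi))) _; apply: connect1.
apply/linkP; exists (iter n.+1 (next_passage D) (cr x), false).
by rewrite smooth_erased // ?hn // /edge /= permK.
Qed.

(** Erased crossings are not kept, so every smoothing goes straight through them. An edge of [R]
    thus becomes a segment of [D] lying on a single circle. *)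
Lemma virtual_Rel asg asg' : on_S S asg -> on_S S' asg' ->
  (forall c, c \in S -> asg' (oc c) = asg c) ->
  (forall x x', Rel asg x x' = Rel asg' (cr x) (cr x')) /\
  (forall y, exists x, Rel asg' y (cr x)).
Proof.
move=> h h' /(on_S_oc h h') ea.
have [ka [k1 k2 k3 k4]] := segments carry_inj carry_first (erasure_meets e).
have [_ sy tr] := Rel_eqv asg'.
have cs y o : smooth asg' (cr y, o) = (cr (smooth asg (y, o)).1, (smooth asg (y, o)).2).
  exact: (carry_smooth (y, o) ea).
have ke x o : ka (edge (cr x, o)) = edge (x, o) by rewrite /edge /=; case: o; rewrite ?k1 ?k3.
have ce x o : Rel asg' (cr (edge (x, o))) (edge (cr x, o)).
  by rewrite -ke; apply: (seg_Rel h'); apply: k4.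
split; last by move=> y; exists (ka y); rewrite sy; apply: (seg_Rel h').
move=> x x'; symmetry; apply: (connect_contract (lz := link asg) (ka := ka)).
- exact: link_sym.
- move=> z z' /linkP[[y o] [<- <-]]; apply: (tr _ _ _ (ce _ _)).
  apply: (tr (edge (smooth asg' (cr y, o)))); first exact/connect1/link_dart.
  rewrite cs; case: (smooth asg (y, o)) => y' o' /=.
  by rewrite sy; apply: ce.
- move=> z z' /linkP[[w o] [<- <-]]; case wc: (w \in codom cr).
    move/codomP: wc => [y ->]; rewrite cs ke.
    by case: (smooth asg (y, o)) (link_dart asg (y, o)) => y' o' /connect1; rewrite ke.
  rewrite smooth_erased ?wc // /edge /=.
  by case: o => /=; rewrite (k2 w) ?wc //; apply: connect0.
- by move=> z; rewrite k1; apply: connect0.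
Qed.

Lemma virtual_HI F : HI F S S'.
Proof.
apply: (@HI_same F R S D S' oc oc_inj erefl oc_over (passage R) (fun x => x) cr) => //.
- exact: carry_inj.
- by move=> asg asg' h h' ea z z'; have [-> _] := virtual_Rel h h' ea.
- by move=> asg h x; exists x; apply: connect0.
- move=> asg' h' y.
  pose asg c := if c \in S then asg' (oc c) else None.
  have h : on_S S asg.
    move=> c; rewrite /asg; case: ifP => // cS; rewrite h' imset_f //.
  have ea c : c \in S -> asg' (oc c) = asg c by rewrite /asg => ->.
  by have [_ mt] := virtual_Rel h h' ea; apply: mt.
Qed.

Lemma virtual_flips_down tau : flips S' tau ->
  flips S (tau \o cr) /\ evens S' tau = oc @: evens S (tau \o cr).
Proof.
move=> fl; split.
  have st z x : in_seg (next_passage D) cr z x -> tau z = tau (cr x).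
    move=> [n [-> hn]]; elim: n hn => // n IH hn; rewrite iterS fl IH; last first.
      by move=> i hi; apply: hn; apply: ltnW.
    by case k: (kept _ _); rewrite ?addbF //; move: (hn n (ltnSn n)); rewrite (kept_codom k).
  move=> x; rewrite /= -carry_kept; have [n [-> hn]] := carry_first x.
  by rewrite iterS fl; congr addb; apply: st; exists n.
apply/setP => c; rewrite inE; apply/andP/imsetP.
  move=> [/imsetP[d dS ->] t]; exists d => //.
  by rewrite inE dS /= !ocE.
by move=> [d]; rewrite inE /= !ocE => /andP[dS t] ->; rewrite imset_f.
Qed.

Lemma virtual_flips_up tau : flips S tau -> exists2 tau', flips S' tau' &
  evens S' tau' = oc @: evens S tau.
Proof.
move=> fl; have [ka [k1 k2 k3 k4]] := segments carry_inj carry_first (erasure_meets e).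
exists (tau \o ka).
  move=> y /=; case yc: (next_passage D y \in codom cr).
    move/codomP: yc => [x ex]; have := k3 x; rewrite -ex permK => ->.
    by rewrite ex carry_kept k1 -{1}[x](permKV (next_passage R)) fl permKV.
  rewrite k2 ?yc // permK; case k: (kept _ _); last by rewrite addbF.
  by rewrite (kept_codom k) in yc.
have tk c s : tau (ka (inl (inl (oc c), s))) = tau (inl (inl c, s)) by rewrite -carry_oc k1.
apply/setP => c; rewrite inE; apply/andP/imsetP.
  move=> [/imsetP[d dS ->] t]; exists d => //.
  by rewrite inE dS /= -!tk.
by move=> [d]; rewrite inE /= => /andP[dS t] ->; rewrite imset_f // !tk.
Qed.

End Virtual.

End Erasure.

(** * Tangles inserted into strands *)

Local Close Scope ring_scope.

Section Merging.

Definition merge_link (f : nat -> nat) (l : nat * nat) : nat -> nat :=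
  fun n => if f n == f l.2 then f l.1 else f n.

(** A union-find on numbers: two nodes get the same value iff the listed links connect them. As it
    evaluates, the finitely many patterns inside of a tangle can be compared by computation. *)
Definition merging (ls : seq (nat * nat)) : nat -> nat := foldl merge_link id ls.

Lemma merging_link ls a b : (a, b) \in ls -> merging ls a = merging ls b.
Proof.
rewrite /merging; have keep l f : f a = f b -> foldl merge_link f l a = foldl merge_link f l b.
  elim: l f => //= x l IH f e; apply: IH; by rewrite /merge_link e.
elim: ls id => //= l ls IH f; rewrite inE => /orP[/eqP<-|/IH//].
by apply: keep; rewrite /merge_link /= eqxx; case: ifP.
Qed.

Lemma merging_sound (T : Type) (E : T -> T -> bool) (node : nat -> T) ls :
  (forall x, E x x) -> (forall x y, E x y -> E y x) -> (forall x y z, E x y -> E y z -> E x z) ->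
  (forall a b, (a, b) \in ls -> E (node a) (node b)) ->
  forall a b, merging ls a = merging ls b -> E (node a) (node b).
Proof.
move=> r s t h; rewrite /merging.
suff H f : (forall a b, f a = f b -> E (node a) (node b)) ->
    forall a b, foldl merge_link f ls a = foldl merge_link f ls b -> E (node a) (node b).
  by apply: H => a b /= ->.
elim: ls f h => //= l ls IH f h hf; apply: IH; first by move=> a b ab; apply: (h a b); rewrite inE ab orbT.
have hl : E (node l.1) (node l.2) by apply: h; rewrite inE; case: l => ? ?; rewrite eqxx.
move=> a b; rewrite /merge_link; case: eqP => [ea|_]; case: eqP => [eb|_].
- by move=> _; apply: (t _ _ _ (hf _ _ ea)); apply: s; apply: hf.
- by move=> e; apply: (t _ _ _ (hf _ _ ea)); apply: (t _ _ _ (s _ _ hl)); apply: hf.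
- by move=> e; apply: (t _ _ _ (hf _ _ e)); apply: (t _ _ _ hl); apply: s; apply: hf.
- exact: hf.
Qed.

End Merging.

(* The links made by a crossing whose slots false and true are entered at the
   nodes p0 and p1 and left at the nodes p0.+1 and p1.+1. *)
Definition xlinks (o : bool) (asg : option bool) (p0 p1 : nat) : seq (nat * nat) :=
  match asg with
  | None => [:: (p0, p0.+1); (p1, p1.+1)]
  | Some b => if o == b then [:: (p0, p1.+1); (p1, p0.+1)]
              else [:: (p0, p1); (p0.+1, p1.+1)]
  end.

(** * Separation of a diagram into a tangle and its outside *)

Section Boundary.

Variables (n' : nat) (R : diagram).
Local Notation n := n'.+1.
Variable a : 'I_n -> point R.
Hypothesis a_inj : injective a.

(* The edges outside of the tangle: inr i is the one by which the strand i leaves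
   it, and inl (inr (a i)) the one by which this strand enters it. *)
Definition bZ : finType := (passage R + 'I_n)%type.

Definition outer_edge (h : dart R) : bZ :=
  if h.2 then inl h.1 else
  if [pick i | (next_passage R)^-1%g h.1 == inr (a i)] is Some i then inr i
  else inl ((next_passage R)^-1%g h.1).

(* The three successive edges of the strand i are numbered 3 i, 3 i + 1, 3 i + 2;
   only the middle one is inside of the tangle. *)
Definition bnode (m : nat) : bZ :=
  if m %% 3 == 0 then inl (inr (a (inord (m %/ 3)))) else inr (inord (m %/ 3)).

Definition bnd (m : nat) : bool := (m < 3 * n) && (m %% 3 != 1).

(** [mu] is the connection that the tangle induces between its ends. Hence two tangles inducing the
    same [mu] yield the same circles outside, whatever the rest of the diagram is. *)
Definition blink (asg : classical R -> option bool) (mu : rel nat) : rel bZ := fun z z' =>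
  [exists h, (outer_edge h == z) && (outer_edge (smooth asg h) == z')]
  || [exists m : 'I_(3 * n), exists m' : 'I_(3 * n),
       [&& bnd m, bnd m', mu m m', bnode m == z & bnode m' == z']].

Lemma blinkP asg (mu : rel nat) z z' :
  reflect ((exists h, outer_edge h = z /\ outer_edge (smooth asg h) = z') \/
    (exists m m', [/\ bnd m, bnd m', mu m m', bnode m = z & bnode m' = z']))
   (blink asg mu z z').
Proof.
apply: (iffP orP) => -[].
- by move=> /existsP[h /andP[/eqP e /eqP e']]; left; exists h.
- move=> /existsP[m /existsP[m' /and5P[b b' u /eqP e /eqP e']]].
  by right; exists m, m'.
- by move=> [h [e e']]; left; apply/existsP; exists h; rewrite e e' !eqxx.
- move=> [m [m' [b b' u e e']]]; right.
  have /andP[lm _] := b; have /andP[lm' _] := b'.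
  apply/existsP; exists (Ordinal lm); apply/existsP; exists (Ordinal lm') => /=.
  by rewrite b b' u e e' !eqxx.
Qed.

Lemma blink_sym asg (mu : rel nat) : symmetric mu -> symmetric (blink asg mu).
Proof.
move=> s; have H z z' : blink asg mu z z' -> blink asg mu z' z.
  move=> /blinkP[[h [<- <-]]|[m [m' [b b' u <- <-]]]]; apply/blinkP; [left|right].
    by exists (smooth asg h); rewrite smoothK.
  by exists m', m; rewrite s.
by move=> z z'; apply/idP/idP; apply: H.
Qed.

Lemma divn3 (i : 'I_n) j : j < 3 -> (3 * i + j) %/ 3 = i /\ (3 * i + j) %% 3 = j.
Proof. by move=> lj; split; lia. Qed.

Lemma bnodeE (i : 'I_n) : bnode (3 * i) = inl (inr (a i)) /\ bnode (3 * i + 2) = inr i.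
Proof.
rewrite /bnode; have [] := @divn3 i 2 isT; have [] := @divn3 i 0 isT.
by rewrite addn0 => -> -> -> -> /=; rewrite inord_val.
Qed.

Definition straight : rel nat := fun m m' => m %/ 3 == m' %/ 3.

(** The trivial tangle gives back [R] itself. This identifies the states of a kink or a bigon in
    which the ends are joined as in the diagram before the move. *)
Lemma straight_Rel asg x x' :
  Rel asg x x' = connect (blink asg straight) (inl x) (inl x').
Proof.
symmetry.
pose ka (z : bZ) : passage R := match z with inl x => x | inr i => inr (a i) end.
have ko h : ka (outer_edge h) = edge h.
  rewrite /outer_edge /edge; case: ifP => //= _; case: pickP => [i /eqP-> //|//].
have ss : symmetric (blink asg straight) by apply: blink_sym => m m'; rewrite /straight eq_sym.
have cs := sym_connect_sym ss.
have oe h : connect (blink asg straight) (inl (edge h)) (outer_edge h).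
  rewrite /outer_edge /edge; case: ifP => [_|_]; first exact: connect0.
  case: pickP => [i /eqP->|_]; last exact: connect0.
  apply: connect1; apply/blinkP; right; have [e e'] := bnodeE i.
  exists (3 * i), (3 * i + 2); split=> //; rewrite /bnd /straight; have := ltn_ord i; lia.
apply: (connect_contract (l := blink asg straight) (lz := link asg) (ka := ka)).
- exact: link_sym.
- move=> z z' /linkP[h [<- <-]]; apply: connect_trans (oe h) _.
  apply: connect_trans (_ : connect _ _ (outer_edge (smooth asg h))) _.
    by apply: connect1; apply/blinkP; left; exists h.
  by rewrite cs; apply: oe.
- move=> z z' /blinkP[[h [<- <-]]|[m [m' [b b' u <- <-]]]].
    by rewrite !ko; apply: connect1; apply: link_dart.
  move: u; rewrite /straight /bnode /= => /eqP->.
  by do 2!case: ifP => _ /=; apply: connect0.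
- by move=> z; apply: connect0.
Qed.

Section Insertion.

Variables (D : diagram) (e : erasure R D) (oc : classical R -> classical D).
Hypothesis ocE : forall c, on_crossing e (inl c) = inl (oc c).
Local Notation cr := (carry (on_crossing e) (on_point e)).
Local Notation P x := (inl (inl x.1, x.2) : passage D).

Variable pass : 'I_n -> bool -> classical D * bool.

Record inserted : Prop := Inserted {
  ins1 : forall i, next_passage D (cr (inr (a i))) = P (pass i false);
  ins2 : forall i, next_passage D (P (pass i false)) = P (pass i true);
  ins3 : forall i, next_passage D (P (pass i true)) = cr (next_passage R (inr (a i)));
  ins_cov : forall y, y \notin codom cr -> exists i b, y = P (pass i b);
  ins_nc : forall i b, P (pass i b) \notin codom cr
}.

Hypothesis ins : inserted.

Lemma pass_inj i b j b' : pass i b = pass j b' -> i = j /\ b = b'.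
Proof.
have p1 k : (next_passage D)^-1%g (P (pass k false)) = cr (inr (a k)) by rewrite -(ins1 ins) permK.
have p2 k : (next_passage D)^-1%g (P (pass k true)) = P (pass k false) by rewrite -(ins2 ins) permK.
have nc k l : cr (inr (a k)) <> P (pass l false).
  by move=> E; have := ins_nc ins l false; rewrite -E codom_f.
have ca k l : cr (inr (a k)) = cr (inr (a l)) -> k = l.
  by move=> /carry_inj[] /a_inj.
case: b; case: b' => E; have := congr1 (fun q => (next_passage D)^-1%g (P q)) E => /=; rewrite ?p1 ?p2.
- by move=> /(congr1 (next_passage D)^-1%g); rewrite !p1 => /ca.
- by move=> /esym/nc.
- by move=> /nc.
- by move=> /ca.
Qed.

Lemma P_inj i b j b' : P (pass i b) = P (pass j b') -> i = j /\ b = b'.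
Proof.
move=> E; apply: pass_inj.
by case: (pass i b) (pass j b') E => [c s] [c' s'] /= [-> ->].
Qed.

Lemma next_outer x : (forall i, x <> inr (a i)) -> next_passage D (cr x) = cr (next_passage R x).
Proof.
move=> nx; have [n0 [h1 h2]] := carry_first e x.
case: n0 h1 h2 => [//|n0] _ /(_ 0 isT) /= nc.
have [i [b E]] := ins_cov ins nc; case: b E => E.
  have := congr1 (next_passage D)^-1%g E; rewrite permK -(ins2 ins) permK => E'.
  by have := ins_nc ins i false; rewrite -E' codom_f.
have := congr1 (next_passage D)^-1%g E; rewrite permK -(ins1 ins) permK => /carry_inj E'.
by case: (nx i).
Qed.

Definition outD (z : bZ) : passage D := match z with inl x => cr x | inr i => P (pass i true) end.

Lemma outD_inj : injective outD.
Proof.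
move=> [x|i] [y|j] //=.
- by move=> /carry_inj->.
- by move=> E; have := ins_nc ins j true; rewrite -E codom_f.
- by move=> E; have := ins_nc ins i true; rewrite E codom_f.
- move=> E; have : pass i true = pass j true.
    by case: (pass i true) (pass j true) E => [c s] [c' s'] /= [-> ->].
  by move=> /pass_inj[->].
Qed.

Lemma outD_edge y o : outD (outer_edge (y, o)) = edge (cr y, o).
Proof.
rewrite /outer_edge /edge /=; case: o => //=; case: pickP => [i /eqP E|nE] /=.
  by rewrite -[P _](permK (next_passage D)) (ins3 ins) -E permKV.
rewrite -[LHS](permK (next_passage D)) next_outer ?permKV // => i E.
by have := nE i; rewrite E eqxx.
Qed.

Definition nodeij (i : 'I_n) (j : nat) : passage D :=
  match j with 0 => cr (inr (a i)) | 1 => P (pass i false) | _ => P (pass i true) end.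

Definition node (m : nat) : passage D := nodeij (inord (m %/ 3)) (m %% 3).

Lemma nodeE (i : 'I_n) j : j < 3 -> node (3 * i + j) = nodeij i j.
Proof. by move=> lj; rewrite /node; have [-> ->] := divn3 i lj; rewrite inord_val. Qed.

Lemma node_bnode m : bnd m -> node m = outD (bnode m).
Proof.
rewrite /bnd /node /bnode => /andP[_]; have : m %% 3 < 3 by rewrite ltn_mod.
by case: (m %% 3) => [|[|[|k]]].
Qed.

(** The node by which the passage [q] is entered; its successor is the node by which it is left, as
    [xlinks] expects. *)
Definition code (q : 'I_n * bool) : nat := 3 * q.1 + q.2.

Lemma node_code q : node (code q) = edge (P (pass q.1 q.2), false) /\
  node (code q).+1 = P (pass q.1 q.2).
Proof.
case: q => i b; rewrite /code /= -addnS !nodeE; try by case: b.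
case: b; rewrite /edge /=; first by rewrite -(ins2 ins) permK.
by rewrite -(ins1 ins) permK.
Qed.
Variable xs : seq (classical D * (('I_n * bool) * ('I_n * bool))).
Hypothesis xs_pass : forall x, x \in xs ->
  pass x.2.1.1 x.2.1.2 = (x.1, false) /\ pass x.2.2.1 x.2.2.2 = (x.1, true).
Hypothesis xs_cov : forall q, exists2 x, x \in xs & q = x.2.1 \/ q = x.2.2.

Definition local_links (asg : classical D -> option bool) : seq (nat * nat) :=
  flatten [seq xlinks (over_strand x.1) (asg x.1) (code x.2.1) (code x.2.2) | x <- xs].

Definition cls asg : nat -> nat := merging (local_links asg).

Lemma code_bound q : (code q).+1 < 3 * n.
Proof. by rewrite /code; have := ltn_ord q.1; case: q.2 => /=; lia. Qed.

Lemma local_link asg m m' : (m, m') \in local_links asg -> link asg (node m) (node m').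
Proof.
move=> /flattenP[l /mapP[x xx ->]]; have [h0 h1] := xs_pass xx.
have [a0 b0] := node_code x.2.1; have [a1 b1] := node_code x.2.2.
rewrite h0 /= in a0 b0; rewrite h1 /= in a1 b1.
have L s o := link_dart asg (inl (inl x.1, s), o); move: L => L.
have L1 s o := L s o; rewrite /xlinks; case E: (asg x.1) => [b|].
  case ob: (over_strand x.1 == b); rewrite !inE => /orP[]/eqP[-> ->]; rewrite ?a0 ?a1 ?b0 ?b1.
  - by have := L false false; rewrite smoothE E ob.
  - by have := L true false; rewrite smoothE E ob.
  - by have := L false false; rewrite smoothE E ob.
  - by have := L false true; rewrite smoothE E ob.
rewrite !inE => /orP[]/eqP[-> ->]; rewrite ?a0 ?a1 ?b0 ?b1.
- by have := L false false; rewrite smoothE E.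
- by have := L true false; rewrite smoothE E.
Qed.

Lemma cls_Rel asg m m' : cls asg m = cls asg m' -> Rel asg (node m) (node m').
Proof.
have [r s t] := Rel_eqv asg; apply: merging_sound.
- exact: r.
- by move=> x y; rewrite s.
- by move=> x y z; apply: t.
- by move=> x y /local_link/connect1.
Qed.

Lemma local_dart asg i b o : exists m m',
  [/\ edge (P (pass i b), o) = node m, edge (smooth asg (P (pass i b), o)) = node m',
      m < 3 * n, m' < 3 * n & cls asg m = cls asg m'].
Proof.
have [x xx hq] := xs_cov (i, b); have [h0 h1] := xs_pass xx.
have [a0 b0] := node_code x.2.1; have [a1 b1] := node_code x.2.2.
have l0 := code_bound x.2.1; have l1 := code_bound x.2.2.
have l0' := ltnW l0; have l1' := ltnW l1.
rewrite h0 /= in a0 b0; rewrite h1 /= in a1 b1.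
have K m m' : (m, m') \in xlinks (over_strand x.1) (asg x.1) (code x.2.1) (code x.2.2) ->
    cls asg m = cls asg m'.
  by move=> h; apply: merging_link; apply/flattenP; eexists; last exact: h; apply: map_f xx.
have [s Es] : exists s, pass i b = (x.1, s).
  by case: hq h0 h1 => <- /= h0 h1; [exists false|exists true].
rewrite Es /= smoothE; move: K; rewrite /xlinks; case E: (asg x.1) => [c|] K; last first.
  case: s {Es}; case: o.
  - exists (code x.2.2).+1, (code x.2.2); rewrite a1 b1; split=> //; symmetry; apply: K.
    by rewrite !inE !eqxx !orbT.
  - exists (code x.2.2), (code x.2.2).+1; rewrite a1 b1; split=> //; apply: K.
    by rewrite !inE !eqxx !orbT.
  - exists (code x.2.1).+1, (code x.2.1); rewrite a0 b0; split=> //; symmetry; apply: K.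
    by rewrite !inE !eqxx.
  - exists (code x.2.1), (code x.2.1).+1; rewrite a0 b0; split=> //; apply: K.
    by rewrite !inE !eqxx.
case ob: (over_strand x.1 == c) K => K; case: s {Es}; case: o => /=.
- exists (code x.2.2).+1, (code x.2.1); rewrite a0 b1; split=> //; symmetry; apply: K.
  by rewrite !inE !eqxx.
- exists (code x.2.2), (code x.2.1).+1; rewrite a1 b0; split=> //; apply: K.
  by rewrite !inE !eqxx !orbT.
- exists (code x.2.1).+1, (code x.2.2); rewrite a1 b0; split=> //; symmetry; apply: K.
  by rewrite !inE !eqxx !orbT.
- exists (code x.2.1), (code x.2.2).+1; rewrite a0 b1; split=> //; apply: K.
  by rewrite !inE !eqxx.
- exists (code x.2.2).+1, (code x.2.1).+1; rewrite b0 b1; split=> //; symmetry; apply: K.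
  by rewrite !inE !eqxx !orbT.
- exists (code x.2.2), (code x.2.1); rewrite a0 a1; split=> //; symmetry; apply: K.
  by rewrite !inE !eqxx.
- exists (code x.2.1).+1, (code x.2.2).+1; rewrite b0 b1; split=> //; apply: K.
  by rewrite !inE !eqxx !orbT.
- exists (code x.2.1), (code x.2.2); rewrite a0 a1; split=> //; apply: K.
  by rewrite !inE !eqxx.
Qed.

Section Contraction.

Variables (asgR : classical R -> option bool) (asgD : classical D -> option bool).
Hypothesis asgE : forall c, asgD (oc c) = asgR c.
Local Notation f := (cls asgD).
Local Notation bl := (blink asgR (fun m m' => f m == f m')).

Lemma bl_sym : symmetric bl.
Proof. by apply: blink_sym => m m'; rewrite eq_sym. Qed.

Variable l : 'I_n.
Local Notation ml := (3 * l + 1).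

Definition attaching : bool := [exists m : 'I_(3 * n), bnd m && (f m == f ml)].

Lemma attachingP : reflect (exists2 m, bnd m & f m = f ml) attaching.
Proof.
apply: (iffP existsP) => [[m /andP[b /eqP e1]]|[m b e1]]; first by exists m.
by have /andP[lm _] := b; exists (Ordinal lm); rewrite /= b e1 eqxx.
Qed.

Hypothesis inner : forall i : 'I_n,
  (exists2 m, bnd m & f m = f (3 * i + 1)) \/ (~~ attaching /\ f (3 * i + 1) = f ml).

Definition obl : rel (option bZ) := fun z z' =>
  match z, z' with
  | Some z, Some z' => bl z z'
  | None, None => false
  | Some z, None | None, Some z => [exists m : 'I_(3 * n), [&& bnd m, f m == f ml & bnode m == z]]
  end.

Lemma obl_sym : symmetric obl.
Proof. by move=> [z|] [z'|] //=; apply: bl_sym. Qed.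

Lemma bl_cls m m' : bnd m -> bnd m' -> f m = f m' -> bl (bnode m) (bnode m').
Proof. by move=> b b' e1; apply/blinkP; right; exists m, m'; split=> //; apply/eqP. Qed.

Lemma obl_Some z z' : connect obl (Some z) (Some z') = connect bl z z'.
Proof.
(* The extra vertex is contracted to an end of its class if there is one. Otherwise it is isolated
   and any value serves. *)
have [z0 hz0] : exists z0, forall m, bnd m -> f m = f ml -> connect bl z0 (bnode m).
  case: (boolP attaching) => [/attachingP[m b e1]|/attachingP na].
    by exists (bnode m) => m' b' e2; apply/connect1/bl_cls; rewrite // e1.
  by exists (inr ord0) => m b e1; case: na; exists m.
have cs := sym_connect_sym bl_sym.
apply: (connect_contract (l := obl) (lz := bl) (io := Some) (ka := fun z => if z is Some z then z else z0)).
- exact: bl_sym.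
- by move=> x y xy; apply: connect1.
- move=> [x|] [y|] //=; first exact: connect1.
    by move=> /existsP[m /and3P[b /eqP e1 /eqP<-]]; rewrite cs; apply: hz0.
  by move=> /existsP[m /and3P[b /eqP e1 /eqP<-]]; apply: hz0.
- by move=> x; apply: connect0.
Qed.

Lemma obl_None z : ~~ attaching -> connect obl None (Some z) = false.
Proof.
move=> /existsP na; apply/negP => /connectP[[|[y|] p]] //=.
move=> /andP[/existsP[m /and3P[b b' _]] _ _]; case: na; exists m.
by rewrite b.
Qed.

Definition oout (z : option bZ) : passage D := if z is Some z then outD z else node ml.

Lemma ex_pull y : exists k : option bZ, (forall z, y = outD z -> k = Some z) /\
  forall i, y = P (pass i false) ->
    (exists m, [/\ bnd m, f m = f (3 * i + 1) & k = Some (bnode m)]) \/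
    [/\ ~~ attaching, f (3 * i + 1) = f ml & k = None].
Proof.
case: (boolP (y \in codom outD)) => [/codomP[z ->]|ny].
  exists (Some z); split=> [z' /outD_inj->//|i].
  case: z => [x|j] /= E; first by have := ins_nc ins i false; rewrite -E codom_f.
  by have [] := P_inj E.
have nz z : y <> outD z by move=> E; move: ny; rewrite E codom_f.
have [|i [b E]] := ins_cov ins (y := y).
  by apply/negP => /codomP[x E]; apply: (nz (inl x)).
case: b E => E; first by case: (nz (inr i)).
case: (inner i) => [[m b em]|[na em]].
  exists (Some (bnode m)); split=> [z /nz//|j]; rewrite E => /P_inj[<- _].
  by left; exists m.
exists None; split=> [z /nz//|j]; rewrite E => /P_inj[<- _].
by right.
Qed.

(** Each inner edge is contracted to an end of the tangle in its local class. The hypothesis [inner]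
    allows one class to reach no end: this is the small circle, kept as the vertex [None] of
    [obl]. *)
Lemma cls_out :
  [/\ forall z z', Rel asgD (outD z) (outD z') = connect bl z z',
      forall y, (exists z, Rel asgD y (outD z)) \/ Rel asgD y (node ml)
    & ~~ attaching -> forall z, ~~ Rel asgD (node ml) (outD z)].
Proof.
have /fin_all_exists[ka kaP] := ex_pull.
have kao z : ka (outD z) = Some z by have [h _] := kaP (outD z); apply: h.
have kan m : m < 3 * n -> (exists m', [/\ bnd m', f m' = f m & ka (node m) = Some (bnode m')]) \/
    [/\ ~~ attaching, f m = f ml & ka (node m) = None].
  move=> lm; case: (boolP (bnd m)) => [b|].
    by left; exists m; split=> //; rewrite node_bnode // kao.
  rewrite /bnd lm negbK => /eqP m1.
  have lq : m %/ 3 < n by lia.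
  have em : m = 3 * Ordinal lq + 1 by rewrite /=; lia.
  rewrite em; have [_] := kaP (node (3 * Ordinal lq + 1)).
  by apply; rewrite nodeE.
have M : forall z z', Rel asgD (oout z) (oout z') = connect obl z z'.
  apply: (connect_contract (l := link asgD) (lz := obl) (io := oout) (ka := ka)).
  - exact: obl_sym.
  - have H z m : bnd m -> f m = f ml -> bnode m = z -> Rel asgD (node ml) (outD z).
      by move=> b em <-; rewrite -node_bnode //; apply: cls_Rel.
    move=> [z|] [z'|] //=.
    + move=> /blinkP[[h [<- <-]]|[m [m' [b b' /eqP u <- <-]]]].
        case: h => y o; rewrite outD_edge; have := carry_smooth ocE (y, o) asgE.
        case: (smooth asgR (y, o)) => y' o' /= E; rewrite outD_edge -E.
        exact/connect1/link_dart.
      by rewrite -!node_bnode //; apply: cls_Rel.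
    + move=> /existsP[m /and3P[b /eqP em /eqP ez]].
      by rewrite (sym_connect_sym (link_sym asgD)); apply: H b em ez.
    + by move=> /existsP[m /and3P[b /eqP em /eqP ez]]; apply: H b em ez.
  - move=> x x' /linkP[[w o] [<- <-]]; case: (boolP (w \in codom cr)) => wc.
      move/codomP: wc => [y ->]; rewrite (carry_smooth ocE (y, o) asgE) -outD_edge kao.
      case E: (smooth asgR (y, o)) => [y' o']; rewrite /= -outD_edge kao.
      by apply/connect1/blinkP; left; exists (y, o); rewrite E.
    have [i [b ->]] := ins_cov ins wc.
    have [m [m' [-> -> lm lm' em]]] := local_dart asgD i b o.
    have [[m1 [b1 e1 ->]]|[na1 e1 ->]] := kan _ lm; have [[m2 [b2 e2 ->]]|[na2 e2 ->]] := kan _ lm'.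
    + by apply/connect1/bl_cls; rewrite // e1 em.
    + by case/attachingP: na2; exists m1; rewrite // e1 em.
    + by case/attachingP: na1; exists m2; rewrite // e2 -em.
    + exact: connect0.
  - move=> [z|]; first by rewrite kao; apply: connect0.
    have lm : ml < 3 * n by have := ltn_ord l; lia.
    have [[m [b e1 ->]]|[na e1 ->]] := kan _ lm; last exact: connect0.
    have /andP[lm' _] := b.
    by apply: connect1; apply/existsP; exists (Ordinal lm'); rewrite /= b e1 !eqxx.
split.
- by move=> z z'; rewrite -obl_Some -M.
- have ro : forall z : option bZ, (exists z1, Rel asgD (oout z) (outD z1)) \/ Rel asgD (oout z) (node ml).
    by move=> [z|]; [left; exists z|right]; apply: connect0.
  move=> y; case: (boolP (y \in codom cr)) => [/codomP[x ->]|/(ins_cov ins)[i [b ->]]].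
    by left; exists (inl x); apply: connect0.
  case: b; first by left; exists (inr i); apply: connect0.
  have -> : P (pass i false) = node (3 * i + 1) by rewrite nodeE.
  case: (inner i) => [[m bm em]|[_ em]]; last by right; apply: cls_Rel.
  by left; exists (bnode m); rewrite -node_bnode //; apply: cls_Rel.
- by move=> na z; rewrite -[outD z]/(oout (Some z)) -[node ml]/(oout None) M obl_None.
Qed.

End Contraction.

End Insertion.

End Boundary.

Section Tangle.

Variables (n' : nat) (R D : diagram) (e : erasure R D) (oc : classical R -> classical D).
Local Notation n := n'.+1.
Hypothesis ocE : forall c, on_crossing e (inl c) = inl (oc c).
Local Notation cr := (carry (on_crossing e) (on_point e)).
Local Notation P x := (inl (inl x.1, x.2) : passage D).
Variables (a b : 'I_n -> point R) (pass : 'I_n -> bool -> classical D * bool).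
Variable xs : seq (classical D * (('I_n * bool) * ('I_n * bool))).

(** Every strand passes exactly two crossings. [xs] records for each crossing the passages, given by
    a strand and its first or second passage, that occupy the slots [false] and [true]. *)
Record tangle : Prop := Tangle {
  t_in : forall i, next_passage D (inr (e (a i))) = P (pass i false);
  t_mid : forall i, next_passage D (P (pass i false)) = P (pass i true);
  t_out : forall i, next_passage D (P (pass i true)) = inr (e (b i));
  t_pass : forall x, x \in xs ->
    pass x.2.1.1 x.2.1.2 = (x.1, false) /\ pass x.2.2.1 x.2.2.2 = (x.1, true);
  t_cov : forall q, exists2 x, x \in xs & q = x.2.1 \/ q = x.2.2;
  t_uniq : uniq (unzip1 xs);
  t_points : erased_points e = set0;
  t_crossings : forall c, (c \in erased_crossings e) = (c \in [seq inl x.1 | x <- xs])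
}.

Hypothesis tg : tangle.

Lemma tangle_pass_inj i j c c' : pass i c = pass j c' -> i = j /\ c = c'.
Proof.
have [x xx hx] := t_cov tg (i, c); have [y yy hy] := t_cov tg (j, c') => E.
have [x0 x1] := t_pass tg xx; have [y0 y1] := t_pass tg yy.
have xy : x.1 = y.1 -> x = y.
  elim: (xs) (t_uniq tg) xx yy {x0 x1 y0 y1 hx hy} => //= z s IH /andP[nz us].
  rewrite !inE => /orP[/eqP->|xs'] /orP[/eqP->|ys'] // E'; last exact: IH.
  - by case/negP: nz; rewrite E'; apply: (map_f fst).
  - by case/negP: nz; rewrite -E'; apply: (map_f fst).
have K : (i, c) = (j, c') -> i = j /\ c = c' by move=> [-> ->].
case: hx => hx; case: hy => hy; move: x0 x1 y0 y1; rewrite -hx -hy /= => x0 x1 y0 y1.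
- by move: E; rewrite x0 y0 => -[/xy E]; apply: K; rewrite hx hy E.
- by move: E; rewrite x0 y1.
- by move: E; rewrite x1 y0.
- by move: E; rewrite x1 y1 => -[/xy E]; apply: K; rewrite hx hy E.
Qed.

Lemma tangle_inj : injective a.
Proof.
move=> i j E; have : P (pass i false) = P (pass j false) by rewrite -!(t_in tg) E.
move=> E'; have [] // : i = j /\ false = false.
apply: tangle_pass_inj; by case: (pass i false) (pass j false) E' => [c s] [c' s'] /= [-> ->].
Qed.

Definition in_tangle (c : classical D) : bool := c \in unzip1 xs.

Lemma in_tangleE c : in_tangle c = (inl c \in erased_crossings e).
Proof.
rewrite (t_crossings tg); apply/mapP/mapP => -[x xx E]; exists x => //; first by rewrite E.
by case: E.
Qed.

Lemma in_tangle_oc c : in_tangle (oc c) = false.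
Proof. by rewrite in_tangleE inE -ocE codom_f. Qed.

Lemma not_in_tangle c : ~~ in_tangle c -> exists d, c = oc d.
Proof.
rewrite in_tangleE inE negbK => /codomP[[d|d] E]; first by exists d; move: E; rewrite ocE => -[].
by have /= := erasure_kind e (inr d); rewrite -E.
Qed.

Lemma in_tangle_codom c s : in_tangle c -> inl (inl c, s) \notin codom cr.
Proof.
rewrite in_tangleE inE => nc; apply/negP => /codomP[[[d s']|p]] //= [E _].
by case/negP: nc; rewrite E codom_f.
Qed.

Lemma pass_in_tangle i c : in_tangle (pass i c).1.
Proof.
have [x xx] := t_cov tg (i, c); have [x0 x1] := t_pass tg xx.
by case=> h; move: x0 x1; rewrite -h /= => x0 x1; rewrite ?x0 ?x1; apply: (map_f fst).
Qed.

Lemma ex_pass c s : in_tangle c -> exists i d, (c, s) = pass i d.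
Proof.
move=> /mapP[x xx ->]; have [x0 x1] := t_pass tg xx.
by case: s; [rewrite -x1|rewrite -x0]; eexists; eexists.
Qed.

Lemma tangle_next i : next_passage R (inr (a i)) = inr (b i).
Proof.
have nc j d : P (pass j d) \notin codom cr by apply/in_tangle_codom/pass_in_tangle.
have [m [E h]] := carry_first e (inr (a i)); apply: (@carry_inj _ _ e) => /=.
have i1 : iter 1 (next_passage D) (cr (inr (a i))) = P (pass i false) by apply: (t_in tg).
have i2 : iter 2 (next_passage D) (cr (inr (a i))) = P (pass i true) by rewrite -(t_mid tg) -i1.
have i3 : iter 3 (next_passage D) (cr (inr (a i))) = cr (inr (b i)) by rewrite /= -(t_out tg) -i2.
case: m E h => [|[|[|m]]] E h.
- by have := nc i false; rewrite -i1 -E codom_f.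
- by have := nc i true; rewrite -i2 -E codom_f.
- by rewrite E i3.
- by have := h 2 isT; rewrite i3 codom_f.
Qed.

Lemma tangle_inserted : inserted a e pass.
Proof.
split.
- exact: (t_in tg).
- exact: (t_mid tg).
- by move=> i; rewrite tangle_next; apply: (t_out tg).
- case=> [[[c|c] s]|p] ny.
  + have ic : in_tangle c.
      rewrite in_tangleE inE; apply/negP => /codomP[d E].
      by case/negP: ny; apply/codomP; exists (inl (d, s)); rewrite /= E.
    by have [i [d E]] := ex_pass s ic; exists i, d; rewrite -E.
  + have : inr c \in erased_crossings e.
      rewrite inE; apply/negP => /codomP[d E].
      by case/negP: ny; apply/codomP; exists (inl (d, s)); rewrite /= E.
    by rewrite (t_crossings tg) => /mapP[].
  + case/negP: ny; have : p \notin erased_points e by rewrite (t_points tg) inE.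
    by rewrite inE negbK => /codomP[q ->]; apply/codomP; exists (inr q).
- by move=> i d; apply/in_tangle_codom/pass_in_tangle.
Qed.

Section Parity.

Variables (S : {set classical R}) (T : {set classical D}).
Hypothesis sT : forall c, c \in T -> in_tangle c.
Local Notation S' := (oc @: S :|: T).

Definition strand_flip (i : 'I_n) : bool := ((pass i false).1 \in T) (+) ((pass i true).1 \in T).

(* The strands appear in R as single edges, which flip when an odd number of the
   passages of the strand are kept. *)
Definition twisted (tau : passage R -> bool) : Prop := forall x,
  tau (next_passage R x) =
  tau x (+) kept S (next_passage R x) (+) [exists i, (x == inr (a i)) && strand_flip i].

Lemma mem_oc_tangle c : (oc c \in S') = (c \in S).
Proof.
rewrite inE mem_imset; last exact: (oc_inj ocE).
case h: (oc c \in T); last by rewrite orbF.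
by have := sT h; rewrite in_tangle_oc.
Qed.

Lemma mem_tangle c : in_tangle c -> (c \in S') = (c \in T).
Proof.
move=> ic; rewrite inE; case h: (c \in oc @: S) => //.
by move/imsetP: h ic => [d _ ->]; rewrite in_tangle_oc.
Qed.

Lemma kept_cr x : kept S' (cr x) = kept S x.
Proof.
case: x => [[[c|c] s]|p] //; first by rewrite (carry_oc ocE) /= mem_oc_tangle.
by have /= := erasure_kind e (inr c); case: (on_crossing e (inr c)).
Qed.

Lemma kept_pass i c : kept S' (P (pass i c)) = ((pass i c).1 \in T).
Proof. exact/mem_tangle/pass_in_tangle. Qed.

Lemma flips_pass tau i : flips S' tau ->
  tau (P (pass i false)) = tau (inr (e (a i))) (+) ((pass i false).1 \in T) /\
  tau (P (pass i true)) = tau (inr (e (a i))) (+) strand_flip i.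
Proof.
move=> fl; have h1 := fl (inr (e (a i))); rewrite (t_in tg) kept_pass in h1.
have h2 := fl (P (pass i false)); rewrite (t_mid tg) kept_pass in h2.
by rewrite h2 h1 -addbA.
Qed.

Lemma flips_down tau : flips S' tau -> twisted (tau \o cr).
Proof.
move=> fl x /=; case: existsP => [[i /andP[/eqP-> K]]|nK].
  have := fl (P (pass i true)); rewrite (t_out tg) tangle_next /= (flips_pass i fl).2 K => ->.
  by rewrite ?addbT ?addbF.
rewrite addbF; case: (altP (@existsP _ (fun i => x == inr (a i)))) => [[i /eqP E]|/existsP nx].
  have := fl (P (pass i true)); rewrite E (t_out tg) tangle_next /= (flips_pass i fl).2 => ->.
  case K: (strand_flip i); last by rewrite !addbF.
  by case: nK; exists i; rewrite E eqxx.
rewrite -(next_outer tangle_inserted); last by move=> i E; case: nx; exists i; apply/eqP.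
rewrite fl (next_outer tangle_inserted) ?kept_cr // => i E; case: nx; exists i; exact/eqP.
Qed.

(** Inside of a strand the colours are forced by the one at its entrance; [twisted] says precisely
    that the strand then leaves with the colour prescribed outside. *)
Lemma flips_up tau : twisted tau -> exists2 tau', flips S' tau' & forall x, tau' (cr x) = tau x.
Proof.
move=> tw.
have ex y : exists t, (forall x, y = cr x -> t = tau x) /\ forall i c, y = P (pass i c) ->
    t = tau (inr (a i)) (+) ((pass i false).1 \in T) (+) (c && ((pass i true).1 \in T)).
  case: (boolP (y \in codom cr)) => [/codomP[x ->]|ny].
    exists (tau x); split=> [x' /carry_inj->//|i c E].
    by have := ins_nc tangle_inserted i c; rewrite -E codom_f.
  have [i [c E]] := ins_cov tangle_inserted ny.
  exists (tau (inr (a i)) (+) ((pass i false).1 \in T) (+) (c && ((pass i true).1 \in T))).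
  split=> [x E'|j d]; first by rewrite E' codom_f in ny.
  by rewrite E => /(P_inj tangle_inj tangle_inserted)[-> ->].
have [tau' h] := fin_all_exists ex.
have h1 x : tau' (cr x) = tau x by have [h1 _] := h (cr x); apply: h1.
have h2 i c : tau' (P (pass i c)) =
    tau (inr (a i)) (+) ((pass i false).1 \in T) (+) (c && ((pass i true).1 \in T)).
  by have [_ h2] := h (P (pass i c)); apply: h2.
exists tau' => // y; case: (boolP (y \in codom cr)) => [/codomP[x ->]|ny].
  case: (altP (@existsP _ (fun i => x == inr (a i)))) => [[i /eqP->]|/existsP nx].
    by rewrite /= (t_in tg) kept_pass h2 addbF; have /= -> := h1 (inr (a i)).
  rewrite (next_outer tangle_inserted); last by move=> i E; case: nx; exists i; apply/eqP.
  rewrite !h1 tw kept_cr; case: existsP => [[i /andP[E _]]|]; last by rewrite addbF.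
  by case: nx; exists i.
have [i [c ->]] := ins_cov tangle_inserted ny; case: c.
  have := h1 (inr (b i)); rewrite (t_out tg) /= => ->; rewrite -tangle_next tw tangle_next h2 /=.
  have -> : [exists j, (inr (a i) == inr (a j) :> passage R) && strand_flip j] = strand_flip i.
    apply/existsP/idP => [[j /andP[/eqP[/tangle_inj->]]]//|K].
    by exists i; rewrite eqxx.
  by rewrite !addbF -addbA.
by rewrite (t_mid tg) !h2 kept_pass addbF.
Qed.

Lemma evens_tangle tau : evens S' tau = oc @: evens S (tau \o cr) :|: evens T tau.
Proof.
apply/setP => c; rewrite !inE; case: (boolP (in_tangle c)) => ic.
  case: imsetP => [[d _ E]|_]; first by rewrite E in_tangle_oc in ic.
  case: imsetP => [[d _ E]|_] //; by rewrite E in_tangle_oc in ic.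
have [d E] := not_in_tangle ic; have -> : c \in T = false by apply/negP => /sT; apply/negP.
rewrite E !mem_imset ?orbF; try exact: (oc_inj ocE).
by rewrite inE /= !ocE.
Qed.

End Parity.

End Tangle.

Section Pull.

Variables (F : fieldType) (D : diagram) (S : {set classical D}).
Variables (J Z : finType) (h : J -> classical D) (io : Z -> passage D).
Hypotheses (h_inj : injective h) (hS : forall c, (c \in S) = (c \in codom h)) (io_inj : injective io).
Hypothesis meets : forall asg, on_S S asg -> forall x, exists z, Rel asg x (io z).

Lemma pull_cube (V : vcube F {c | c \in S} (passage D)) (rk : {c | c \in S} -> nat) : realizes V -> injective rk ->
  exists2 W : vcube F J Z,
    forall (st : {ffun J -> bool}) asg, on_S S asg -> (forall j, asg (h j) = Some (st j)) ->
      forall z z', W st z z' = Rel asg (io z) (io z')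
  & forall rk' : J -> nat, injective rk' -> Hiso 0 0 (cube V rk) (cube W rk').
Proof.
move=> hV i.
have hS' j : h j \in S by rewrite hS codom_f.
pose h' j : {c | c \in S} := Sub (h j) (hS' j).
have hb : bijective h'.
  apply: inj_card_bij => [j j' /(congr1 val) /= /h_inj//|].
  rewrite card_sig -(card_codom h_inj); apply: subset_leq_card.
  by apply/subsetP => c; rewrite !inE hS.
have [g hK gK] := hb.
have mt st x : exists z, V st x (io z) by rewrite hV; apply/meets/asg_of_on.
pose Q (st : {ffun J -> bool}) z z' := V (spull g st) (io z) (io z').
have [W hW] := vpull (Q := Q) hK gK io_inj (fun _ _ _ => erefl) mt.
exists W.
  move=> st asg ha hj z z'; rewrite hW /Q hV.
  have E : asg_of (spull g st) =1 asg.
    move=> c; case cS: (c \in S); last first.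
      rewrite asg_ofN ?cS //; have := ha c; rewrite cS.
      by case: (asg c).
    rewrite -[c]/(val (Sub c cS : {c | c \in S})) asg_ofE ffunE -hj.
    by rewrite -[h _]/(val (h' _)) gK.
  by apply: eq_connect => x y; apply/linkP/linkP => -[d [<- <-]]; exists d;
    rewrite /smooth; case: d => [[[[c|c] s]|p] o] //=; rewrite ?E.
move=> rk' i'; apply: ciso_Hiso; apply: (cube_equiv hK gK io_inj _ mt i i').
by move=> st z z'; rewrite hW.
Qed.

End Pull.

(** * Decidable conditions on the patterns inside of a tangle *)

Section Tables.

Variable n' : nat.
Local Notation n := n'.+1.

Definition bnds : seq nat := [seq m <- iota 0 (3 * n) | m %% 3 != 1].
Definition touches (f : nat -> nat) (m : nat) : bool := has (fun m' => f m' == f m) bnds.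
Definition inner_ok (f : nat -> nat) (l : nat) : bool :=
  all (fun i => touches f (3 * i + 1) || (~~ touches f l) && (f (3 * i + 1) == f l)) (iota 0 n).
Definition same_bnd (f g : nat -> nat) : bool :=
  all (fun m => all (fun m' => (f m == f m') == (g m == g m')) bnds) bnds.

Lemma mem_bnds m : (m \in bnds) = bnd n' m.
Proof. by rewrite mem_filter mem_iota add0n andbC. Qed.

Lemma touchesP f m : reflect (exists2 m', bnd n' m' & f m' = f m) (touches f m).
Proof.
apply: (iffP hasP) => -[m']; first by rewrite mem_bnds => b /eqP; exists m'.
by move=> b e; exists m'; rewrite ?mem_bnds // e.
Qed.

Lemma same_bnd_blink (R : diagram) (a : 'I_n -> point R) asg f g : same_bnd f g ->
  connect (blink a asg (fun m m' => f m == f m')) =2 connect (blink a asg (fun m m' => g m == g m')).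
Proof.
move=> /allP h; apply: eq_connect => z z'.
apply/blinkP/blinkP => -[|[m [m' [b b' u e e']]]]; try (by left); right; exists m, m'; split=> //.
  by move: b b'; rewrite -!mem_bnds => /h/allP h' /h'/eqP <-.
by move: b b'; rewrite -!mem_bnds => /h/allP h' /h'/eqP ->.
Qed.

End Tables.

Section TangleOut.

Variables (n' : nat) (R D : diagram) (e : erasure R D) (oc : classical R -> classical D).
Local Notation n := n'.+1.
Hypothesis ocE : forall c, on_crossing e (inl c) = inl (oc c).
Variables (a b : 'I_n -> point R) (pass : 'I_n -> bool -> classical D * bool).
Variable xs : seq (classical D * (('I_n * bool) * ('I_n * bool))).
Hypothesis tg : tangle e a b pass xs.
Variables (asgR : classical R -> option bool) (asgD : classical D -> option bool).
Hypothesis asgE : forall c, asgD (oc c) = asgR c.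
Variables (f : nat -> nat) (l : 'I_n).
Hypotheses (clsE : cls xs asgD = f) (inner : inner_ok n' f (3 * l + 1)).

Lemma tangle_out :
  [/\ forall z z', Rel asgD (outD e pass z) (outD e pass z') =
        connect (blink a asgR (fun m m' => f m == f m')) z z',
      forall y, (exists z, Rel asgD y (outD e pass z)) \/ Rel asgD y (node a e pass (3 * l + 1)),
      ~~ touches n' f (3 * l + 1) ->
        forall z, ~~ Rel asgD (node a e pass (3 * l + 1)) (outD e pass z)
    & forall m, bnd n' m -> f m = f (3 * l + 1) ->
        Rel asgD (node a e pass (3 * l + 1)) (outD e pass (bnode a m))].
Proof.
have ti := tangle_inserted tg; have ai := tangle_inj tg.
have inn (i : 'I_n) : (exists2 m, bnd n' m & cls xs asgD m = cls xs asgD (3 * i + 1)) \/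
    ~~ attaching xs asgD l /\ cls xs asgD (3 * i + 1) = cls xs asgD (3 * l + 1).
  move/allP: inner => /(_ (val i)); rewrite mem_iota add0n clsE => /(_ (ltn_ord i)).
  case/orP => [/touchesP|/andP[nt /eqP]]; first by left.
  right; split=> //; apply/negP => /attachingP[m bm em].
  by case/touchesP: nt; exists m; rewrite // -clsE.
have [h1 h2 h3] := cls_out ai ocE ti (t_pass tg) (t_cov tg) asgE inn.
split=> //.
- by move=> z z'; rewrite h1 clsE.
- move=> /touchesP nt z; apply: h3; apply/negP => /attachingP[m bm em].
  by case: nt; exists m; rewrite // -clsE.
- move=> m bm em; rewrite -(node_bnode a e pass bm).
  by apply: (cls_Rel ti (t_pass tg)); rewrite clsE.
Qed.

End TangleOut.

Definition at_slot (T : Type) (s : bool) (x y : T) : T * T := if s then (y, x) else (x, y).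

Definition strands2 (T : Type) (x y : T) (i : 'I_2) : T := if val i is 0 then x else y.
Definition strands3 (T : Type) (x y z : T) (i : 'I_3) : T :=
  match val i with 0 => x | 1 => y | _ => z end.

Definition i20 : 'I_2 := @Ordinal 2 0 isT.
Definition i21 : 'I_2 := @Ordinal 2 1 isT.
Definition i30 : 'I_3 := @Ordinal 3 0 isT.
Definition i31 : 'I_3 := @Ordinal 3 1 isT.
Definition i32 : 'I_3 := @Ordinal 3 2 isT.

Lemma ord2P (i : 'I_2) : i = i20 \/ i = i21.
Proof. by case: i => [[|[|//]] h]; [left|right]; apply: val_inj. Qed.

Lemma ord3P (i : 'I_3) : [\/ i = i30, i = i31 | i = i32].
Proof. by case: i => [[|[|[|//]]] h]; [apply: Or31|apply: Or32|apply: Or33]; apply: val_inj. Qed.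

Lemma strandP (D : diagram) (p q : point D) x y : strand p [:: x; y] q ->
  [/\ next_passage D (inr p) = inl x, next_passage D (inl x) = inl y
    & next_passage D (inl y) = inr q].
Proof. by move=> /= /and4P[/eqP-> /eqP-> /eqP-> _]. Qed.

Section Kink.

Variables (R D : diagram) (e : erasure R D) (a b : point R) (c : classical D) (s : bool).

Definition kink_pass (i : 'I_1) (d : bool) : classical D * bool := (c, s (+) d).
Definition kink_xs : seq (classical D * (('I_1 * bool) * ('I_1 * bool))) :=
  [:: (c, at_slot s (ord0, false) (ord0, true))].

Lemma kink_tangle :
  strand (e a) [:: (inl c, s); (inl c, ~~ s)] (e b) ->
  erased_points e = set0 -> erased_crossings e = [set inl c] ->
  tangle e (fun=> a) (fun=> b) kink_pass kink_xs.
Proof.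
move=> /strandP[h1 h2 h3] ep ec.
split=> //.
- by move=> i; rewrite /= addbF.
- by move=> i; rewrite /= addbF addbT.
- by move=> i; rewrite /= addbT.
- by move=> x; rewrite inE => /eqP->; rewrite /kink_pass; case: (s).
- move=> [i d]; rewrite (ord1 i); eexists; first exact: mem_head.
  by rewrite /=; case: (s); case: d; [left|right|right|left].
- by move=> x; rewrite ec !inE.
Qed.

End Kink.

Section Bigon.

Variables (R D : diagram) (e : erasure R D) (a1 b1 a2 b2 : point R) (c d : classical D) (s par : bool).

Definition bigon_pass : 'I_2 -> bool -> classical D * bool :=
  strands2 (fun k => if k then (d, ~~ s) else (c, s))
           (fun k => if k == par then (d, s) else (c, ~~ s)).
Definition bigon_xs : seq (classical D * (('I_2 * bool) * ('I_2 * bool))) :=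
  [:: (c, at_slot s (i20, false) (i21, ~~ par)); (d, at_slot (~~ s) (i20, true) (i21, par))].

Lemma bigon_tangle :
  let t2 := [:: (inl c, ~~ s); (inl d, s)] in
  strand (e a1) [:: (inl c, s); (inl d, ~~ s)] (e b1) ->
  strand (e a2) (if par then t2 else rev t2) (e b2) ->
  c != d ->
  erased_points e = set0 -> erased_crossings e = [set inl c; inl d] ->
  tangle e (strands2 a1 a2) (strands2 b1 b2) bigon_pass bigon_xs.
Proof.
move=> t2 /strandP[h1 h2 h3].
have -> : (if par then t2 else rev t2) = if par then t2 else [:: (inl d, s); (inl c, ~~ s)] by [].
move=> h4 cd ep ec.
have [k1 k2 k3] : [/\ next_passage D (inr (e a2)) = inl (if par then (inl c, ~~ s) else (inl d, s)),
   next_passage D (inl (if par then (inl c, ~~ s) else (inl d, s))) =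
     inl (if par then (inl d, s) else (inl c, ~~ s))
   & next_passage D (inl (if par then (inl d, s) else (inl c, ~~ s))) = inr (e b2)].
  by case: (par) h4 => /strandP.
split=> //.
- by move=> i; case: (ord2P i) => ->; rewrite /bigon_pass //=; case: (par) k1.
- by move=> i; case: (ord2P i) => ->; rewrite /bigon_pass //=; case: (par) k2.
- by move=> i; case: (ord2P i) => ->; rewrite /bigon_pass //=; case: (par) k3.
- move=> x; rewrite !inE => /orP[]/eqP->; rewrite /bigon_pass /=; case: (s); case: (par) => //=.
- move=> [i k]; have : has (fun x => ((i, k) == x.2.1) || ((i, k) == x.2.2)) bigon_xs.
    by case: (ord2P i) => ->; case: k; rewrite /bigon_xs; case: (s); case: (par).
  by move=> /hasP[x xx /orP[]/eqP h]; exists x; auto.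
- by rewrite /= inE cd.
- by move=> x; rewrite ec !inE.
Qed.

End Bigon.

Section Triangle.

Variables (R D : diagram) (e : erasure R D) (a1 b1 a2 b2 a3 b3 : point R) (k o1 o2 o3 : bool).
Variables (c12 c13 c23 : classical D).

Definition triangle_pass : 'I_3 -> bool -> classical D * bool :=
  strands3 (fun j => if j == o1 then (c13, k (+) o1 (+) o3) else (c12, k (+) o1 (+) o2))
           (fun j => if j == o2 then (c23, k (+) o2 (+) o3) else (c12, ~~ (k (+) o1 (+) o2)))
           (fun j => if j == o3 then (c23, ~~ (k (+) o2 (+) o3)) else (c13, ~~ (k (+) o1 (+) o3))).
Definition triangle_xs : seq (classical D * (('I_3 * bool) * ('I_3 * bool))) :=
  [:: (c12, at_slot (k (+) o1 (+) o2) (i30, ~~ o1) (i31, ~~ o2));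
      (c13, at_slot (k (+) o1 (+) o3) (i30, o1) (i32, ~~ o3));
      (c23, at_slot (k (+) o2 (+) o3) (i31, o2) (i32, o3))].

Lemma in_orderP (T : diagram) (p q : point T) o x y : strand p (in_order o x y) q ->
  let x1 := if o then x else y in let x2 := if o then y else x in
  [/\ next_passage T (inr p) = inl x1, next_passage T (inl x1) = inl x2
    & next_passage T (inl x2) = inr q].
Proof. by case: o => /strandP. Qed.

Lemma triangle_tangle :
  triangle (e a1) (e b1) (e a2) (e b2) (e a3) (e b3) k o1 o2 o3 c12 c13 c23 ->
  erased_points e = set0 -> erased_crossings e = [set inl c12; inl c13; inl c23] ->
  tangle e (strands3 a1 a2 a3) (strands3 b1 b2 b3) triangle_pass triangle_xs.
Proof.
move=> [u _ /in_orderP/=[h1 h2 h3] /in_orderP/=[h4 h5 h6] /in_orderP/=[h7 h8 h9]] ep ec.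
split=> //.
- move=> i; case: (ord3P i) => ->; rewrite /triangle_pass /=.
  + by case: (o1) h1.
  + by case: (o2) h4.
  + by case: (o3) h7.
- move=> i; case: (ord3P i) => ->; rewrite /triangle_pass /=.
  + by case: (o1) h2.
  + by case: (o2) h5.
  + by case: (o3) h8.
- move=> i; case: (ord3P i) => ->; rewrite /triangle_pass /=.
  + by case: (o1) h3.
  + by case: (o2) h6.
  + by case: (o3) h9.
- move=> x; rewrite !inE => /or3P[]/eqP->; rewrite /triangle_pass /=;
    by case: (o1); case: (o2); case: (o3); case: (k).
- move=> [i j]; have : has (fun x => ((i, j) == x.2.1) || ((i, j) == x.2.2)) triangle_xs.
    by case: (ord3P i) => ->; case: j; rewrite /triangle_xs; case: (o1); case: (o2); case: (o3); case: (k).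
  by move=> /hasP[x xx /orP[]/eqP h]; exists x; auto.
- by move=> x; rewrite ec !inE -orbA.
Qed.

End Triangle.

Lemma Rel_ext (D : diagram) (asg asg' : classical D -> option bool) :
  asg =1 asg' -> Rel asg =2 Rel asg'.
Proof.
move=> E; apply: eq_connect => x y; apply/linkP/linkP => -[d [<- <-]]; exists d;
  by rewrite /smooth; case: d => [[[[c|c] s]|p] o] //=; rewrite E.
Qed.

Lemma ex_asg (D : diagram) (S : {set classical D}) (J : finType) (h : J -> classical D)
    (st : {ffun J -> bool}) :
  injective h -> (forall c, (c \in S) = (c \in codom h)) ->
  exists2 asg, on_S S asg & forall j, asg (h j) = Some (st j).
Proof.
move=> hi hS; exists (fun c => omap st [pick j | h j == c]).
  move=> c; rewrite hS; case: pickP => [j /eqP<-|nj] /=; first by rewrite codom_f.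
  by symmetry; apply/negP => /codomP[j E]; have := nj j; rewrite E eqxx.
by move=> j; case: pickP => [j' /eqP/hi->//|/(_ j)]; rewrite eqxx.
Qed.

Section KeptSum.

Lemma kept_negU (D : diagram) (A B : {set classical D}) : [disjoint A & B] ->
  kept_neg (A :|: B) = kept_neg A + kept_neg B /\ kept_pos (A :|: B) = kept_pos A + kept_pos B.
Proof.
move=> AB; have K (p : pred (classical D)) :
    #|[set c in A :|: B | p c]| = #|[set c in A | p c]| + #|[set c in B | p c]|.
  rewrite -cardsUI [X in _ + X](_ : _ = 0) ?addn0; last first.
    apply/eqP; rewrite cards_eq0 -subset0; apply/subsetP => c; rewrite !inE.
    by case/andP=> /andP[cA _] /andP[cB _]; have := disjointFr AB cA; rewrite cB.
  by apply: eq_card => c; rewrite !inE andb_orl.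
by split; apply: K.
Qed.

Lemma kept_neg1 (D : diagram) (c : classical D) :
  kept_neg [set c] = over_strand c /\ kept_pos [set c] = ~~ over_strand c.
Proof.
have K (p : pred (classical D)) : #|[set d in [set c] | p d]| = p c.
  case pc: (p c) => /=; last first.
    by apply/eqP; rewrite cards_eq0 -subset0; apply/subsetP => d; rewrite !inE => /andP[/eqP->]; rewrite pc.
  rewrite -(cards1 c); apply: eq_card => d; rewrite !inE; case: eqP => // ->; exact: pc.
by split; apply: K.
Qed.

End KeptSum.

Section TangleLow.

Variables (n' : nat) (R D : diagram) (e : erasure R D) (oc : classical R -> classical D).
Local Notation n := n'.+1.
Local Notation cr := (carry (on_crossing e) (on_point e)).
Hypothesis ocE : forall c, on_crossing e (inl c) = inl (oc c).
Variables (a b : 'I_n -> point R) (pass : 'I_n -> bool -> classical D * bool).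
Variable xs : seq (classical D * (('I_n * bool) * ('I_n * bool))).
Hypothesis tg : tangle e a b pass xs.

(** The edge leaving the tangle ends at the regular point [b i], hence lies on the circle of the
    next edge in every state. The ends can thus be named by passages of [R]. *)
Definition low_point (z : bZ n' R) : passage R :=
  match z with inl x => x | inr i => inr (b i) end.

Lemma low_pointP asgD z : Rel asgD (outD e pass z) (cr (low_point z)).
Proof.
case: z => [x|i]; first exact: connect0.
apply: connect1; apply/linkP; exists (inr (e (b i)), false).
by rewrite /smooth /edge /= -(t_out tg) permK.
Qed.

Variable l : 'I_n.
Local Notation ml := (3 * l + 1).

Definition with_loop (z : option (passage R)) : passage D :=
  if z is Some x then cr x else node a e pass ml.
Definition with_loopZ (z : option (bZ n' R)) : passage D :=
  if z is Some x then outD e pass x else node a e pass ml.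

Lemma loop_node : node a e pass ml = inl (inl (pass l false).1, (pass l false).2).
Proof. by rewrite nodeE. Qed.

Lemma with_loop_inj : injective with_loop.
Proof.
have nc x : cr x <> node a e pass ml.
  by rewrite loop_node => E; have := ins_nc (tangle_inserted tg) l false; rewrite -E codom_f.
by move=> [x|] [y|] //= E; [congr Some; apply: (carry_inj E)|case: (nc x)|case: (nc y)].
Qed.

Lemma with_loopZ_inj : injective with_loopZ.
Proof.
have ti := tangle_inserted tg.
have nc x : outD e pass x <> node a e pass ml.
  rewrite loop_node; case: x => [x|i] /= E.
    by have := ins_nc ti l false; rewrite -E codom_f.
  by have [] := P_inj (tangle_inj tg) ti E.
move=> [x|] [y|] //= E; [|by case: (nc x)|by case: (nc y)].
by congr Some; apply: (outD_inj (tangle_inj tg) ti E).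
Qed.

Variables (asgR : classical R -> option bool) (asgD : classical D -> option bool).
Hypothesis asgE : forall c, asgD (oc c) = asgR c.
Variables (f : nat -> nat).
Hypotheses (clsE : cls xs asgD = f) (inner : inner_ok n' f ml).

Lemma tangle_low :
  [/\ same_bnd n' f (fun m => m %/ 3) -> forall x x', Rel asgD (cr x) (cr x') = Rel asgR x x',
      forall y, exists z, Rel asgD y (with_loop z),
      ~~ touches n' f ml -> forall x, ~~ Rel asgD (node a e pass ml) (cr x)
    & forall m, bnd n' m -> f m = f ml ->
        Rel asgD (node a e pass ml) (cr (low_point (bnode a m)))].
Proof.
have [h1 h2 h3 h4] := tangle_out ocE tg asgE clsE inner.
have [_ _ tr] := Rel_eqv asgD; split.
- move=> sb x x'; rewrite -[cr x]/(outD e pass (inl x)) -[cr x']/(outD e pass (inl x')).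
  by rewrite h1 (same_bnd_blink a asgR sb) (straight_Rel a).
- move=> y; have [[z yz]|yl] := h2 y; last by exists None.
  by exists (Some (low_point z)); apply: (tr _ _ _ yz); apply: low_pointP.
- by move=> nt x; apply: (h3 nt (inl x)).
- by move=> m bm em; apply: (tr _ _ _ (h4 m bm em)); apply: low_pointP.
Qed.

Lemma tangle_lowB : forall x x', Rel asgD (cr x) (cr x') =
  connect (blink a asgR (fun m m' => f m == f m')) (inl x) (inl x').
Proof.
have [h1 h2 h3 h4] := tangle_out ocE tg asgE clsE inner.
by move=> x x'; rewrite -h1.
Qed.

End TangleLow.

(** * Invariance under each of the three moves when the kept crossings are oriented *)

Section Kink.

Variables (F : fieldType) (R D : diagram) (e : erasure R D) (oc : classical R -> classical D).
Hypothesis ocE : forall c, on_crossing e (inl c) = inl (oc c).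
Variables (a b : point R) (c : classical D) (s : bool).
Hypothesis tg : tangle e (fun=> a) (fun=> b) (kink_pass c s) (kink_xs c s).
Local Notation cr := (carry (on_crossing e) (on_point e)).

Definition kink_table (o bit : bool) : nat -> nat :=
  merging (xlinks o (Some bit) (at_slot s 0 1).1 (at_slot s 0 1).2 ++ [::]).

(** Node 1 is the inner edge of the kink. It closes up exactly in the state [o], and the ends 0 and
    2 are joined in both states. *)
Lemma kink_tableP o bit : [/\ inner_ok 0 (kink_table o bit) 1,
  same_bnd 0 (kink_table o bit) (fun m => m %/ 3) & touches 0 (kink_table o bit) 1 = (o != bit)].
Proof. by rewrite /kink_table; case: (s); case: o; case: bit; vm_compute. Qed.

Lemma kink_cls asg bit : asg c = Some bit -> cls (kink_xs c s) asg = kink_table (over_strand c) bit.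
Proof. by rewrite /cls /local_links /kink_xs /kink_table /= => ->; case: (s). Qed.

Variable S : {set classical R}.
Local Notation S' := (oc @: S :|: [set c]).

(** The circle appears in the state [false] at a positive crossing and [true] at a negative one. The
    shifts (0, 1) and (-1, -2) of the two loop lemmas are cancelled by what the crossing contributes
    to the normalisation. *)
Lemma kink_HI : HI F S' S.
Proof.
move=> V V0 rk rk0 hV hV0 i i0.
have ic : in_tangle (kink_xs c s) c by rewrite /in_tangle /= mem_head.
have noc d : oc d != c by apply/eqP => E; have := in_tangle_oc ocE tg d; rewrite E ic.
pose h (j : option {c | c \in S}) := if j is Some j then oc (val j) else c.
have h_inj : injective h.
  move=> [j|] [k|] //=; first by move=> /(oc_inj ocE)/val_inj->.
    by move=> E; case/eqP: (noc (val j)).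
  by move=> E; case/eqP: (noc (val k)).
have hS d : (d \in S') = (d \in codom h).
  rewrite !inE; apply/orP/codomP => [[/imsetP[k kS ->]|/eqP->]|[[j|] ->]].
  - by exists (Some (Sub k kS)).
  - by exists None.
  - by left; apply: imset_f; apply: valP.
  - by right; rewrite /=.
have tb asg (j : on_S S' asg) : exists2 bit, asg c = Some bit &
    cls (kink_xs c s) asg = kink_table (over_strand c) bit.
  have := j c; rewrite !inE eqxx orbT; case E: (asg c) => [bit|] // _.
  by exists bit; rewrite // (kink_cls E).
pose io := with_loop e (fun=> a) (kink_pass c s) (ord0 : 'I_1).
have mt asg : on_S S' asg -> forall x, exists z, Rel asg x (io z).
  move=> /tb[bit _ ce]; have [k1 k2 k3] := kink_tableP (over_strand c) bit.
  by have [_ ? _ _] := tangle_low ocE tg (l := ord0) (fun _ => erefl) ce k1.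
have [W hW HW] := pull_cube h_inj hS (with_loop_inj tg (l:=ord0)) mt hV i.
have st0 (bit : bool) (st : {ffun {c | c \in S} -> bool}) : exists asg asgR,
   [/\ forall z z', W (oext bit st) z z' = Rel asg (io z) (io z'),
       forall d, asg (oc d) = asgR d, Rel asgR =2 V0 st
     & cls (kink_xs c s) asg = kink_table (over_strand c) bit].
  have [asg ha hj] := ex_asg (oext bit st) h_inj hS.
  have ac : asg c = Some bit by have := hj None; rewrite ffunE.
  exists asg, (fun d => asg (oc d)); split=> //; last exact: kink_cls.
    by move=> z z'; rewrite (hW _ _ ha hj).
  move=> x y; rewrite hV0; apply: Rel_ext => d; case dS: (d \in S).
    by have := hj (Some (Sub d dS)); rewrite ffunE /= => ->; rewrite -{2}[d]/(val (Sub d dS : {c | c \in S})) asg_ofE.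
  rewrite asg_ofN ?dS //; have := ha (oc d).
  rewrite (mem_oc_tangle ocE tg) ?dS; first by case: (asg _).
  by move=> d'; rewrite inE => /eqP->.
have rs bit : restricts (vsub W bit) V0.
  move=> st z z' /=; have [asg [asgR [-> ea <- ce]]] := st0 bit st.
  have [k1 k2 k3] := kink_tableP (over_strand c) bit.
  by have [/(_ k2) -> _ _ _] := tangle_low ocE tg (l := ord0) ea ce k1.
have is0 bit : over_strand c = bit -> isolated (vsub W bit).
  move=> ob st z /=; have [asg [asgR [-> ea _ ce]]] := st0 bit st.
  have [k1 k2 k3] := kink_tableP (over_strand c) bit.
  by have [_ _ + _] := tangle_low ocE tg (l := ord0) ea ce k1; apply; rewrite k3 ob eqxx.
have at0 bit : over_strand c != bit -> exists q, attached q (vsub W bit).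
  move=> ob; have [k1 k2 k3] := kink_tableP (over_strand c) bit.
  rewrite ob in k3; have [m bm em] := touchesP _ _ _ k3.
  exists (low_point (fun=> b) (bnode (fun=> a) m : bZ 0 R)) => st /=.
  have [asg [asgR [-> ea _ ce]]] := st0 bit st.
  by have [_ _ _] := tangle_low ocE tg (l := ord0) ea ce k1; apply.
have dj : [disjoint oc @: S & [set c]].
  by rewrite disjoint_sym disjoints1; apply/imsetP => -[d _ E]; have := noc d; rewrite E eqxx.
have [en ep] := kept_negU dj; have [n1 p1] := kept_neg1 c.
have e1 := kept_neg_eq (oc_inj ocE) (erefl (oc @: S)) (oc_over ocE).
have e2 := kept_pos_eq (oc_inj ocE) (erefl (oc @: S)) (oc_over ocE).
rewrite /kept_shift en ep n1 p1 e1 e2.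
have oi : injective (ork rk0) by move=> [x|] [y|] //= [] /i0->.
have H := HW _ oi.
case o: (over_strand c) => /=.
  have [|q hq] := at0 false; first by rewrite o.
  have H' := loop1_Hiso rk0 (rs false) (rs true) hq (is0 true o).
  by apply: Hiso_eq (Hiso_trans H H') _ _; set u := kept_neg S; set v := kept_pos S; lia.
have [|q hq] := at0 true; first by rewrite o.
have H' := loop0_Hiso rk0 (rs false) (rs true) (is0 false o) hq.
by apply: Hiso_eq (Hiso_trans H H') _ _; set u := kept_neg S; set v := kept_pos S; lia.
Qed.

End Kink.

Section Bigon.

Variables (F : fieldType) (R D : diagram) (e : erasure R D) (oc : classical R -> classical D).
Hypothesis ocE : forall c, on_crossing e (inl c) = inl (oc c).
Variables (a b : 'I_2 -> point R) (c d : classical D) (s par : bool).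
Hypothesis tg : tangle e a b (bigon_pass c d s par) (bigon_xs c d s par).
Hypothesis over_d : over_strand d = ~~ over_strand c.
Local Notation cr := (carry (on_crossing e) (on_point e)).

(* The state in which the two strands enclose a circle smooths the crossing
   first_crossing along A and the other one along B. *)
Let w := over_strand c == par.
Definition bigon_table (p q : bool) : nat -> nat :=
  merging (xlinks (over_strand c) (Some (if w then p else q))
             (at_slot s 0 (3 + ~~ par)).1 (at_slot s 0 (3 + ~~ par)).2 ++
           xlinks (~~ over_strand c) (Some (if w then q else p))
             (at_slot (~~ s) 1 (3 + par)).1 (at_slot (~~ s) 1 (3 + par)).2 ++ [::]).

Lemma bigon_tableP p q : inner_ok 1 (bigon_table p q) 1 /\
  touches 1 (bigon_table p q) 1 = ~~ (~~ p && q).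
Proof.
by rewrite /bigon_table /w; case: (over_strand c); case: (s); case: (par); case: p; case: q; vm_compute.
Qed.

(** The state (true, false) joins the ends like two strands that do not meet. The other three
    connect the four ends in the same way as each other and differ only in the small circle. *)
Lemma bigon_table_same : [/\ same_bnd 1 (bigon_table true false) (fun m => m %/ 3),
  same_bnd 1 (bigon_table false true) (bigon_table false false)
  & same_bnd 1 (bigon_table true true) (bigon_table false false)].
Proof.
by rewrite /bigon_table /w; case: (over_strand c); case: (s); case: (par); vm_compute.
Qed.

Let x1 := if w then c else d.
Let x2 := if w then d else c.

Lemma bigon_cls asg p q : asg x1 = Some p -> asg x2 = Some q ->
  cls (bigon_xs c d s par) asg = bigon_table p q.
Proof.
rewrite /x1 /x2 /cls /local_links /bigon_xs /bigon_table /= over_d; case: (w) => -> ->;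
  by case: (s); case: (par).
Qed.

Variable S : {set classical R}.
Local Notation S' := (oc @: S :|: [set c; d]).

(** The two crossings have opposite signs, so together they change both normalisations by the shift
    (-1, -1) of [R2_Hiso]. *)
Lemma bigon_HI : HI F S' S.
Proof.
move=> V V0 rk rk0 hV hV0 i i0.
have ncd : c != d by have := t_uniq tg; rewrite /= inE andbT.
have it y : y \in [set c; d] -> in_tangle (bigon_xs c d s par) y by rewrite /in_tangle /= !inE.
have noc y : oc y \notin [set c; d].
  by apply/negP => /it; rewrite (in_tangle_oc ocE tg).
have x12 : [set c; d] = [set x1; x2] by rewrite /x1 /x2; case: (w); rewrite // setUC.
have nx : x1 != x2 by rewrite /x1 /x2; case: (w); rewrite // eq_sym.
have noc1 y : oc y != x1 by apply: contraNneq (noc y) => ->; rewrite x12 !inE eqxx.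
have noc2 y : oc y != x2 by apply: contraNneq (noc y) => ->; rewrite x12 !inE eqxx orbT.
pose h (j : option (option {c | c \in S})) :=
  match j with Some (Some j) => oc (val j) | Some None => x2 | None => x1 end.
have h_inj : injective h.
  move=> [[j|]|] [[k|]|] //=; first by move=> /(oc_inj ocE)/val_inj->.
  - by move=> E; case/eqP: (noc2 (val j)).
  - by move=> E; case/eqP: (noc1 (val j)).
  - by move=> E; case/eqP: (noc2 (val k)).
  - by move=> E; case/eqP: nx.
  - by move=> E; case/eqP: (noc1 (val k)).
  - by move=> E; case/eqP: nx.
have hS y : (y \in S') = (y \in codom h).
  rewrite x12 !inE; apply/or3P/codomP => [[/imsetP[k kS ->]|/eqP->|/eqP->]|[[[j|]|] ->]].
  - by exists (Some (Some (Sub k kS))).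
  - by exists None.
  - by exists (Some None).
  - by apply: Or31; apply: imset_f; apply: valP.
  - by apply: Or33; rewrite /=.
  - by apply: Or32; rewrite /=.
have h1 asg : on_S S' asg -> exists p, asg x1 = Some p.
  by move=> /(_ x1); rewrite hS (codom_f h None); case: (asg x1) => // p; exists p.
have h2 asg : on_S S' asg -> exists q, asg x2 = Some q.
  by move=> /(_ x2); rewrite hS (codom_f h (Some None)); case: (asg x2) => // p; exists p.
pose io := with_loop e a (bigon_pass c d s par) i20.
have mt asg : on_S S' asg -> forall x, exists z, Rel asg x (io z).
  move=> ha; have [p hp] := h1 _ ha; have [q hq] := h2 _ ha.
  have [k1 _] := bigon_tableP p q.
  by have [_ ? _ _] := tangle_low ocE tg (l := i20) (fun _ => erefl) (bigon_cls hp hq) k1.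
have [W hW HW] := pull_cube h_inj hS (with_loop_inj tg (l := i20)) mt hV i.
have st0 p q (st : {ffun {c | c \in S} -> bool}) : exists asg,
   [/\ forall z z', W (oext p (oext q st)) z z' = Rel asg (io z) (io z'),
       forall y, asg (oc y) = asg_of st y
     & cls (bigon_xs c d s par) asg = bigon_table p q].
  have [asg ha hj] := ex_asg (oext p (oext q st)) h_inj hS.
  exists asg; split.
  - by move=> z z'; rewrite (hW _ _ ha hj).
  - move=> y; case yS: (y \in S).
      have := hj (Some (Some (Sub y yS))); rewrite !ffunE /= => ->.
      by rewrite -[y in RHS]/(val (Sub y yS : {c | c \in S})) asg_ofE.
    rewrite asg_ofN ?yS //; have := ha (oc y).
    by rewrite (mem_oc_tangle ocE tg _ it) yS; case: (asg _).
  - by apply: bigon_cls; [have := hj None|have := hj (Some None)]; rewrite !ffunE.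
have rs : restricts (vsub (vsub W true) false) V0.
  move=> st z z' /=; have [asg [-> ea ce]] := st0 true false st.
  have [k1 _] := bigon_tableP true false; have [k2 _ _] := bigon_table_same.
  have [/(_ k2) -> _ _ _] := tangle_low ocE tg (l := i20) ea ce k1.
  by rewrite hV0.
have is0 : isolated (vsub (vsub W false) true).
  move=> st z /=; have [asg [-> ea ce]] := st0 false true st.
  have [k1 k3] := bigon_tableP false true.
  by have [_ _ + _] := tangle_low ocE tg (l := i20) ea ce k1; apply; rewrite k3.
have at0 p q : ~~ (~~ p && q) -> exists z, attached z (vsub (vsub W p) q).
  move=> pq; have [k1 k3] := bigon_tableP p q.
  rewrite pq in k3; have [m bm em] := touchesP _ _ _ k3.
  exists (low_point b (bnode a m)) => st /=; have [asg [-> ea ce]] := st0 p q st.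
  by have [_ _ _] := tangle_low ocE tg (l := i20) ea ce k1; apply.
have [q1 a00] := at0 false false isT; have [q2 a11] := at0 true true isT.
have [q3 a10] := at0 true false isT.
have rB p q st z z' : vsub (vsub W p) q st (Some z) (Some z') =
   connect (blink a (asg_of st) (fun m m' => bigon_table p q m == bigon_table p q m')) (inl z) (inl z').
  rewrite /=; have [asg [-> ea ce]] := st0 p q st; have [k1 k3] := bigon_tableP p q.
  by rewrite (tangle_lowB ocE tg (l := i20) ea ce k1).
have [Q hQ] : exists Q : vcube F {c | c \in S} (passage R),
    forall st z z', Q st z z' = vsub (vsub W false) false st (Some z) (Some z').
  by apply: vpull_low => st; exists q1; apply: a00.
have [_ sb1 sb2] := bigon_table_same.
have r01 : restricts (vsub (vsub W false) true) Q.
  by move=> st z z'; rewrite hQ !rB (same_bnd_blink a _ sb1).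
have r11 : restricts (vsub (vsub W true) true) Q.
  by move=> st z z'; rewrite hQ !rB (same_bnd_blink a _ sb2).
have H' := R2_Hiso i0 hQ r01 r11 is0 a00 a11 rs a10.
have dj : [disjoint oc @: S & [set c; d]].
  rewrite -setI_eq0; apply/eqP/setP => y; rewrite [in RHS]inE; apply/negP; rewrite inE => /andP[/imsetP[k _ ->]].
  by apply/negP.
have dj2 : [disjoint [set c] & [set d]] by rewrite disjoints1 inE.
have [en ep] := kept_negU dj; have [n1 p1] := kept_neg1 c; have [n2 p2] := kept_neg1 d.
have [en2 ep2] := kept_negU dj2.
have e1 := kept_neg_eq (oc_inj ocE) (erefl (oc @: S)) (oc_over ocE).
have e2 := kept_pos_eq (oc_inj ocE) (erefl (oc @: S)) (oc_over ocE).
rewrite /kept_shift en ep en2 ep2 n1 p1 n2 p2 e1 e2 over_d.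
have oi : injective (ork (ork rk0)) by move=> [[x|]|] [[y|]|] //= [] /i0->.
have H := HW _ oi.
by apply: Hiso_eq (Hiso_trans H H') _ _; set u := kept_neg S; set v := kept_pos S;
  case: (over_strand c) => /=; lia.
Qed.

End Bigon.

Section TriangleTables.

Variables (k o1 o2 o3 : bool).
Local Notation s12 := (k (+) o1 (+) o2).
Local Notation s13 := (k (+) o1 (+) o3).
Local Notation s23 := (k (+) o2 (+) o3).

Definition triangle_table (x12 x13 x23 : option bool) : nat -> nat :=
  let q12 := at_slot s12 (nat_of_bool (~~ o1)) (3 + ~~ o2) in
  let q13 := at_slot s13 (nat_of_bool o1) (6 + ~~ o3) in
  let q23 := at_slot s23 (3 + o2) (6 + o3) in
  merging (xlinks s12 x12 q12.1 q12.2 ++ xlinks s13 x13 q13.1 q13.2 ++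
           xlinks s23 x23 q23.1 q23.2 ++ [::]).

(* The arcs inside of the triangle close up in the state (~~ k, k, ~~ k). *)
Definition triangle_kept (x y z : bool) : nat -> nat :=
  triangle_table (Some x) (Some (if k then z else y)) (Some (if k then y else z)).

(** Node 7 is the inner edge of the third strand. In the state [~~ k] of the pivot [c12], this
    strand bounds the bigon. The definition of [triangle_kept] orders the other two crossings so
    that the circle always appears at (false, true), as [r3_side] prescribes. *)
Lemma triangle_keptP x y z : inner_ok 2 (triangle_kept x y z) 7 /\
  touches 2 (triangle_kept x y z) 7 = ~~ [&& x == ~~ k, ~~ y & z].
Proof.
by rewrite /triangle_kept /triangle_table; case: (k); case: (o1); case: (o2); case: (o3);
  case: x; case: y; case: z; vm_compute.
Qed.

Lemma triangle_kept_same :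
  [/\ same_bnd 2 (triangle_kept (~~ k) false true) (triangle_kept (~~ k) false false),
      same_bnd 2 (triangle_kept (~~ k) false true) (triangle_kept (~~ k) true true)
    & same_bnd 2 (triangle_kept (~~ k) false true) (triangle_kept k false true)].
Proof.
by rewrite /triangle_kept /triangle_table; case: (k); case: (o1); case: (o2); case: (o3); vm_compute.
Qed.

End TriangleTables.

(** Once the pivot is opened in the state [k], the third strand can be moved past it, and the two
    tangles differ only by exchanging the roles of the two remaining crossings. *)
Lemma triangle_kept_swap k o1 o2 o3 y z :
  same_bnd 2 (triangle_kept k o1 o2 o3 k y z) (triangle_kept k (~~ o1) (~~ o2) (~~ o3) k z y).
Proof.
by rewrite /triangle_kept /triangle_table; case: k; case: o1; case: o2; case: o3;
  case: y; case: z; vm_compute.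
Qed.

Lemma triangle_kept_last k o1 o2 o3 : same_bnd 2 (triangle_kept k o1 o2 o3 (~~ k) true false)
  (triangle_kept k (~~ o1) (~~ o2) (~~ o3) (~~ k) true false).
Proof.
by rewrite /triangle_kept /triangle_table; case: k; case: o1; case: o2; case: o3; vm_compute.
Qed.

(** With at most one kept crossing, a strand is moved past crossings at which everything goes
    straight on, so that the connection of the six ends does not change and no inner circle
    arises. *)
Lemma triangle_few k o1 o2 o3 (x y z : option bool) :
  (x != None) + (y != None) + (z != None) <= 1 ->
  [/\ inner_ok 2 (triangle_table k o1 o2 o3 x y z) 7,
      touches 2 (triangle_table k o1 o2 o3 x y z) 7
    & same_bnd 2 (triangle_table k o1 o2 o3 x y z)
        (triangle_table k (~~ o1) (~~ o2) (~~ o3) x y z)].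
Proof.
by rewrite /triangle_table; case: k; case: o1; case: o2; case: o3;
  case: x => [[]|]; case: y => [[]|]; case: z => [[]|] // _; vm_compute.
Qed.

Definition triangle_set (T : finType) (c12 c13 c23 : T) (u12 u13 u23 : bool) : {set T} :=
  [set c | [|| (c == c12) && u12, (c == c13) && u13 | (c == c23) && u23]].

Section TriangleSide.

Variables (F : fieldType) (R D : diagram) (e : erasure R D) (oc : classical R -> classical D).
Hypothesis ocE : forall c, on_crossing e (inl c) = inl (oc c).
Variables (a b : 'I_3 -> point R) (k o1 o2 o3 : bool) (c12 c13 c23 : classical D).
Hypothesis tg : tangle e a b (triangle_pass k o1 o2 o3 c12 c13 c23)
  (triangle_xs k o1 o2 o3 c12 c13 c23).
Hypotheses (ov12 : over_strand c12 = k (+) o1 (+) o2)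
  (ov13 : over_strand c13 = k (+) o1 (+) o3) (ov23 : over_strand c23 = k (+) o2 (+) o3).
Local Notation cr := (carry (on_crossing e) (on_point e)).

Lemma triangle_cls asg : cls (triangle_xs k o1 o2 o3 c12 c13 c23) asg =
  triangle_table k o1 o2 o3 (asg c12) (asg c13) (asg c23).
Proof.
rewrite /cls /local_links /triangle_xs /triangle_table /= ov12 ov13 ov23.
by case: (k); case: (o1); case: (o2); case: (o3).
Qed.

Variable S : {set classical R}.
Variables (u12 u13 u23 : bool).
Local Notation S' := (oc @: S :|: triangle_set c12 c13 c23 u12 u13 u23).

Lemma triangle_oc d : [/\ oc d != c12, oc d != c13 & oc d != c23].
Proof.
have := in_tangle_oc ocE tg d; rewrite /in_tangle !inE /=.
by case: eqP => // _; case: eqP => // _; case: eqP.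
Qed.

Lemma triangle_uniq : [/\ c12 != c13, c12 != c23 & c13 != c23].
Proof. by have := t_uniq tg; rewrite /= !inE negb_or andbT => /andP[/andP[]]. Qed.

Lemma in_triangle c : c \in triangle_set c12 c13 c23 u12 u13 u23 ->
  in_tangle (triangle_xs k o1 o2 o3 c12 c13 c23) c.
Proof. by rewrite inE /in_tangle !inE => /or3P[]/andP[->]; rewrite ?orbT. Qed.

Lemma triangle_mem : [/\ (c12 \in S') = u12, (c13 \in S') = u13 & (c23 \in S') = u23].
Proof.
have [n1 n2 n3] := triangle_uniq.
have M c : in_tangle (triangle_xs k o1 o2 o3 c12 c13 c23) c ->
    (c \in S') = (c \in triangle_set c12 c13 c23 u12 u13 u23).
  exact: (mem_tangle ocE tg).
split; rewrite M; try (by rewrite /in_tangle !inE eqxx ?orbT).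
- by rewrite inE eqxx (negPf n1) (negPf n2) !orbF.
- by rewrite inE eqxx [c13 == c12]eq_sym (negPf n1) (negPf n3) !orbF.
- by rewrite inE eqxx [c23 == c12]eq_sym [c23 == c13]eq_sym (negPf n2) (negPf n3).
Qed.

Lemma triangle_restrict asg asgR : on_S S' asg -> on_S S asgR ->
  (forall c, c \in S -> asg (oc c) = asgR c) -> forall c, asg (oc c) = asgR c.
Proof.
move=> h h' ea c; case cS: (c \in S); first exact: ea.
have := h (oc c); rewrite (mem_oc_tangle ocE tg _ in_triangle) cS; have := h' c; rewrite cS.
by case: (asg _); case: (asgR _).
Qed.

End TriangleSide.

Section TriangleCube.

Variables (F : fieldType) (R D : diagram) (e : erasure R D) (oc : classical R -> classical D).
Hypothesis ocE : forall c, on_crossing e (inl c) = inl (oc c).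
Variables (a b : 'I_3 -> point R) (k o1 o2 o3 : bool) (c12 c13 c23 : classical D).
Hypothesis tg : tangle e a b (triangle_pass k o1 o2 o3 c12 c13 c23)
  (triangle_xs k o1 o2 o3 c12 c13 c23).
Hypotheses (ov12 : over_strand c12 = k (+) o1 (+) o2)
  (ov13 : over_strand c13 = k (+) o1 (+) o3) (ov23 : over_strand c23 = k (+) o2 (+) o3).
Variable S : {set classical R}.
Local Notation S' := (oc @: S :|: triangle_set c12 c13 c23 true true true).
Local Notation I := {c | c \in S}.

(** The cube is read on the edges outside of the triangle together with one inner edge, which
    becomes the point [None] of the small circle. The pivot [c12] is the first coordinate. *)
Lemma triangle_cube (V : vcube F {c | c \in S'} (passage D)) (rk : {c | c \in S'} -> nat) :
  realizes V -> injective rk ->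
  exists W : vcube F (option (option (option I))) (option (bZ 2 R)),
  [/\ r3_side (~~ k) W,
      forall x y z (st : {ffun I -> bool}) u v,
        W (oext x (oext y (oext z st))) (Some u) (Some v) =
        connect (blink a (asg_of st) (fun m m' => triangle_kept k o1 o2 o3 x y z m
                                              == triangle_kept k o1 o2 o3 x y z m')) u v
    & forall rk' : _ -> nat, injective rk' -> Hiso 0 0 (cube V rk) (cube W rk')].
Proof.
move=> hV i.
have [n1 n2 n3] := triangle_uniq tg.
have it := @in_triangle _ k o1 o2 o3 c12 c13 c23 true true true.
have oct := triangle_oc ocE tg.
have i12 d : oc d != c12 by have [] := oct d.
have i13 d : oc d != c13 by have [] := oct d.
have i23 d : oc d != c23 by have [] := oct d.
pose x2 := if k then c23 else c13; pose x3 := if k then c13 else c23.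
have m2 : c12 != x2 by rewrite /x2; case: (k).
have m3 : c12 != x3 by rewrite /x3; case: (k).
have m23 : x2 != x3 by rewrite /x2 /x3; case: (k); rewrite // eq_sym.
have j2 d : oc d != x2 by rewrite /x2; case: (k).
have j3 d : oc d != x3 by rewrite /x3; case: (k).
pose h (j : option (option (option I))) :=
  match j with
  | Some (Some (Some j)) => oc (val j) | Some (Some None) => x3 | Some None => x2
  | None => c12 end.
have h_inj : injective h.
  have ne (x y : classical D) (P : Prop) : x != y -> x = y -> P by move=> /eqP.
  move=> [[[j|]|]|] [[[l|]|]|] //=; first (by move=> /(oc_inj ocE)/val_inj->);
  by [apply: ne | move=> /esym; apply: ne].
have hS y : (y \in S') = (y \in codom h).
  have e23 : ((y == c13) || (y == c23)) = ((y == x2) || (y == x3)).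
    by rewrite /x2 /x3; case: (k); rewrite // orbC.
  rewrite inE [X in _ || X]inE !andbT e23; apply/orP/codomP => [[/imsetP[l lS ->]|/or3P[]/eqP->]|].
  - by exists (Some (Some (Some (Sub l lS)))).
  - by exists None.
  - by exists (Some None).
  - by exists (Some (Some None)).
  - move=> [[[[j|]|]|] ->] /=.
    + by left; apply: imset_f; apply: valP.
    + by right; rewrite eqxx !orbT.
    + by right; rewrite eqxx !orbT.
    + by right; rewrite eqxx.
pose io := with_loopZ e a (triangle_pass k o1 o2 o3 c12 c13 c23) i32.
have tcls asg x y z : asg c12 = Some x -> asg x2 = Some y -> asg x3 = Some z ->
    cls (triangle_xs k o1 o2 o3 c12 c13 c23) asg = triangle_kept k o1 o2 o3 x y z.
  move=> h1; rewrite (triangle_cls ov12 ov13 ov23) h1 /x2 /x3 /triangle_kept.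
  by case: (k) => -> ->.
have ex asg : on_S S' asg -> forall j, exists x, asg (h j) = Some x.
  by move=> ha j; have := ha (h j); rewrite hS codom_f; case: (asg _) => // x; exists x.
have mt asg : on_S S' asg -> forall x, exists z, Rel asg x (io z).
  move=> ha x; have [p hp] := ex _ ha None; have [q hq] := ex _ ha (Some None).
  have [r hr] := ex _ ha (Some (Some None)).
  have [k1 _] := triangle_keptP k o1 o2 o3 p q r.
  have [_ h2 _ _] := tangle_out ocE tg (l := i32) (fun _ => erefl) (tcls asg p q r hp hq hr) k1.
  by have [[z hz]|hn] := h2 x; [exists (Some z)|exists None].
have [W hW HW] := pull_cube h_inj hS (with_loopZ_inj tg (l := i32)) mt hV i.
have st0 p q r (st : {ffun I -> bool}) : exists asg,
   [/\ forall z z', W (oext p (oext q (oext r st))) z z' = Rel asg (io z) (io z'),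
       forall y, asg (oc y) = asg_of st y
     & cls (triangle_xs k o1 o2 o3 c12 c13 c23) asg = triangle_kept k o1 o2 o3 p q r].
  have [asg ha hj] := ex_asg (oext p (oext q (oext r st))) h_inj hS.
  exists asg; split.
  - by move=> z z'; rewrite (hW _ _ ha hj).
  - apply: (triangle_restrict ocE tg ha (asg_of_on st)) => y yS.
    have := hj (Some (Some (Some (Sub y yS)))); rewrite !ffunE /= => ->.
    by rewrite -[y in RHS]/(val (Sub y yS : I)) asg_ofE.
  - by apply: tcls; [have := hj None|have := hj (Some None)|have := hj (Some (Some None))];
      rewrite !ffunE.
have is0 : isolated (vsub (vsub (vsub W (~~ k)) false) true).
  move=> st z /=; have [asg [-> ea ce]] := st0 (~~ k) false true st.
  have [k1 k3] := triangle_keptP k o1 o2 o3 (~~ k) false true.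
  by have [_ _ + _] := tangle_out ocE tg (l := i32) ea ce k1; apply; rewrite k3 eqxx.
have at0 p q r : ~~ [&& p == ~~ k, ~~ q & r] -> att_cst (vsub (vsub (vsub W p) q) r).
  move=> pq; have [k1 k3] := triangle_keptP k o1 o2 o3 p q r.
  rewrite pq in k3; have [m bm em] := touchesP _ _ _ k3.
  exists (bnode a m) => st /=; have [asg [-> ea ce]] := st0 p q r st.
  by have [_ _ _] := tangle_out ocE tg (l := i32) ea ce k1; apply.
have rB p q r (st : {ffun I -> bool}) u v : W (oext p (oext q (oext r st))) (Some u) (Some v) =
   connect (blink a (asg_of st) (fun m m' => triangle_kept k o1 o2 o3 p q r m
      == triangle_kept k o1 o2 o3 p q r m')) u v.
  have [asg [-> ea ce]] := st0 p q r st; have [k1 k3] := triangle_keptP k o1 o2 o3 p q r.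
  by have [-> _ _ _] := tangle_out ocE tg (l := i32) ea ce k1.
have [sb1 sb2 sb3] := triangle_kept_same k o1 o2 o3.
exists W; split=> //; split.
- by move=> x y; apply: at0; rewrite negbK; case: (k).
- exact: is0.
- by split; apply: at0; rewrite ?eqxx ?andbF.
- by split=> st u v; rewrite /= !rB ?negbK; apply: same_bnd_blink.
Qed.

End TriangleCube.

Section TriangleMove.

Variables (F : fieldType) (R D D' : diagram) (e : erasure R D) (e' : erasure R D').
Variables (oc : classical R -> classical D) (oc' : classical R -> classical D').
Hypotheses (ocE : forall c, on_crossing e (inl c) = inl (oc c))
  (ocE' : forall c, on_crossing e' (inl c) = inl (oc' c)).
Variables (a b : 'I_3 -> point R) (k o1 o2 o3 : bool).
Variables (c12 c13 c23 : classical D) (c12' c13' c23' : classical D').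
Local Notation xs := (triangle_xs k o1 o2 o3 c12 c13 c23).
Local Notation xs' := (triangle_xs k (~~ o1) (~~ o2) (~~ o3) c12' c13' c23').
Hypothesis tg : tangle e a b (triangle_pass k o1 o2 o3 c12 c13 c23) xs.
Hypothesis tg' : tangle e' a b (triangle_pass k (~~ o1) (~~ o2) (~~ o3) c12' c13' c23') xs'.
Hypotheses (ov12 : over_strand c12 = k (+) o1 (+) o2)
  (ov13 : over_strand c13 = k (+) o1 (+) o3) (ov23 : over_strand c23 = k (+) o2 (+) o3).
Hypotheses (ov12' : over_strand c12' = k (+) ~~ o1 (+) ~~ o2)
  (ov13' : over_strand c13' = k (+) ~~ o1 (+) ~~ o3)
  (ov23' : over_strand c23' = k (+) ~~ o2 (+) ~~ o3).

Lemma triangle_match : exists f : classical D -> classical D',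
  [/\ injective f, forall c, over_strand (f c) = over_strand c, forall c, f (oc c) = oc' c
    & [/\ f c12 = c12', f c13 = c13' & f c23 = c23']].
Proof.
have [n1 n2 n3] := triangle_uniq tg; have [n1' n2' n3'] := triangle_uniq tg'.
have oct := triangle_oc ocE tg; have oct' := triangle_oc ocE' tg'.
have i12 d : oc d <> c12 by have [/eqP] := oct d.
have i13 d : oc d <> c13 by have [_ /eqP] := oct d.
have i23 d : oc d <> c23 by have [_ _ /eqP] := oct d.
have i12' d : oc' d <> c12' by have [/eqP] := oct' d.
have i13' d : oc' d <> c13' by have [_ /eqP] := oct' d.
have i23' d : oc' d <> c23' by have [_ _ /eqP] := oct' d.
have tri c : (exists d, c = oc d) \/ [\/ c = c12, c = c13 | c = c23].
  case: (boolP (in_tangle xs c)); last by move=> /(not_in_tangle ocE tg); left.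
  by rewrite /in_tangle !inE => /or3P[]/eqP->; right; [apply: Or31|apply: Or32|apply: Or33].
pose f c := if c == c12 then c12' else if c == c13 then c13' else if c == c23 then c23' else
  if [pick d | c == oc d] is Some d then oc' d else c12'.
have fo d : f (oc d) = oc' d.
  rewrite /f; case: eqP => [/i12//|_]; case: eqP => [/i13//|_]; case: eqP => [/i23//|_].
  by case: pickP => [d' /eqP/(oc_inj ocE)->//|/(_ d)]; rewrite eqxx.
have f12 : f c12 = c12' by rewrite /f eqxx.
have f13 : f c13 = c13' by rewrite /f eq_sym (negPf n1) eqxx.
have f23 : f c23 = c23' by rewrite /f ![c23 == _]eq_sym (negPf n2) (negPf n3) eqxx.
exists f; split=> //.
- have ne (x y : classical D') (P : Prop) : x != y -> x = y -> P by move=> /eqP.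
  move=> x y; case: (tri x) => [[d ->]|[]->]; case: (tri y) => [[d' ->]|[]->] //;
  rewrite ?fo ?f12 ?f13 ?f23; first (by move=> /(oc_inj ocE')->);
  by [move=> /i12'|move=> /i13'|move=> /i23'|move=> /esym/i12'|move=> /esym/i13'|move=> /esym/i23'
     |apply: ne|move=> /esym; apply: ne].
- move=> c; case: (tri c) => [[d ->]|[]->]; rewrite ?fo ?f12 ?f13 ?f23.
  + by rewrite (oc_over ocE) (oc_over ocE').
  + by rewrite ov12 ov12'; case: (k); case: (o1); case: (o2).
  + by rewrite ov13 ov13'; case: (k); case: (o1); case: (o3).
  + by rewrite ov23 ov23'; case: (k); case: (o2); case: (o3).
Qed.

Variables (S : {set classical R}) (u12 u13 u23 : bool).
Local Notation SD := (oc @: S :|: triangle_set c12 c13 c23 u12 u13 u23).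
Local Notation SD' := (oc' @: S :|: triangle_set c12' c13' c23' u12 u13 u23).

(** With at most one kept crossing the circles of the two diagrams match state by state; with all
    three, the retractions of [R3_eq] are needed. *)
Lemma triangle_HI : (u12 + u13 + u23 != 2)%N -> HI F SD SD'.
Proof.
move=> u2; have [f [f_inj f_over fo [f12 f13 f23]]] := triangle_match.
have fS : SD' = f @: SD.
  rewrite imsetU -imset_comp; congr (_ :|: _); first by apply: eq_imset => c; rewrite /= fo.
  apply/setP => c; rewrite inE; apply/or3P/imsetP.
    case=> /andP[/eqP-> u]; [exists c12|exists c13|exists c23];
      by rewrite ?f12 ?f13 ?f23 // inE u eqxx ?orbT.
  case=> d; rewrite inE => /or3P[]/andP[/eqP-> u] ->.
  - by apply: Or31; rewrite f12 eqxx.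
  - by apply: Or32; rewrite f13 eqxx.
  - by apply: Or33; rewrite f23 eqxx.
case: (leqP (u12 + u13 + u23) 1) => u1.
  have asgR_on asg : on_S SD asg -> on_S S (fun c => asg (oc c)).
    by move=> h c; rewrite h (mem_oc_tangle ocE tg _ (@in_triangle _ k o1 o2 o3 _ _ _ _ _ _)).
  have fw (X : diagram) (T : {set classical X}) asg (x y z : classical X) : on_S T asg ->
      (x \in T) = u12 -> (y \in T) = u13 -> (z \in T) = u23 ->
      (asg x != None) + (asg y != None) + (asg z != None) <= 1.
    by move=> h e1 e2 e3; rewrite !h e1 e2 e3.
  have [m12 m13 m23] := triangle_mem ocE tg S u12 u13 u23.
  have [m12' m13' m23'] := triangle_mem ocE' tg' S u12 u13 u23.
  have mt (X : diagram) (eX : erasure R X) ocX p1 p2 p3 d12 d13 d23 asg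
     (ocXE : forall c, on_crossing eX (inl c) = inl (ocX c))
     (tgX : tangle eX a b (triangle_pass k p1 p2 p3 d12 d13 d23) (triangle_xs k p1 p2 p3 d12 d13 d23)) :
     over_strand d12 = k (+) p1 (+) p2 -> over_strand d13 = k (+) p1 (+) p3 ->
     over_strand d23 = k (+) p2 (+) p3 ->
     (asg d12 != None) + (asg d13 != None) + (asg d23 != None) <= 1 ->
     forall x, exists z, Rel asg x (outD eX (triangle_pass k p1 p2 p3 d12 d13 d23) z).
    move=> h12 h13 h23 /(triangle_few k p1 p2 p3)[k1 k2 _] x.
    have [_ h2 _ h4] := tangle_out ocXE tgX (l := i32) (fun _ => erefl)
      (triangle_cls h12 h13 h23 asg) k1.
    have [//|xl] := h2 x; have [m bm em] := touchesP _ _ _ k2.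
    have [_ _ tr] := Rel_eqv asg.
    by exists (bnode a m); apply: (tr _ _ _ xl); apply: h4.
  apply: (HI_same f_inj fS f_over (Z := bZ 2 R)
     (io := outD e (triangle_pass k o1 o2 o3 c12 c13 c23))
     (io' := outD e' (triangle_pass k (~~ o1) (~~ o2) (~~ o3) c12' c13' c23'))).
  - exact: (outD_inj (tangle_inj tg) (tangle_inserted tg)).
  - exact: (outD_inj (tangle_inj tg') (tangle_inserted tg')).
  - move=> asg asg' h h' ea z z'.
    have ea' c : asg' (f c) = asg c.
      case cS: (c \in SD); first exact: ea.
      have := h c; have := h' (f c); rewrite fS (mem_imset _ _ f_inj) cS.
      by case: (asg c); case: (asg' _).
    have [k1 k2 k3] := triangle_few k o1 o2 o3 (fw _ _ _ _ _ _ h m12 m13 m23).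
    have [k1' k2' k3'] := triangle_few k (~~ o1) (~~ o2) (~~ o3) (fw _ _ _ _ _ _ h' m12' m13' m23').
    have [-> _ _ _] := tangle_out ocE tg (l := i32) (fun _ => erefl)
      (triangle_cls ov12 ov13 ov23 asg) k1.
    have [-> _ _ _] := tangle_out ocE' tg' (l := i32) (fun _ => erefl)
      (triangle_cls ov12' ov13' ov23' asg') k1'.
    rewrite (same_bnd_blink a _ k3) -f12 -f13 -f23 !ea'.
    apply: eq_connect => u v; apply/blinkP/blinkP => -[[d [<- <-]]|?]; [left|by right|left|by right];
    by exists d; rewrite /smooth; case: d => [[[[c|c] s]|p] o] //=; rewrite -fo ea'.
  - by move=> asg h; apply: (mt _ _ _ _ _ _ _ _ _ _ ocE tg) => //; apply: fw m12 m13 m23.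
  - by move=> asg h; apply: (mt _ _ _ _ _ _ _ _ _ _ ocE' tg') => //; apply: fw m12' m13' m23'.
have [t12 t13 t23] : [/\ u12 = true, u13 = true & u23 = true].
  by move: u1 u2; case: (u12); case: (u13); case: (u23).
move: fS; rewrite t12 t13 t23 => fS V V' rk rk' hV hV' i i'.
have [W [sW rW HW]] := triangle_cube ocE tg ov12 ov13 ov23 hV i.
have [W' [sW' rW' HW']] := triangle_cube ocE' tg' ov12' ov13' ov23' hV' i'.
have [rk0 i0] := ex_rank {c | c \in S}.
have oi : injective (ork (ork (ork rk0))) by move=> [[[x|]|]|] [[[y|]|]|] //= [] /i0->.
have H := R3_eq i0 sW sW'.
rewrite /kept_shift (kept_neg_eq f_inj fS f_over) (kept_pos_eq f_inj fS f_over) !subrr.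
have := Hiso_trans (HW _ oi) (Hiso_trans (H _ _) (Hiso_sym (HW' _ oi))).
move=> H'; apply: Hiso_eq (H' _ _) _ _ => //.
- move=> y z st u v; rewrite /= rW rW' negbK; apply: same_bnd_blink.
  exact: triangle_kept_swap.
- by move=> st u v; rewrite /= rW rW'; apply/same_bnd_blink/triangle_kept_last.
Qed.

End TriangleMove.

(** * Parity along the moves *)

(* The crossings outside of S are treated as virtual. A triangle with exactly two
   kept crossings would not be invariant; parity never produces it. *)
Inductive step : forall (D : diagram) (S : {set classical D}) (D' : diagram) (S' : {set classical D'}), Prop :=
| StepVirtual R D (e : erasure R D) oc (S : {set classical R}) :
    (forall c, on_crossing e (inl c) = inl (oc c)) -> step S (oc @: S)
| StepKink R D (e : erasure R D) oc (S : {set classical R}) a b c s :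
    (forall c, on_crossing e (inl c) = inl (oc c)) ->
    tangle e (fun=> a) (fun=> b) (kink_pass c s) (kink_xs c s) ->
    step S (oc @: S :|: [set c])
| StepBigon R D (e : erasure R D) oc (S : {set classical R}) a b c d s par :
    (forall c, on_crossing e (inl c) = inl (oc c)) ->
    tangle e a b (bigon_pass c d s par) (bigon_xs c d s par) ->
    over_strand d = ~~ over_strand c ->
    step S (oc @: S :|: [set c; d])
| StepTriangle R D D' (e : erasure R D) (e' : erasure R D') oc oc' (S : {set classical R}) a b k
      o1 o2 o3 p1 p2 p3 c12 c13 c23 c12' c13' c23' (u12 u13 u23 : bool) :
    (forall c, on_crossing e (inl c) = inl (oc c)) ->
    (forall c, on_crossing e' (inl c) = inl (oc' c)) ->
    [/\ p1 = ~~ o1, p2 = ~~ o2 & p3 = ~~ o3] ->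
    tangle e a b (triangle_pass k o1 o2 o3 c12 c13 c23) (triangle_xs k o1 o2 o3 c12 c13 c23) ->
    tangle e' a b (triangle_pass k p1 p2 p3 c12' c13' c23') (triangle_xs k p1 p2 p3 c12' c13' c23') ->
    [/\ over_strand c12 = k (+) o1 (+) o2, over_strand c13 = k (+) o1 (+) o3
      & over_strand c23 = k (+) o2 (+) o3] ->
    [/\ over_strand c12' = k (+) p1 (+) p2, over_strand c13' = k (+) p1 (+) p3
      & over_strand c23' = k (+) p2 (+) p3] ->
    (u12 + u13 + u23 != 2)%N ->
    step (oc @: S :|: triangle_set c12 c13 c23 u12 u13 u23)
         (oc' @: S :|: triangle_set c12' c13' c23' u12 u13 u23).

Lemma step_HI F D (S : {set classical D}) D' (S' : {set classical D'}) : step S S' -> HI F S S'.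
Proof.
case=> {D S D' S'}.
- by move=> R D e oc S ocE; apply: virtual_HI.
- by move=> R D e oc S a b c s ocE tg; apply: HI_sym; apply: (kink_HI ocE tg).
- by move=> R D e oc S a b c d s par ocE tg ov; apply: HI_sym; apply: (bigon_HI ocE tg ov).
- move=> R D D' e e' oc oc' S a b k o1 o2 o3 p1 p2 p3 c12 c13 c23 c12' c13' c23' u12 u13 u23.
  move=> ocE ocE' [-> -> ->] tg tg' [h1 h2 h3] [h1' h2' h3'] u2.
  exact: (triangle_HI ocE ocE' tg tg' h1 h2 h3 h1' h2' h3').
Qed.

Lemma evens_ext (D : diagram) (S : {set classical D}) tau tau' :
  (forall x, tau x = tau' x) -> evens S tau = evens S tau'.
Proof. by move=> E; apply/setP => c; rewrite !inE !E. Qed.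

Lemma twisted0 (n' : nat) (R D : diagram) (a : 'I_n'.+1 -> point R)
    (pass : 'I_n'.+1 -> bool -> classical D * bool) (S : {set classical R}) (T : {set classical D}) tau :
  (forall i, strand_flip pass T i = false) -> twisted a pass S T tau <-> flips S tau.
Proof.
move=> h; have E x : [exists i, (x == inr (a i)) && strand_flip pass T i] = false.
  by apply/existsP => -[i]; rewrite h andbF.
by split=> tw x; have := tw x; rewrite E addbF.
Qed.

Section TriangleFlips.

Variables (R D : diagram) (e : erasure R D) (oc : classical R -> classical D).
Hypothesis ocE : forall c, on_crossing e (inl c) = inl (oc c).
Variables (a b : 'I_3 -> point R) (k o1 o2 o3 : bool) (c12 c13 c23 : classical D).
Hypothesis tg : tangle e a b (triangle_pass k o1 o2 o3 c12 c13 c23)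
  (triangle_xs k o1 o2 o3 c12 c13 c23).
Variables (u12 u13 u23 : bool).
Local Notation T := (triangle_set c12 c13 c23 u12 u13 u23).

Lemma triangle_set_mem : [/\ (c12 \in T) = u12, (c13 \in T) = u13 & (c23 \in T) = u23].
Proof.
have [n1 n2 n3] := triangle_uniq tg.
split; rewrite inE eqxx /=.
- by rewrite (negPf n1) (negPf n2) !orbF.
- by rewrite [c13 == c12]eq_sym (negPf n1) (negPf n3) !orbF.
- by rewrite [c23 == c12]eq_sym [c23 == c13]eq_sym (negPf n2) (negPf n3).
Qed.

Definition triangle_strand (i : 'I_3) : bool :=
  strands3 (u12 (+) u13) (u12 (+) u23) (u13 (+) u23) i.

Lemma triangle_strand_flip i :
  strand_flip (triangle_pass k o1 o2 o3 c12 c13 c23) T i = triangle_strand i.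
Proof.
have [m12 m13 m23] := triangle_set_mem.
by case: (ord3P i) => ->; rewrite /strand_flip /triangle_strand /triangle_pass /=;
  [case: (o1)|case: (o2)|case: (o3)]; rewrite /= ?m12 ?m13 ?m23 // addbC.
Qed.

(** [x1] and [x2] are the colours with which the strands enter the triangle. The correction of each
    is a flip at its other crossing, if that one is kept and is met before the crossing under
    consideration. *)
Definition even12 (x1 x2 : bool) : bool :=
  u12 && (x1 (+) (~~ o1 && u13) != x2 (+) (~~ o2 && u23)).
Definition even13 (x1 x3 : bool) : bool :=
  u13 && (x1 (+) (o1 && u12) != x3 (+) (~~ o3 && u23)).
Definition even23 (x2 x3 : bool) : bool :=
  u23 && (x2 (+) (o2 && u12) != x3 (+) (o3 && u13)).

Lemma triangle_evens (S : {set classical R}) tau : flips (oc @: S :|: T) tau ->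
  let x i := tau (inr (e (a i))) in
  evens T tau = triangle_set c12 c13 c23 (even12 (x i30) (x i31)) (even13 (x i30) (x i32))
                  (even23 (x i31) (x i32)).
Proof.
move=> fl x; have [m12 m13 m23] := triangle_set_mem; have [n1 n2 n3] := triangle_uniq tg.
have [h1 h2] := flips_pass ocE tg i30 fl; have [h3 h4] := flips_pass ocE tg i31 fl.
have [h5 h6] := flips_pass ocE tg i32 fl.
rewrite triangle_strand_flip /triangle_strand in h2; rewrite triangle_strand_flip /triangle_strand in h4.
rewrite triangle_strand_flip /triangle_strand in h6.
rewrite -/(x i30) in h1 h2; rewrite -/(x i31) in h3 h4; rewrite -/(x i32) in h5 h6.
move: h1 h2 h3 h4 h5 h6; rewrite /triangle_pass /strands3 /=.
move: (x i30) (x i31) (x i32) => x1 x2 x3 h1 h2 h3 h4 h5 h6.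
have d12 : u12 && (tau (inl (inl c12, false)) != tau (inl (inl c12, true))) = even12 x1 x2.
  move: h1 h2 h3 h4; rewrite /even12; case: (o1); case: (o2); case: (k) => /=;
  rewrite ?m12 ?m13 ?m23 => g1 g2 g3 g4; rewrite ?g1 ?g2 ?g3 ?g4;
  by case: (x1); case: (x2); case: (u12); case: (u13); case: (u23).
have d13 : u13 && (tau (inl (inl c13, false)) != tau (inl (inl c13, true))) = even13 x1 x3.
  move: h1 h2 h5 h6; rewrite /even13; case: (o1); case: (o3); case: (k) => /=;
  rewrite ?m12 ?m13 ?m23 => g1 g2 g3 g4; rewrite ?g1 ?g2 ?g3 ?g4;
  by case: (x1); case: (x3); case: (u12); case: (u13); case: (u23).
have d23 : u23 && (tau (inl (inl c23, false)) != tau (inl (inl c23, true))) = even23 x2 x3.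
  move: h3 h4 h5 h6; rewrite /even23; case: (o2); case: (o3); case: (k) => /=;
  rewrite ?m12 ?m13 ?m23 => g1 g2 g3 g4; rewrite ?g1 ?g2 ?g3 ?g4;
  by case: (x2); case: (x3); case: (u12); case: (u13); case: (u23).
apply/setP => y; rewrite [LHS]inE [RHS]inE -d12 -d13 -d23 [y \in _]inE.
case: (altP (y =P c12)) => [->|y12]; first by rewrite (negPf n1) (negPf n2) !orbF.
case: (altP (y =P c13)) => [->|y13]; first by rewrite (negPf n3) !orbF.
by case: (altP (y =P c23)) => [->|y23].
Qed.

End TriangleFlips.

(** Reversing the strands' orders changes the comparison at [c12] by [u13 (+) u23]. This vanishes if
    [c12] is kept, as the number of kept crossings is not 2; likewise for the other two. If all
    three are kept, the three comparisons add up to 1 modulo 2, so the number of even crossings is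
    odd. *)
Lemma even_move (u12 u13 u23 o1 o2 o3 x1 x2 x3 : bool) : (u12 + u13 + u23 != 2)%N ->
  [/\ even12 (~~ o1) (~~ o2) u12 u13 u23 x1 x2 = even12 o1 o2 u12 u13 u23 x1 x2,
      even13 (~~ o1) (~~ o3) u12 u13 u23 x1 x3 = even13 o1 o3 u12 u13 u23 x1 x3,
      even23 (~~ o2) (~~ o3) u12 u13 u23 x2 x3 = even23 o2 o3 u12 u13 u23 x2 x3
    & (even12 o1 o2 u12 u13 u23 x1 x2 + even13 o1 o3 u12 u13 u23 x1 x3
         + even23 o2 o3 u12 u13 u23 x2 x3 != 2)%N].
Proof.
by case: u12; case: u13; case: u23; case: o1; case: o2; case: o3; case: x1; case: x2; case: x3.
Qed.

Section TriangleTransfer.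

Variables (R D D' : diagram) (e : erasure R D) (e' : erasure R D').
Variables (oc : classical R -> classical D) (oc' : classical R -> classical D').
Hypotheses (ocE : forall c, on_crossing e (inl c) = inl (oc c))
  (ocE' : forall c, on_crossing e' (inl c) = inl (oc' c)).
Variables (a b : 'I_3 -> point R) (k o1 o2 o3 p1 p2 p3 : bool).
Hypotheses (e1 : p1 = ~~ o1) (e2 : p2 = ~~ o2) (e3 : p3 = ~~ o3).
Variables (c12 c13 c23 : classical D) (c12' c13' c23' : classical D').
Hypothesis tg : tangle e a b (triangle_pass k o1 o2 o3 c12 c13 c23)
  (triangle_xs k o1 o2 o3 c12 c13 c23).
Hypothesis tg' : tangle e' a b (triangle_pass k p1 p2 p3 c12' c13' c23')
  (triangle_xs k p1 p2 p3 c12' c13' c23').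
Variables (S : {set classical R}) (u12 u13 u23 : bool).
Hypothesis u2 : (u12 + u13 + u23 != 2)%N.

Lemma triangle_flips tau : flips (oc @: S :|: triangle_set c12 c13 c23 u12 u13 u23) tau ->
  exists2 tau', flips (oc' @: S :|: triangle_set c12' c13' c23' u12 u13 u23) tau' &
  exists (S0 : {set classical R}) (v12 v13 v23 : bool), [/\ (v12 + v13 + v23 != 2)%N,
    evens (oc @: S :|: triangle_set c12 c13 c23 u12 u13 u23) tau =
      oc @: S0 :|: triangle_set c12 c13 c23 v12 v13 v23
  & evens (oc' @: S :|: triangle_set c12' c13' c23' u12 u13 u23) tau' =
      oc' @: S0 :|: triangle_set c12' c13' c23' v12 v13 v23].
Proof.
move=> fl; have sT := @in_triangle _ k o1 o2 o3 c12 c13 c23 u12 u13 u23.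
have sT' := @in_triangle _ k p1 p2 p3 c12' c13' c23' u12 u13 u23.
have tw := flips_down ocE tg sT fl.
have tw' : twisted a (triangle_pass k p1 p2 p3 c12' c13' c23') S
    (triangle_set c12' c13' c23' u12 u13 u23) (tau \o carry (on_crossing e) (on_point e)).
  move=> x; rewrite tw; congr addb; apply: eq_existsb => i.
  by rewrite (triangle_strand_flip tg) (triangle_strand_flip tg').
have [tau' fl' E] := flips_up ocE' tg' sT' tw'; exists tau' => //.
pose x i := tau (inr (e (a i))).
have x' i : tau' (inr (e' (a i))) = x i by have := E (inr (a i)).
have [h1 h2 h3 h4] := even_move o1 o2 o3 (x i30) (x i31) (x i32) u2.
exists (evens S (tau \o carry (on_crossing e) (on_point e))), (even12 o1 o2 u12 u13 u23 (x i30) (x i31)),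
  (even13 o1 o3 u12 u13 u23 (x i30) (x i32)), (even23 o2 o3 u12 u13 u23 (x i31) (x i32)).
split=> //.
- by rewrite (evens_tangle ocE tg _ sT) (triangle_evens ocE tg fl).
- rewrite (evens_tangle ocE' tg' _ sT') (triangle_evens ocE' tg' fl') !x' e1 e2 e3 h1 h2 h3.
  rewrite (evens_ext S (tau := tau' \o carry (on_crossing e') (on_point e'))
    (tau' := tau \o carry (on_crossing e) (on_point e))) // => y; exact: E.
Qed.

End TriangleTransfer.

(** The induction behind parity: a colouring can be carried across a step in either direction, and
    the even crossings form a step again. A bigon of odd crossings turns into a virtual step. *)
Lemma step_flips D (S : {set classical D}) D' (S' : {set classical D'}) : step S S' ->
  (forall tau, flips S tau -> exists2 tau', flips S' tau' & step (evens S tau) (evens S' tau')) /\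
  (forall tau', flips S' tau' -> exists2 tau, flips S tau & step (evens S tau) (evens S' tau')).
Proof.
case=> {D S D' S'}.
- move=> R D e oc S ocE; split=> tau fl.
    have [tau' fl' E] := virtual_flips_up ocE fl; exists tau' => //; rewrite E; exact: StepVirtual.
  have [fl' E] := virtual_flips_down ocE fl; exists (tau \o carry (on_crossing e) (on_point e)) => //.
  by rewrite E; apply: StepVirtual.
- move=> R D e oc S a b c s ocE tg.
  have sT y : y \in [set c] -> in_tangle (kink_xs c s) y by rewrite /in_tangle /= !inE.
  have sf i : strand_flip (kink_pass c s) [set c] i = false by rewrite /strand_flip !inE eqxx.
  (* The two passages of the kink are consecutive, so their colours differ and the crossing is even
     for every colouring. *)
  have ev tau : flips (oc @: S :|: [set c]) tau ->
      evens (oc @: S :|: [set c]) tau =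
      oc @: evens S (tau \o carry (on_crossing e) (on_point e)) :|: [set c].
    move=> fl; rewrite (evens_tangle ocE tg _ sT); congr (_ :|: _).
    apply/setP => y; rewrite !inE; case: eqP => // -> /=.
    have [] := flips_pass ocE tg ord0 fl.
    rewrite sf /= !inE eqxx addbT addbF addbF; case: (s) => /= -> ->;
      by case: (tau _).
  split=> tau fl.
    have [tau' fl' E] := flips_up ocE tg sT ((twisted0 _ _ _ sf).2 fl).
    exists tau' => //; rewrite (ev _ fl') (evens_ext S (tau' := tau)); last by move=> x; rewrite /= E.
    exact: StepKink ocE tg.
  have fl' := (twisted0 _ _ _ sf).1 (flips_down ocE tg sT fl).
  by exists (tau \o carry (on_crossing e) (on_point e)) => //; rewrite ev //; apply: StepKink ocE tg.
- move=> R D e oc S a b c d s par ocE tg ov.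
  have ncd : c != d by have := t_uniq tg; rewrite /= inE andbT.
  have sT y : y \in [set c; d] -> in_tangle (bigon_xs c d s par) y by rewrite /in_tangle /= !inE.
  have sf i : strand_flip (bigon_pass c d s par) [set c; d] i = false.
    by case: (ord2P i) => ->; rewrite /strand_flip /bigon_pass /=; case: (par);
      rewrite /= set21 set22.
  (* For parallel strands the colours at both crossings differ iff those at the entrances do. For
     antiparallel strands each crossing is met first by one strand and second by the other, and the
     additional flip reverses the criterion. *)
  have ev tau : flips (oc @: S :|: [set c; d]) tau ->
      evens (oc @: S :|: [set c; d]) tau =
      oc @: evens S (tau \o carry (on_crossing e) (on_point e)) :|:
        (if (tau (inr (e (a i20))) != tau (inr (e (a i21)))) == par then [set c; d] else set0).
    move=> fl; rewrite (evens_tangle ocE tg _ sT); congr (_ :|: _).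
    have [h1 h2] := flips_pass ocE tg i20 fl.
    have [h3 h4] := flips_pass ocE tg i21 fl.
    rewrite sf in h2; rewrite sf in h4; move: h1 h2 h3 h4.
    rewrite /bigon_pass /= set21.
    move: (tau (inr (e (a i20)))) (tau (inr (e (a i21)))) => x1 x2 h1 h2 h3 h4.
    apply/setP => y; rewrite inE.
    have -> : (y \in (if (x1 != x2) == par then [set c; d] else set0)) =
        (y \in [set c; d]) && ((x1 != x2) == par).
      by case: ((x1 != x2) == par); rewrite ?andbT ?andbF // inE.
    case yT: (y \in [set c; d]) => //=.
    move: yT h1 h2 h3 h4; rewrite [y \in _]inE !in_set1 => /orP[]/eqP->; case: (par) => /=;
    rewrite ?set21 ?set22; case: (s) => /= h1 h2 h3 h4;
    by rewrite ?h1 ?h2 ?h3 ?h4; case: (x1); case: (x2).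
  have st tau (S0 : {set classical R}) : step S0 (oc @: S0 :|:
        (if (tau (inr (e (a i20))) != tau (inr (e (a i21)))) == par then [set c; d] else set0)).
    case: ifP => _; first exact: StepBigon ocE tg ov.
    by rewrite setU0; apply: StepVirtual ocE.
  split=> tau fl.
    have [tau' fl' E] := flips_up ocE tg sT ((twisted0 _ _ _ sf).2 fl).
    exists tau' => //; rewrite (ev _ fl') (evens_ext S (tau' := tau)); last by move=> x; rewrite /= E.
    exact: st.
  have fl' := (twisted0 _ _ _ sf).1 (flips_down ocE tg sT fl).
  by exists (tau \o carry (on_crossing e) (on_point e)) => //; rewrite ev //; apply: st.
- move=> R D D' e e' oc oc' S a b k o1 o2 o3 p1 p2 p3 c12 c13 c23 c12' c13' c23' u12 u13 u23.
  move=> ocE ocE' [e1 e2 e3] tg tg' ov ov' u2; split=> tau fl.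
    have [tau' fl' [S0 [v12 [v13 [v23 [v2 E E']]]]]] := triangle_flips ocE ocE' e1 e2 e3 tg tg' u2 fl.
    by exists tau' => //; rewrite E E'; apply: (StepTriangle _ ocE ocE' _ tg tg' ov ov' v2).
  have e1' : o1 = ~~ p1 by rewrite e1 negbK.
  have e2' : o2 = ~~ p2 by rewrite e2 negbK.
  have e3' : o3 = ~~ p3 by rewrite e3 negbK.
  have [tau' fl' [S0 [v12 [v13 [v23 [v2 E E']]]]]] := triangle_flips ocE' ocE e1' e2' e3' tg' tg u2 fl.
  by exists tau' => //; rewrite E E'; apply: (StepTriangle _ ocE ocE' _ tg tg' ov ov' v2).
Qed.

(** * Descent along a sequence of steps *)

Section Chains.

Definition pdiag : Type := {D : diagram & {set classical D}}.
Definition pd (D : diagram) (S : {set classical D}) : pdiag := existT _ D S.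
Definition psize (X : pdiag) : nat := #|projT2 X|.
Definition por (X : pdiag) : Prop := oriented (projT2 X).

Definition adj (X Y : pdiag) : Prop := step (projT2 X) (projT2 Y) \/ step (projT2 Y) (projT2 X).

(** The weight counts the kept crossings of all the diagrams after the first one; it is what
    decreases. Likewise [ochain] requires orientability after the first diagram only. *)
Inductive walk : pdiag -> pdiag -> nat -> Prop :=
| Walk0 X : walk X X 0
| WalkS X Y Z n : adj X Y -> walk Y Z n -> walk X Z (psize Y + n).

Inductive ochain : pdiag -> pdiag -> Prop :=
| Ochain0 X : ochain X X
| OchainS X Y Z : adj X Y -> por Y -> ochain Y Z -> ochain X Z.

Lemma adj_sym X Y : adj X Y -> adj Y X.
Proof. by case; [right|left]. Qed.

Lemma ochain_trans X Y Z : ochain X Y -> ochain Y Z -> ochain X Z.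
Proof. by elim=> // {}X X1 {}Y a o _ IH /IH; apply: OchainS. Qed.

Lemma ochain_sym X Y : por X -> ochain X Y -> ochain Y X /\ por Y.
Proof.
move=> o h; elim: h o => [{}X|{}X X1 {}Y a o1 _ IH] o; first by split=> //; apply: Ochain0.
have [h ?] := IH o1; split=> //; apply: ochain_trans h _.
by apply: OchainS (adj_sym a) o _; apply: Ochain0.
Qed.

Lemma ochain_walk X Y : ochain X Y -> exists n, walk X Y n.
Proof.
elim=> [{}X|{}X X1 {}Y a _ _ [n h]]; first by exists 0; apply: Walk0.
by eexists; apply: WalkS a h.
Qed.

Lemma walk_trans X Y Z n m : walk X Y n -> walk Y Z m -> walk X Z (n + m).
Proof.
by elim=> // {}X X1 {}Y k a _ IH /IH; rewrite -addnA; apply: WalkS.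
Qed.

Lemma walk_sym X Y n : walk X Y n -> exists m, walk Y X m.
Proof.
elim=> [{}X|{}X X1 {}Y k a _ [m h]]; first by exists 0; apply: Walk0.
by eexists; apply: walk_trans h (WalkS (adj_sym a) (Walk0 _)).
Qed.

Lemma HI_refl F D (S : {set classical D}) : HI F S S.
Proof.
apply: (HI_same (f := fun c => c) _ _ _ (Z := passage D) (io := fun x => x) (io' := fun x => x)) => //.
- by rewrite imset_id.
- move=> asg asg' h h' ea z z'; apply: Rel_ext => c; case cS: (c \in S); first by rewrite ea.
  by have := h c; have := h' c; rewrite cS; case: (asg c); case: (asg' c).
- by move=> asg _ x; exists x; apply: connect0.
- by move=> asg _ x; exists x; apply: connect0.
Qed.

Lemma ochain_HI F X Y : por X -> ochain X Y -> HI F (projT2 X) (projT2 Y).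
Proof.
move=> o h; elim: h o => [{}X|{}X X1 {}Y a o1 _ IH] o; first exact: HI_refl.
have h1 : HI F (projT2 X) (projT2 X1).
  by case: a => s; [apply: step_HI|apply: HI_sym; apply: step_HI].
exact: HI_trans o1 h1 (IH o1).
Qed.

Definition pevens (X : pdiag) tau : pdiag := pd (evens (projT2 X) tau).

Arguments pevens : clear implicits.

Lemma evens_sub (D : diagram) (S : {set classical D}) tau : evens S tau \subset S.
Proof. by apply/subsetP => c; rewrite inE => /andP[]. Qed.

Lemma pevens_size X tau : psize (pevens X tau) <= psize X.
Proof. exact/subset_leq_card/evens_sub. Qed.

Lemma pevens_eq X tau : psize X <= psize (pevens X tau) -> evens (projT2 X) tau = projT2 X.
Proof. by move=> le; apply/eqP; rewrite eqEcard evens_sub. Qed.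

Lemma pevens_id X tau : evens (projT2 X) tau = projT2 X -> pevens X tau = X.
Proof. by case: X tau => D S tau /= e; rewrite /pevens /= e. Qed.

(** Repeated passage to the even crossings, with a new colouring each time. *)
Inductive red : pdiag -> pdiag -> Prop :=
| Red0 X : red X X
| RedS X tau A : flips (projT2 X) tau -> red (pevens X tau) A -> red X A.

Lemma red_size X A : red X A -> psize A <= psize X.
Proof.
elim=> // {}X tau {}A _ _ IH; exact: leq_trans IH (pevens_size _).
Qed.

Lemma red_eq X A : red X A -> psize X <= psize A -> A = X.
Proof.
elim=> // {}X tau {}A _ r IH le.
have e := pevens_id (pevens_eq (leq_trans le (red_size r))).
by rewrite -e; apply: IH; rewrite e.
Qed.

Lemma adj_flips X Y tau : adj X Y -> flips (projT2 X) tau ->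
  exists2 tau', flips (projT2 Y) tau' & adj (pevens X tau) (pevens Y tau').
Proof.
case=> /step_flips[h1 h2]; first by move=> /h1[tau' f s]; exists tau' => //; left.
by move=> /h2[tau' f s]; exists tau' => //; right.
Qed.

(** Carrying [tau] along cannot raise the weight. If the weight stays the same, no diagram after the
    first has lost a crossing, so the carried colouring shows each of them to be oriented. *)
Lemma walk_lift X Y n tau : walk X Y n -> flips (projT2 X) tau ->
  exists2 tau', flips (projT2 Y) tau' &
  exists2 m, walk (pevens X tau) (pevens Y tau') m & m < n \/ m = n /\ ochain X Y.
Proof.
move=> h; elim: h tau => [{}X|{}X X1 {}Y k a _ IH] tau f.
  by exists tau => //; exists 0; [apply: Walk0|right; split=> //; apply: Ochain0].
have [tau1 f1 a1] := adj_flips a f; have [tau' f' [m hm lt]] := IH _ f1.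
exists tau' => //; exists (psize (pevens X1 tau1) + m); first exact: WalkS a1 hm.
have le1 := pevens_size tau1.
case: (leqP (psize X1) (psize (pevens X1 tau1))) => le; last by left; case: lt => [|[]]; lia.
case: lt => [|[em oc]]; first by left; lia.
right; split; first by lia.
by apply: OchainS a _ oc; exists tau1 => //; apply: pevens_eq.
Qed.

(** A colouring for which all crossings of [X] are even leaves [X] in place, so the passage to even
    crossings can be repeated from the same start until the weight stops falling. *)
Lemma walk_red0 n X Y : walk X Y n -> por X -> exists2 B, red Y B & ochain X B.
Proof.
elim: n {-2}n (leqnn n) X Y => [|n IH] k le X Y h [tau f e];
  have [tau' f' [m hm [lt|[_ oc]]]] := walk_lift h f; try (by exists Y; [apply: Red0|]).
  by lia.
rewrite (pevens_id e) in hm.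
have [|B r o] := IH m _ _ _ hm (ex_intro2 _ _ tau f e); first by lia.
by exists B => //; apply: RedS f' r.
Qed.

Lemma walk_red X Y n A : walk X Y n -> red X A -> por A -> exists2 B, red Y B & ochain A B.
Proof.
move=> h r; elim: r Y n h => [{}X|{}X tau {}A f _ IH] Y n h o; first exact: walk_red0 h o.
have [tau' f' [m hm _]] := walk_lift h f.
by have [B r oc] := IH _ _ hm o; exists B => //; apply: RedS f' r.
Qed.

(** By the oriented chains it suffices to compare [A] and [A']. Carrying the reduction of [X'] to
    [A'] along the chain to [A] yields [A2], a reduction of [A] linked to [A']; [A2'] arises
    symmetrically. The hypotheses therefore hold for [A] and [A'], which are both strictly smaller,
    unless [A' = X'] or [A = X], where a chain already suffices. *)
Lemma oriented_pair F n X X' A A' : psize X + psize X' <= n ->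
  por X -> por X' -> por A -> por A' ->
  ochain X A' -> red X' A' -> ochain X' A -> red X A -> HI F (projT2 X) (projT2 X').
Proof.
elim: n X X' A A' => [|n IH] X X' A A' le oX oX' oA oA' c1 r1 c2 r2;
  (case: (leqP (psize X') (psize A')) => l1; first by rewrite -(red_eq r1 l1); apply: ochain_HI);
  (case: (leqP (psize X) (psize A)) => l2;
     first by rewrite -(red_eq r2 l2); apply: HI_sym; apply: ochain_HI); first by lia.
have [k2 h2] := ochain_walk c2; have [k1 h1] := ochain_walk c1.
have [A2 q2 d2] := walk_red h2 r1 oA'; have [A2' q2' d2'] := walk_red h1 r2 oA.
have oA2 := (ochain_sym oA' d2).2; have oA2' := (ochain_sym oA d2').2.
have H : HI F (projT2 A) (projT2 A').
  by apply: (IH A A' A2 A2') => //; lia.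
apply: HI_trans oA' (ochain_HI oX c1) _; apply: HI_trans oA (HI_sym H) _.
by apply: HI_sym; apply: ochain_HI.
Qed.

Lemma walk_HI F n X X' : walk X X' n -> por X -> por X' -> HI F (projT2 X) (projT2 X').
Proof.
move=> h oX oX'; have [m h'] := walk_sym h.
have [A' r1 c1] := walk_red0 h oX; have [A r2 c2] := walk_red0 h' oX'.
apply: (oriented_pair (leqnn _) oX oX' _ _ c1 r1 c2 r2).
  exact: (ochain_sym oX' c2).2.
exact: (ochain_sym oX c1).2.
Qed.

End Chains.

Section Moves.

Definition all_kept (D : diagram) : pdiag := pd [set: classical D].

Lemma virtual_adj (R D : diagram) (e : erasure R D) :
  (forall c, inl c \notin erased_crossings e) -> step [set: classical R] [set: classical D].
Proof.
move=> ne; have [oc ocE] := ex_on_classical e.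
suff <- : oc @: [set: classical R] = [set: classical D] by apply: StepVirtual ocE.
apply/setP => c; rewrite inE; apply/imsetP; have := ne c; rewrite inE negbK => /codomP[[d|d] E].
  by exists d => //; move: E; rewrite ocE => -[].
by have /= := erasure_kind e (inr d); rewrite -E.
Qed.

Lemma erased_setT (R D : diagram) (e : erasure R D) oc (T : {set classical D}) :
  (forall c, on_crossing e (inl c) = inl (oc c)) ->
  (forall c, inl c \in erased_crossings e -> c \in T) ->
  oc @: [set: classical R] :|: T = [set: classical D].
Proof.
move=> ocE h; apply/setP => c; rewrite [RHS]inE inE.
case: (boolP (inl c \in erased_crossings e)) => [/h->|]; first by rewrite orbT.
rewrite inE negbK => /codomP[[d|d] E].
  by move: E; rewrite ocE => -[->]; rewrite imset_f.
by have /= := erasure_kind e (inr d); rewrite -E.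
Qed.

Lemma move_adj (L L' : virtual_diagram) : move L L' ->
  exists n, walk (all_kept L) (all_kept L') n.
Proof.
have one X Y : adj X Y -> exists n, walk X Y n.
  by move=> a; exists (psize Y + 0); apply: WalkS a (Walk0 _).
case=> [[e ec]|[]].
- by apply: one; left; apply: (virtual_adj (e := e)) => c; rewrite ec inE.
- move=> [R [e [e' [a [b [t [t' [_ [_ _ vt ec] [_ _ vt' ec']]]]]]]]].
  have K (D : diagram) (u : seq (crossing D * bool)) c : all (fun x => kind x.1 == None) u ->
      inl c \notin [set x.1 | x in u].
    by move=> /allP h; apply/imsetP => -[x /h]; case: x => x s /= k E; rewrite -E in k.
  (* A detour is an erasure of virtual crossings down to [R] followed by an insertion. Steps accept
     arbitrary diagrams, so that [R] may fail to be planar. *)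
  exists (psize (all_kept R) + (psize (all_kept L') + 0)); apply: WalkS; last apply: WalkS; last exact: Walk0.
  + by right; apply: (virtual_adj (e := e)) => c; rewrite ec; apply: K.
  + by left; apply: (virtual_adj (e := e')) => c; rewrite ec'; apply: K.
- move=> [e [a [b [c [s [st1 st2 ep ec]]]]]]; apply: one; left => /=.
  have [oc ocE] := ex_on_classical e.
  have tg := kink_tangle st2 ep ec.
  rewrite -(erased_setT (T := [set c]) ocE); first exact: StepKink ocE tg.
  by move=> d; rewrite ec !inE => /eqP[->].
- move=> [e [a1 [b1 [a2 [b2 [c [d [s [par /= [_ st1 st2 ov [ep ec]]]]]]]]]]]; apply: one; left => /=.
  have [oc ocE] := ex_on_classical e.
  have cd : c != d by apply: contra_eqN ov => /eqP->; case: (over_strand d).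
  have tg := bigon_tangle st1 st2 cd ep ec.
  rewrite -(erased_setT (T := [set c; d]) ocE); first exact: StepBigon ocE tg ov.
  by move=> y; rewrite ec !inE => /orP[]/eqP[->]; rewrite eqxx ?orbT.
- move=> [R [e [e' [a1 [b1 [a2 [b2 [a3 [b3 [k [o1 [o2 [o3 [c12 [c13 [c23 [c12' [c13' [c23'
    [tr tr' [ep ep'] ec ec']]]]]]]]]]]]]]]]]]]]; apply: one; left => /=.
  have [oc ocE] := ex_on_classical e; have [oc' ocE'] := ex_on_classical e'.
  have tg := triangle_tangle tr ep ec; have tg' := triangle_tangle tr' ep' ec'.
  rewrite -(erased_setT (T := triangle_set c12 c13 c23 true true true) ocE); last first.
    by move=> y; rewrite ec !inE -orbA => /or3P[]/eqP[->]; rewrite eqxx ?orbT.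
  rewrite -(erased_setT (T := triangle_set c12' c13' c23' true true true) ocE'); last first.
    by move=> y; rewrite ec' !inE -orbA => /or3P[]/eqP[->]; rewrite eqxx ?orbT.
  case: tr tr' => _ ov _ _ _ [_ ov' _ _ _].
  by apply: (StepTriangle _ ocE ocE' _ tg tg' ov ov').
Qed.

Lemma equivalent_walk (L L' : virtual_diagram) : equivalent L L' ->
  exists n, walk (all_kept L) (all_kept L') n.
Proof.
elim=> [x y /move_adj//|x|x y _ [n h]|x y z _ [n h] _ [m h']].
- by exists 0; apply: Walk0.
- exact: walk_sym h.
- by exists (n + m); apply: walk_trans h h'.
Qed.

Theorem equivalent_HI F (L L' : virtual_diagram) : equivalent L L' ->
  oriented [set: classical L] -> oriented [set: classical L'] ->
  HI F [set: classical L] [set: classical L'].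
Proof. by move=> /equivalent_walk[n h] o o'; apply: (walk_HI h). Qed.

End Moves.

(** * Orientability of the atom *)

Section Orientable.

Variable D : diagram.
Local Notation next := (next_passage D).

Definition classical_slot (x : classical D * bool) : passage D := inl (inl x.1, x.2).

Lemma classical_slot_inj : injective classical_slot.
Proof. by move=> [c s] [c' s'] [-> ->]. Qed.

Lemma classical_slotE x : classical_passage x = (x \in codom classical_slot).
Proof.
case: x => [[[c|c] s]|p] /=; symmetry; [exact: (codom_f classical_slot (c, s))| |];
  by apply/codomP => -[].
Qed.

Lemma kept_setT x : kept [set: classical D] x = (x \in codom classical_slot).
Proof. by rewrite -classical_slotE; case: x => [[[c|c] s]|p] //=; rewrite inE. Qed.

(** The colour of an edge is the sign of the black flag at the half-edge where it leaves a classical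
    crossing. The corners give opposite signs to the two strands of a crossing ([gm]) and equal
    signs to both halves of a strand ([gi]); across an edge the sign changes. The first makes every
    crossing even, the others give [flips]. *)
Lemma orientable_oriented : orientable (atom_of D) -> oriented [set: classical D].
Proof.
case=> sg [fe cm ca]; pose g (x : classical D * bool) := sg (x, true) true.
have ca' h : sg h true = ~~ sg h false by rewrite ca negbK.
have gm c s out : sg (c, ~~ s, out) true = ~~ sg (c, s, out) true.
  case o: (over_strand c).
    have := cm (c, s, out) false; rewrite /= /angle_mate /turn /= o !ca' negbK.
    by case: (s); case: (out) => /= ->; rewrite ?negbK.
  have := cm (c, s, out) true; rewrite /= /angle_mate /turn /= o.
  by case: (s); case: (out) => /= ->.
have gi c s : sg (c, s, false) true = sg (c, s, true) true.
  have g0 := gm c false false; have g1 := gm c false true; rewrite /= in g0 g1.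
  case o: (over_strand c).
    have := cm (c, s, true) true; rewrite /= /angle_mate /turn /= o.
    by case: (s); rewrite /= ?g0 ?g1; case: (sg _ _); case: (sg _ _).
  have := cm (c, s, true) false; rewrite /= /angle_mate /turn /= o !ca.
  by case: (s); rewrite /= ?g0 ?g1; case: (sg _ _); case: (sg _ _).
pose seg y x := in_seg next classical_slot y x.
(* The colour is constant along a segment between classical crossings. Passages on no such segment
   lie on curves without classical crossings and all get [false]. *)
have ex y : exists t, (forall x, seg y x -> t = g x) /\ ((forall x, ~ seg y x) -> t = false).
  case: (Classical_Prop.classic (exists x, seg y x)) => [[x h]|n].
    exists (g x); split=> [x' h'|n]; last by case: (n x).
    by rewrite (seg_uniq classical_slot_inj h h').
  by exists false; split=> [x h|//]; case: n; exists x.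
have [tau ht] := fin_all_exists ex.
have tc x : tau (classical_slot x) = g x by have [h _] := ht (classical_slot x); apply: h; exists 0.
have ex_seg' x0 y : fconnect next (classical_slot x0) y -> exists x, seg y x.
  move=> /iter_findex <-; elim: (findex _ _ _) => [|m [x' [n [e h]]]]; first by exists x0, 0.
  case: (boolP (iter m.+1 next (classical_slot x0) \in codom classical_slot)) => [/codomP[z ez]|nc].
    by exists z, 0; rewrite -ez.
  exists x', n.+1; rewrite iterS e; split=> // i; rewrite ltnS leq_eqVlt => /orP[/eqP->|/h//].
  by rewrite iterS -e -iterS.
exists tau; last first.
  by apply/setP => c; rewrite !inE /=; have := tc (c, false); have := tc (c, true);
     rewrite /classical_slot /= /g (gm c false) => -> ->; case: (sg _ _).
move=> y; rewrite kept_setT; case: (boolP (next y \in codom classical_slot)) => [/codomP[x' ex']|nc].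
  have [x hx] : exists x, seg y x.
    apply: (ex_seg' x'); rewrite -ex' fconnect_sym; last exact: perm_inj.
    exact: fconnect1.
  rewrite ex' tc addbT; have [hy _] := ht y; rewrite (hy _ hx).
  move: hx ex'; case: x => c s; case: x' => c' s' hx ex'.
  have [n [e h]] := hx; rewrite /g -gi; apply: fe; split=> //=.
  exists n; split=> //; first by rewrite -[LHS]ex' iterS; congr (next _).
  by move=> i /h; rewrite classical_slotE.
rewrite addbF; case: (Classical_Prop.classic (exists x, seg y x)) => [[x hx]|n].
  have [hy _] := ht y; rewrite (hy _ hx).
  have [h _] := ht (next y); apply: h; have [n [e h]] := hx; exists n.+1; rewrite iterS -e.
  split=> // i; rewrite ltnS leq_eqVlt => /orP[/eqP->|/h//].
  by rewrite iterS -e.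
have [_ ->] := ht y; last by move=> x h; case: n; exists x.
have [_ -> //] := ht (next y); move=> x [[|m] [e h]]; first by rewrite e /= codom_f in nc.
case: n; exists x, m; split; first by apply: (@perm_inj _ next); rewrite e.
by move=> i hi; apply: h; apply: ltnW.
Qed.

End Orientable.

(** * Comparison with the Khovanov complex *)

Local Open Scope ring_scope.

Section EdgeCoefficient.

Variables (F : fieldType) (T : finType).
Implicit Types (K P : {set T}).

Definition ecoef K K' P P' : F :=
  if [forall C in K :&: K', (C \in P) == (C \in P')] then
    match enum (K :\: K'), enum (K' :\: K) with
    | [:: C1; C2], [:: C] => m_coef F (C1 \in P) (C2 \in P) (C \in P')
    | [:: C], [:: C1; C2] => Delta_coef F (C \in P) (C1 \in P') (C2 \in P')
    | _, _ => 0
    end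
  else 0.

Lemma enum_set2 (A B : T) : A != B -> enum [set A; B] = [:: A; B] \/ enum [set A; B] = [:: B; A].
Proof.
move=> AB; have : perm_eq (enum [set A; B]) [:: A; B].
  apply: uniq_perm; rewrite ?enum_uniq //= ?inE ?AB // => x.
  by rewrite mem_enum !inE.
move: (enum _) => s ps; have := perm_size ps; case: s ps => [|x [|y [|]]] //= ps _.
have := perm_mem ps x; rewrite !inE eqxx => /esym/orP[]/eqP e; subst x.
  move: ps; rewrite perm_cons => /perm_mem/(_ y); rewrite !inE eqxx => /esym/eqP->.
  by left.
right; congr [:: _; _]; have : perm_eq [:: B; y] [:: B; A].
  by apply: (perm_trans ps); rewrite (perm_catC [:: A] [:: B]).
by rewrite perm_cons => /perm_mem/(_ y); rewrite !inE eqxx => /esym/eqP.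
Qed.

Lemma m_coefC x y z : m_coef F x y z = m_coef F y x z.
Proof. by case: x; case: y; case: z. Qed.

Lemma Delta_coefC x y z : Delta_coef F x y z = Delta_coef F x z y.
Proof. by case: x; case: y; case: z. Qed.

Variables (N : {set T}) (A B C : T).
Hypotheses (AB : A != B) (AN : A \notin N) (BN : B \notin N) (CN : C \notin N)
  (CA : C != A) (CB : C != B).

Let KA := [set A; B] :|: N.
Let KC := C |: N.

Lemma ecoef_common : KA :&: KC = N.
Proof.
apply/setP => x; rewrite !inE; case: (boolP (x \in N)) => xN; rewrite ?orbT //= !orbF.
by case: (eqVneq x C) => [->|_]; rewrite ?andbF // (negPf CA) (negPf CB).
Qed.

Lemma ecoef_diffA : KA :\: KC = [set A; B].
Proof.
apply/setP => x; rewrite !inE; case: (boolP (x \in N)) => xN.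
  by rewrite orbT /=; apply/esym/negP => /orP[]/eqP E; move: AN BN; rewrite -E xN.
rewrite !orbF; case: (eqVneq x C) => [->|_] //=.
by rewrite (negPf CA) (negPf CB).
Qed.

Lemma ecoef_diffC : KC :\: KA = [set C].
Proof.
apply/setP => x; rewrite !inE; case: (boolP (x \in N)) => xN.
  by rewrite orbT /=; apply/esym/negP => /eqP E; move: CN; rewrite -E xN.
rewrite !orbF; case: (eqVneq x C) => [->|_]; rewrite ?andbF //.
by rewrite (negPf CA) (negPf CB).
Qed.

Lemma ecoef_merge P P' : ecoef KA KC P P' =
  if P :&: N == P' :&: N then m_coef F (A \in P) (B \in P) (C \in P') else 0.
Proof.
rewrite /ecoef ecoef_common ecoef_diffA ecoef_diffC enum_set1.
have -> : [forall D in N, (D \in P) == (D \in P')] = (P :&: N == P' :&: N).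
  apply/forall_inP/eqP => [h|/setP h D DN].
    by apply/setP => D; rewrite !inE; case DN: (D \in N); rewrite ?andbF // (eqP (h D DN)).
  by have := h D; rewrite !inE DN !andbT => ->.
by case: ifP => // _; case: (enum_set2 AB) => -> //; rewrite m_coefC.
Qed.

Lemma ecoef_split P P' : ecoef KC KA P P' =
  if P :&: N == P' :&: N then Delta_coef F (C \in P) (A \in P') (B \in P') else 0.
Proof.
rewrite /ecoef setIC ecoef_common ecoef_diffA ecoef_diffC enum_set1.
have -> : [forall D in N, (D \in P) == (D \in P')] = (P :&: N == P' :&: N).
  apply/forall_inP/eqP => [h|/setP h D DN].
    by apply/setP => D; rewrite !inE; case DN: (D \in N); rewrite ?andbF // (eqP (h D DN)).
  by have := h D; rewrite !inE DN !andbT => ->.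
by case: ifP => // _; case: (enum_set2 AB) => -> //; rewrite Delta_coefC.
Qed.

Variable g : {set T} -> F.

Definition opt1 (x : T) (b : bool) : {set T} := if b then [set x] else set0.

Lemma in_opt1 x y b : (y \in opt1 x b) = (y == x) && b.
Proof. by case: b; rewrite inE ?andbT ?andbF. Qed.

(** Only the sets [P] that agree with [P'] on the common circles contribute. They are determined by
    whether they contain [A] and [B], which leaves four terms of the multiplication table. *)
Lemma sum_merge P' : P' \subset KC ->
  \sum_(P : {set T} | P \subset KA) ecoef KA KC P P' * g P =
  if C \in P' then g (A |: (B |: P' :\ C)) else g (A |: P') + g (B |: P').
Proof.
move=> sP; set Q := P' :&: N.
have qE x : (x \in Q) = (x \in P') && (x \in N) by rewrite inE.
have xNA x : x \in N -> (x == A) = false by move=> xN; apply: contraNF AN => /eqP<-.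
have xNB x : x \in N -> (x == B) = false by move=> xN; apply: contraNF BN => /eqP<-.
pose mk (ab : bool * bool) := opt1 A ab.1 :|: opt1 B ab.2 :|: Q.
have inmk x ab : (x \in mk ab) = [|| (x == A) && ab.1, (x == B) && ab.2 | x \in Q].
  by rewrite !inE !in_opt1 -orbA.
have mkA ab : (A \in mk ab) = ab.1.
  by rewrite inmk eqxx (negPf AB) qE (negPf AN) andbF /= orbF.
have mkB ab : (B \in mk ab) = ab.2.
  by rewrite inmk eqxx [B == A]eq_sym (negPf AB) qE (negPf BN) andbF /= orbF.
have mkN ab : mk ab :&: N = Q.
  apply/setP => x; rewrite inE inmk qE; case xN: (x \in N); last by rewrite !andbF.
  by rewrite xNA // xNB // andbT.
have mkK ab : mk ab \subset KA.
  by apply/subsetP => x; rewrite inmk qE !inE => /or3P[/andP[->]|/andP[->]|/andP[_ ->]]; rewrite ?orbT.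
rewrite (bigID (fun P : {set T} => P :&: N == Q)) /= [X in _ + X]big1 ?addr0; last first.
  by move=> P /andP[_ /negPf n]; rewrite ecoef_merge n mul0r.
rewrite (reindex_onto mk (fun P : {set T} => (A \in P, B \in P))) /=; last first.
  move=> P /andP[/subsetP sK /eqP E]; apply/setP => x; rewrite inmk qE /=.
  case: (eqVneq x A) => [->|nA] /=; first by rewrite -qE -E inE (negPf AN) andbF orbF (negPf AB) orbF.
  case: (eqVneq x B) => [->|nB] /=; first by rewrite -qE -E inE (negPf BN) andbF orbF.
  rewrite -qE -E inE; case xP: (x \in P) => //=.
  by move: (sK x xP); rewrite !inE (negPf nA) (negPf nB).
have -> : \sum_(j | (mk j \subset KA) && (mk j :&: N == Q) && ((A \in mk j, B \in mk j) == j))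
     ecoef KA KC (mk j) P' * g (mk j) =
   \sum_(j : bool * bool) m_coef F j.1 j.2 (C \in P') * g (mk j).
  apply: eq_big => j; first by rewrite mkK mkN mkA mkB eqxx -surjective_pairing eqxx.
  by move=> _; rewrite ecoef_merge mkN eqxx mkA mkB.
rewrite -(pair_bigA _ (fun x y => m_coef F x y (C \in P') * g (mk (x, y)))) /=.
rewrite !big_bool /=; case: ifP => CP; rewrite /= ?mul1r ?mul0r ?addr0 ?add0r.
  congr (g _); apply/setP => x; rewrite inmk qE !inE !andbT; congr [|| _, _ | _].
  case: (eqVneq x C) => [->|nC]; first by rewrite (negPf CN) andbF.
  case xP: (x \in P') => //=; move/subsetP: sP => /(_ x xP); rewrite !inE (negPf nC) //.
have PQ : P' = Q.
  apply/setP => x; rewrite inE; case xP: (x \in P') => //=.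
  move/subsetP: sP => /(_ x xP); rewrite !inE; case: eqP => // E; by rewrite -E xP in CP.
congr (g _ + g _); apply/setP => x; rewrite inmk PQ !in_setU !in_set1 ?andbT ?andbF ?orbF /=; by [].
Qed.

Lemma sum_split P' : P' \subset KA ->
  \sum_(P : {set T} | P \subset KC) ecoef KC KA P P' * g P =
  if A \in P' then (if B \in P' then 0 else g (C |: P' :\ A))
  else if B \in P' then g (C |: P' :\ B) else g P'.
Proof.
move=> sP; set Q := P' :&: N.
have qE x : (x \in Q) = (x \in P') && (x \in N) by rewrite inE.
have xNC x : x \in N -> (x == C) = false by move=> xN; apply: contraNF CN => /eqP<-.
pose mk (c : bool) := opt1 C c :|: Q.
have inmk x c : (x \in mk c) = ((x == C) && c) || (x \in Q) by rewrite inE in_opt1.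
have mkC c : (C \in mk c) = c by rewrite inmk eqxx qE (negPf CN) andbF orbF.
have mkN c : mk c :&: N = Q.
  apply/setP => x; rewrite inE inmk qE; case xN: (x \in N); last by rewrite !andbF.
  by rewrite xNC // andbT.
have mkK c : mk c \subset KC.
  by apply/subsetP => x; rewrite inmk qE !inE => /orP[/andP[->]|/andP[_ ->]]; rewrite ?orbT.
rewrite (bigID (fun P : {set T} => P :&: N == Q)) /= [X in _ + X]big1 ?addr0; last first.
  by move=> P /andP[_ /negPf n]; rewrite ecoef_split n mul0r.
rewrite (reindex_onto mk (fun P : {set T} => C \in P)) /=; last first.
  move=> P /andP[/subsetP sK /eqP E]; apply/setP => x; rewrite inmk qE.
  case: (eqVneq x C) => [->|nC] /=; first by rewrite -qE -E inE (negPf CN) andbF orbF.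
  rewrite -qE -E inE; case xP: (x \in P) => //=.
  by move: (sK x xP); rewrite !inE (negPf nC).
have -> : \sum_(j | (mk j \subset KC) && (mk j :&: N == Q) && ((C \in mk j) == j))
     ecoef KC KA (mk j) P' * g (mk j) =
   \sum_(j : bool) Delta_coef F j (A \in P') (B \in P') * g (mk j).
  apply: eq_big => j; first by rewrite mkK mkN mkC !eqxx.
  by move=> _; rewrite ecoef_split mkN eqxx mkC.
have hx x : x \in P' -> [|| x == A, x == B | x \in N].
  by move/(subsetP sP); rewrite !inE -orbA.
rewrite big_bool /=; case: ifP => AP; case: ifP => BP; rewrite /= ?mul1r ?mul0r ?addr0 ?add0r //;
  congr (g _); apply/setP => x; rewrite inmk qE ?inE ?andbT ?andbF /=.
- congr (_ || _); case: (eqVneq x A) => [->|nA]; first by rewrite (negPf AN) andbF.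
  case xP: (x \in P') => //=; move: (hx x xP); rewrite (negPf nA) /=.
  by case: eqP => // E; rewrite -E xP in BP.
- congr (_ || _); case: (eqVneq x B) => [->|nB]; first by rewrite (negPf BN) andbF.
  case xP: (x \in P') => //=; move: (hx x xP); rewrite (negPf nB) /=.
  by case: eqP => // E; rewrite -E xP in AP.
- case xP: (x \in P') => //=; move: (hx x xP).
  by case: eqP => [E|_]; [rewrite -E xP in AP|case: eqP => // E; rewrite -E xP in BP].
Qed.

End EdgeCoefficient.

(** * Coefficients of a tensor on sets of circles *)

Section Circles.

Variables (F : fieldType) (X Y : finType) (edge : Y -> X).
Hypothesis edge_surj : forall x, exists h, edge h = x.
Implicit Types (R : rel X) (K P : {set {set Y}}) (C : {set Y}) (f : Rg F X).

Definition circ R (x : X) : {set Y} := [set h | R x (edge h)].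
Definition circs R : {set {set Y}} := [set circ R x | x : X].

Lemma mem_circs R x : circ R x \in circs R.
Proof. exact: imset_f. Qed.

Lemma circ_eq R a b : eqv R -> (circ R a == circ R b) = R a b.
Proof.
move=> [r s t]; apply/eqP/idP => [E|ab].
  have [h hb] := edge_surj b; have : h \in circ R b by rewrite inE hb.
  by rewrite -E inE hb.
apply/setP => h; rewrite !inE; apply/idP/idP; first by apply: t; rewrite s.
exact: t.
Qed.

(** A tensor is evaluated on a set of circles by choosing one point on each; by [TR] its value is
    independent of the choice. *)
Definition rep C : option X := omap edge [pick h in C].

Lemma repP R C : eqv R -> C \in circs R -> exists2 x, rep C = Some x & circ R x = C.
Proof.
move=> er /imsetP[x _ ->]; have [r _ _] := er; rewrite /rep; case: pickP => [h|] /=.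
  rewrite inE => xh; exists (edge h) => //; apply/eqP; rewrite circ_eq //.
  by case: er => _ -> _.
by have [h hx] := edge_surj x; move=> /(_ h); rewrite inE hx r.
Qed.

Definition reps K : {set X} := [set x | Some x \in [set rep C | C in K]].

Lemma repsP K x : reflect (exists2 C, C \in K & rep C = Some x) (x \in reps K).
Proof.
by rewrite inE; apply: (iffP imsetP) => -[C h1 h2]; exists C.
Qed.

Lemma repsU1 C K x : rep C = Some x -> reps (C |: K) = x |: reps K.
Proof.
move=> e; apply/setP => y; rewrite in_setU1; apply/repsP/orP.
  move=> [D]; rewrite in_setU1 => /orP[/eqP->|DK eD]; first by rewrite e => -[->]; left.
  by right; apply/repsP; exists D.
case=> [/eqP->|/repsP[D DK eD]]; first by exists C; rewrite ?setU11.
by exists D; rewrite // in_setU1 DK orbT.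
Qed.

Lemma not_reps R K x : eqv R -> K \subset circs R -> circ R x \notin K -> x \notin reps K.
Proof.
move=> er /subsetP sK; apply: contra => /repsP[C CK eC].
have [y] := repP er (sK C CK); rewrite eC => -[<-] E.
by rewrite E.
Qed.

Section Fix.

Variable R : rel X.
Hypothesis er : eqv R.
Local Notation Z := {C | C \in circs R}.

Lemma ex_io : exists io : Z -> X, [/\ injective io, forall z, rep (val z) = Some (io z),
  forall z, circ R (io z) = val z, forall x, exists z, R x (io z)
  & forall K, K \subset circs R -> reps K = io @: [set z : Z | val z \in K]].
Proof.
have ex (z : Z) : exists x, rep (val z) = Some x /\ circ R x = val z.
  by have [x] := repP er (valP z); exists x.
have [io ioP] := fin_all_exists ex.
have i1 z : rep (val z) = Some (io z) by have [] := ioP z.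
have i2 z : circ R (io z) = val z by have [] := ioP z.
exists io; split=> //.
- by move=> z z' e; apply: val_inj; rewrite -!i2 e.
- by move=> x; exists (Sub (circ R x) (mem_circs R x)); rewrite -(circ_eq _ _ er) i2 SubK.
- move=> K /subsetP sK; apply/setP => x; apply/repsP/imsetP => [[C CK eC]|[z]].
    exists (Sub C (sK C CK)); first by rewrite inE SubK.
    by have := i1 (Sub C (sK C CK)); rewrite SubK eC => -[].
  by rewrite inE => zK ->; exists (val z).
Qed.

Lemma io_set (V : {set Z}) : [set val z | z in V] \subset circs R /\
  [set z : Z | val z \in [set val z | z in V]] = V.
Proof.
split; first by apply/subsetP => C /imsetP[z _ ->]; apply: valP.
by apply/setP => z; rewrite inE mem_imset //; apply: val_inj.
Qed.

Lemma reps_inj f : TR R f -> (forall K, K \subset circs R -> f (reps K) = 0) -> f = 0.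
Proof.
move=> hf h0; have [io [i1 i2 i3 i4 i5]] := ex_io.
apply: (res_inj i1 i4 hf); apply/ffunP => V; rewrite !ffunE.
by have [sV eV] := io_set V; rewrite -{1}eV -i5 // h0.
Qed.

Lemma reps_surj (g : {set {set Y}} -> F) :
  exists2 f, TR R f & forall K, K \subset circs R -> f (reps K) = g K.
Proof.
have [io [i1 i2 i3 i4 i5]] := ex_io.
pose gZ : Rg F Z := [ffun V : {set Z} => g [set val z | z in V]].
pose RZ : rel Z := fun z z' => R (io z) (io z').
have tZ : TR RZ gZ.
  by move=> z z'; rewrite /RZ -(circ_eq _ _ er) !i3 => /eqP/val_inj->.
have [f hf e] := res_surj i1 er (fun z z' => erefl (RZ z z')) i4 tZ.
exists f => // K sK; rewrite (i5 K sK); have := congr1 (fun h : Rg F Z => h [set z : Z | val z \in K]) e.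
rewrite !ffunE => ->; congr g; apply/setP => C; apply/imsetP/idP => [[z]|CK].
  by rewrite inE => zK ->.
by exists (Sub C (subsetP sK C CK)); rewrite ?inE SubK.
Qed.

Lemma reps_repr f (U : {set X}) : TR R f -> f U != 0 ->
  exists K, [/\ K \subset circs R, f (reps K) = f U & #|K| = #|U|].
Proof.
move=> hf nz; have [io [i1 i2 i3 i4 i5]] := ex_io.
have [V e c] := res_repr i1 i4 hf nz; have [sV eV] := io_set V.
exists [set val z | z in V]; split=> //; first by rewrite i5 // eV.
by rewrite card_imset //; apply: val_inj.
Qed.

Lemma card_reps K : K \subset circs R -> #|reps K| = #|K|.
Proof.
move=> sK; have [io [i1 i2 i3 i4 i5]] := ex_io.
rewrite i5 // card_imset // -(card_imset _ (val_inj : injective (val : Z -> _))).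
apply: eq_card => C; apply/imsetP/idP => [[z]|CK]; first by rewrite inE => zK ->.
by exists (Sub C (subsetP sK C CK)); rewrite ?inE SubK.
Qed.

Lemma card_circs : #|circs R| = #|classes R|.
Proof.
have -> : circs R = [set edge @^-1: (A : {set X}) | A in classes R].
  apply/setP => C; apply/imsetP/imsetP => [[x _ ->]|[A /imsetP[x _ ->] ->]].
    by exists [set y | R x y]; [apply: imset_f|apply/setP => h; rewrite !inE].
  by exists x => //; apply/setP => h; rewrite !inE.
apply: card_in_imset => A B /imsetP[x _ ->] /imsetP[y _ ->] /setP E.
apply/setP => z; have [h <-] := edge_surj z; have := E h; by rewrite !inE.
Qed.

Lemma TR_same f (U : {set X}) a b : TR R f -> R a b -> a != b -> a \in U -> b \in U -> f U = 0.
Proof.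
move=> hf ab nab aU bU; have := congr1 (fun g : Rg F X => g (U :\ a)) (hf _ _ ab).
by rewrite !ffunE setD11 setD1K // !inE eq_sym nab bU.
Qed.

Lemma TR_move f (U : {set X}) a b : TR R f -> R a b -> a \notin U -> b \notin U -> f (a |: U) = f (b |: U).
Proof.
move=> hf ab /negPf aU /negPf bU; have := congr1 (fun g : Rg F X => g U) (hf _ _ ab).
by rewrite !ffunE aU bU.
Qed.

End Fix.

Section Merge.

Variables (R R' : rel X) (p q : X).
Hypotheses (er : eqv R) (er' : eqv R') (m : merge p q R R').
Let N := circs R :&: circs R'.

Lemma merge_circles : [/\ circs R = [set circ R p; circ R q] :|: N, circs R' = circ R' p |: N,
  circ R p \notin N /\ circ R q \notin N & circ R' p \notin N].
Proof.
have [npq mE] := m; have [r s t] := er; have [r' s' t'] := er'.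
have pq' := merge_pq er m.
have nC R1 R2 x y : eqv R1 -> eqv R2 -> circ R1 x = circ R2 y -> forall z, R1 x z = R2 y z.
  move=> e1 e2 /setP E z; have [h <-] := edge_surj z; have := E h; by rewrite !inE.
have xpq x : R' x p -> R x p \/ R x q.
  by rewrite mE => /or3P[->|/andP[->]|/andP[->]]; auto.
have h1 x : ~~ R' x p -> circ R x = circ R' x.
  rewrite mE !negb_or => /and3P[np _]; rewrite r andbT => nq.
  by apply/setP => h; rewrite !inE mE (negPf np) (negPf nq) !orbF.
have n1 : circ R p \notin circs R'.
  apply/imsetP => -[y _ /(nC _ _ _ _ er er') E]; case/negP: npq.
  by rewrite E; apply: t' pq'; rewrite -E.
have n2 : circ R q \notin circs R'.
  apply/imsetP => -[y _ /(nC _ _ _ _ er er') E]; case/negP: npq; rewrite s E.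
  by apply: (t' q); rewrite ?[R' q p]s' // -E.
have n3 : circ R' p \notin circs R.
  apply/imsetP => -[y _ /(nC _ _ _ _ er' er) E]; case/negP: npq.
  by apply: (t y); [rewrite s -E|rewrite -E].
split.
- apply/setP => C; rewrite !inE; apply/idP/idP => [/imsetP[x _ ->]|].
    case: (boolP (R' x p)) => [/xpq[xp|xq]|/h1 E]; rewrite ?(circ_eq _ _ er) ?xp ?xq ?orbT //.
    by rewrite mem_circs E mem_circs orbT.
  by move=> /orP[/orP[]/eqP->|/andP[]//]; apply: mem_circs.
- apply/setP => C; rewrite !inE; apply/idP/idP => [/imsetP[x _ ->]|].
    case: (boolP (R' x p)) => [xp|/h1 E]; first by rewrite (circ_eq _ _ er') xp.
    by rewrite -{2}E mem_circs mem_circs orbT.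
  by move=> /orP[/eqP->|/andP[]//]; apply: mem_circs.
- by rewrite !inE (negPf n1) (negPf n2) !andbF.
- by rewrite inE (negPf n3).
Qed.

Let C1 := circ R p.
Let C2 := circ R q.
Let C0 := circ R' p.

Lemma merge_distinct : [/\ C1 != C2, C0 != C1 & C0 != C2].
Proof.
have [e1 e2 [n1 n2] n0] := merge_circles; have [npq mE] := m.
have k1 : C1 \in circs R by apply: mem_circs.
have k2 : C2 \in circs R by apply: mem_circs.
have k0 : C0 \in circs R' by apply: mem_circs.
split; first by rewrite /C1 /C2 circ_eq.
- by apply: contraNneq n1 => E; rewrite inE k1 -[circ R p]/C1 -E.
- by apply: contraNneq n2 => E; rewrite inE k2 -[circ R q]/C2 -E.
Qed.

Lemma notin_reps K x : K \subset N -> R' x p -> x \notin reps K.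
Proof.
move=> sK xp; have [e1 e2 [n1 n2] n0] := merge_circles.
have sR : K \subset circs R' by apply: (subset_trans sK); apply: subsetIr.
apply: (not_reps er' sR); move: xp; rewrite -(circ_eq _ _ er') => /eqP->.
by apply: contra n0; apply: (subsetP sK).
Qed.

(** The representatives for [R] and [R'] are chosen independently. That of the merged circle lies on
    one of the two circles it came from; in the sum [xop p f + xop q f] the term of this circle
    vanishes, having two points in one class, and the other one is moved to the chosen
    representatives. *)
Lemma Dop_merge_coef f P' : TR R f -> P' \subset circs R' ->
  Dop R R' f (reps P') =
  \sum_(P : {set {set Y}} | P \subset circs R) ecoef F (circs R) (circs R') P P' * f (reps P).
Proof.
move=> hf; have [e1 e2 [n1 n2] n0] := merge_circles; have [d12 d01 d02] := merge_distinct.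
have [npq mE] := m; have [r s t] := er; have [r' s' t'] := er'; have pq' := merge_pq er m.
have [r1 i1] := repP er (mem_circs R p); rewrite -[circ R p]/C1 => c1.
have [r2 i2] := repP er (mem_circs R q); rewrite -[circ R q]/C2 => c2.
have [r0 i0] := repP er' (mem_circs R' p); rewrite -[circ R' p]/C0 => c0.
have pr1 : R p r1 by rewrite -(circ_eq _ _ er) c1.
have qr2 : R q r2 by rewrite -(circ_eq _ _ er) c2.
have pr0 : R' p r0 by rewrite -(circ_eq _ _ er') c0.
have sub a b : R a b -> R' a b := merge_sub m (a := a) (b := b).
move=> sP; have := sum_merge d12 n1 n2 n0 d01 d02 (fun P => f (reps P)) (P' := P').
rewrite -[[set C1; C2] :|: N]e1 -[C0 |: N]e2 => /(_ sP) ->.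
rewrite (Dop_merge er m hf) ffunE; case: ifP => CP; last first.
  have sN : P' \subset N.
    apply/subsetP => C CP'; have := subsetP sP C CP'; rewrite {1}e2 in_setU1 => /orP[/eqP E|//].
    by rewrite -E CP' in CP.
  have np := notin_reps sN (r' p); have nq : q \notin reps P' by apply: notin_reps sN _; rewrite s'.
  have n1r : r1 \notin reps P' by apply: notin_reps sN _; rewrite s'; apply: sub.
  have n2r : r2 \notin reps P'.
    by apply: notin_reps sN _; rewrite s'; apply: t' pq' _; apply: sub.
  rewrite !ffunE (negPf np) (negPf nq) (repsU1 _ i1) (repsU1 _ i2).
  by rewrite (TR_move hf pr1 np n1r) (TR_move hf qr2 nq n2r).
set B := P' :\ C0.
have sB : B \subset N.
  apply/subsetP => C; rewrite in_setD1 => /andP[nC CP']; have := subsetP sP C CP'.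
  by rewrite {1}e2 in_setU1 (negPf nC).
have eP : reps P' = r0 |: reps B by rewrite -(repsU1 _ i0) setD1K.
rewrite (repsU1 _ i1) (repsU1 _ i2) eP !ffunE !in_setU1.
have nB x : R' x p -> x \notin reps B by apply: notin_reps.
have nBf x : R' x p -> (x \in reps B) = false by move=> /nB/negPf.
have r1p : R' r1 p by rewrite s'; apply: sub.
have r2p : R' r2 p by rewrite s'; apply: t' pq' _; apply: sub.
have r0p : R' r0 p by rewrite s'.
have qp : R' q p by rewrite s'.
rewrite (nBf p (r' p)) (nBf q qp) !orbF.
have nR x y : R p x -> R q y -> x != y.
  by move=> px qy; apply: contraNneq npq => E; apply: t px _; rewrite s E.
have : R p r0 \/ R q r0 by have := pr0; rewrite mE r => /or3P[|/andP[]|/andP[]]; auto.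
case=> h.
  have -> : (q == r0) = false by rewrite eq_sym (negPf (nR _ _ h (r q))).
  have -> : (if p == r0 then 0 else f (p |: (r0 |: reps B))) = 0.
    case: eqP => // /eqP ne; apply: (TR_same hf h ne); rewrite ?setU11 //.
    by rewrite in_setU1 setU11 orbT.
  rewrite add0r (TR_move hf qr2).
  - rewrite setUCA; apply: (TR_move hf).
    + by apply: t pr1; rewrite s.
    + by rewrite in_setU1 (nBf r0 r0p) orbF (nR _ _ h qr2).
    + by rewrite in_setU1 (nBf r1 r1p) orbF (nR _ _ pr1 qr2).
  - by rewrite in_setU1 (nBf q qp) orbF eq_sym (nR _ _ h (r q)).
  - by rewrite in_setU1 (nBf r2 r2p) orbF eq_sym (nR _ _ h qr2).
have -> : (p == r0) = false by rewrite (negPf (nR _ _ (r p) h)).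
have -> : (if q == r0 then 0 else f (q |: (r0 |: reps B))) = 0.
  case: eqP => // /eqP ne; apply: (TR_same hf h ne); rewrite ?setU11 //.
  by rewrite in_setU1 setU11 orbT.
rewrite addr0 (TR_move hf pr1).
- rewrite setUCA [RHS](_ : _ = f (r2 |: (r1 |: reps B))); last by rewrite setUCA.
  apply: (TR_move hf).
  + by apply: t qr2; rewrite s.
  + by rewrite in_setU1 (nBf r0 r0p) orbF eq_sym (nR _ _ pr1 h).
  + by rewrite in_setU1 (nBf r2 r2p) orbF eq_sym (nR _ _ pr1 qr2).
- by rewrite in_setU1 (nBf p (r' p)) orbF (nR _ _ (r p) h).
- by rewrite in_setU1 (nBf r1 r1p) orbF (nR _ _ pr1 h).
Qed.

Lemma Dop_split_coef f P' : TR R' f -> P' \subset circs R ->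
  Dop R' R f (reps P') =
  \sum_(P : {set {set Y}} | P \subset circs R') ecoef F (circs R') (circs R) P P' * f (reps P).
Proof.
move=> hf; have [e1 e2 [n1 n2] n0] := merge_circles; have [d12 d01 d02] := merge_distinct.
have [npq mE] := m; have [r s t] := er; have [r' s' t'] := er'; have pq' := merge_pq er m.
have [r1 i1] := repP er (mem_circs R p); rewrite -[circ R p]/C1 => c1.
have [r2 i2] := repP er (mem_circs R q); rewrite -[circ R q]/C2 => c2.
have [r0 i0] := repP er' (mem_circs R' p); rewrite -[circ R' p]/C0 => c0.
have pr1 : R p r1 by rewrite -(circ_eq _ _ er) c1.
have qr2 : R q r2 by rewrite -(circ_eq _ _ er) c2.
have pr0 : R' p r0 by rewrite -(circ_eq _ _ er') c0.
have sub a b : R a b -> R' a b := merge_sub m (a := a) (b := b).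
have pr1' := sub _ _ pr1; have pr2' : R' p r2 by apply: t' pq' (sub _ _ qr2).
move=> sP; have := sum_split d12 n1 n2 n0 d01 d02 (fun P => f (reps P)) (P' := P').
rewrite -[[set C1; C2] :|: N]e1 -[C0 |: N]e2 => /(_ sP) ->.
rewrite Dop_split; last by move=> a b; apply: sub.
have hP C : C \in P' -> [|| C == C1, C == C2 | C \in N].
  by move/(subsetP sP); rewrite e1 !inE -orbA.
have sB1 : C2 \notin P' -> P' :\ C1 \subset N.
  move=> n; apply/subsetP => C; rewrite in_setD1 => /andP[nC CP'].
  have := hP C CP'; rewrite (negPf nC) /=; case: eqP => // E.
  by rewrite -E CP' in n.
have sB2 : C1 \notin P' -> P' :\ C2 \subset N.
  move=> n; apply/subsetP => C; rewrite in_setD1 => /andP[nC CP'].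
  have := hP C CP'; rewrite (negPf nC) /=; case: eqP => // E.
  by rewrite -E CP' in n.
have nr x K : R' p x -> K \subset N -> x \notin reps K.
  by move=> px sK; apply: notin_reps sK _; rewrite s'.
case: ifP => h1; case: ifP => h2 //.
- apply: (TR_same hf (a := r1) (b := r2)).
  + by apply: t' pr2'; rewrite s'.
  + by apply: contraNneq npq => E; apply: t pr1 _; rewrite E s.
  + by apply/repsP; exists C1.
  + by apply/repsP; exists C2.
- rewrite -{1}(setD1K h1) (repsU1 _ i1) (repsU1 _ i0).
  have sB := sB1 (negbT h2); apply: TR_move hf _ (nr _ _ pr1' sB) (nr _ _ pr0 sB).
  by apply: t' pr0; rewrite s'.
- rewrite -{1}(setD1K h2) (repsU1 _ i2) (repsU1 _ i0).
  have sB := sB2 (negbT h1); apply: TR_move hf _ (nr _ _ pr2' sB) (nr _ _ pr0 sB).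
  by apply: t' pr0; rewrite s'.
Qed.

End Merge.

Lemma Dop_coef R R' p q f P' : eqv R -> eqv R' -> saddle p q R R' -> TR R f -> P' \subset circs R' ->
  Dop R R' f (reps P') =
  \sum_(P : {set {set Y}} | P \subset circs R) ecoef F (circs R) (circs R') P P' * f (reps P).
Proof.
move=> er er' [m|m]; first exact: Dop_merge_coef m _ _.
exact: (Dop_split_coef er' er m).
Qed.

End Circles.

Section KhovanovCube.

Variables (F : fieldType) (D : diagram) (rk : classical D -> nat).
Local Notation I := {c | c \in [set: classical D]}.
Local Notation chain := (chain F D).

Definition khH (k q : int) (x : chain) : Prop := forall e : enhanced_state D, x e != 0 ->
  k = (B_count (state_of e))%:Z /\
  q = (#|(val e).2|.*2)%:Z - #|circles (state_of e)|%:Z + (B_count (state_of e))%:Z.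

Program Definition khc : cplx F :=
  @Cplx F chain (fun _ => True) khH (differential_fun rk) _ _ _ _ _ _ _.
Next Obligation. exact: differential_fun_is_linear. Qed.
Next Obligation. by move=> e; rewrite ffunE eqxx. Qed.
Next Obligation.
move=> e; rewrite !ffunE; case E: (x e == 0); last by move=> _; apply/H/negbT.
by rewrite (eqP E) scaler0 add0r; apply: H0.
Qed.

Definition some_state (st : state D) : classical D -> option bool := fun c => Some (st c).

Lemma edge_surj (x : passage D) : exists h : dart D, edge h = x.
Proof. by exists (x, true). Qed.

Lemma circle_of_circ st h : circle_of st h = circ (@edge D) (Rel (some_state st)) (edge h).
Proof.
apply/setP => h'; rewrite !inE -Rel_darts; apply: eq_connect => u v /=.
by congr (_ || (_ == _)); case: u => [[[[c|c] s]|p] o].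
Qed.

Lemma circles_circs st : circles st = circs (@edge D) (Rel (some_state st)).
Proof.
apply/setP => C; apply/imsetP/imsetP => [[h _ ->]|[x _ ->]].
  by exists (edge h); rewrite // circle_of_circ.
by have [h <-] := edge_surj x; exists h; rewrite // circle_of_circ.
Qed.

Definition state_in (st : state D) : {ffun I -> bool} := [ffun i => st (val i)].
Definition state_out (st : {ffun I -> bool}) : state D :=
  [ffun c => st (Sub c (in_setT c))].

Lemma state_outK : cancel state_out state_in.
Proof. by move=> st; apply/ffunP => i; rewrite !ffunE; congr (st _); apply: val_inj. Qed.

Lemma asg_state st : asg_of (state_in st) =1 some_state st.
Proof.
move=> c; rewrite -[c]/(val (Sub c (in_setT c) : I)) asg_ofE ffunE.
by rewrite /some_state SubK.
Qed.

Variables (V : vcube F I (passage D)).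
Hypothesis hV : realizes V.

Lemma V_circs st : circs (@edge D) (V (state_in st)) = circles st.
Proof.
rewrite circles_circs hV; apply: eq_imset => x; apply/setP => h; rewrite !inE.
exact/Rel_ext/asg_state.
Qed.

Lemma ones_state st : ones (state_in st) = B_count st.
Proof.
rewrite /ones /B_count [RHS](reindex (val : I -> _)) /=.
  by apply: eq_bigr => i _; rewrite ffunE.
by exists (fun c => Sub c (in_setT c)) => i _; [apply: val_inj|rewrite SubK].
Qed.

Definition kh_map (f : cubeV F I (passage D)) : chain :=
  [ffun e => f (state_in (state_of e)) (reps (@edge D) (val e).2)].

Lemma sum_states (st : state D) (G : {set {set dart D}} -> F) :
  \sum_(e : enhanced_state D | state_of e == st) G (val e).2 =
  \sum_(P : {set {set dart D}} | P \subset circles st) G P.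
Proof.
have h0 : (st, set0 : {set {set dart D}}).2 \subset circles (st, set0 : {set {set dart D}}).1.
  exact: sub0set.
pose e0 : enhanced_state D := Sub (st, set0) h0.
rewrite (reindex_onto (fun P => insubd e0 (st, P)) (fun e : enhanced_state D => (val e).2)) /=.
  apply: eq_big => P; last first.
    by case/andP=> _ /eqP->.
  rewrite /state_of !val_insubd /=; case: ifP => h /=; first by rewrite !eqxx.
  by rewrite eqxx; apply/negP => /eqP E; rewrite -E sub0set in h.
move=> e /eqP E; rewrite (_ : (st, (val e).2) = val e) ?valKd // -E /state_of.
by case: (val e).
Qed.

Lemma edge_coefE (e e' : enhanced_state D) :
  Defs.edge_map F e e' = ecoef F (circles (state_of e)) (circles (state_of e')) (val e).2 (val e').2.
Proof. by []. Qed.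

(** The coordinate at an enhanced state is the value of the tensor at representatives of the circles
    marked v_+. Both cubes use the same order of the crossings, so their signs agree edge by
    edge. *)
Lemma kh_ciso rk0 : (forall i : I, rk0 i = rk (val i)) -> @ciso F (cube V rk0) khc kh_map.
Proof.
move=> rkE; have es := edge_surj; have er st : eqv (V st) by apply: v_eqv.
split.
- by move=> a u v; apply/ffunP => e; rewrite !ffunE.
- by [].
- move=> k q f hf; split=> [h|[_ h] e].
    split=> // st U; rewrite -(state_outK st) => nz.
    have [K [sK eK cK]] := reps_repr es (er _) (hf _) nz.
    rewrite V_circs in sK.
    pose e : enhanced_state D := Sub (state_out st, K) sK.
    have := h e; rewrite ffunE /state_of /= eK => /(_ nz).
    by rewrite cK ones_state -V_circs (card_circs es).
  have sK : (val e).2 \subset circs (@edge D) (V (state_in (state_of e))).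
    by rewrite V_circs; apply: (valP e).
  by rewrite ffunE => /h; rewrite ones_state -(card_circs es) V_circs (card_reps es (er _) sK).
- move=> f hf; apply/ffunP => e'; rewrite !ffunE.
  set st' := state_of e'.
  under [RHS]eq_bigr => e _ do rewrite /differential_coef big_distrl /=.
  rewrite (exchange_big_dep (fun c => st' c)) /=; last first.
    by move=> e c _ /andP[_ /eqP E]; rewrite /st' E ffunE eqxx.
  rewrite [RHS](reindex (val : I -> _)) /=; last first.
    by exists (fun c => Sub c (in_setT c)) => i _; [apply: val_inj|rewrite SubK].
  rewrite sum_ffunE; apply: eq_big => i; rewrite ffunE // => si.
  set c := val i; set st : state D := [ffun d => (d != c) && st' d].
  have cl : clear i (state_in st') = state_in st by apply/ffunP => j; rewrite !ffunE -val_eqE.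
  have E e : cube_edge c (state_of e) st' = (state_of e == st).
    rewrite /cube_edge; apply/andP/eqP => [[nc /eqP E]|->].
      by apply/ffunP => d; rewrite /st E !ffunE; case: eqP => [->|] //=; apply/negbTE.
    rewrite ffunE eqxx; split=> //; apply/eqP/ffunP => d; rewrite !ffunE.
    by case: eqP => [->|].
  rewrite (eq_bigl _ _ E) !ffunE cl.
  have [p [q s]] : exists p q, saddle p q (V (state_in st)) (V (state_in st')).
    by rewrite -cl; apply: v_sad; rewrite ffunE.
  rewrite (Dop_coef es (er _) (er _) s (hf _)); last by rewrite V_circs; apply: (valP e').
  rewrite !V_circs -(sum_states st (fun P => ecoef F (circles st) (circles st') P (val e').2 *
     f (state_in st) (reps (@edge D) P))) scaler_sumr; apply: eq_bigr => e /eqP es'.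
  rewrite /GRing.scale /= edge_coefE es' ffunE es' !mulrA; congr (_ * _ * _).
  rewrite /edge_sign; congr (_ ^+ _); rewrite [RHS](reindex (val : I -> _)) /=; last first.
    by exists (fun c => Sub c (in_setT c)) => j _; [apply: val_inj|rewrite SubK].
  apply: eq_big => j; first by rewrite !rkE.
  rewrite !rkE => lt; rewrite !ffunE; case: eqP => // ejc.
  by have := lt; rewrite (_ : rk (val j) = rk (val i)) ?ltnn //; exact: (congr1 rk ejc).
- move=> f hf /ffunP f0; apply/ffunP => st; rewrite -(state_outK st) [RHS]ffunE.
  apply: (reps_inj es (er _) (hf _)) => K; rewrite V_circs => sK.
  by have := f0 (Sub (state_out st, K) sK : enhanced_state D); rewrite !ffunE.
- move=> y _.
  pose g (st : {ffun I -> bool}) (K : {set {set dart D}}) : F :=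
    if insub (state_out st, K) is Some e then y e else 0.
  have /fin_all_exists2[f hf e] (st : {ffun I -> bool}) := reps_surj es (er st) (g st).
  exists [ffun st => f st]; first by move=> st; rewrite ffunE.
  apply/ffunP => z; rewrite !ffunE e; last by rewrite V_circs; apply: (valP z).
  rewrite /g (_ : (_, _) = val z) ?valK //.
  rewrite (_ : state_out (state_in (state_of z)) = state_of z); first by rewrite /state_of; case: (val z).
  by apply/ffunP => c; rewrite !ffunE SubK.
Qed.

End KhovanovCube.

(** * From correspondences between cycles to isomorphisms of homology *)

Section Correspondence.

Variables (F : fieldType) (U W : lmodType F) (G : U -> W -> Prop).
Hypotheses (G_lin : forall a u w u' w', G u w -> G u' w' -> G (a *: u + u') (a *: w + w'))
  (G_left : forall u, exists w, G u w) (G_right : forall w, exists u, G u w)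
  (G0l : forall w, G 0 w -> w = 0) (G0r : forall u, G u 0 -> u = 0).

Lemma corr_funl u w w' : G u w -> G u w' -> w = w'.
Proof.
move=> h h'; have := G_lin (-1) h h'; rewrite !scaleN1r addNr => /G0l/eqP.
by rewrite addrC subr_eq0 => /eqP.
Qed.

Lemma corr_funr u u' w : G u w -> G u' w -> u = u'.
Proof.
move=> h h'; have := G_lin (-1) h h'; rewrite !scaleN1r addNr => /G0r/eqP.
by rewrite addrC subr_eq0 => /eqP.
Qed.

(** By linearity the two conditions on zero make the correspondence single-valued in both
    directions, hence the graph of a linear bijection; a description principle turns it into a
    map. *)
Lemma corr_iso : exists f : {linear U -> W}, bijective f.
Proof.
pose f u := proj1_sig (constructive_indefinite_description _ (G_left u)).
pose g w := proj1_sig (constructive_indefinite_description _ (G_right w)).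
have fG u : G u (f u) by exact: proj2_sig (constructive_indefinite_description _ (G_left u)).
have gG w : G (g w) w by exact: proj2_sig (constructive_indefinite_description _ (G_right w)).
have f_lin : linear f.
  by move=> a u v; apply: corr_funl (fG _) (G_lin a (fG u) (fG v)).
exists (HB.pack_for {linear U -> W} f (GRing.isLinear.Build F U W _ f f_lin)).
exists g => x /=; first by apply: corr_funr (gG _) (fG _).
by apply: corr_funl (fG _) (gG _).
Qed.

End Correspondence.

Section Homology.

Variables (F : fieldType) (D : diagram) (rk : classical D -> nat).

Lemma grading_plus (e : enhanced_state D) :
  grading e = (#|(val e).2|.*2)%:Z - #|circles (state_of e)|%:Z + (B_count (state_of e))%:Z
    + ((n_plus D)%:Z - 2 * (n_minus D)%:Z).
Proof.
rewrite /grading [RHS]addrA; congr (_ + _ + _ - _).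
rewrite (bigID (fun C => C \in (val e).2)) /=.
have sK : (val e).2 \subset circles (state_of e) := valP e.
rewrite (eq_bigr (fun=> 1 : int)); last by move=> C /andP[_ h]; rewrite /plus h.
rewrite [X in _ + X](eq_bigr (fun=> -1 : int)); last by move=> C /andP[_ /negPf h]; rewrite /plus h.
rewrite !sumr_const.
have -> : #|[pred C in circles (state_of e) | C \in (val e).2]| = #|(val e).2|.
  by apply: eq_card => C; rewrite !inE; case h: (C \in (val e).2); rewrite ?andbF ?andbT // (subsetP sK).
have -> : #|[pred C in circles (state_of e) | C \notin (val e).2]| =
    (#|circles (state_of e)| - #|(val e).2|)%N.
  by rewrite -cardsDS //; apply: eq_card => C; rewrite !inE andbC.
have := subset_leq_card sK; move: #|circles _| #|(val e).2| => m n le.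
by rewrite mulNrn !natz; lia.
Qed.

Lemma bihomogeneousP k q (x : chain F D) : reflect
  (khH (k + (n_minus D)%:Z) (q - ((n_plus D)%:Z - 2 * (n_minus D)%:Z)) x)
  (x \in bihomogeneous F D k q).
Proof.
have E (e : enhanced_state D) : (k + (n_minus D)%:Z = (B_count (state_of e))%:Z /\
    q - ((n_plus D)%:Z - 2 * (n_minus D)%:Z) =
    (#|(val e).2|.*2)%:Z - #|circles (state_of e)|%:Z + (B_count (state_of e))%:Z) <->
    (height e == k) && (grading e == q).
  rewrite grading_plus /height; split=> [[e1 e2]|/andP[/eqP<- /eqP<-]].
    by rewrite -e2 -e1 addrK subrK !eqxx.
  by rewrite subrK addrK.
apply: (iffP idP) => [/memv_sumP[v hv ->] e nz|h].
  apply/E; apply/negP => /negP n; move/eqP: nz; apply; rewrite sum_ffunE big1 // => e' he'.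
  have /vlineP[a ->] := hv e' he'; rewrite !ffunE; case: eqP => [E'|_]; last by rewrite scaler0.
  by rewrite E' he' in n.
have -> : x = \sum_(e | (height e == k) && (grading e == q)) x e *: basis_chain F e.
  apply/ffunP => e; rewrite sum_ffunE.
  case: (boolP ((height e == k) && (grading e == q))) => he.
    rewrite (bigD1 e) //= big1 ?addr0; first by rewrite !ffunE eqxx /GRing.scale /= mulr1.
    by move=> e' /andP[_ ne]; rewrite !ffunE eq_sym (negPf ne) scaler0.
  rewrite big1; last first.
    move=> e' he'; rewrite !ffunE; case: eqP => [E'|_]; last by rewrite scaler0.
    by rewrite -E' (negPf he) in he'.
  by apply/eqP/negPn/negP => /h/E; apply/negP.
by apply: memv_suml => e he; rewrite memvZ // (subvP (sumv_sup e he (subvv _))) ?memv_line.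
Qed.

Lemma cyclesP k q (x : chain F D) :
  cyc (A := khc F rk) (k + (n_minus D)%:Z) (q - ((n_plus D)%:Z - 2 * (n_minus D)%:Z)) x <->
  x \in cycles F rk k q.
Proof.
rewrite memv_cap memv_ker /differential lfunE; split.
  by move=> [h d]; apply/andP; split; [apply/eqP|apply/bihomogeneousP].
by move=> /andP[/eqP d /bihomogeneousP h].
Qed.

Lemma boundariesP k q (u : subvs_of (cycles F rk k q)) :
  bdry (A := khc F rk) (vsval u) <-> u \in boundaries F rk k q.
Proof.
rewrite /boundaries -memv_preim lfunE; split=> [[y _ /= ->]|/memv_imgP[y _ ->]].
  by rewrite -[differential_fun rk y]lfunE memv_img ?memvf.
by exists y; rewrite // lfunE.
Qed.

End Homology.

Lemma vquot_pi0 (F : fieldType) (V : vectType F) (W : {vspace V}) : vquot_pi W 0 = 0.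
Proof.
by have := vquot_piD W 0 0; rewrite addr0 => /eqP; rewrite -subr_eq0 opprD addNKr oppr_eq0 => /eqP.
Qed.

Lemma vquot_pi_eq0 (F : fieldType) (V : vectType F) (W : {vspace V}) u : vquot_pi W u = 0 <-> u \in W.
Proof. by rewrite -(vquot_pi0 W) vquot_piE subr0. Qed.

(** Two classes correspond when they have corresponding representatives. Since [G] respects
    boundaries in both directions, zero corresponds to zero only, as [corr_iso] requires. *)
Lemma Hiso_Kh (F : fieldType) (D D' : diagram) (rk : classical D -> nat) (rk' : classical D' -> nat) :
  Hiso ((n_minus D')%:Z - (n_minus D)%:Z)
    (((n_plus D)%:Z - 2 * (n_minus D)%:Z) - ((n_plus D')%:Z - 2 * (n_minus D')%:Z))
    (khc F rk) (khc F rk') ->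
  bigraded_isomorphic (Kh F rk) (Kh F rk').
Proof.
move=> H; suff iso k q : exists f : {linear Kh F rk k q -> Kh F rk' k q}, bijective f.
  exists (fun k q => proj1_sig (constructive_indefinite_description _ (iso k q))) => k q.
  exact: proj2_sig (constructive_indefinite_description _ (iso k q)).
have [G [Gc Gl Gt Gs Gb]] := H (k + (n_minus D)%:Z) (q - ((n_plus D)%:Z - 2 * (n_minus D)%:Z)).
have e1 : k + (n_minus D)%:Z + ((n_minus D')%:Z - (n_minus D)%:Z) = k + (n_minus D')%:Z by zmod.
have e2 : q - ((n_plus D)%:Z - 2 * (n_minus D)%:Z) +
    (((n_plus D)%:Z - 2 * (n_minus D)%:Z) - ((n_plus D')%:Z - 2 * (n_minus D')%:Z)) =
    q - ((n_plus D')%:Z - 2 * (n_minus D')%:Z) by zmod.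
rewrite e1 e2 in Gc Gs.
pose B := boundaries F rk k q; pose B' := boundaries F rk' k q.
pose Ga (x : Kh F rk k q) (y : Kh F rk' k q) := exists u v,
  [/\ G (vsval u) (vsval v), x = vquot_pi B u & y = vquot_pi B' v].
apply: (@corr_iso F _ _ Ga).
- move=> a x y x' y' [u [v [g -> ->]]] [u' [v' [g' -> ->]]].
  exists (a *: u + u'), (a *: v + v'); split.
  + by rewrite !linearP; apply: Gl.
  + by rewrite vquot_piD vquot_piZ.
  + by rewrite vquot_piD vquot_piZ.
- move=> x; pose u := vquot_repr x.
  have /cyclesP/Gt[y g] : vsval u \in cycles F rk k q by apply: subvsP.
  have /cyclesP yc := (Gc _ _ g).2.
  exists (vquot_pi B' (vsproj _ y)), u, (vsproj _ y); split=> //; first by rewrite vsprojK.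
  by rewrite vquot_reprK.
- move=> x; pose u := vquot_repr x.
  have /cyclesP/Gs[y g] : vsval u \in cycles F rk' k q by apply: subvsP.
  have /cyclesP yc := (Gc _ _ g).1.
  exists (vquot_pi B (vsproj _ y)), (vsproj _ y), u; split=> //; first by rewrite vsprojK.
  by rewrite vquot_reprK.
- move=> y [u [v [g /esym/vquot_pi_eq0/boundariesP b ->]]].
  by apply/vquot_pi_eq0/boundariesP/(Gb _ _ g).
- move=> y [u [v [g -> /esym/vquot_pi_eq0/boundariesP b]]].
  by apply/vquot_pi_eq0/boundariesP/(Gb _ _ g).
Qed.

Theorem theorem4 (F : fieldType) (L L' : virtual_diagram)
    (rk : classical L -> nat) (rk' : classical L' -> nat) :
  injective rk -> injective rk' ->
  equivalent L L' ->
  orientable (atom_of L) -> orientable (atom_of L') ->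
  bigraded_isomorphic (Kh F rk) (Kh F rk').
Proof.
move=> i i' eq /orientable_oriented o /orientable_oriented o'.
apply: Hiso_Kh; have H := @equivalent_HI F _ _ eq o o'.
have neg (D : diagram) : kept_neg [set: classical D] = n_minus D.
  by apply: eq_card => c; rewrite !inE.
have pos (D : diagram) : kept_pos [set: classical D] = n_plus D.
  by apply: eq_card => c; rewrite !inE.
case: (o) (o') => tau fl ev [tau' fl' ev'].
(* [HI] is a statement about all realising cubes; orientability of the two atoms is what produces
   one at each end. *)
have [V hV] := Rel_vcube fl ev F; have [V' hV'] := Rel_vcube fl' ev' F.
have iv (D : diagram) (r : classical D -> nat) : injective r ->
    injective (fun c : {c | c \in [set: classical D]} => r (val c)).
  by move=> ir x y /ir/val_inj.
have h := H V V' _ _ hV hV' (iv _ _ i) (iv _ _ i').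
have c := ciso_Hiso (kh_ciso hV (fun c => erefl (rk (val c)))).
have c' := ciso_Hiso (kh_ciso hV' (fun c => erefl (rk' (val c)))).
rewrite /kept_shift !neg !pos in h.
apply: Hiso_eq (Hiso_trans (Hiso_sym c) (Hiso_trans h c')) _ _; lia.
Qed.
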